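(* Let $\psi=\psi_R+i\psi_I$ be an analytic wavelet and $\phi$ an averaging function satisfying Assumption W (with exponent $\alpha>0$), and let $X$ be a stationary real Gaussian process satisfying Assumption S (with parameter $\beta\in(0,1]$), as stated in the context, with $2\alpha+\beta\ge1$. Let $A(r)=r^\nu$ with $\nu\in(0,\infty)$, or $A(r)=\ln r$ (in which case set $\nu=0$). Let $d\in\mathbb N$. For any $t_1,\dots,t_d\in\mathbb R$, $j_1,\dots,j_d\in\mathbb Z$ (with $\sigma_{j_m}>0$ for all $m$), and $h\in\mathcal H_2$, there exists a constant $C$ such that $$\big|\mathbb E[h(\mathbf F_{\le K})]-\mathbb E[h(\mathbf N_{\mathbf C_{J,K}})]\big|\le C\,2^{-J/2}\left(\sum_{\ell\in\{2,4,\dots,K\}}|c_\ell|\,\sqrt{\ell!}\;3^{\ell/2}\right)^2$$ for all $J\in\mathbb Z$ and $K\in2\mathbb N=\{2,4,6,\dots\}$. Here $\mathbf F_{\le K}=(F_{1,\le K},\dots,F_{d,\le K})$ with $$F_{m,\le K}=2^{J/2}\sum_{\ell\in\{2,4,\dots,K\}}I_\ell\big(s^{(\ell)}_{2^Jt_m,j_m}\big),$$ $\mathbf C_{J,K}$ is the covariance matrix of $\mathbf F_{\le K}$, $\mathbf N_{\mathbf C_{J,K}}$ is a zero-mean $d$-dimensional normal random vector with covariance matrix $\mathbf C_{J,K}$, and $c_\ell$, $s^{(\ell)}_{t,j}$, $I_\ell$, $\mathcal H_2$ are defined in the context. The constant $C$ depends only on $j_1,\dots,j_d$, $f_X$, $\psi$,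 $\phi$ and $A$.
   Context: Fourier transform: $\widehat g(\lambda)=\int_{\mathbb R}e^{-it\lambda}g(t)\,dt$. Analytic wavelet: $\psi=\psi_R+i\psi_I\in L^1(\mathbb R)\cap L^2(\mathbb R)$ with $\psi_R,\psi_I$ real-valued and forming a Hilbert pair, $\widehat{\psi_I}(\lambda)=-i\,\mathrm{sgn}(\lambda)\widehat{\psi_R}(\lambda)$. Assumption W: $\widehat{\psi_R}\in L^1(\mathbb R)\cap L^2(\mathbb R)$ and $\widehat{\psi_R}(\lambda)=C_{\psi_R}(\lambda)|\lambda|^\alpha$ for some $\alpha>0$ and some bounded continuous $C_{\psi_R}:\mathbb R\to\mathbb C$ with $C_{\psi_R}(0)\neq0$. The averaging function $\phi$ is real-valued and integrable with $\widehat\phi\in L^1(\mathbb R)\cap L^2(\mathbb R)$; $\phi_J(t)=2^{-J}\phi(2^{-J}t)$, so $\widehat{\phi_J}(\lambda)=\widehat\phi(2^J\lambda)$. Assumption S: $X$ is a mean-square continuous stationary real Gaussian process with constant mean and covariance function $R_X(t)=\int_{\mathbb R}e^{i\lambda t}f_X(\lambda)\,d\lambda$, where $f_X\in L^1(\mathbb R)$ is nonnegative, even, and of one of the forms (a) $f_X(\lambda)=C_X(\lambda)$ (called the case $\beta=1$), or (b) $f_X(\lambda)=C_X(\lambda)|\lambda|^{\beta-1}$ with $\beta\in(0,1)$ and $C_X(0)>0$; in both cases $C_X:\mathbb R\to[0,\infty)$ is bounded and continuous. Random measure: $W$ is a complex-valued Gaussian random measure on $\mathbb R$ with $W(\Delta)=\overline{W(-\Delta)}$,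 $\mathbb E[W(\Delta)]=0$ and $\mathbb E[W(\Delta_1)\overline{W(\Delta_2)}]=\mathrm{Leb}(\Delta_1\cap\Delta_2)$. Wiener-Itô integrals: let $\overline H=\{f\in L^2(\mathbb R;\mathbb C): f(-\lambda)=\overline{f(\lambda)}\}$, a real Hilbert space. For $f\in\overline H^{\otimes m}$ (i.e. $f\in L^2(\mathbb R^m;\mathbb C)$ with $f(-\lambda_1,\dots,-\lambda_m)=\overline{f(\lambda_1,\dots,\lambda_m)}$), $I_m(f)=\int'_{\mathbb R^m}f\,W(d\lambda_1)\cdots W(d\lambda_m)$ is the $m$-fold Wiener-Itô integral (hyperplanes $\lambda_k=\pm\lambda_{k'}$, $k\ne k'$, excluded). It is the continuous linear map determined by $I_m(f)=I_m(\mathrm{Sym} f)$, $\mathbb E[I_m(f)^2]=m!\,\|\mathrm{Sym} f\|_{L^2}^2$, and $I_m(g^{\otimes m})=H_m(\int g\,dW)$ for $g\in\overline H$, $\|g\|=1$, with $H_m(x)=(-1)^me^{x^2/2}\frac{d^m}{dx^m}e^{-x^2/2}$. Kernels: $\sigma_j^2=\int_{\mathbb R}|\widehat{\psi_R}(2^j\lambda)|^2f_X(\lambda)\,d\lambda$; $L_k(u)=\frac{e^u}{k!}\frac{d^k}{du^k}(e^{-u}u^k)$; $c_{A,k}=\int_0^\infty A(\sqrt{2u})L_k(u)e^{-u}du$; for $\ell\in2\mathbb N$, $c_\ell=(-2)^{\ell/2}\frac{(\ell/2)!}{\ell!}c_{A,\ell/2}$ and $$s^{(\ell)}_{t,j}(\lambda_1,\dots,\lambda_\ell)=\sigma_j^{\nu-\ell}c_\ell\left[\prod_{k=1}^\ell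 e^{it\lambda_k}\widehat{\psi_R}(2^j\lambda_k)\sqrt{f_X(\lambda_k)}\right]1_{\{N(\lambda_{1:\ell})=\ell/2\}}\;\widehat{\phi_J}(\lambda_1+\cdots+\lambda_\ell),$$ where $N(\lambda_{1:\ell})$ is the number of indices $k$ with $\lambda_k<0$. ($\mathbf F_{\le K}$ is the truncation at chaos order $K$ of the Wiener chaos expansion of the centered and rescaled moving averages $2^{J/2}\{S^A_J[j_m]X(2^Jt_m)-\mathbb E[\cdot]\}$, where $S_J^A[j]X=A(|X\star\psi_j|)\star\phi_J$ and $\psi_j(t)=2^{-j}\psi(2^{-j}t)$.) Test functions: $\mathcal H_2$ is the set of real-valued $h\in C^1(\mathbb R^d)$ with $\|h\|_\infty\le1$, $\max_m\sup_{\mathbf x}|\partial h/\partial x_m(\mathbf x)|\le1$, and $\max_m\sup_{\mathbf x\ne\mathbf y}\frac{|\partial h/\partial x_m(\mathbf x)-\partial h/\partial x_m(\mathbf y)|}{\|\mathbf x-\mathbf y\|}\le1$. *)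

(* Defs.v *)
From HB Require Import structures.
From mathcomp Require Import all_boot all_order all_algebra all_fingroup.
From mathcomp Require Import complex.
From mathcomp Require Import all_classical all_reals all_analysis.

Set Implicit Arguments.
Unset Strict Implicit.
Unset Printing Implicit Defensive.

Import Order.TTheory GRing.Theory Num.Theory.
Import numFieldNormedType.Exports.

Local Open Scope classical_set_scope.
Local Open Scope ring_scope.
Local Open Scope complex_scope.

Section measure_tuple.
Context d (T : measurableType d) (R : realType).
Context (m : {sigma_finite_measure set T -> \bar R}).

Section cons.
Context n (mu : {sigma_finite_measure set (n.-tuple T) -> \bar R}).

Definition cons_pair (p : T * n.-tuple T) : n.+1.-tuple T :=
  [tuple of p.1 :: p.2].

Lemma measurable_cons_pair : measurable_fun setT cons_pair.
Proof. exact: measurable_cons. Qed.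

Definition measure_cons : set (n.+1.-tuple T) -> \bar R :=
  pushforward (m \x mu)%E cons_pair.

Let pf : {measure set (n.+1.-tuple T) -> \bar R} :=
  measure_function_pushforward__canonical__measure_function_Measure
    (m \x mu)%E measurable_cons_pair.

HB.instance Definition _ := isMeasure.Build _ _ _ measure_cons
  (measure0 pf) (measure_ge0 pf) (@measure_semi_sigma_additive _ _ _ pf).

Lemma measure_cons_sigma_finite : sigma_finite setT measure_cons.
Proof.
have /sigma_finiteP[F [TF ndF Foo]] := sigma_finiteT m.
have /sigma_finiteP[G [TG ndG Goo]] := sigma_finiteT mu.
pose g (x : n.+1.-tuple T) := (thead x, [tuple of behead x]).
exists (fun k => g @^-1` (F k `*` G k)).
  rewrite predeqE => x; split=> // _.
  have [k1 _ Fk1] : (\bigcup_k F k) (thead x) by rewrite -TF.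
  have [k2 _ Gk2] : (\bigcup_k G k) [tuple of behead x] by rewrite -TG.
  exists (maxn k1 k2) => //; split=> /=.
  - by move: Fk1; exact/subsetPset/ndF/leq_maxl.
  - by move: Gk2; exact/subsetPset/ndG/leq_maxr.
move=> k; have [mFk Fk] := Foo k; have [mGk Gk] := Goo k; split.
  rewrite -[X in measurable X]setTI.
  have mg : measurable_fun setT g.
    apply: measurable_fun_pair; first exact: measurable_tnth.
    exact: measurable_behead.
  by apply: mg => //; exact: measurableX.
rewrite /measure_cons /pushforward -comp_preimage (_ : _ \o _ = id).
  by rewrite product_measure1E// lte_mul_pinfty// ge0_fin_numE.
apply/funext => -[x y]; rewrite /g /=; congr pair; exact: val_inj.
Qed.

HB.instance Definition _ :=
  Measure_isSigmaFinite.Build _ _ _ measure_cons measure_cons_sigma_finite.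

End cons.

(* n-fold product of m, carried on n.-tuple T through (x, s) |-> x :: s. *)
Fixpoint measure_tuple n : {sigma_finite_measure set (n.-tuple T) -> \bar R} :=
  match n with
  | 0 => \d_([tuple] : 0.-tuple T)
  | n.+1 => measure_cons (measure_tuple n)
  end.

End measure_tuple.

Definition lebesgue_tuple (R : realType) (n : nat) :
    {sigma_finite_measure set (n.-tuple (measurableTypeR R)) -> \bar R} :=
  measure_tuple (@lebesgue_measure R) n.

Section complex_functions.
Context (R : realType).

Definition cis (x : R) : R[i] := cos x +i* sin x.

Context d (T : measurableType d).

Definition cmeasurable (f : T -> R[i]) :=
  measurable_fun setT (fun x => complex.Re (f x)) /\
  measurable_fun setT (fun x => complex.Im (f x)).

Definition cLp (mu : {measure set T -> \bar R}) (p : nat) (f : T -> R[i]) :=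
  cmeasurable f /\ (\int[mu]_x ((Normc.normc (f x)) ^+ p)%:E < +oo)%E.

Definition cintegral (mu : {measure set T -> \bar R}) (f : T -> R[i]) : R[i] :=
  (\int[mu]_x complex.Re (f x)) +i* (\int[mu]_x complex.Im (f x)).

Definition sqnormL2 (mu : {measure set T -> \bar R}) (f : T -> R[i]) : R :=
  \int[mu]_x (Normc.normc (f x)) ^+ 2.

End complex_functions.

Definition fourier (R : realType) (g : R -> R[i]) (lambda : R) : R[i] :=
  cintegral (@lebesgue_measure R) (fun t => cis (- (t * lambda)) * g t).

Section wavelets.
Context (R : realType).
Implicit Types (psi : R -> R[i]) (phi : R -> R).

Definition reC psi : R -> R[i] := fun t => (complex.Re (psi t))%:C.
Definition imC psi : R -> R[i] := fun t => (complex.Im (psi t))%:C.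

Definition analytic_wavelet psi :=
  [/\ cLp (@lebesgue_measure R) 1 psi, cLp (@lebesgue_measure R) 2 psi &
      forall lambda, fourier (imC psi) lambda =
        (0 -i* 1) * (Num.sg lambda)%:C * fourier (reC psi) lambda].

Definition assumption_W (alpha : R) psi phi :=
  [/\ 0 < alpha,
      cLp (@lebesgue_measure R) 1 (fourier (reC psi)) /\
      cLp (@lebesgue_measure R) 2 (fourier (reC psi)),
      exists Cpsi : R -> R[i],
        [/\ continuous (fun x => complex.Re (Cpsi x)) /\
            continuous (fun x => complex.Im (Cpsi x)),
            exists M : R, forall x, Normc.normc (Cpsi x) <= M,
            Cpsi 0 != 0 &
            forall lambda, fourier (reC psi) lambda =
              Cpsi lambda * (`|lambda| `^ alpha)%:C],
      cLp (@lebesgue_measure R) 1 (fun t => (phi t)%:C) &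
      cLp (@lebesgue_measure R) 1 (fourier (fun t => (phi t)%:C)) /\
      cLp (@lebesgue_measure R) 2 (fourier (fun t => (phi t)%:C))].

Definition dilate_phi phi (J : int) (t : R) : R :=
  2 ^ (- J) * phi (2 ^ (- J) * t).

End wavelets.

(* In the singular case fX is unconstrained at 0, where |0|^(beta - 1) is
   infinite (and powR would return the junk value 0). *)
Definition spectral_density (R : realType) (beta : R) (fX : R -> R) :=
  [/\ cLp (@lebesgue_measure R) 1 (fun x => (fX x)%:C),
      forall x, 0 <= fX x,
      forall x, fX (- x) = fX x &
      exists CX : R -> R,
        [/\ continuous CX, forall x, 0 <= CX x,
            exists M, forall x, CX x <= M &
            (beta = 1 /\ forall x, fX x = CX x) \/
            ([/\ 0 < beta, beta < 1, 0 < CX 0 &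
              forall x, x != 0 -> fX x = CX x * `|x| `^ (beta - 1)])]].

Section gaussian.
Context (R : realType) d (Omega : measurableType d) (P : probability Omega R).

(* v is the variance; v = 0 gives the point mass at m, a case that the
   library's normal_prob does not cover. *)
Definition gaussian_rv (Y : Omega -> R) (m v : R) :=
  [/\ 0 <= v, measurable_fun setT Y &
      forall B : set R, measurable B ->
        P (Y @^-1` B) =
        if v == 0 then \d_m B else normal_prob m (Num.sqrt v) B].

Definition normal_vector n (N : 'I_n -> Omega -> R) (Sigma : 'M[R]_n) :=
  forall a : 'I_n -> R,
    gaussian_rv (fun w => \sum_i a i * N i w) 0
      (\sum_i \sum_k a i * a k * Sigma i k).

Definition stationary_gaussian (fX : R -> R) (X : R -> Omega -> R) :=
  [/\ forall n (t a : 'I_n -> R), exists m v,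
        gaussian_rv (fun w => \sum_i a i * X (t i) w) m v,
      exists m : R, forall t, ('E_P[X t] = m%:E)%E,
      forall s t, (fine (covariance P (X s) (X t)))%:C =
        cintegral (@lebesgue_measure R)
          (fun x => cis (x * (s - t)) * (fX x)%:C) &
      forall t : R,
        ('E_P[fun w => ((X s w - X t w) ^+ 2)%R])%E @[s --> t] --> (0 : \bar R)].

Definition finite_borel (D : set R) :=
  measurable D /\ (lebesgue_measure D < +oo)%E.

(* Additivity of W (almost surely, and countably in L^2) is a consequence of
   the covariance identity. Joint Gaussianity of the real and imaginary parts
   is expressed through all real parts of complex linear combinations. *)
Definition gaussian_random_measure (W : set R -> Omega -> R[i]) :=
  [/\ forall D, finite_borel D -> cmeasurable (W D),
      forall n (D : 'I_n -> set R) (c : 'I_n -> R[i]),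
        (forall k, finite_borel (D k)) ->
        exists m v,
          gaussian_rv (fun w => complex.Re (\sum_k c k * W (D k) w)) m v,
      forall D, finite_borel D ->
        {ae P, forall w, W D w = conjc (W (-%R @` D) w)},
      forall D, finite_borel D -> cintegral P (W D) = 0 &
      forall D1 D2, finite_borel D1 -> finite_borel D2 ->
        cintegral P (fun w => W D1 w * conjc (W D2 w)) =
        (fine (lebesgue_measure (D1 `&` D2)))%:C].

(* Y = \int g dW, as the L^2(P)-limit of integrals of simple functions. *)
Definition wiener_integral (W : set R -> Omega -> R[i]) (g : R -> R[i])
    (Y : Omega -> R) :=
  forall e : R, 0 < e ->
    exists n (c : 'I_n -> R[i]) (D : 'I_n -> set R),
      [/\ forall k, finite_borel (D k),
          (\int[lebesgue_measure]_x
             ((Normc.normc (g x - \sum_k c k * (\1_(D k) x)%:C)) ^+ 2)%:E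
           < e%:E)%E &
          (\int[P]_w
             ((Normc.normc ((Y w)%:C - \sum_k c k * W (D k) w)) ^+ 2)%:E
           < e%:E)%E].

Definition hermite (m : nat) (x : R) : R :=
  (-1) ^+ m * expR (x ^+ 2 / 2) *
  derive1n m (fun y : R => expR (- (y ^+ 2 / 2))) x.

Definition Hbar (g : R -> R[i]) :=
  cLp (@lebesgue_measure R) 2 g /\
  {ae @lebesgue_measure R, forall x, g (- x) = conjc (g x)}.

(* m-th tensor power of the real Hilbert space Hbar, as a subspace of L^2(R^m). *)
Definition Hbar_tensor m (f : m.-tuple (measurableTypeR R) -> R[i]) :=
  cLp (lebesgue_tuple R m) 2 f /\
  {ae lebesgue_tuple R m, forall x, f (map_tuple -%R x) = conjc (f x)}.

Definition Sym m (f : m.-tuple R -> R[i]) (x : m.-tuple R) : R[i] :=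
  (m`!%:R)^-1 * \sum_(s : {perm 'I_m}) f [tuple tnth x (s k) | k < m].

Definition tensor_pow m (g : R -> R[i]) (x : m.-tuple R) : R[i] :=
  \prod_(k < m) g (tnth x k).

(* These clauses determine I m almost surely: I 1 is the first-order integral
   g |-> \int g dW, and for every m the map is linear, continuous (isometric on
   symmetric kernels) and prescribed on tensor powers, whose linear span is
   dense among symmetric kernels. *)
Definition wiener_ito (W : set R -> Omega -> R[i])
    (I : forall m, (m.-tuple R -> R[i]) -> Omega -> R) :=
  [/\ forall m f, (0 < m)%N -> Hbar_tensor f ->
        [/\ measurable_fun setT (I m f),
            {ae P, forall w, I m f w = I m (Sym f) w} &
            ('E_P[fun w => (I m f w ^+ 2)%R] =
             (m`!%:R * sqnormL2 (lebesgue_tuple R m) (Sym f))%R%:E)%E],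
      forall m f g (a b : R), (0 < m)%N -> Hbar_tensor f -> Hbar_tensor g ->
        {ae P, forall w, I m (fun x => a%:C * f x + b%:C * g x) w =
                         a * I m f w + b * I m g w},
      forall g, Hbar g -> wiener_integral W g (I 1%N (@tensor_pow 1 g)) &
      forall m g, (0 < m)%N -> Hbar g ->
        sqnormL2 (@lebesgue_measure R) g = 1 ->
        {ae P, forall w,
          I m (@tensor_pow m g) w = hermite m (I 1%N (@tensor_pow 1 g) w)}].

End gaussian.

Section kernels.
Context (R : realType).

Definition power_or_log (nu : R) (A : R -> R) :=
  (0 < nu /\ forall r, 0 <= r -> A r = r `^ nu) \/
  (nu = 0 /\ forall r, 0 < r -> A r = ln r).

Definition laguerre (k : nat) (u : R) : R :=
  expR u / k`!%:R * derive1n k (fun v : R => expR (- v) * v ^+ k) u.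

Definition cA (A : R -> R) (k : nat) : R :=
  \int[lebesgue_measure]_(u in `[0, +oo[)
    (A (Num.sqrt (2 * u)) * laguerre k u * expR (- u)).

Definition c_coef (A : R -> R) (l : nat) : R :=
  (-2) ^+ l./2 * ((l./2)`!%:R / l`!%:R) * cA A l./2.

Definition sigma (psi : R -> R[i]) (fX : R -> R) (j : int) : R :=
  Num.sqrt (\int[lebesgue_measure]_x
    ((Normc.normc (fourier (reC psi) (2 ^ j * x))) ^+ 2 * fX x)).

Definition chaos_kernel (psi : R -> R[i]) (phi : R -> R) (fX : R -> R)
    (A : R -> R) (nu : R) (J : int) (t : R) (j : int) (l : nat)
    (x : l.-tuple R) : R[i] :=
  (sigma psi fX j `^ (nu - l%:R) * c_coef A l)%:C *
  (\prod_(k < l) (cis (t * tnth x k) *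
                  fourier (reC psi) (2 ^ j * tnth x k) *
                  (Num.sqrt (fX (tnth x k)))%:C)) *
  (count (fun y => y < 0) x == l./2)%:R *
  fourier (fun s => (dilate_phi phi J s)%:C) (\sum_(k < l) tnth x k).

(* F_{m, <= K} for t = t_m and j = j_m. *)
Definition truncated_chaos (Omega : Type)
    (I : forall m, (m.-tuple R -> R[i]) -> Omega -> R)
    (psi : R -> R[i]) (phi : R -> R) (fX : R -> R) (A : R -> R) (nu : R)
    (J : int) (K : nat) (t : R) (j : int) (w : Omega) : R :=
  2 `^ (J%:~R / 2) *
  \sum_(2 <= l < K.+1 | ~~ odd l)
    I l (@chaos_kernel psi phi fX A nu J (2 ^ J * t) j l) w.

Definition covariance_mx d (Omega : measurableType d) (P : probability Omega R)
    n (F : 'I_n -> Omega -> R) : 'M[R]_n :=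
  \matrix_(m, k) fine (covariance P (F m) (F k)).

Definition partial n (h : 'rV[R]_n -> R) (m : 'I_n) (x : 'rV[R]_n) : R :=
  'D_(delta_mx 0 m) h x.

(* The library's norm on 'rV_n is the maximum norm. *)
Definition eucl_norm n (x : 'rV[R]_n) : R := Num.sqrt (\sum_i x 0 i ^+ 2).

Definition test_H2 n (h : 'rV[R]_n -> R) :=
  [/\ forall m x, derivable h x (delta_mx 0 m),
      forall m, continuous (partial h m),
      forall x, `|h x| <= 1,
      forall m x, `|partial h m x| <= 1 &
      forall m x y, x <> y ->
        `|partial h m x - partial h m y| / eucl_norm (x - y) <= 1].

End kernels.

(* Main.v *)
(* Interpolating by U = sin(theta) F + cos(theta) N and integrating by parts in the
   Gaussian variables bounds |E h(F) - E h(N)| by the sum over m, q of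
   E |<DF_m, -DL^-1 F_q> - C_mq|, because the gradient of h is Lipschitz.  To keep
   finitely many Gaussian variables, each chaos kernel is approximated in L^2 by
   finite sums of tensor powers: an average over roots of unity selects the
   frequencies with as many negative as positive signs, and a quadrature of phi_J
   splits the factor phi_J^(lambda_1 + ... + lambda_l) into products.
   The variance of <DF_m, -DL^-1 F_q> is a sum over Feynman diagrams in which some
   edge joins the two copies.  In the frequency domain an edge is an average over a
   shift, against an amplitude that is bounded because 2 alpha + beta >= 1; so every
   such diagram is at most a constant times 2^(-3J), and the prefactor 2^J leaves
   2^J 2^(-3J/2) = 2^(-J/2).  The number of diagrams for the orders p and q is
   E[He_(p-1)^2 He_(q-1)^2] <= p! q! 3^(p+q) / q^2. *)

Require Import Defs.
From mathcomp Require Import all_boot all_order all_algebra.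
From mathcomp Require Import complex.
From mathcomp Require Import all_classical all_reals all_analysis.
From mathcomp Require Import perm measurable_realfun.
From mathcomp Require Import zify ring lra.

Set Implicit Arguments.
Unset Strict Implicit.
Unset Printing Implicit Defensive.

Import Order.TTheory GRing.Theory Num.Theory.
Import numFieldNormedType.Exports.

Local Open Scope classical_set_scope.
Local Open Scope ring_scope.
Local Open Scope complex_scope.

(** * Real integrals *)

(** With finitely many Gaussian variables, Malliavin calculus reduces to finite-dimensional Gaussian
    integration by parts. Two obstacles shape the argument. The gradient of [h] is only Lipschitz,
    so second derivatives come from averages over small boxes; their bound 1 does not depend on the
    box size, and only that bound enters the estimate. The quadrature weights of [phi_J] are signed,
    and absolute values node by node would lose the decay in [J]: a finite exponential sum is not
    integrable in frequency. The variance is therefore bounded only in the limit of infinitely many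
    nodes, when each vertex carries the Fourier transform of [phi_J]. The power [2^(-3J)] comes from
    the four vertices of a diagram: three of the transforms are integrated, each giving [2^(-J)]
    times the mass of the transform of [phi], and the fourth is bounded by its supremum, for which
    the [L^1] norm of [phi_J], free of [J], suffices. Laws are identified by cosine transforms with
    a free phase, so singular covariance matrices are allowed. *)

Notation integ mu f := (integrable mu setT (EFin \o f)).

Section real_integral.
Context d (T : measurableType d) (R : realType).
Implicit Types (mu : {measure set T -> \bar R}) (P : probability T R).
Implicit Types (f g : T -> R).

Lemma integ_measurable mu f : integ mu f -> measurable_fun setT f.
Proof. by move=> /measurable_int/measurable_EFinP. Qed.

Lemma integ_le mu f g : measurable_fun setT f -> (forall x, `|f x| <= g x) ->
  integ mu g -> integ mu f.
Proof.
move=> mf fg ig; apply: le_integrable ig => //; first exact/measurable_EFinP.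
by move=> x _ /=; rewrite lee_fin (le_trans (fg x))// ler_norm.
Qed.

Lemma integD mu f g : integ mu f -> integ mu g -> integ mu (fun x => f x + g x).
Proof. by move=> intf intg; exact: (integrableD _ intf intg). Qed.

Lemma integB mu f g : integ mu f -> integ mu g -> integ mu (fun x => f x - g x).
Proof. by move=> intf intg; exact: (integrableB _ intf intg). Qed.

Lemma integZ mu r f : integ mu f -> integ mu (fun x => r * f x).
Proof. by move=> intf; exact: (integrableZl _ r intf). Qed.

Lemma integN mu f : integ mu f -> integ mu (fun x => - f x).
Proof. by move=> intf; exact: (integrableN intf). Qed.

Lemma integ_norm mu f : integ mu f -> integ mu (fun x => `|f x|).
Proof. by move=> intf; exact: (integrable_norm intf). Qed.

Lemma integ_sum mu I (s : seq I) (Q : pred I) (f : I -> T -> R) :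
  (forall i, Q i -> integ mu (f i)) ->
  integ mu (fun x => \sum_(i <- s | Q i) f i x).
Proof.
move=> intf.
rewrite (_ : _ \o _ = (fun x => \sum_(i <- s | Q i) (f i x)%:E))%E.
  by apply: integrable_sum => // i Qi; exact: intf.
by apply/funext => x /=; rewrite sumEFin.
Qed.

Lemma rint_sum mu I (s : seq I) (Q : pred I) (f : I -> T -> R) :
  (forall i, Q i -> integ mu (f i)) ->
  \int[mu]_x (\sum_(i <- s | Q i) f i x) = \sum_(i <- s | Q i) \int[mu]_x f i x.
Proof.
move=> intf; elim: s => [|i s ih].
  rewrite big_nil; under eq_Rintegral do rewrite big_nil.
  by rewrite /Rintegral integral0.
rewrite big_cons; case: ifPn => Qi; last first.
  by rewrite -ih; apply: eq_Rintegral => x _; rewrite big_cons (negbTE Qi).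
rewrite -ih -RintegralD//; [|exact: intf|exact: integ_sum].
by apply: eq_Rintegral => x _; rewrite big_cons Qi.
Qed.

Lemma rintD mu f g : integ mu f -> integ mu g ->
  \int[mu]_x (f x + g x) = \int[mu]_x f x + \int[mu]_x g x.
Proof. by move=> *; rewrite RintegralD. Qed.

Lemma rintB mu f g : integ mu f -> integ mu g ->
  \int[mu]_x (f x - g x) = \int[mu]_x f x - \int[mu]_x g x.
Proof. by move=> *; rewrite RintegralB. Qed.

Lemma rintZ mu r f : integ mu f ->
  \int[mu]_x (r * f x) = r * \int[mu]_x f x.
Proof. by move=> *; rewrite RintegralZl. Qed.

Lemma rintN mu f : integ mu f -> \int[mu]_x (- f x) = - \int[mu]_x f x.
Proof.
move=> intf; rewrite -mulN1r -rintZ//; apply: eq_Rintegral => x _.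
by rewrite mulN1r.
Qed.

Lemma eq_rint mu f g : (forall x, f x = g x) -> \int[mu]_x f x = \int[mu]_x g x.
Proof. by move=> fg; apply: eq_Rintegral => x _. Qed.

Lemma le_rint mu f g : integ mu f -> integ mu g -> (forall x, f x <= g x) ->
  \int[mu]_x f x <= \int[mu]_x g x.
Proof. by move=> intf intg fg; apply: le_Rintegral. Qed.

Lemma le_abs_rint mu f g : measurable_fun setT f -> integ mu g ->
  (forall x, `|f x| <= g x) -> `|\int[mu]_x f x| <= \int[mu]_x g x.
Proof.
move=> mf intg fg; have intf := integ_le mf fg intg.
apply: (le_trans (le_normr_Rintegral _ intf)) => //.
by apply: le_rint => //; exact: integ_norm.
Qed.

Lemma rint_ge0 mu f : (forall x, 0 <= f x) -> 0 <= \int[mu]_x f x.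
Proof. by move=> f0; apply: Rintegral_ge0. Qed.

Lemma rintE mu f : integ mu f -> (\int[mu]_x f x)%:E = (\int[mu]_x (f x)%:E)%E.
Proof. by move=> intf; rewrite /Rintegral fineK// integrable_fin_num. Qed.

Lemma rint_cst P r : \int[P]_x r = r.
Proof.
rewrite Rintegral_cst// -[RHS]mulr1; congr (_ * _).
exact: (congr1 fine (probability_setT P)).
Qed.

Lemma integ_cst P r : integ P (fun=> r).
Proof. exact: (@finite_measure_integrable_cst _ _ _ P setT r). Qed.

Lemma integ_bounded P f M : measurable_fun setT f -> (forall x, `|f x| <= M) ->
  integ P f.
Proof. by move=> mf fM; apply: (integ_le mf fM); exact: integ_cst. Qed.

Lemma abs_rint_le P f M : measurable_fun setT f -> (forall x, `|f x| <= M) ->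
  `|\int[P]_x f x| <= M.
Proof.
move=> mf fM; rewrite -(rint_cst P M).
by apply: le_abs_rint => //; exact: integ_cst.
Qed.

Lemma ge0_integ mu f : measurable_fun setT f -> (forall x, 0 <= f x) ->
  (\int[mu]_x (f x)%:E < +oo)%E -> integ mu f.
Proof.
move=> mf f0 foo; apply/integrableP; split; first exact/measurable_EFinP.
by under eq_integral do rewrite /= ger0_norm//.
Qed.

Lemma ge0_integ_lty mu f : (forall x, 0 <= f x) -> integ mu f ->
  (\int[mu]_x (f x)%:E < +oo)%E.
Proof. by move=> f0 /integrable_lty; apply. Qed.

Lemma rint_dct mu (f_ : nat -> T -> R) f g :
  (forall n, measurable_fun setT (f_ n)) ->
  (forall x, f_ ^~ x @ \oo --> f x) ->
  integ mu g -> (forall n x, `|f_ n x| <= g x) ->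
  integ mu f /\ (fun n => \int[mu]_x f_ n x) @ \oo --> \int[mu]_x f x.
Proof.
move=> mf ff ig fg.
have mf' : measurable_fun setT f by exact: (measurable_fun_cvg mf).
have := @dominated_convergence _ T R mu setT measurableT
  (fun n x => (f_ n x)%:E) (fun x => (f x)%:E) (fun x => (g x)%:E).
case.
- by move=> n; exact/measurable_EFinP.
- exact/measurable_EFinP.
- by apply/aeW => x _; apply: cvg_EFin; [exact: nearW|exact: ff].
- exact: ig.
- by apply/aeW => x n _ /=; rewrite lee_fin.
move=> intf _ cv; split => //.
by apply: fine_cvg; rewrite rintE.
Qed.

End real_integral.

Section real_fubini.
Context d1 d2 (T1 : measurableType d1) (T2 : measurableType d2) (R : realType).
Variables (m1 : {sigma_finite_measure set T1 -> \bar R}).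
Variables (m2 : {sigma_finite_measure set T2 -> \bar R}).

Lemma rfubini1 (f : T1 * T2 -> R) : integ (m1 \x m2)%E f ->
  (forall x, integ m2 (fun y => f (x, y))) ->
  integ m1 (fun x => \int[m2]_y f (x, y)) /\
  \int[m1]_x \int[m2]_y f (x, y) = \int[(m1 \x m2)%E]_z f z.
Proof.
move=> intf int1.
have E : (fun x => (\int[m2]_y f (x, y))%:E) =
    fubini_F m2 (EFin \o f) by apply/funext => x; rewrite rintE.
split; first by rewrite /comp E; exact: integrable_fubini_F.
rewrite {1 3}/Rintegral; congr fine.
by rewrite -integral12_prod_meas1// -E.
Qed.

Lemma rfubini2 (f : T1 * T2 -> R) : integ (m1 \x m2)%E f ->
  (forall y, integ m1 (fun x => f (x, y))) ->
  \int[m2]_y \int[m1]_x f (x, y) = \int[(m1 \x m2)%E]_z f z.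
Proof.
move=> intf int1.
have E : (fun y => (\int[m1]_x f (x, y))%:E) =
    fubini_G m1 (EFin \o f) by apply/funext => x; rewrite rintE.
rewrite {1 3}/Rintegral; congr fine.
by rewrite -integral21_prod_meas1// -E.
Qed.

Lemma rfubini (f : T1 * T2 -> R) : integ (m1 \x m2)%E f ->
  (forall x, integ m2 (fun y => f (x, y))) ->
  (forall y, integ m1 (fun x => f (x, y))) ->
  \int[m1]_x \int[m2]_y f (x, y) = \int[m2]_y \int[m1]_x f (x, y).
Proof.
by move=> intf h1 h2; rewrite (rfubini1 intf h1).2 (rfubini2 intf h2).
Qed.

End real_fubini.

Section cvg_bound.
Context (R : realType).

(** A quadratic remainder passes through integrals and finite sums by monotonicity, so this
    criterion differentiates functions defined by means without interchanging limits. *)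
Lemma quad_is_derive (g : R -> R) (x g' C : R) :
  (forall r, `|r| <= 1 -> `|g (x + r) - g x - r * g'| <= C * r ^+ 2) ->
  is_derive x 1 g g'.
Proof.
move=> H.
have C0 : 0 <= C by have := H 1; rewrite normr1 expr1n mulr1 => /(_ (lexx _)); exact: le_trans.
have cvg0 : (fun h : R => h^-1 *: (g (h *: 1 + x) - g x)) @ 0^' --> g'.
  apply/subr_cvg0; apply: (@cvg_to_0_linear _ _ C 1) => // r /andP[r0 r1].
  rewrite normr_gt0 in r0.
  have E : r^-1 *: (g (r *: 1 + x) - g x) - g' =
      r^-1 * (g (x + r) - g x - r * g').
    by rewrite [r *: 1]mulr1 (addrC r x) [_ *: _]/GRing.scale/= [RHS]mulrBr mulKf.
  rewrite [X in `|X|](_ : _ = r^-1 * (g (x + r) - g x - r * g'))//.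
  rewrite normrM normfV ler_pdivrMl ?normr_gt0//.
  by rewrite (le_trans (H _ (ltW r1)))// -[r ^+ 2]real_normK ?num_real// expr2 mulrCA.
apply: DeriveDef; first by apply/cvg_ex; exists g'.
exact/cvg_lim.
Qed.

End cvg_bound.

(** * Mean value estimates in one variable *)

Section one_variable.
Context (R : realType).
Implicit Types (g dg : R -> R) (x y L : R).

Lemma is_derive_continuous g dg : (forall x, is_derive x 1 g (dg x)) ->
  continuous g.
Proof.
move=> dgP x; apply: differentiable_continuous.
by apply/derivable1_diffP; have [] := dgP x.
Qed.

Lemma derive_MVT g dg x y : (forall x, is_derive x 1 g (dg x)) ->
  exists2 c, `|c - x| <= `|y - x| & g y - g x = dg c * (y - x).
Proof.
move=> dgP; have cg := is_derive_continuous dgP.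
have H a b : a <= b -> exists2 c, a <= c <= b & g b - g a = dg c * (b - a).
  move=> ab.
  have [|c cab E] := @MVT_segment _ g dg a b ab (fun x _ => dgP x).
    exact: continuous_subspaceT.
  by exists c => //; rewrite in_itv in cab.
have [xy|/ltW yx] := leP x y.
  have [c /andP[xc cy] E] := H _ _ xy; exists c => //.
  by rewrite !ger0_norm ?subr_ge0// lerB.
have [c /andP[yc cx] E] := H _ _ yx; exists c.
  by rewrite !ler0_norm ?subr_le0// lerN2 lerB.
by rewrite -opprB E -mulrN opprB.
Qed.

Lemma derive_lip g dg L x y : (forall x, is_derive x 1 g (dg x)) ->
  (forall x, `|dg x| <= L) -> `|g y - g x| <= L * `|y - x|.
Proof.
move=> dgP dgL; have [c _ ->] := derive_MVT x y dgP.
by rewrite normrM ler_wpM2r.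
Qed.

Lemma derive_quad g dg L x y : (forall x, is_derive x 1 g (dg x)) ->
  (forall x y, `|dg y - dg x| <= L * `|y - x|) ->
  `|g y - g x - (y - x) * dg x| <= L * (y - x) ^+ 2.
Proof.
move=> dgP dgL; have [c cx ->] := derive_MVT x y dgP.
rewrite (mulrC (y - x)) -mulrBl normrM -[_ ^+ 2]real_normK ?num_real//.
rewrite expr2 mulrA ler_wpM2r// (le_trans (dgL _ _))//.
have := dgL 0 1; rewrite subr0 normr1 mulr1 => L0.
by rewrite ler_wpM2l// (le_trans _ L0).
Qed.

Lemma derive0_cst g x y : (forall x, is_derive x 1 g 0) -> g x = g y.
Proof.
move=> dg0; apply/eqP; rewrite -subr_eq0 -normr_le0.
by have := @derive_lip g (fun=> 0) 0 y x dg0; rewrite mul0r; apply => _; rewrite normr0.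
Qed.

Lemma normr_cos x : `|cos x| <= 1.
Proof. by rewrite ler_norml cos_geN1 cos_le1. Qed.

Lemma normr_sin x : `|sin x| <= 1.
Proof. by rewrite ler_norml sin_geN1 sin_le1. Qed.

Lemma sin_lip x y : `|sin y - sin x| <= `|y - x|.
Proof.
rewrite -[leRHS]mul1r; apply: (derive_lip (dg := cos)) => z.
exact: normr_cos.
Qed.

Lemma cos_lip x y : `|cos y - cos x| <= `|y - x|.
Proof.
rewrite -[leRHS]mul1r; apply: (derive_lip (dg := fun x => - sin x)) => z.
by rewrite normrN normr_sin.
Qed.

Lemma cos_quad x h : `|cos (x + h) - cos x + h * sin x| <= h ^+ 2.
Proof.
have := @derive_quad cos (fun x => - sin x) 1 x (x + h) (@is_derive_cos _).
rewrite (_ : x + h - x = h) ?mulrN ?opprK ?mul1r; last by ring.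
by apply=> u v; rewrite mul1r -opprD normrN sin_lip.
Qed.

Lemma sin_quad x h : `|sin (x + h) - sin x - h * cos x| <= h ^+ 2.
Proof.
have := @derive_quad sin cos 1 x (x + h) (@is_derive_sin _).
rewrite (_ : x + h - x = h) ?mul1r; last by ring.
by apply=> u v; rewrite mul1r cos_lip.
Qed.

End one_variable.

(** * Integration against a density *)

Section density.
Import HBNNSimple.
Context d (T : measurableType d) (R : realType).
Variables (mu nu : {measure set T -> \bar R}) (p : T -> R).
Hypotheses (mp : measurable_fun setT p) (p0 : forall x, 0 <= p x).
Hypothesis nuE : forall A, measurable A -> nu A = (\int[mu]_(x in A) (p x)%:E)%E.

(** Both sides are continuous along increasing sequences, so it suffices to treat simple functions,
    for which the claim is the hypothesis on [nu], term by term over the finite range. *)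
Lemma ge0_integral_density (f : T -> R) :
  measurable_fun setT f -> (forall x, 0 <= f x) ->
  (\int[nu]_x (f x)%:E = \int[mu]_x (f x * p x)%:E)%E.
Proof.
move=> mf f0.
have mf' : measurable_fun setT (EFin \o f) by exact/measurable_EFinP.
pose h := nnsfun_approx measurableT mf'.
have cvh (x : T) : (h n x)%:E @[n --> \oo] --> (f x)%:E.
  by apply: (cvg_nnsfun_approx measurableT mf') => // y _; rewrite lee_fin.
have cv1 : (\int[nu]_x (h n x)%:E @[n --> \oo] --> \int[nu]_x (f x)%:E)%E.
  rewrite [X in _ --> X](_ : _ =
      \int[nu]_x (limn (fun n => (h n x)%:E)))%E; last first.
    by apply: eq_integral => x _; exact/esym/cvg_lim.
  apply: cvg_monotone_convergence => //.
  - by move=> n; exact/measurable_EFinP.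
  - by move=> n x _; rewrite lee_fin.
  - by move=> x _ a b ab; rewrite lee_fin; exact/lefP/nd_nnsfun_approx.
have cv2 : (\int[mu]_x (h n x * p x)%:E @[n --> \oo] -->
    \int[mu]_x (f x * p x)%:E)%E.
  rewrite [X in _ --> X](_ : _ =
      \int[mu]_x (limn (fun n => (h n x * p x)%:E)))%E; last first.
    apply: eq_integral => x _; apply/esym/cvg_lim => //.
    under eq_fun do rewrite EFinM.
    by rewrite EFinM; apply: cvgeZr => //; exact: cvh.
  apply: cvg_monotone_convergence => //.
  - by move=> n; apply/measurable_EFinP; exact: measurable_funM.
  - by move=> n x _; rewrite lee_fin mulr_ge0.
  - move=> x _ a b ab; rewrite lee_fin ler_wpM2r//.
    exact/lefP/nd_nnsfun_approx.
suff E n : (\int[nu]_x (h n x)%:E = \int[mu]_x (h n x * p x)%:E)%E.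
  have {}cv1 : (\int[mu]_x (h n x * p x)%:E @[n --> \oo] -->
      \int[nu]_x (f x)%:E)%E.
    by under eq_fun do rewrite -E.
  by rewrite -(cvg_lim _ cv1)// (cvg_lim _ cv2).
have mh r : measurable (h n @^-1` [set r]) by exact: measurable_funPTI.
transitivity (\int[nu]_x \sum_(y \in range (h n))
    (y * \1_(h n @^-1` [set y]) x)%:E)%E.
  by apply: eq_integral => x _; rewrite /= fimfunE -fsumEFin.
transitivity (\int[mu]_x \sum_(y \in range (h n))
    (y * \1_(h n @^-1` [set y]) x * p x)%:E)%E; last first.
  apply: eq_integral => x _; rewrite /= [in RHS]fimfunE mulr_fsuml.
  by rewrite -fsumEFin.
rewrite ge0_integral_fsum//; last 2 first.
- by move=> r; apply/measurable_EFinP; exact: measurable_funM.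
- by move=> r x _; exact: nnfun_muleindic_ge0.
rewrite ge0_integral_fsum//; last 2 first.
- move=> r; apply/measurable_EFinP; apply: measurable_funM => //.
  exact: measurable_funM.
- move=> r x _; rewrite EFinM mule_ge0 ?lee_fin//.
  by have := nnfun_muleindic_ge0 (h n) r x; rewrite lee_fin.
apply: eq_fsbigr => r /[!inE] -[x _ <-].
under eq_integral do rewrite EFinM.
rewrite ge0_integralZl//; [|exact/measurable_EFinP|by rewrite lee_fin].
rewrite integral_indic// setIT nuE//.
under [RHS]eq_integral do rewrite -mulrA EFinM.
rewrite [RHS]ge0_integralZl//; last 3 first.
- by apply/measurable_EFinP; exact: measurable_funM.
- by move=> y _; rewrite lee_fin mulr_ge0.
- by rewrite lee_fin.
congr (_ * _)%E; rewrite [LHS]integral_mkcond; apply: eq_integral => y _.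
rewrite patchE indicE; case: ifPn => _; last by rewrite mul0r.
by rewrite mul1r.
Qed.

Lemma integ_density (f : T -> R) : measurable_fun setT f ->
  integ mu (fun x => f x * p x) ->
  integ nu f /\ \int[nu]_x f x = \int[mu]_x (f x * p x).
Proof.
move=> mf /[dup] intf /integrableP[_ foo].
have mfp (g : R -> R) : measurable_fun setT g -> measurable_fun setT (g \o f).
  by move=> mg; exact: measurableT_comp.
have abs_integ : integ nu (fun x => `|f x|).
  apply: ge0_integ => //; first exact: measurableT_comp.
  rewrite ge0_integral_density//; last exact: measurableT_comp.
  move: foo; congr (_ < _)%E; apply: eq_integral => x _ /=.
  by rewrite normrM (ger0_norm (p0 x)).
have nuf : integ nu f by apply: (integ_le _ _ abs_integ).
split=> //.
have ge0E (g : T -> R) : measurable_fun setT g -> (forall x, 0 <= g x) ->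
    \int[nu]_x g x = \int[mu]_x (g x * p x).
  by move=> mg g0; rewrite /Rintegral ge0_integral_density.
(* Both [f + |f|] and [|f|] are nonnegative, so the nonnegative case applies to each. *)
have fE x : f x = (f x + `|f x|) - `|f x| by rewrite addrK.
have mabs : measurable_fun setT (fun x => `|f x|) by exact: measurableT_comp.
have mu_abs : integ mu (fun x => `|f x| * p x).
  apply: integ_le (integ_norm intf); first exact: measurable_funM.
  by move=> x; rewrite !normrM normr_id.
rewrite (eq_rint _ fE) rintB//; last exact: integD.
rewrite ge0E//; last 2 first.
- exact: measurable_funD.
- by move=> x; have := ler_norm (- f x); rewrite normrN; lra.
rewrite ge0E// -rintB//; last first.
  by under eq_fun do rewrite mulrDl; exact: integD.
by apply: eq_rint => x; rewrite -mulrBl addrK.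
Qed.

End density.

(** * Gaussian families *)

Section standard_gaussian.
Context (R : realType).
Local Notation mu := (@lebesgue_measure R).

Definition stdg : probability (measurableTypeR R) R := normal_prob 0 1.

Local Notation gam := stdg.
Local Notation phi := (@normal_pdf R 0 1).

Lemma stdpdfE (x : R) : phi x = normal_peak 1 * expR (- (x ^+ 2 / 2)).
Proof.
by rewrite normal_pdfE ?oner_neq0// /normal_fun subr0 expr1n mulNr.
Qed.

Lemma stdpdf_ge0 (x : R) : 0 <= phi x.
Proof. exact: normal_pdf_ge0. Qed.

Lemma measurable_stdpdf : measurable_fun setT phi.
Proof. exact: measurable_normal_pdf. Qed.

Lemma continuous_stdpdf : continuous phi.
Proof. by apply: continuous_normal_pdf; rewrite oner_neq0. Qed.

Lemma integ_stdg (f : R -> R) : measurable_fun setT f ->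
  integ mu (fun x => f x * phi x) ->
  integ gam f /\ \int[gam]_x f x = \int[mu]_x (f x * phi x).
Proof.
exact: (@integ_density _ _ R mu gam phi measurable_stdpdf stdpdf_ge0).
Qed.

Lemma integ_expR_stdpdf (N : R) : integ mu (fun x => expR (N * `|x|) * phi x).
Proof.
have s2 : Num.sqrt 2 != 0 :> R by rewrite gt_eqF// sqrtr_gt0.
(* Completing the square in [|x|]: the product is dominated by a multiple of the normal density of
   variance 2, which is integrable. *)
have H (x : R) : N * `|x| - x * (x / 2) <= N ^+ 2 + - x ^+ 2 / (2 *+ 2).
  rewrite mulrA -expr2.
  have := sqr_ge0 (N - `|x| / 2); rewrite -[x ^+ 2]real_normK ?num_real//.
  have -> : - `|x| ^+ 2 / (2 *+ 2) = - (`|x| ^+ 2 / 4) :> R.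
    by rewrite -mulr_natr; field.
  lra.
have /(integZ (normal_peak 1 * expR (N ^+ 2) / normal_peak (Num.sqrt 2))) :=
  integrable_normal_pdf (0 : R) (Num.sqrt 2).
apply: integ_le.
  apply: measurable_funM; last exact: measurable_stdpdf.
  by apply: measurableT_comp => //; apply: measurable_funM => //; exact: measurableT_comp.
move=> x; rewrite ger0_norm; last by rewrite mulr_ge0 ?expR_ge0 ?stdpdf_ge0.
rewrite stdpdfE normal_pdfE// mulrCA -!mulrA ler_wpM2l ?normal_peak_ge0//.
rewrite mulKf ?gt_eqF ?normal_peak_gt0// -!expRD ler_expR.
rewrite /normal_fun subr0 sqr_sqrtr//.
Qed.

Lemma integ_stdg_expR (f : R -> R) (C N : R) : measurable_fun setT f ->
  (forall x, `|f x| <= C * expR (N * `|x|)) -> integ gam f.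
Proof.
move=> mf fC; apply: (integ_stdg mf _).1.
have := integZ C (integ_expR_stdpdf N); apply: integ_le.
  by apply: measurable_funM => //; exact: measurable_stdpdf.
move=> x; rewrite normrM (ger0_norm (stdpdf_ge0 _)) mulrA.
by rewrite ler_wpM2r ?stdpdf_ge0.
Qed.

Lemma stdpdf_decay (N : R) :
  (fun n : nat => expR (N * n%:R) * phi n%:R) @ \oo --> 0.
Proof.
have H : (fun n : nat => normal_peak 1 * expR ((N + 1) ^+ 2 / 2) * expR (- n%:R))
    @ \oo --> (0 : R).
  rewrite -[X in _ --> X](mulr0 (normal_peak 1 * expR ((N + 1) ^+ 2 / 2))).
  apply: cvgMr.
  exact: (cvg_comp _ _ (@cvgr_idn R) (@cvgr_expR R)).
apply: (squeeze_cvgr _ (cvg_cst 0) H); apply: nearW => n; apply/andP; split.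
  by rewrite mulr_ge0 ?expR_ge0 ?stdpdf_ge0.
rewrite stdpdfE mulrCA -mulrA ler_wpM2l ?normal_peak_ge0// -!expRD ler_expR.
have := sqr_ge0 (N + 1 - n%:R); set m : R := n%:R; lra.
Qed.

Lemma is_derive_stdpdf (x : R) : is_derive x 1 phi (- x * phi x).
Proof.
rewrite (_ : phi = fun x => normal_peak 1 * expR (- (x ^+ 2 / 2))); last first.
  by apply/funext => y; rewrite stdpdfE.
apply: is_derive_eq.
by rewrite /GRing.scale/=; field.
Qed.

(** The derivative of [psi * phi] is [(dpsi - x psi) * phi]; its integral over growing intervals is
    a boundary term that the Gaussian density kills, and dominated convergence reaches the whole
    line. *)
Lemma gauss_ibp (psi dpsi : R -> R) (C N : R) :
  (forall x : R, is_derive x 1 psi (dpsi x)) -> continuous dpsi ->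
  (forall x, `|psi x| <= C * expR (N * `|x|)) ->
  (forall x, `|dpsi x| <= C * expR (N * `|x|)) ->
  \int[gam]_x (x * psi x) = \int[gam]_x dpsi x.
Proof.
move=> dP cd psiC dpsiC.
have cpsi := is_derive_continuous dP.
have mpsi : measurable_fun setT psi by exact: continuous_measurable_fun.
have mdpsi : measurable_fun setT dpsi by exact: continuous_measurable_fun.
have C0 : 0 <= C.
  have := psiC 0; rewrite normr0 mulr0 expR0 mulr1; exact: le_trans.
pose chi x := (dpsi x - x * psi x) * phi x.
have intd : integ gam dpsi by exact: integ_stdg_expR dpsiC.
have xpsiC x : `|x * psi x| <= C * expR ((N + 1) * `|x|).
  rewrite normrM mulrC mulrDl mul1r expRD mulrA ler_pM//.
  by rewrite (le_trans _ (expR_ge1Dx _))// lerDr.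
have mxpsi : measurable_fun setT (fun x : R => x * psi x) by exact: measurable_funM.
have intx : integ gam (fun x : R => x * psi x).
  exact: integ_stdg_expR xpsiC.
apply/esym/eqP; rewrite -subr_eq0 -rintB//; apply/eqP.
have mdx : measurable_fun setT (fun x : R => dpsi x - x * psi x).
  exact: measurable_funB.
have ichi : integ mu chi.
  have := integD (integZ C (integ_expR_stdpdf N)) (integZ C (integ_expR_stdpdf (N + 1))).
  apply: integ_le; first by apply: measurable_funM => //; exact: measurable_stdpdf.
  move=> x; rewrite /chi normrM (ger0_norm (stdpdf_ge0 _)) !mulrA -mulrDl.
  rewrite ler_wpM2r ?stdpdf_ge0// (le_trans (ler_normB _ _))// lerD//.
rewrite (integ_stdg mdx ichi).2.
pose F x := psi x * phi x.
have dF (x : R) : is_derive x 1 F (chi x).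
  have := is_derive_stdpdf x; have := dP x => h1 h2.
  apply: is_derive_eq; rewrite /GRing.scale/= /chi; ring.
have cchi : continuous chi.
  move=> x; apply: cvgM; last exact: continuous_stdpdf.
  by apply: cvgB; [exact: cd|apply: cvgM; [exact: cvg_id|exact: cpsi]].
pose D (n : nat) := `[- n.+1%:R, n.+1%:R]%classic : set R.
have ED n : \int[mu]_x (chi x * \1_(D n) x) = F n.+1%:R - F (- n.+1%:R).
  have n0 : (0 : R) < n.+1%:R by [].
  rewrite -[RHS]/(fine ((F n.+1%:R)%:E - (F (- n.+1%:R))%:E)%E).
  rewrite -(@continuous_FTC2 R chi F (- n.+1%:R) n.+1%:R).
  - rewrite -[RHS]/(\int[mu]_(x in `[- n.+1%:R, n.+1%:R]) chi x).
    rewrite [RHS]Rintegral_mkcond; apply: eq_rint => x.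
    by rewrite patchE indicE; case: ifPn => _; rewrite ?mulr1 ?mulr0.
  - by lra.
  - exact: continuous_subspaceT.
  - have cF := is_derive_continuous dF; split.
    + by move=> x _; have [] := dF x.
    + by apply: cvg_at_right_filter; exact: cF.
    + by apply: cvg_at_left_filter; exact: cF.
  - by move=> x _; rewrite derive1E derive_val.
have [_ cv] : integ mu chi /\ (fun n => \int[mu]_x (chi x * \1_(D n) x)) @ \oo
    --> \int[mu]_x chi x.
  apply: (@rint_dct _ _ _ mu (fun n (x : R) => chi x * \1_(D n) x) chi
    (fun x : R => `|chi x|)).
  - move=> n; apply: measurable_funM; last first.
      by apply: measurable_indic; exact: measurable_itv.
    exact: continuous_measurable_fun.
  - move=> x; apply: cvg_near_cst; near=> n.
    rewrite indicE mem_set ?mulr1// /D /= in_itv/= -ler_norml.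
    apply: (@le_trans _ _ n%:R); last by rewrite ler_nat.
    near: n; exact: nbhs_infty_ger.
  - exact: integ_norm.
  - move=> n x; rewrite normrM ler_piMr// indicE; case: (_ \in _) => /=; rewrite ?normr1 ?normr0//.
have cv0 : (fun n => \int[mu]_x (chi x * \1_(D n) x)) @ \oo --> 0.
  have H (s : R) : `|s| = 1 -> (fun n : nat => F (s * n.+1%:R)) @ \oo --> (0 : R).
    move=> s1; apply/cvgr0Pnorm_le => e e0.
    have : (fun n : nat => C * (expR (N * n.+1%:R) * phi n.+1%:R)) @ \oo --> (0 : R).
      rewrite -[X in _ --> X](mulr0 C); apply: cvgMr.
      by have := stdpdf_decay N; rewrite -cvg_shiftS.
    move/cvgr0Pnorm_le => /(_ _ e0); apply: filterS => n; apply: le_trans.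
    rewrite [leRHS]ger0_norm; last by rewrite !mulr_ge0 ?expR_ge0 ?stdpdf_ge0.
    have -> : phi n.+1%:R = phi (s * n.+1%:R).
      by rewrite !stdpdfE exprMn -[s ^+ 2]real_normK ?num_real// s1 expr1n mul1r.
    rewrite /F normrM (ger0_norm (stdpdf_ge0 _)) mulrA ler_wpM2r ?stdpdf_ge0//.
    by rewrite (le_trans (psiC _))// normrM s1 mul1r ger0_norm.
  have -> : (fun n => \int[mu]_x (chi x * \1_(D n) x)) =
      (fun n : nat => F (1 * n.+1%:R) - F (-1 * n.+1%:R)).
    by apply/funext => n; rewrite ED mul1r mulN1r.
  suff : (fun n : nat => F (1 * n.+1%:R) - F (-1 * n.+1%:R)) @ \oo
      --> (0 - 0 : R) by rewrite subr0.
  by apply: cvgB; apply: H; rewrite ?normrN1 ?normr1.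
exact: (cvg_unique _ cv cv0).
Unshelve. all: by end_near.
Qed.

(** As a function of [s] the left side satisfies [f' = - s f]: differentiation under the integral
    brings down a factor [x], which integration by parts turns into [s]. *)
Lemma stdg_cos (s c : R) : \int[gam]_x cos (s * x + c) = expR (- (s ^+ 2 / 2)) * cos c.
Proof.
pose f s := \int[gam]_x cos (s * x + c).
have maff (a b : R) : measurable_fun setT (fun x : R => a * x + b).
  by apply: measurable_funD => //; exact: measurable_funM.
have mcos (a b : R) : measurable_fun setT (fun x : R => cos (a * x + b)).
  apply: (measurableT_comp _ (maff a b)).
  by apply: continuous_measurable_fun; exact: continuous_cos.
have msin (a b : R) : measurable_fun setT (fun x : R => sin (a * x + b)).
  apply: (measurableT_comp _ (maff a b)).
  by apply: continuous_measurable_fun; exact: continuous_sin.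
have icos a b : integ gam (fun x => cos (a * x + b)).
  apply: (@integ_bounded _ _ _ gam (fun x : R => cos (a * x + b)) 1) => [|x]; first exact: mcos.
   exact: normr_cos.
have ixsin a b : integ gam (fun x => x * sin (a * x + b)).
  apply: (@integ_stdg_expR _ 1 1); first exact: measurable_funM.
  move=> x; rewrite normrM mul1r -[leRHS]mulr1 ler_pM ?normr_sin// mul1r.
  by rewrite (le_trans _ (expR_ge1Dx _))// lerDr.
have ix2 : integ gam (fun x => x ^+ 2).
  apply: (@integ_stdg_expR _ 2 1); first exact: measurable_funX.
  move=> x; rewrite mul1r normrX.
  by have := @expR_ge1Dxn R `|x| 1 (normr_ge0 _); rewrite (_ : 2`!%:R = 2 :> R)//; lra.
have df (s1 : R) : is_derive s1 1 f (- s1 * f s1).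
  have E1 : - s1 * f s1 = - \int[gam]_x (x * sin (s1 * x + c)).
    rewrite mulNr; congr (- _).
    have dsin (x : R) :
        is_derive x 1 (fun x => sin (s1 * x + c)) (s1 * cos (s1 * x + c)).
      by apply: is_derive_eq; rewrite /GRing.scale/=; ring.
    rewrite (@gauss_ibp _ _ (1 + `|s1|) 0 dsin); first by rewrite rintZ.
    - move=> x; apply: cvgM; first exact: cvg_cst.
      apply: continuous_comp; last exact: continuous_cos.
      by apply: cvgD; [apply: cvgM; [exact: cvg_cst|exact: cvg_id]|exact: cvg_cst].
    - move=> x; rewrite mul0r expR0 mulr1 (le_trans (normr_sin _))//.
      by rewrite lerDl.
    - move=> x; rewrite mul0r expR0 mulr1 normrM (@le_trans _ _ `|s1|)//.
        by rewrite ler_piMr ?normr_cos.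
      by rewrite lerDr.
  (* The remainder of [cos] is at most [(h x)^2], so the second moment serves as the constant. *)
  apply: (@quad_is_derive _ _ _ _ (\int[gam]_x (x ^+ 2))) => h _.
  rewrite E1 -rintN// -rintZ; last exact: integN.
  rewrite -!rintB//; last 2 first.
  - by apply: integB.
  - by apply: integZ; exact: integN.
  rewrite mulrC -rintZ//; apply: le_abs_rint; last first.
  - move=> x; have := cos_quad (s1 * x + c) (h * x).
    rewrite (_ : s1 * x + c + h * x = (s1 + h) * x + c); last by ring.
    by rewrite mulrN opprK exprMn -mulrA.
  - exact: integZ.
  - apply: (@integ_measurable _ _ _ gam).
    by apply: integB; [exact: integB|apply: integZ; exact: integN].
(* With this integrating factor the differential equation says that [g] is constant. *)
pose g s := f s * expR (s ^+ 2 / 2).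
have dg (s1 : R) : is_derive s1 1 g 0.
  have := df s1 => h1; apply: is_derive_eq.
  by rewrite /GRing.scale/=; field.
have := derive0_cst s 0 dg; rewrite /g expr0n/= mul0r expR0 mulr1.
rewrite {2}/f; under [X in _ = X -> _]eq_rint do rewrite mul0r add0r.
rewrite rint_cst => <-.
by rewrite mulrCA -expRD addNr expR0 mulr1.
Qed.

End standard_gaussian.

(** * Uniqueness of laws from cosine transforms *)

Section gaussian_smoothing.
Context (R : realType).
Local Notation mu := (@lebesgue_measure R).
Local Notation gam := (@stdg R).
Local Notation phi := (@normal_pdf R 0 1).

Lemma ge0_integral_affine (G : R -> R) (v e : R) : 0 < e ->
  continuous G -> (forall x, 0 <= G x) ->
  (\int[mu]_x (G x)%:E = \int[mu]_x (G (v + e * x)%R * e)%:E)%E.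
Proof.
move=> e0 cG G0; pose F (x : R) := v + e * x.
have dF (x : R) : is_derive x 1 F e.
  by apply: is_derive_eq; rewrite /GRing.scale/=; ring.
have F'E : (F^`())%classic = (fun=> e) by apply/funext => x; rewrite derive1E derive_val.
rewrite (@increasing_ge0_integration_by_substitutionT R F G)//.
- by rewrite F'E.
- by move=> x y xy; rewrite ltrD2l ltr_pM2l.
- by rewrite F'E; move=> x; exact: cvg_cst.
- by rewrite F'E; exact: is_cvg_cst.
- by rewrite F'E; exact: is_cvg_cst.
- apply/cvgrNyPle => A.
  apply: filterS (nbhs_ninfty_le (num_real ((A - v) / e))) => x xA.
  by rewrite /F -lerBrDl mulrC -ler_pdivlMr.
- apply/cvgryPge => A.
  apply: filterS (nbhs_pinfty_ge (num_real ((A - v) / e))) => x xA.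
  by rewrite /F -lerBlDl mulrC -ler_pdivrMr.
Qed.

(** The standard normal density is its own Fourier transform; this writes a Gaussian kernel as an
    average of cosines. *)
Lemma cos_stdpdf (t : R) : phi t = normal_peak 1 * \int[gam]_x cos (t * x).
Proof.
rewrite stdpdfE; congr (_ * _).
have := @stdg_cos R t 0; rewrite cos0 mulr1 => <-.
by apply: eq_rint => x; rewrite addr0.
Qed.

Variables (k : R -> R) (ck : continuous k) (k01 : forall x, 0 <= k x <= 1).

Let k0 x : 0 <= k x. Proof. by have /andP[] := k01 x. Qed.
Let k1 x : `|k x| <= 1. Proof. by have /andP[h1 h2] := k01 x; rewrite ger0_norm. Qed.
Let mk : measurable_fun setT k. Proof. exact: continuous_measurable_fun. Qed.

Lemma smoothingE (e v : R) : 0 < e ->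
  integ mu (fun y => k y * phi ((y - v) / e)) /\
  \int[mu]_y (k y * phi ((y - v) / e)) = e * \int[gam]_z k (v + e * z).
Proof.
move=> e0.
have caff (a b : R) : continuous (fun x : R => a + b * x).
  by move=> x; apply: cvgD; [exact: cvg_cst|apply: cvgM; [exact: cvg_cst|exact: cvg_id]].
have caff' : continuous (fun x : R => (x - v) / e).
  by move=> x; apply: cvgM; [apply: cvgB; [exact: cvg_id|exact: cvg_cst]|exact: cvg_cst].
have cG : continuous (fun y => k y * phi ((y - v) / e)).
  move=> x; apply: cvgM; first exact: ck.
  apply: (@continuous_comp _ _ _ (fun x : R => (x - v) / e) phi); first exact: caff'.
  exact: continuous_stdpdf.
have G0 y : 0 <= k y * phi ((y - v) / e) by rewrite mulr_ge0 ?stdpdf_ge0.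
have E := ge0_integral_affine v e0 cG G0.
have ckv : continuous (fun z => k (v + e * z)).
  move=> x; apply: (@continuous_comp _ _ _ (fun z : R => v + e * z) k).
    exact: caff.
  exact: ck.
have mkv : measurable_fun setT (fun z => k (v + e * z)).
  exact: continuous_measurable_fun.
have iphi : integ mu phi by exact: integrable_normal_pdf.
have ikv : integ mu (fun z => k (v + e * z) * phi z).
  apply: integ_le iphi; first by apply: measurable_funM => //; exact: measurable_stdpdf.
  move=> z; rewrite normrM (ger0_norm (stdpdf_ge0 _)).
  by rewrite ler_piMl ?stdpdf_ge0.
have [_ E2] := integ_stdg mkv ikv.
have E3 : (\int[mu]_x (k x * phi ((x - v) / e))%:E =
    (e * \int[mu]_z (k (v + e * z) * phi z))%:E)%E.
  rewrite E EFinM rintE// -integralZl//; apply: eq_integral => x _.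
  rewrite -EFinM; congr EFin.
  rewrite [X in phi X](_ : _ = x); last by field; rewrite gt_eqF.
  by rewrite mulrC.
split.
  apply: ge0_integ => //; first exact: continuous_measurable_fun.
  by rewrite E3 ltry.
by rewrite [LHS]/Rintegral E3/= E2.
Qed.

Lemma smoothing_cvg (v : R) :
  (fun n : nat => \int[gam]_z k (v + n.+1%:R^-1 * z)) @ \oo --> k v.
Proof.
rewrite -(rint_cst gam (k v)).
apply: (proj2 (@rint_dct _ _ R gam (fun n (z : R) => k (v + n.+1%:R^-1 * z))
  (fun=> k v) (fun=> 1) _ _ _ _)) => //.
- move=> n; apply: (measurableT_comp mk).
  by apply: measurable_funD => //; exact: measurable_funM.
- move=> z.
  apply: (@cvg_comp _ _ _ (fun n : nat => v + n.+1%:R^-1 * z) k _ (nbhs v)).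
    have -> : nbhs v = nbhs (v + 0 * z) by rewrite mul0r addr0.
    apply: cvgD; first exact: cvg_cst.
    by apply: cvgM; [exact: cvg_harmonic|exact: cvg_cst].
  exact: ck.
- exact: integ_cst.
Qed.

Context d (T : measurableType d).

Lemma integ_smoothing (P : probability T R) (Y V : T -> R) (e : R) : 0 < e ->
  measurable_fun setT Y -> measurable_fun setT V -> (forall w, `|Y w| <= 1) ->
  integ (P \x mu)%E (fun z => Y z.1 * (k z.2 * phi ((z.2 - V z.1) / e))) /\
  (forall w, integ mu (fun y => Y w * (k y * phi ((y - V w) / e)))) /\
  (forall y, integ P (fun w => Y w * (k y * phi ((y - V w) / e)))).
Proof.
move=> e0 mY mV Y1; split; last split.
- have mm : measurable_fun setT (fun z : T * R =>
      Y z.1 * (k z.2 * phi ((z.2 - V z.1) / e))).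
    apply: measurable_funM; first exact: measurableT_comp.
    apply: measurable_funM; first exact: measurableT_comp.
    apply: (measurableT_comp (@measurable_stdpdf R)).
    apply: measurable_funM => //; apply: measurable_funB => //.
    exact: measurableT_comp.
  apply/(@integrable12ltyP _ _ T (measurableTypeR R) R P mu).
    exact/measurable_EFinP.
  apply: (@le_lt_trans _ _ (\int[P]_w e%:E)%E); last first.
    by rewrite integral_cst// [X in (_ * X)%E](_ : _ = 1%E) ?mule1 ?ltry//;
      exact: probability_setT.
  apply: ge0_le_integral => //.
  - by move=> w _; exact: integral_ge0.
  - apply: (@measurable_fun_fubini_tonelli_F _ _ T (measurableTypeR R) R mu
      (fun z => `|(Y z.1 * (k z.2 * phi ((z.2 - V z.1) / e)))%:E|%E)) => //.
    by apply: measurableT_comp => //; exact/measurable_EFinP.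
  move=> w _ /=.
  have [i1 E1] := smoothingE (V w) e0.
  apply: (@le_trans _ _ (\int[mu]_y (k y * phi ((y - V w) / e))%:E)%E).
    apply: ge0_le_integral => //.
    + apply/measurable_EFinP; apply: measurableT_comp => //.
      exact: (measurableT_comp mm (pair1_measurable w)).
    + exact: measurable_int i1.
    move=> y _; rewrite lee_fin normrM -[leRHS]mul1r ler_pM//.
    by rewrite ger0_norm// mulr_ge0 ?stdpdf_ge0.
  rewrite -rintE// E1 lee_fin; apply: ler_piMr; first exact: ltW.
  rewrite -(rint_cst gam 1); apply: le_rint; last by move=> z; have /andP[] := k01 (V w + e * z).
  + apply: (@integ_bounded _ _ _ gam _ 1) => //.
    by apply: (measurableT_comp mk); apply: measurable_funD.
  + exact: integ_cst.
- by move=> w; apply: integZ; exact: (smoothingE (V w) e0).1.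
- move=> y; apply: (@integ_bounded _ _ _ P _ (1 * (1 * normal_peak 1))).
    apply: measurable_funM => //; apply: measurable_funM => //.
    apply: (measurableT_comp (@measurable_stdpdf R)).
    by apply: measurable_funM => //; exact: measurable_funB.
  move=> w; rewrite normrM ler_pM// normrM ler_pM//.
  by rewrite ger0_norm ?stdpdf_ge0// normal_pdf_ub ?oner_neq0.
Qed.

(** Averaging cosines over the frequency [x] rebuilds the Gaussian kernel, so a mean against that
    kernel depends on [(Y, V)] only through the means of [Y] times cosines of [V]. *)
Lemma cos_stdpdf_fubini (P : probability T R) (Y V : T -> R) (e y : R) :
  measurable_fun setT Y -> measurable_fun setT V -> (forall w, `|Y w| <= 1) ->
  \int[P]_w (Y w * phi ((y - V w) / e)) = normal_peak 1 *
    \int[gam]_x \int[P]_w (Y w * cos ((- x / e) * V w + x * y / e)).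
Proof.
move=> mY mV Y1.
have mm : measurable_fun setT (fun z : T * R =>
    Y z.1 * cos ((- z.2 / e) * V z.1 + z.2 * y / e)).
  apply: measurable_funM; first exact: measurableT_comp.
  apply: measurableT_comp.
    by apply: continuous_measurable_fun; exact: continuous_cos.
  apply: measurable_funD.
    apply: measurable_funM; last exact: measurableT_comp.
    by apply: measurable_funM => //; exact: measurableT_comp.
  by apply: measurable_funM => //; exact: measurable_funM.
have b1 w x : `|Y w * cos ((- x / e) * V w + x * y / e)| <= 1.
  by rewrite normrM -[leRHS]mulr1 ler_pM// normr_cos.
rewrite -(@rfubini _ _ T (measurableTypeR R) R P gam
  (fun z => Y z.1 * cos ((- z.2 / e) * V z.1 + z.2 * y / e)))//.
- rewrite -rintZ; last first.
    have [] := @rfubini1 _ _ T (measurableTypeR R) R P gam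
      (fun z => Y z.1 * cos ((- z.2 / e) * V z.1 + z.2 * y / e)) => //.
      by apply: (@integ_bounded _ _ _ (P \x gam)%E _ 1) => // -[w x]; exact: b1.
    move=> w; apply: (@integ_bounded _ _ _ gam _ 1) => [|x]; last exact: b1.
    exact: (measurableT_comp mm (pair1_measurable w)).
  apply: eq_rint => w; rewrite cos_stdpdf mulrCA; congr (_ * _).
  rewrite -rintZ; last first.
    apply: (@integ_bounded _ _ _ gam _ 1) => // [|x]; last exact: normr_cos.
    apply: measurableT_comp; last exact: measurable_funM.
    by apply: continuous_measurable_fun; exact: continuous_cos.
  apply: eq_rint => x /=; congr (_ * cos _); ring.
- by apply: (@integ_bounded _ _ _ (P \x gam)%E _ 1) => // -[w x]; exact: b1.
- move=> w; apply: (@integ_bounded _ _ _ gam _ 1) => [|x]; last exact: b1.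
  exact: (measurableT_comp mm (pair1_measurable w)).
- move=> x; apply: (@integ_bounded _ _ _ P _ 1) => [|w]; last exact: b1.
  exact: (measurableT_comp mm (pair2_measurable x)).
Qed.

(** Convolving [k] with a Gaussian of width [1/(n+1)] recovers [k] pointwise; after an exchange of
    integrals the approximations involve [V] only through Gaussian kernels centred at it. *)
Lemma smoothing_limit (P : probability T R) (Y V : T -> R) :
  measurable_fun setT Y -> measurable_fun setT V -> (forall w, `|Y w| <= 1) ->
  (fun n : nat => n.+1%:R * \int[mu]_y (k y *
    \int[P]_w (Y w * phi ((y - V w) / n.+1%:R^-1)))) @ \oo -->
  \int[P]_w (Y w * k (V w)).
Proof.
move=> mY mV Y1.
have E n : n.+1%:R * \int[mu]_y (k y *
      \int[P]_w (Y w * phi ((y - V w) / n.+1%:R^-1))) =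
    \int[P]_w (Y w * \int[gam]_z k (V w + n.+1%:R^-1 * z)) /\
    measurable_fun setT (fun w => Y w * \int[gam]_z k (V w + n.+1%:R^-1 * z)).
  have e0 : 0 < n.+1%:R^-1 :> R by rewrite invr_gt0.
  have [i1 [i2 i3]] := integ_smoothing P e0 mY mV Y1.
  have [i4 E1] := rfubini1 i1 i2.
  have E2 := rfubini2 i1 i3.
  have E3 w : n.+1%:R * \int[mu]_y (Y w * (k y * phi ((y - V w) / n.+1%:R^-1))) =
      Y w * \int[gam]_z k (V w + n.+1%:R^-1 * z).
    have [i5 E5] := smoothingE (V w) e0.
    by rewrite rintZ// E5 mulrCA; congr (_ * _); rewrite mulVKf.
  have -> : \int[mu]_y (k y * \int[P]_w (Y w * phi ((y - V w) / n.+1%:R^-1))) =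
      \int[P]_w \int[mu]_y (Y w * (k y * phi ((y - V w) / n.+1%:R^-1))).
    rewrite E1 -E2; apply: eq_rint => y.
    rewrite -rintZ; first by apply: eq_rint => w; rewrite mulrCA.
    apply: (@integ_bounded _ _ _ P _ (1 * normal_peak 1)).
      apply: measurable_funM => //.
      apply: (measurableT_comp (@measurable_stdpdf R)).
      by apply: measurable_funM => //; exact: measurable_funB.
    move=> w; rewrite normrM ler_pM//.
    by rewrite ger0_norm ?stdpdf_ge0// normal_pdf_ub ?oner_neq0.
  rewrite -rintZ//; split; first exact: eq_rint.
  by have := integ_measurable (integZ n.+1%:R i4); under eq_fun do rewrite E3.
under eq_fun do rewrite (E _).1.
apply: (proj2 (@rint_dct _ _ R P
  (fun n w => Y w * \int[gam]_z k (V w + n.+1%:R^-1 * z)) _ (fun=> 1) _ _ _ _)).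
- by move=> n; have [] := E n.
- move=> w; apply: cvgM; first exact: cvg_cst.
  exact: smoothing_cvg.
- exact: integ_cst.
- move=> n w; rewrite normrM -[leRHS]mul1r ler_pM//.
  apply: (@abs_rint_le _ _ _ gam) => //.
  by apply: (measurableT_comp mk); apply: measurable_funD.
Qed.

End gaussian_smoothing.

Section cos_unique.
Context (R : realType) d d' (T : measurableType d) (T' : measurableType d').
Local Notation mu := (@lebesgue_measure R).
Variables (P : probability T R) (P' : probability T' R).
Variables (Y V : T -> R) (Y' V' : T' -> R).
Hypotheses (mY : measurable_fun setT Y) (mV : measurable_fun setT V).
Hypotheses (mY' : measurable_fun setT Y') (mV' : measurable_fun setT V').
Hypotheses (Y1 : forall w, `|Y w| <= 1) (Y1' : forall w, `|Y' w| <= 1).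
Hypothesis cosE : forall s a, \int[P]_w (Y w * cos (s * V w + a)) =
  \int[P']_w (Y' w * cos (s * V' w + a)).

Lemma cos_unique_cont (k : R -> R) : continuous k ->
  (forall x, 0 <= k x <= 1) ->
  \int[P]_w (Y w * k (V w)) = \int[P']_w (Y' w * k (V' w)).
Proof.
move=> ck k01.
have cv := @smoothing_limit R k ck k01 _ T P Y V mY mV Y1.
have cv' := @smoothing_limit R k ck k01 _ T' P' Y' V' mY' mV' Y1'.
suff E : (fun n : nat => n.+1%:R * \int[mu]_y (k y *
      \int[P]_w (Y w * normal_pdf 0 1 ((y - V w) / n.+1%:R^-1)))) =
    (fun n : nat => n.+1%:R * \int[mu]_y (k y *
      \int[P']_w (Y' w * normal_pdf 0 1 ((y - V' w) / n.+1%:R^-1)))).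
  by rewrite E in cv; exact: (cvg_unique _ cv cv').
apply/funext => n; congr (_ * _); apply: eq_rint => y; congr (_ * _).
rewrite !cos_stdpdf_fubini//; congr (_ * _).
by apply: eq_rint => x; exact: cosE.
Qed.

(** The weight [Y] is what permits an induction over coordinates: it will hold indicators of the
    coordinates already treated and a cosine of those still to come. *)
Lemma cos_unique_le (c : R) :
  \int[P]_w (Y w * (V w <= c)%R%:R) = \int[P']_w (Y' w * (V' w <= c)%R%:R).
Proof.
(* A ramp equal to 1 up to [c] and, for positive [n], to 0 from [c + 1/n] on; it converges to the
   indicator of the closed half-line. *)
pose k n v : R := Num.min 1 (Num.max 0 (1 - n%:R * (v - c))).
have ck n : continuous (k n).
  have c1 : continuous (fun v : R => 1 - n%:R * (v - c)).
    move=> x; apply: cvgB; first exact: cvg_cst.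
    apply: cvgM; first exact: cvg_cst.
    by apply: cvgB; [exact: cvg_id|exact: cvg_cst].
  move=> x.
  have cc (a : R) : {for x, continuous (fun _ : R => a)} by exact: cvg_cst.
  exact: (continuous_min (cc 1) (continuous_max (cc 0) (c1 x))).
have k01 n x : 0 <= k n x <= 1.
  by rewrite /k ge_min lexx le_min ler01 le_max lexx.
have kcvg v : k ^~ v @ \oo --> ((v <= c)%R%:R : R).
  have [vc|cv] := leP v c.
    apply: cvg_near_cst; apply: nearW => n; apply/eqP.
    rewrite /k; apply/eqP; apply/min_idPl; rewrite le_max; apply/orP; right.
    by rewrite lerBrDl gerDr mulr_ge0_le0// subr_le0.
  apply: cvg_near_cst; near=> n.
  rewrite /k (_ : Num.max _ _ = 0); first by apply/min_idPr.
  apply/max_idPl; rewrite subr_le0 -ler_pdivrMr ?subr_gt0// mul1r.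
  by near: n; exact: nbhs_infty_ger.
have lim d0 (T0 : measurableType d0) (P0 : probability T0 R) (Y0 V0 : T0 -> R) :
    measurable_fun setT Y0 -> measurable_fun setT V0 ->
    (forall w, `|Y0 w| <= 1) ->
    (fun n : nat => \int[P0]_w (Y0 w * k n (V0 w))) @ \oo -->
    \int[P0]_w (Y0 w * (V0 w <= c)%R%:R).
  move=> mY0 mV0 Y01.
  apply: (proj2 (@rint_dct _ _ R P0 (fun n w => Y0 w * k n (V0 w)) _ (fun=> 1) _ _ _ _)).
  - move=> n; apply: measurable_funM => //; apply: measurableT_comp => //.
    exact: continuous_measurable_fun.
  - by move=> w; apply: cvgM; [exact: cvg_cst|exact: kcvg].
  - exact: integ_cst.
  - move=> n w; rewrite normrM -[leRHS]mul1r ler_pM//.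
    by have /andP[h1 h2] := k01 n (V0 w); rewrite ger0_norm.
have cv := lim _ _ P _ _ mY mV Y1.
have cv' := lim _ _ P' _ _ mY' mV' Y1'.
have E : (fun n => \int[P]_w (Y w * k n (V w))) =
    (fun n => \int[P']_w (Y' w * k n (V' w))).
  by apply/funext => n; exact: cos_unique_cont.
by rewrite E in cv; exact: (cvg_unique _ cv cv').
Unshelve. all: by end_near.
Qed.

End cos_unique.

(** * From cosine transforms to joint laws *)

Section cramer_wold.
Context (R : realType) (n : nat).

Lemma cosMcos (a b : R) : cos a * cos b = 2^-1 * (cos (a + b) + cos (a - b)).
Proof. by rewrite cosD cosB; lra. Qed.

Lemma measurable_cos : measurable_fun setT (@cos R).
Proof. by apply: continuous_measurable_fun; exact: continuous_cos. Qed.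

Lemma measurable_leq d (T : measurableType d) (V : T -> R) (c : R) :
  measurable_fun setT V -> measurable_fun setT (fun w => (V w <= c)%R%:R : R).
Proof.
move=> mV; rewrite (_ : (fun w => _) = \1_(V @^-1` `]-oo, c])); last first.
  apply/funext => w; rewrite indicE; congr (_%:R); congr nat_of_bool.
  by apply/idP/idP => h; [rewrite inE /= in_itv|rewrite inE /= in_itv in h].
apply: measurable_indic; rewrite -[X in measurable X]setTI.
exact: mV.
Qed.

Section box_part.
Context d (T : measurableType d).
Variables (V : 'I_n -> T -> R) (c : 'I_n -> R).
Hypothesis mV : forall i, measurable_fun setT (V i).

(** Mixed transform: the coordinates below [k] enter through indicators of half-lines, the others
    through a linear form inside a cosine. *)
Definition box_part k w : R := \prod_(i < n | (i < k)%N) (V i w <= c i)%R%:R.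
Definition lin_part k (eta : 'I_n -> R) w : R :=
  \sum_(i < n | (k <= i)%N) eta i * V i w.

Lemma measurable_box_part k : measurable_fun setT (box_part k).
Proof.
rewrite /box_part; under eq_fun do rewrite -big_filter.
elim: [seq _ <- _ | _] => [|i s ih].
  rewrite (_ : (fun w => _) = fun=> 1); first exact: measurable_cst.
  by apply/funext => w; rewrite big_nil.
rewrite (_ : (fun w => _) = fun w => (V i w <= c i)%R%:R *
  \prod_(i <- s) (V i w <= c i)%R%:R); last first.
  by apply/funext => w; rewrite big_cons.
by apply: measurable_funM => //; exact: measurable_leq.
Qed.

Lemma measurable_lin_part k eta : measurable_fun setT (lin_part k eta).
Proof.
rewrite /lin_part; under eq_fun do rewrite -big_filter.
by apply: measurable_sum => i; exact: measurable_funM.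
Qed.

Lemma box_part01 k w : 0 <= box_part k w <= 1.
Proof.
rewrite /box_part; elim/big_rec: _ => [|i x _ /andP[x0 x1]]; first by rewrite ler01 lexx.
by case: (V i w <= c i); rewrite /= ?mul1r ?mul0r ?x0 ?x1 ?lexx ?ler01.
Qed.

Lemma box_part_abs k w : `|box_part k w| <= 1.
Proof. by have /andP[h ?] := box_part01 k w; rewrite ger0_norm. Qed.

Lemma box_partS (i : 'I_n) w :
  box_part i.+1 w = box_part i w * (V i w <= c i)%R%:R.
Proof.
rewrite /box_part (bigD1 i)//= mulrC; congr (_ * _).
by apply: eq_bigl => j; rewrite ltnS ltn_neqAle andbC.
Qed.

Lemma lin_partS (i : 'I_n) eta w :
  lin_part i eta w = eta i * V i w + lin_part i.+1 eta w.
Proof.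
rewrite /lin_part (bigD1 i)//=; congr (_ + _).
by apply: eq_bigl => j; rewrite ltn_neqAle andbC eq_sym.
Qed.

Lemma lin_part_update (i : 'I_n) s eta w :
  lin_part i (fun j => if j == i then s else eta j) w =
  s * V i w + lin_part i.+1 eta w.
Proof.
rewrite lin_partS eqxx; congr (_ + _).
by apply: eq_bigr => j ij; rewrite (gtn_eqF ij : (j == i) = false).
Qed.

End box_part.

Context d d' (T : measurableType d) (T' : measurableType d').
Variables (P : probability T R) (P' : probability T' R).
Variables (V : 'I_n -> T -> R) (V' : 'I_n -> T' -> R).
Hypotheses (mV : forall i, measurable_fun setT (V i)).
Hypotheses (mV' : forall i, measurable_fun setT (V' i)).
Hypothesis cosV : forall (eta : 'I_n -> R) a,
  \int[P]_w cos (\sum_i eta i * V i w + a) =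
  \int[P']_w cos (\sum_i eta i * V' i w + a).

Let measurable_term d0 (T0 : measurableType d0) (V0 : 'I_n -> T0 -> R) c k eta a :
  (forall i, measurable_fun setT (V0 i)) ->
  measurable_fun setT (fun w => box_part V0 c k w * cos (lin_part V0 k eta w + a)).
Proof.
move=> mV0; apply: measurable_funM; first exact: measurable_box_part.
apply: (measurableT_comp measurable_cos); apply: measurable_funD => //.
exact: measurable_lin_part.
Qed.

Let term_abs d0 (T0 : measurableType d0) (V0 : 'I_n -> T0 -> R) c k k' eta a w :
  `|box_part V0 c k w * cos (lin_part V0 k' eta w + a)| <= 1.
Proof.
rewrite normrM -[leRHS]mulr1; apply: ler_pM => //; last exact: normr_cos.
exact: box_part_abs.
Qed.

(** Induction on [k]: the indicators and the remaining cosine form a bounded weight, and one more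
    coordinate is traded from cosine to indicator. The product of the two cosines splits into two
    cosines of the enlarged linear form, to which the induction hypothesis applies. *)
Lemma cramer_wold_part c k : (k <= n)%N -> forall (eta : 'I_n -> R) a,
  \int[P]_w (box_part V c k w * cos (lin_part V k eta w + a)) =
  \int[P']_w (box_part V' c k w * cos (lin_part V' k eta w + a)).
Proof.
elim: k => [_ eta a|k ih kn eta a].
  have E d0 (T0 : measurableType d0) (V0 : 'I_n -> T0 -> R) w :
      box_part V0 c 0 w * cos (lin_part V0 0 eta w + a) =
      cos (\sum_i eta i * V0 i w + a).
    by rewrite /box_part /lin_part big_pred0 ?mul1r.
  by rewrite (eq_rint P (E _ _ _)) (eq_rint P' (E _ _ _)).
have {}ih := ih (ltnW kn).
pose i := Ordinal kn.
have E d0 (T0 : measurableType d0) (V0 : 'I_n -> T0 -> R) w :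
    box_part V0 c k.+1 w * cos (lin_part V0 k.+1 eta w + a) =
    box_part V0 c k w * cos (lin_part V0 k.+1 eta w + a) * (V0 i w <= c i)%R%:R.
  by rewrite (box_partS V0 c i) -!mulrA [X in _ * X]mulrC.
rewrite (eq_rint P (E _ _ _)) (eq_rint P' (E _ _ _)).
have mY d0 (T0 : measurableType d0) (V0 : 'I_n -> T0 -> R) :
    (forall i, measurable_fun setT (V0 i)) -> measurable_fun setT
    (fun w => box_part V0 c k w * cos (lin_part V0 k.+1 eta w + a)).
  move=> mV0; apply: measurable_funM; first exact: measurable_box_part.
  apply: (measurableT_comp measurable_cos); apply: measurable_funD => //.
  exact: measurable_lin_part.
have Y1 d0 (T0 : measurableType d0) (V0 : 'I_n -> T0 -> R) w :
    `|box_part V0 c k w * cos (lin_part V0 k.+1 eta w + a)| <= 1.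
  exact: term_abs.
apply: (cos_unique_le (mY _ _ _ mV) (mV i) (mY _ _ _ mV') (mV' i) (Y1 _ _ _)
  (Y1 _ _ _)).
move=> s b.
have E2 d0 (T0 : measurableType d0) (P0 : probability T0 R) (V0 : 'I_n -> T0 -> R) :
    (forall i, measurable_fun setT (V0 i)) ->
    \int[P0]_w (box_part V0 c k w * cos (lin_part V0 k.+1 eta w + a) *
       cos (s * V0 i w + b)) =
    2^-1 * (\int[P0]_w (box_part V0 c k w *
      cos (lin_part V0 k (fun j => if j == i then s else eta j) w + (a + b))) +
     \int[P0]_w (box_part V0 c k w *
      cos (lin_part V0 k (fun j => if j == i then - s else eta j) w + (a - b)))).
  move=> mV0.
  have it eta' a' : integ P0 (fun w =>
      box_part V0 c k w * cos (lin_part V0 k eta' w + a')).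
    apply: (@integ_bounded _ _ _ P0 _ 1) => [|w]; first exact: measurable_term.
    exact: term_abs.
  rewrite -rintD// -rintZ; last exact: integD.
  apply: eq_rint => w; rewrite -mulrA cosMcos mulrCA -mulrDr; congr (_ * (_ * _)).
  rewrite !(lin_part_update V0 i).
  by congr (cos _ + cos _); ring.
by rewrite !E2// !ih.
Qed.

Lemma cramer_wold_box c :
  \int[P]_w \prod_i (V i w <= c i)%R%:R = \int[P']_w \prod_i (V' i w <= c i)%R%:R.
Proof.
have := cramer_wold_part c (leqnn n) (fun=> 0) 0.
have E d0 (T0 : measurableType d0) (V0 : 'I_n -> T0 -> R) w :
    box_part V0 c n w * cos (lin_part V0 n (fun=> 0) w + 0) =
    \prod_i (V0 i w <= c i)%R%:R.
  rewrite /lin_part big1 ?addr0 ?cos0 ?mulr1; last by move=> i _; rewrite mul0r.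
  by apply: eq_bigl => i; rewrite ltn_ord.
by rewrite (eq_rint P (E _ _ _)) (eq_rint P' (E _ _ _)).
Qed.

Definition tuple_of d0 (T0 : measurableType d0) (V0 : 'I_n -> T0 -> R) (w : T0) :
  n.-tuple (measurableTypeR R) := [tuple V0 i w | i < n].

Lemma measurable_tuple_of d0 (T0 : measurableType d0) (V0 : 'I_n -> T0 -> R) :
  (forall i, measurable_fun setT (V0 i)) -> measurable_fun setT (tuple_of V0).
Proof.
move=> mV0; apply/measurable_fun_tnthP => i.
by apply: (eq_measurable_fun (V0 i)) => // w _ /=; rewrite tnth_mktuple.
Qed.

Definition tbox (c : 'I_n -> R) : set (n.-tuple (measurableTypeR R)) :=
  [set x | forall i, tnth x i <= c i].

Lemma measurable_tbox c : measurable (tbox c).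
Proof.
rewrite (_ : tbox c = \bigcap_(i in setT)
    (fun x : n.-tuple (measurableTypeR R) => tnth x i) @^-1` `]-oo, c i]); last first.
  apply/seteqP; split => x /=; first by move=> h i _; rewrite /= in_itv/=.
  by move=> h i; have := h i I; rewrite /= in_itv/=.
apply: fin_bigcap_measurable => // i _.
by rewrite -[X in measurable X]setTI; apply: measurable_tnth.
Qed.

Lemma tbox_cover : \bigcup_m tbox (fun=> m%:R) = setT.
Proof.
rewrite -subTset => x _.
exists (Num.bound (\sum_i `|tnth x i|)) => // i.
apply: (@le_trans _ _ (\sum_i `|tnth x i|)).
  rewrite (bigD1 i)//= (le_trans (ler_norm _))// lerDl.
  by apply: sumr_ge0.
by apply/ltW/archi_boundP/sumr_ge0.
Qed.

Lemma tbox_generate : (measurable : set (set (n.-tuple (measurableTypeR R)))) =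
  <<s range tbox >>.
Proof.
apply/seteqP; split; last first.
  apply: smallest_sub; first exact: sigma_algebra_measurable.
  by move=> _ [c _ <-]; exact: measurable_tbox.
apply: smallest_sub; first exact: smallest_sigma_algebra.
rewrite -bigcup_seq => A [i _ [B mB <-]].
pose TG := g_sigma_algebraType (range tbox).
have mi : measurable_fun [set: TG] (fun x : TG => tnth x i : measurableTypeR R).
  apply: (measurability _ (RGenOInfty.measurableE R)) => //.
  move=> /= _ [_ [a ->] <-]; rewrite setTI.
  (* The half-space [x_i > a] is the complement of the union of boxes with side [a] in direction [i]
     and arbitrarily large sides elsewhere. *)
  rewrite (_ : _ @^-1` _ = ~` (\bigcup_m
      tbox (fun j => if j == i then a else m%:R))); last first.
    apply/seteqP; split => x /=.
      rewrite in_itv/= andbT => ax [m _ /(_ i)].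
      by rewrite eqxx => /(lt_le_trans ax); rewrite ltxx.
    move=> h; rewrite in_itv/= andbT ltNge; apply/negP => xa; apply: h.
    have : (\bigcup_m tbox (fun=> m%:R)) x by rewrite tbox_cover.
    by case=> m _ xm; exists m => // j; case: eqP => [->|_]; last exact: xm.
  apply: measurableC; apply: bigcupT_measurable => m.
  by apply: sub_sigma_algebra; eexists.
exact: mi.
Qed.

(** Boxes are stable under intersection, generate the sigma-algebra and exhaust the space, so
    agreement on them determines a finite measure. *)
Lemma cramer_wold_measure A : measurable A ->
  P (tuple_of V @^-1` A) = P' (tuple_of V' @^-1` A).
Proof.
have mX := measurable_tuple_of mV; have mX' := measurable_tuple_of mV'.
pose m1 : {measure set (n.-tuple (measurableTypeR R)) -> \bar R} :=
  measure_function_pushforward__canonical__measure_function_Measure P mX.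
pose m2 : {measure set (n.-tuple (measurableTypeR R)) -> \bar R} :=
  measure_function_pushforward__canonical__measure_function_Measure P' mX'.
move=> mA.
apply: (@measure_unique _ R _ (range tbox) (fun m => tbox (fun=> m%:R)) _ _ _ _
  m1 m2) => //.
- exact: tbox_generate.
- move=> _ _ [c1 _ <-] [c2 _ <-]; exists (fun i => Num.min (c1 i) (c2 i)) => //.
  apply/seteqP; split => x /=.
    by move=> h; split=> i; have := h i; rewrite le_min => /andP[].
  by case=> h1 h2 i; rewrite le_min h1 h2.
- exact: tbox_cover.
- move=> _ [c _ <-]; rewrite /m1 /m2 /=.
  have E d0 (T0 : measurableType d0) (P0 : probability T0 R) (V0 : 'I_n -> T0 -> R) :
      (forall i, measurable_fun setT (V0 i)) ->
      P0 (tuple_of V0 @^-1` tbox c) = (\int[P0]_w \prod_i (V0 i w <= c i)%R%:R)%:E.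
    move=> mV0; have mX0 := measurable_tuple_of mV0.
    have mB : measurable (tuple_of V0 @^-1` tbox c).
      by rewrite -[X in measurable X]setTI; apply: mX0 => //; exact: measurable_tbox.
    have IE w : \prod_i (V0 i w <= c i)%R%:R = \1_(tuple_of V0 @^-1` tbox c) w :> R.
      rewrite indicE; have [h|h] := boolP (w \in _).
        move: h; rewrite inE => h; rewrite big1// => i _.
        by have := h i; rewrite tnth_mktuple => ->.
      have [i hi] : exists i, ~~ (V0 i w <= c i).
        apply: contrapT => h'; move/negP: h; apply; rewrite inE => i.
        rewrite tnth_mktuple; apply: contrapT => /negP hi.
        by apply: h'; exists i.
      by rewrite (bigD1 i)//= (negbTE hi) mul0r.
    rewrite (eq_rint P0 IE) rintE ?integral_indic ?setIT//.
    by apply: integrable_indic.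
  by rewrite /pushforward !E// cramer_wold_box.
- move=> m; rewrite /m1 /=; apply: (@le_lt_trans _ _ 1%E); last exact: ltry.
  apply: probability_le1; rewrite -[X in measurable X]setTI.
  by apply: (measurable_tuple_of mV) => //; exact: measurable_tbox.
Qed.

Lemma cramer_wold (f : n.-tuple (measurableTypeR R) -> R) :
  measurable_fun setT f ->
  integ P (fun w => f (tuple_of V w)) ->
  integ P' (fun w => f (tuple_of V' w)) /\
  \int[P]_w f (tuple_of V w) = \int[P']_w f (tuple_of V' w).
Proof.
move=> mf intf.
have mX := measurable_tuple_of mV; have mX' := measurable_tuple_of mV'.
pose m1 : {measure set (n.-tuple (measurableTypeR R)) -> \bar R} :=
  measure_function_pushforward__canonical__measure_function_Measure P mX.
pose m2 : {measure set (n.-tuple (measurableTypeR R)) -> \bar R} :=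
  measure_function_pushforward__canonical__measure_function_Measure P' mX'.
have m12 A : measurable A -> m1 A = m2 A by exact: cramer_wold_measure.
have mf' : measurable_fun setT (EFin \o f) by exact/measurable_EFinP.
have i1 : m1.-integrable setT (EFin \o f) by exact: integrable_pushforward.
have i2 : integ P' (fun w => f (tuple_of V' w)).
  move/integrableP : i1 => [_ foo]; apply/integrableP; split.
    by apply/measurable_EFinP; exact: measurableT_comp.
  move: foo; rewrite (eq_measure_integral m2); last by move=> A mA _; exact: m12.
  by rewrite ge0_integral_pushforward//; exact: measurableT_comp.
split=> //; rewrite /Rintegral; congr fine.
rewrite -[LHS](@integral_pushforward _ _ _ _ R _ mX P setT (EFin \o f))//.
rewrite -[RHS](@integral_pushforward _ _ _ _ R _ mX' P' setT (EFin \o f))//.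
by apply: eq_measure_integral => A mA _; exact: m12.
Qed.

End cramer_wold.

Lemma cvgr_sum (R : realType) (T : Type) (F : set_system T) (FF : Filter F) J
    (r : seq J) (Q : pred J) (f : J -> T -> R) (l : J -> R) :
  (forall j, Q j -> f j @ F --> l j) ->
  (fun x => \sum_(j <- r | Q j) f j x) @ F --> \sum_(j <- r | Q j) l j.
Proof.
move=> fl; elim: r => [|j r ih].
  rewrite big_nil (_ : (fun x => _) = fun=> 0); first exact: cvg_cst.
  by apply/funext => x; rewrite big_nil.
rewrite big_cons; case: ifPn => Qj.
  rewrite (_ : (fun x => _) = fun x => f j x + \sum_(j <- r | Q j) f j x).
    by apply: cvgD => //; exact: fl.
  by apply/funext => x; rewrite big_cons Qj.
rewrite (_ : (fun x => _) = fun x => \sum_(j <- r | Q j) f j x)//.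
by apply/funext => x; rewrite big_cons (negbTE Qj).
Qed.

(** Measurability is tested by composition with measurable families, so no sigma-algebra on [I -> R]
    has to be chosen and closure under composition is immediate. *)
Definition mfun (R : realType) (I : Type) (f : (I -> R) -> R) :=
  forall d (T : measurableType d) (X : I -> T -> R),
  (forall i, measurable_fun setT (X i)) ->
  measurable_fun setT (fun w => f (fun i => X i w)).

Section law_transfer.
Context (R : realType) (I : finType) d d' (T : measurableType d)
  (T' : measurableType d').
Variables (P : probability T R) (P' : probability T' R).
Variables (X : I -> T -> R) (X' : I -> T' -> R).
Hypotheses (mX : forall i, measurable_fun setT (X i)).
Hypotheses (mX' : forall i, measurable_fun setT (X' i)).
Hypothesis cosX : forall (a : I -> R) c,
  \int[P]_w cos (\sum_i a i * X i w + c) =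
  \int[P']_w cos (\sum_i a i * X' i w + c).

Lemma law_transfer (f : (I -> R) -> R) : mfun f ->
  integ P (fun w => f (fun i => X i w)) ->
  integ P' (fun w => f (fun i => X' i w)) /\
  \int[P]_w f (fun i => X i w) = \int[P']_w f (fun i => X' i w).
Proof.
move=> mf.
pose F (x : #|I|.-tuple (measurableTypeR R)) := f (fun i => tnth x (enum_rank i)).
have mF : measurable_fun setT F.
  by apply: (mf _ _ (fun i x => tnth x (enum_rank i))) => i; exact: measurable_tnth.
have FE d0 (T0 : measurableType d0) (X0 : I -> T0 -> R) w :
    F (tuple_of (fun k => X0 (enum_val k)) w) = f (fun i => X0 i w).
  by congr f; apply/funext => i; rewrite tnth_mktuple enum_rankK.
have := @cramer_wold R #|I| _ _ T T' P P' (fun k => X (enum_val k))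
  (fun k => X' (enum_val k)) (fun k => mX _) (fun k => mX' _) _ F mF.
rewrite !(eq_rint _ (FE _ _ _)).
rewrite (_ : (fun w => F _) = fun w => f (fun i => X i w)); last first.
  by apply/funext => w; rewrite FE.
rewrite (_ : (fun w => F _) = fun w => f (fun i => X' i w)); last first.
  by apply/funext => w; rewrite FE.
apply=> eta a.
have := cosX (fun i => eta (enum_rank i)) a.
have E d0 (T0 : measurableType d0) (X0 : I -> T0 -> R) w :
    \sum_i eta (enum_rank i) * X0 i w = \sum_i eta i * X0 (enum_val i) w.
  rewrite (reindex (@enum_val I predT)); last exact/onW_bij/enum_val_bij.
  by apply: eq_bigr => i _; rewrite enum_valK.
under eq_rint do rewrite E.
by under [X in _ = X -> _]eq_rint do rewrite E.
Qed.

End law_transfer.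

(** * Integration by parts for Gaussian families *)

Section gaussian_family.
Context (R : realType) (I : finType).
Implicit Types (G : I -> I -> R) (g : (I -> R) -> R) (dg : I -> (I -> R) -> R).

Definition qform G (a : I -> R) : R := \sum_i \sum_k a i * a k * G i k.

(* Centered Gaussian family; the phase [c] makes the real cosine transform carry
   the whole characteristic function. *)
Definition gfam d (T : measurableType d) (P : probability T R)
    (X : I -> T -> R) G :=
  [/\ forall i, measurable_fun setT (X i), forall i k, G i k = G k i &
      forall (a : I -> R) c, \int[P]_w cos (\sum_i a i * X i w + c) =
        expR (- (qform G a / 2)) * cos c].

(** This growth class is stable under sums and products, contains polynomials and Lipschitz
    functions, and makes measurable functions integrable for every Gaussian family. *)
Definition expgrowth g := exists C N, [/\ 0 <= C, 0 <= N &
  forall x, `|g x| <= C * expR (N * \sum_i `|x i|)].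

Lemma qform_update G a (i : I) s : (forall j k, G j k = G k j) ->
  qform G (fun k => a k - (k == i)%:R * s) =
  qform G a - 2 * s * (\sum_k a k * G k i) + s ^+ 2 * G i i.
Proof.
move=> symG; rewrite /qform.
have D (f : I -> R) : \sum_k (k == i)%:R * f k = f i.
  rewrite (bigD1 i)//= eqxx mul1r big1 ?addr0// => k /negbTE ->.
  by rewrite mul0r.
have E : \sum_j \sum_k (a j - (j == i)%:R * s) * (a k - (k == i)%:R * s) * G j k
    = \sum_j (\sum_k a j * a k * G j k - s * (a j * G j i)
        - (j == i)%:R * (s * \sum_k a k * G j k)
        + (j == i)%:R * (s ^+ 2 * G j i)).
  apply: eq_bigr => j _.
  rewrite -(D (fun k => a j * G j k)) -(D (fun k => s ^+ 2 * G j k)) !mulr_sumr.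
  rewrite -!sumrB -big_split; apply: eq_bigr => k _ /=; ring.
rewrite E big_split/= !sumrB !D -!mulr_sumr.
under [X in _ - _ * X + _ = _]eq_bigr do rewrite symG.
ring.
Qed.

Section gfam_theory.
Context d (T : measurableType d) (P : probability T R).
Variables (X : I -> T -> R) (G : I -> I -> R).
Hypothesis gX : gfam P X G.

Let mX : forall i, measurable_fun setT (X i). Proof. by have [] := gX. Qed.
Let symG : forall i k, G i k = G k i. Proof. by have [] := gX. Qed.
Let cosX : forall (a : I -> R) c, \int[P]_w cos (\sum_i a i * X i w + c) =
  expR (- (qform G a / 2)) * cos c. Proof. by have [] := gX. Qed.

Lemma measurable_linear (a : I -> R) (c : R) :
  measurable_fun setT (fun w => \sum_i a i * X i w + c).
Proof.
apply: measurable_funD => //.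
by apply: measurable_sum => i; exact: measurable_funM.
Qed.

(** Positivity comes from the transform: a mean of cosines is at most 1, which forces
    [exp (- q / 2) <= 1]. *)
Lemma qform_ge0 a : 0 <= qform G a.
Proof.
have := cosX a 0; rewrite cos0 mulr1 => E.
suff : expR (- (qform G a / 2)) <= 1.
  by rewrite -expR0 ler_expR oppr_le0 pmulr_lge0.
rewrite -E (le_trans (ler_norm _))//.
apply: abs_rint_le => [|w]; last exact: normr_cos.
by apply: (measurableT_comp (@measurable_cos R)); exact: measurable_linear.
Qed.

Lemma qform_delta i s : qform G (fun k => (k == i)%:R * s) = s ^+ 2 * G i i.
Proof.
have := qform_update (fun=> 0) i (- s) symG.
rewrite [qform G (fun=> 0)]/qform big1 ?big1 => [|j _|j _]; last 2 first.
  by rewrite mul0r.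
  by rewrite big1// => k _; rewrite !mul0r.
rewrite mulr0 sqrrN add0r oppr0 add0r => <-.
by congr qform; apply/funext => k; rewrite mulrN opprK add0r.
Qed.

Lemma gfam_var_ge0 i : 0 <= G i i.
Proof.
have := qform_ge0 (fun k => (k == i)%:R * 1).
by rewrite qform_delta expr1n mul1r.
Qed.

(** The marginal has the law of a scaled standard normal, by uniqueness applied with a one-element
    index; variance zero is included. *)
Lemma gfam_scalar i (f : R -> R) : measurable_fun setT f ->
  integ (@stdg R) (fun z => f (Num.sqrt (G i i) * z)) ->
  integ P (fun w => f (X i w)) /\
  \int[P]_w f (X i w) = \int[@stdg R]_z f (Num.sqrt (G i i) * z).
Proof.
move=> mf intf.
have [] := @law_transfer R unit _ _ (measurableTypeR R) T (@stdg R) P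
  (fun _ z => Num.sqrt (G i i) * z) (fun _ => X i) _ (fun _ => mX i) _
  (fun x => f (x tt)).
- by move=> _; exact: measurable_funM.
- move=> a c.
  have E d0 (T0 : measurableType d0) (V0 : T0 -> R) w :
      \sum_(j : unit) a j * V0 w = a tt * V0 w.
    by rewrite (bigD1 tt)//= big1 ?addr0// => -[].
  under eq_rint do rewrite E mulrA.
  rewrite stdg_cos exprMn sqr_sqrtr ?gfam_var_ge0// -(qform_delta i) -cosX.
  apply: eq_rint => w; congr (cos (_ + _)); rewrite E.
  rewrite (bigD1 i)//= eqxx mul1r big1 ?addr0// => k /negbTE ->.
  by rewrite !mul0r.
- by move=> d0 T0 V0 mV0; exact: measurableT_comp.
- exact: intf.
- by move=> i1 ->.
Qed.

(** Cauchy-Schwarz for a vanishing variance: the quadratic form becomes affine in [s] and could not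
    stay nonnegative if its slope were nonzero. *)
Lemma gfam_degenerate i k : G i i = 0 -> G i k = 0.
Proof.
move=> Gi0; apply: contrapT => /eqP Gik.
have H s : 0 <= G k k - 2 * s * G i k.
  have := qform_ge0 (fun j => (j == k)%:R * 1 - (j == i)%:R * s).
  rewrite qform_update// qform_delta expr1n mul1r Gi0 mulr0 addr0.
  rewrite (bigD1 k)//= eqxx mul1r mul1r big1 ?addr0 => [|j /negbTE ->].
    by rewrite (symG k i).
  by rewrite !mul0r.
have := H ((G k k + 1) / (2 * G i k)).
rewrite (_ : 2 * _ * _ = G k k + 1); first lra.
by field; rewrite Gik.
Qed.

(** Induction over the coordinates through [a b <= a^2 + b^2], at the price of doubling [N]; hence
    only one-dimensional marginals enter and correlations are harmless. *)
Lemma gfam_integ_expR N : integ P (fun w => expR (N * \sum_i `|X i w|)).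
Proof.
pose s := index_enum I; rewrite -/s.
have mS t : measurable_fun setT (fun w => \sum_(i <- t) `|X i w|).
  by apply: measurable_sum => i; exact: measurableT_comp.
have mE t N' : measurable_fun setT (fun w => expR (N' * \sum_(i <- t) `|X i w|)).
  by apply: measurableT_comp => //; exact: measurable_funM.
elim: s N => [|i s ih] N.
  rewrite (_ : _ \o _ = EFin \o fun=> 1); first exact: integ_cst.
  by apply/funext => w /=; rewrite big_nil mulr0 expR0.
have i1 : integ P (fun w => expR (2 * N * `|X i w|)).
  have mexp : measurable_fun setT (fun x : R => expR (2 * N * `|x|)).
    by apply: measurableT_comp => //; apply: measurable_funM => //;
      exact: measurableT_comp.
  apply: (gfam_scalar (i := i) (f := fun x => expR (2 * N * `|x|)) mexp _).1.
  apply: (@integ_stdg_expR R _ 1 (2 * N * Num.sqrt (G i i))).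
    by apply: (measurableT_comp mexp); exact: measurable_funM.
  move=> z; rewrite ger0_norm ?expR_ge0// mul1r normrM.
  by rewrite (ger0_norm (sqrtr_ge0 _)) mulrA.
have := integD i1 (ih (2 * N)); apply: integ_le; first exact: mE.
move=> w; rewrite ger0_norm ?expR_ge0// big_cons mulrDr expRD.
have sqE x : expR (2 * N * x) = expR (N * x) ^+ 2.
  by rewrite expr2 -expRD; congr expR; ring.
rewrite !sqE.
set a := expR _; set b := expR _.
have := sqr_ge0 (a - b); have := sqr_ge0 a; have := sqr_ge0 b.
lra.
Qed.

Lemma gfam_integ g : mfun g -> expgrowth g ->
  integ P (fun w => g (fun i => X i w)).
Proof.
move=> mg [C [N [C0 N0 gC]]].
by have := integZ C (gfam_integ_expR N); apply: integ_le => //; exact: mg.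
Qed.

End gfam_theory.

(** Differentiability is demanded along lines: in the integration by parts the family moves along a
    line once its part independent of [X i] is fixed. [dg] is the gradient. *)
Record smooth g dg := Smooth {
  smooth_mfun : mfun g ;
  smooth_dmfun : forall k, mfun (dg k) ;
  smooth_growth : expgrowth g ;
  smooth_dgrowth : forall k, expgrowth (dg k) ;
  smooth_derive : forall x v (z : R),
    is_derive z 1 (fun z => g (fun k => x k + z * v k))
      (\sum_k v k * dg k (fun k => x k + z * v k)) ;
  smooth_continuous : forall k x v,
    continuous (fun z : R => dg k (fun k => x k + z * v k)) }.

Lemma expgrowth_line g x v : expgrowth g -> exists C N,
  forall z, `|g (fun k => x k + z * v k)| <= C * expR (N * `|z|).
Proof.
move=> [C [N [C0 N0 gC]]].
exists (C * expR (N * \sum_i `|x i|)), (N * \sum_i `|v i|) => z.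
apply: (le_trans (gC _)); rewrite -mulrA ler_wpM2l// -expRD ler_expR.
rewrite -mulrA -mulrDr ler_wpM2l// mulr_suml -big_split.
apply: ler_sum => k _ /=; rewrite (le_trans (ler_normD _ _))// lerD//.
by rewrite normrM mulrC.
Qed.

Lemma expgrowth_coord i : expgrowth (fun x => x i).
Proof.
exists 1, 1; split=> // x; rewrite !mul1r.
rewrite (le_trans _ (expR_ge1Dx _))// (bigD1 i)//= [leRHS]addrCA lerDl.
by rewrite addr_ge0// sumr_ge0.
Qed.

Lemma expgrowthM g g' : expgrowth g -> expgrowth g' ->
  expgrowth (fun x => g x * g' x).
Proof.
move=> [C [N [C0 N0 gC]]] [C' [N' [C0' N0' gC']]].
exists (C * C'), (N + N'); split; rewrite ?mulr_ge0 ?addr_ge0// => x.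
by rewrite normrM mulrDl expRD mulrACA ler_pM.
Qed.

Lemma expgrowthD g g' : expgrowth g -> expgrowth g' ->
  expgrowth (fun x => g x + g' x).
Proof.
move=> [C [N [C0 N0 gC]]] [C' [N' [C0' N0' gC']]].
exists (C + C'), (N + N'); split; rewrite ?addr_ge0// => x.
have s0 : 0 <= \sum_i `|x i| by exact: sumr_ge0.
rewrite (le_trans (ler_normD _ _))// mulrDl lerD//.
  by rewrite (le_trans (gC _))// ler_wpM2l// ler_expR ler_wpM2r// lerDl.
by rewrite (le_trans (gC' _))// ler_wpM2l// ler_expR ler_wpM2r// lerDr.
Qed.

Lemma expgrowth_bounded g M : (forall x, `|g x| <= M) -> expgrowth g.
Proof.
move=> gM; exists M, 0; split=> //; first exact: le_trans (gM (fun=> 0)).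
by move=> x; rewrite mul0r expR0 mulr1.
Qed.

Lemma expgrowth_sum J (r : seq J) (f : J -> (I -> R) -> R) :
  (forall j, expgrowth (f j)) -> expgrowth (fun x => \sum_(j <- r) f j x).
Proof.
move=> ef; elim: r => [|j r ih].
  by apply: (@expgrowth_bounded _ 0) => x; rewrite big_nil normr0.
have := expgrowthD (ef j) ih.
by congr expgrowth; apply/funext => x; rewrite big_cons.
Qed.

Lemma line_integ g x v : mfun g -> expgrowth g ->
  integ (@stdg R) (fun z => g (fun k => x k + z * v k)).
Proof.
move=> mg eg; have [C [N gC]] := expgrowth_line x v eg.
apply: (@integ_stdg_expR R _ C N) => //.
apply: (mg _ (measurableTypeR R) (fun k z => x k + z * v k)) => k.
by apply: measurable_funD => //; exact: measurable_funM.
Qed.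

Lemma gauss_degenerate d (T : measurableType d) (P : probability T R) X G g i :
  gfam P X G -> mfun g -> expgrowth g -> G i i = 0 ->
  \int[P]_w (X i w * g (fun k => X k w)) = 0.
Proof.
move=> gX mg eg Gi0; have [mX _ _] := gX.
have mcoord : mfun (fun x : I -> R => x i) by move=> d0 T0 V mV; exact: mV.
have mX2 : mfun (fun x : I -> R => x i * x i).
  by move=> d0 T0 V mV; exact: measurable_funM.
have mg2 : mfun (fun x : I -> R => g x * g x).
  by move=> d0 T0 V mV; apply: measurable_funM; exact: mg.
have mXg : mfun (fun x : I -> R => x i * g x).
  by move=> d0 T0 V mV; apply: measurable_funM => //; exact: mg.
have eX := expgrowth_coord i.
have iX2 := gfam_integ gX mX2 (expgrowthM eX eX).
have ig2 := gfam_integ gX mg2 (expgrowthM eg eg).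
have X20 : \int[P]_w (X i w * X i w) = 0.
  have [] := @gfam_scalar _ _ P X G gX i (fun x => x * x).
  - exact: measurable_funM.
  - rewrite Gi0 sqrtr0 (_ : _ \o _ = EFin \o fun=> 0); first exact: integ_cst.
    by apply/funext => z /=; rewrite !mul0r.
  - move=> _ ->; rewrite Gi0 sqrtr0 -[RHS](rint_cst (@stdg R)).
    by apply: eq_rint => z; rewrite !mul0r.
set c := \int[P]_w (g (fun k => X k w) * g (fun k => X k w)) in ig2 *.
have c0 : 0 <= c by apply: rint_ge0 => w; rewrite -expr2 sqr_ge0.
(* Weighted arithmetic-geometric inequality; the square of [X i] has mean 0, so the term with the
   factor [M] disappears and [M] may tend to infinity. *)
have bound M : 0 < M -> `|\int[P]_w (X i w * g (fun k => X k w))| <= M^-1 * c.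
  move=> M0; rewrite -[leRHS](add0r) -[X in X + _](mulr0 M) -X20 -!rintZ//.
  rewrite -rintD; [|exact: integZ|exact: integZ].
  apply: le_abs_rint; first exact: mXg.
  - by apply: integD; exact: integZ.
  - move=> w; set x := X i w; set y := g _.
    rewrite -(ler_pM2l M0).
    have -> : M * (M * (x * x) + M^-1 * (y * y)) = (M * `|x|) ^+ 2 + `|y| ^+ 2.
      rewrite exprMn !real_normK ?num_real//; field; exact: lt0r_neq0.
    rewrite normrM mulrA.
    have := sqr_ge0 (M * `|x| - `|y|).
    have : 0 <= M * `|x| * `|y| by rewrite !mulr_ge0// ltW.
    by rewrite sqrrB; lra.
apply/eqP; rewrite -normr_le0 leNgt; apply/negP => e0.
set e := `|_| in e0 bound.
have := bound ((c + 1) / e) (divr_gt0 (ltr_wpDl c0 ltr01) e0).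
rewrite invf_div mulrAC ler_pdivlMr ?ltr_wpDl// mulrDr mulr1.
by rewrite gerDl leNgt e0.
Qed.

(** Regression on [X i]: in law, [X k] is [Rm k + z v k] with [z] a fresh standard normal
    independent of [Rm]. For fixed [Rm] the claim is the one-variable formula along the direction
    [v]. *)
Theorem gauss_ibp_family d (T : measurableType d) (P : probability T R) X G g dg i :
  gfam P X G -> smooth g dg ->
  \int[P]_w (X i w * g (fun k => X k w)) =
  \sum_k G i k * \int[P]_w dg k (fun k => X k w).
Proof.
move=> gX [mg mdg eg edg deriv cont].
have [mX symG cosX] := gX.
have gi0 := gfam_var_ge0 gX i.
have mf : mfun (fun x => x i * g x).
  by move=> d0 T0 V mV; apply: measurable_funM => //; exact: mg.
have ef := expgrowthM (expgrowth_coord i) eg.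
have intf := gfam_integ gX mf ef.
have intdg k := gfam_integ gX (mdg k) (edg k).
have [Gi0|Gi0] := eqVneq (G i i) 0.
  rewrite [RHS]big1 => [|k _]; last by rewrite (gfam_degenerate gX) ?mul0r.
  exact: gauss_degenerate gX mg eg Gi0.
pose s := Num.sqrt (G i i).
have s0 : s != 0 by rewrite sqrtr_eq0 -ltNge lt_def Gi0.
have ss : s * s = G i i by rewrite -expr2 sqr_sqrtr.
pose v k := G i k / s.
pose Rm k w := X k w - v k * (X i w / s).
pose X' k (zw : R * T) := Rm k zw.2 + zw.1 * v k.
pose PP : probability (measurableTypeR R * T)%type R := (@stdg R \x P)%E.
have mRm k : measurable_fun setT (Rm k).
  apply: measurable_funB => //; apply: measurable_funM => //.
  exact: measurable_funM.
have mX' k : measurable_fun setT (X' k).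
  apply: measurable_funD; first exact: measurableT_comp.
  by apply: measurable_funM.
(* Equality of the laws: integrating out [z] restores exactly the variance that removing the
   component along [X i] has taken away. *)
have cosX' a c : \int[P]_w cos (\sum_k a k * X k w + c) =
    \int[PP]_w cos (\sum_k a k * X' k w + c).
  pose b := \sum_k a k * v k.
  have mc : measurable_fun setT (fun zw => cos (\sum_k a k * X' k zw + c)).
    apply: (measurableT_comp (@measurable_cos R)); apply: measurable_funD => //.
    by apply: measurable_sum => k; exact: measurable_funM.
  rewrite -(@rfubini2 _ _ (measurableTypeR R) T R (@stdg R) P); last 2 first.
  - by apply: (@integ_bounded _ _ _ PP _ 1) => // zw; exact: normr_cos.
  - move=> w; apply: (@integ_bounded _ _ _ (@stdg R) _ 1).
      exact: (measurableT_comp mc (pair2_measurable w)).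
    by move=> z; exact: normr_cos.
  have E w : \int[@stdg R]_z cos (\sum_k a k * X' k (z, w) + c) =
      expR (- (b ^+ 2 / 2)) *
      cos (\sum_k (a k - (k == i)%:R * (b / s)) * X k w + c).
    rewrite -stdg_cos; apply: eq_rint => z; congr cos; rewrite addrA.
    congr (_ + _); rewrite /X' /Rm /=.
    under eq_bigr do rewrite mulrDr mulrBr.
    rewrite big_split sumrB /= addrC; congr (_ + _).
      by rewrite /b mulr_suml; apply: eq_bigr => k _; ring.
    rewrite [RHS](eq_bigr (fun k => a k * X k w - (k == i)%:R * (b / s * X k w))).
      rewrite sumrB; congr (_ - _).
      rewrite [RHS](bigD1 i)//= eqxx mul1r [X in _ = _ + X]big1 ?addr0; last first.
        by move=> k /negbTE ->; rewrite mul0r.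
      by rewrite /b !mulr_suml; apply: eq_bigr => k _; ring.
    by move=> k _; ring.
  rewrite (eq_rint P E) rintZ; last first.
    apply: (@integ_bounded _ _ _ P _ 1) => [|w]; last exact: normr_cos.
    apply: (measurableT_comp (@measurable_cos R)).
    exact: measurable_linear.
  rewrite !cosX mulrA -expRD; congr (expR _ * _).
  rewrite qform_update// -ss.
  have -> : \sum_k a k * G k i = b * s.
    rewrite /b mulr_suml; apply: eq_bigr => k _.
    by rewrite /v mulrA mulfVK// symG.
  by field.
have X'E w : (fun k => X' k w) = (fun k => Rm k w.2 + w.1 * v k) by [].
have X'i w : X' i w = s * w.1.
  by rewrite /X' /Rm /v -ss mulfK// mulrCA mulfV// mulr1 subrr add0r mulrC.
pose law := @law_transfer R I _ _ T (measurableTypeR R * T)%type P PP X X' mX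
  mX' cosX'.
have [i1 ->] := law _ mf intf.
have tr k := law _ (mdg k) (intdg k).
under [RHS]eq_bigr do rewrite (tr _).2 -(rintZ _ (tr _).1).
rewrite -rint_sum; last by move=> k _; apply: integZ; exact: (tr k).1.
rewrite -!(@rfubini2 _ _ (measurableTypeR R) T R (@stdg R) P)//; last 3 first.
- by apply: integ_sum => k _; apply: integZ; exact: (tr k).1.
- move=> w; apply: integ_sum => k _; apply: integZ.
  exact: (line_integ (fun k => Rm k w) v (mdg k) (edg k)).
- by move=> w; exact: (line_integ (fun k => Rm k w) v mf ef).
apply: eq_rint => w.
pose psi (z : R) := g (fun k => Rm k w + z * v k).
pose dpsi (z : R) := \sum_k v k * dg k (fun k => Rm k w + z * v k).
have [C [N psiC]] := expgrowth_line (fun k => Rm k w) v eg.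
have dsum_growth : expgrowth (fun x => \sum_k v k * dg k x).
  by apply: expgrowth_sum => k; apply: expgrowthM => //;
    exact: (@expgrowth_bounded _ `|v k|).
have [C' [N' dpsiC]] := expgrowth_line (fun k => Rm k w) v dsum_growth.
have X'psi (z : measurableTypeR R) :
    X' i (z, w) * g (fun k => X' k (z, w)) = s * (z * psi z).
  by rewrite X'i mulrA.
rewrite (eq_rint _ X'psi).
have C0 : 0 <= C by have := psiC 0; rewrite normr0 mulr0 expR0 mulr1; exact: le_trans.
have C'0 : 0 <= C' by have := dpsiC 0; rewrite normr0 mulr0 expR0 mulr1; exact: le_trans.
(* The one-variable formula asks for a single growth bound valid for both [psi] and [dpsi]. *)
have mono (a b c e : R) x : 0 <= a -> 0 <= c ->
    a * expR (b * `|x|) <= (a + c) * expR ((`|b| + `|e|) * `|x|).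
  move=> a0 c0; apply: ler_pM; rewrite ?expR_ge0 ?lerDl//.
  by rewrite ler_expR ler_wpM2r// (le_trans (ler_norm _))// lerDl.
rewrite rintZ; last first.
  have := line_integ (fun k => Rm k w) v mf ef.
  move/(integZ s^-1); congr (integ _ _); apply/funext => z /=.
  by rewrite -[_ + _]/(X' i (z, w)) X'i mulrA mulKf.
rewrite (@gauss_ibp R psi dpsi (C + C') (`|N| + `|N'|)).
- rewrite -rintZ.
    apply: eq_rint => z; rewrite mulr_sumr; apply: eq_bigr => k _.
    by rewrite mulrA /v (mulrC s) mulfVK.
  apply: integ_sum => k _; apply: integZ.
  exact: (line_integ (fun k => Rm k w) v (mdg k) (edg k)).
- move=> z; apply: cvgr_sum => k _; apply: cvgM; first exact: cvg_cst.
  exact: cont.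
- by move=> z; rewrite (le_trans (psiC _))// mono.
- by move=> z; rewrite (le_trans (dpsiC _))// addrC (addrC `|N|) mono.
Qed.

End gaussian_family.

(** * Hermite polynomials and diagrams *)

Section hermite_polynomials.
Context (R : realType).

Fixpoint He (m : nat) : {poly R} :=
  if m is m'.+1 then 'X * He m' - (He m')^`() else 1.

Lemma HeS m : He m.+1 = 'X * He m - (He m)^`().
Proof. by []. Qed.

Lemma He_deriv m : (He m)^`() = m%:R *: He m.-1.
Proof.
elim: m => [|m ih]; first by rewrite /= scale0r -[1]/(1%:P) derivC.
case: m ih => [|m] ih.
  by rewrite /= mulr1 -[1]/(1%:P) derivC subr0 derivX scale1r.
rewrite HeS derivB derivM derivX mul1r ih derivZ -scalerAr -addrA -scalerBr -HeS /=.
by rewrite -[X in X + _]scale1r -scalerDl nat1r.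
Qed.

(** Each derivative of the Gaussian weight multiplies it by a polynomial that obeys the recursion of
    [He] up to sign; the outer exponential then cancels the weight. *)
Lemma hermiteE m x : hermite m x = (He m).[x].
Proof.
have E : derive1n m (fun y : R => expR (- (y ^+ 2 / 2))) =
    (fun y => (-1) ^+ m * (He m).[y] * expR (- (y ^+ 2 / 2))).
  elim: m => [|m ih]; first by apply/funext => y; rewrite /= hornerC expr0 !mul1r.
  rewrite derive1nS ih; apply/funext => y; rewrite derive1E.
  apply: derive_val.
  apply: is_derive_eq.
  rewrite HeS !hornerE/= /GRing.scale/= [(-1) ^+ m.+1]exprS.
  by field.
rewrite /hermite E.
have s1 : (-1) ^+ m * (-1) ^+ m = 1 :> R by rewrite -exprMn mulrNN mulr1 expr1n.
have e1 : expR (x ^+ 2 / 2) * expR (- (x ^+ 2 / 2)) = 1 :> R.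
  by rewrite -expRD subrr expR0.
transitivity ((-1) ^+ m * (-1) ^+ m *
    (expR (x ^+ 2 / 2) * expR (- (x ^+ 2 / 2))) * (He m).[x]); first by ring.
by rewrite s1 e1 !mul1r.
Qed.

End hermite_polynomials.

Section smooth_closure.
Context (R : realType) (I : finType).
Implicit Types (g : (I -> R) -> R) (dg : I -> (I -> R) -> R).

Lemma smooth_mul g dg g' dg' : smooth g dg -> smooth g' dg' ->
  smooth (fun x => g x * g' x) (fun k x => dg k x * g' x + g x * dg' k x).
Proof.
move=> sg sg'; split.
- move=> d T X mX; apply: measurable_funM.
    exact: (smooth_mfun sg).
  exact: (smooth_mfun sg').
- move=> k d T X mX; apply: measurable_funD; apply: measurable_funM.
  + exact: (smooth_dmfun sg).
  + exact: (smooth_mfun sg').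
  + exact: (smooth_mfun sg).
  + exact: (smooth_dmfun sg').
- by apply: expgrowthM; apply: smooth_growth; eassumption.
- move=> k; apply: expgrowthD; apply: expgrowthM.
  + exact: (smooth_dgrowth sg).
  + exact: (smooth_growth sg').
  + exact: (smooth_growth sg).
  + exact: (smooth_dgrowth sg').
- move=> x v z.
  have h := smooth_derive sg x v z; have h' := smooth_derive sg' x v z.
  apply: is_derive_eq; rewrite /GRing.scale/= !mulr_sumr -big_split/=.
  by apply: eq_bigr => k _; ring.
- have cg g1 dg1 : smooth g1 dg1 -> forall x v,
      continuous (fun z : R => g1 (fun k => x k + z * v k)).
    move=> sg1 x v; apply: (is_derive_continuous
      (dg := fun z => \sum_k v k * dg1 k (fun k => x k + z * v k))) => z.
    exact: (smooth_derive sg1).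
  move=> k x v z; apply: cvgD; apply: cvgM.
  + exact: (smooth_continuous sg).
  + exact: (cg _ _ sg').
  + exact: (cg _ _ sg).
  + exact: (smooth_continuous sg').
Qed.

Lemma smooth_cst c : smooth (fun=> c) (fun k (_ : I -> R) => 0).
Proof.
split.
- by move=> d T X mX; exact: measurable_cst.
- by move=> k d T X mX; exact: measurable_cst.
- exact: (@expgrowth_bounded _ _ _ `|c|).
- by move=> _; apply: (@expgrowth_bounded _ _ _ 0) => x; rewrite normr0.
- move=> x v z; rewrite big1; first exact: is_derive_cst.
  by move=> k _; rewrite mulr0.
- by move=> k x v z; exact: cvg_cst.
Qed.

Lemma expgrowth_horner (p : {poly R}) (i : I) : expgrowth (fun x => p.[x i]).
Proof.
elim/poly_ind: p => [|p c ih].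
  by apply: (@expgrowth_bounded _ _ _ 0) => x; rewrite horner0 normr0.
have := expgrowthD (expgrowthM ih (expgrowth_coord R i))
  (@expgrowth_bounded R I (fun=> c) `|c| (fun=> lexx _)).
by congr expgrowth; apply/funext => x; rewrite !hornerE.
Qed.

Lemma measurable_horner (p : {poly R}) : measurable_fun setT (horner p).
Proof. by apply: continuous_measurable_fun; exact: continuous_horner. Qed.

Lemma smooth_horner (p : {poly R}) (i : I) :
  smooth (fun x => p.[x i]) (fun k x => (k == i)%:R * p^`().[x i]).
Proof.
have mp (q : {poly R}) : mfun (fun x => q.[x i]).
  by move=> d T X mX; exact: (measurableT_comp (measurable_horner q)).
split=> //.
- by move=> k d T X mX; apply: measurable_funM => //; exact: mp.
- exact: expgrowth_horner.
- move=> k; apply: expgrowthM; last exact: expgrowth_horner.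
  exact: (@expgrowth_bounded _ _ _ `|(k == i)%:R|).
- move=> x v z.
  have h : is_derive (x i + z * v i) (1 : R) (horner p) (p^`()).[x i + z * v i].
    exact: is_derive_poly.
  rewrite (bigD1 i)//= eqxx mul1r big1 ?addr0; last first.
    by move=> k /negbTE ->; rewrite mul0r mulr0.
  have h1 : is_derive z 1 (fun z : R => x i + z * v i) (v i).
    by apply: is_derive_eq; rewrite /GRing.scale/=; ring.
  have := @is_derive1_comp R (horner p) (fun z => x i + z * v i) z _ _ h h1.
  by rewrite mulrC.
- move=> k x v z; apply: cvgM; first exact: cvg_cst.
  apply: (@continuous_comp _ _ _ (fun z : R => x i + z * v i) (horner p^`())).
    apply: cvgD; first exact: cvg_cst.
    by apply: cvgM; [exact: cvg_id|exact: cvg_cst].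
  exact: continuous_horner.
Qed.

Lemma smooth_eq g dg g' dg' : smooth g dg -> (forall x, g x = g' x) ->
  (forall k x, dg k x = dg' k x) -> smooth g' dg'.
Proof.
move=> sg gg' dgg'; rewrite (_ : g' = g); last exact/funext.
by rewrite (_ : dg' = dg)//; apply/funext => k; exact/funext.
Qed.

Lemma smoothD g dg g' dg' : smooth g dg -> smooth g' dg' ->
  smooth (fun x => g x + g' x) (fun k x => dg k x + dg' k x).
Proof.
move=> sg sg'; split.
- move=> d T X mX; apply: measurable_funD.
    exact: (smooth_mfun sg).
  exact: (smooth_mfun sg').
- move=> k d T X mX; apply: measurable_funD.
    exact: (smooth_dmfun sg).
  exact: (smooth_dmfun sg').
- by apply: expgrowthD; apply: smooth_growth; eassumption.
- move=> k; apply: expgrowthD.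
    exact: (smooth_dgrowth sg).
  exact: (smooth_dgrowth sg').
- move=> x v z.
  have h := smooth_derive sg x v z; have h' := smooth_derive sg' x v z.
  apply: is_derive_eq; rewrite -big_split/=.
  by apply: eq_bigr => k _; ring.
- move=> k x v z; apply: cvgD.
    exact: (smooth_continuous sg).
  exact: (smooth_continuous sg').
Qed.

Lemma smooth_sum J (r : seq J) (Q : pred J) (g : J -> (I -> R) -> R)
    (dg : J -> I -> (I -> R) -> R) :
  (forall j, smooth (g j) (dg j)) ->
  smooth (fun x => \sum_(j <- r | Q j) g j x)
    (fun k x => \sum_(j <- r | Q j) dg j k x).
Proof.
move=> sg; elim: r => [|j r ih].
  by apply: smooth_eq (smooth_cst 0) _ _ => *; rewrite big_nil.
have [Qj|Qj] := boolP (Q j).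
  by apply: smooth_eq (smoothD (sg j) ih) _ _ => *; rewrite big_cons Qj.
by apply: smooth_eq ih _ _ => *; rewrite big_cons (negbTE Qj).
Qed.

Lemma smooth_prod_horner (q : I -> {poly R}) (r : seq I) : uniq r ->
  smooth (fun x => \prod_(v <- r) (q v).[x v])
    (fun k x => (k \in r)%:R * ((q k)^`().[x k] *
       \prod_(v <- r | v != k) (q v).[x v])).
Proof.
elim: r => [_|i r ih /= /andP[ir ur]].
  by apply: smooth_eq (smooth_cst 1) _ _ => *; rewrite ?big_nil// mul0r.
apply: smooth_eq (smooth_mul (smooth_horner (q i) i) (ih ur)) _ _ => [x|k x].
  by rewrite big_cons.
rewrite big_cons inE; have [->|ki] := eqVneq k i.
  rewrite /= (negbTE ir) mul0r mulr0 addr0 !mul1r; congr (_ * _).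
  rewrite big_seq [RHS]big_seq_cond; apply: eq_bigl => v; case: eqP => [->|_].
    by rewrite (negbTE ir).
  by rewrite andbT.
by rewrite /= !mul0r add0r; ring.
Qed.

(** Integrating the factor [X i] of [He m.+1] by parts also differentiates [He m]; because the
    variance is 1, that term cancels the subtracted derivative in the recursion. This cancellation
    is the absence of loops in the diagrams. *)
Lemma hermite_ibp d (T : measurableType d) (P : probability T R) X G g dg i m :
  gfam P X G -> G i i = 1 -> smooth g dg ->
  \int[P]_w ((He R m.+1).[X i w] * g (fun k => X k w)) =
  \sum_k G i k * \int[P]_w ((He R m).[X i w] * dg k (fun k => X k w)).
Proof.
move=> gX Gi1 sg.
have sp := smooth_horner (He R m) i.
have sm := smooth_mul sp sg.
have H := gauss_ibp_family i gX sm.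
have i1 : integ P (fun w => (He R m)^`().[X i w] * g (fun k => X k w)).
  apply: (gfam_integ gX (g := fun x => (He R m)^`().[x i] * g x)).
    move=> d0 T0 V mV; apply: measurable_funM.
      exact: (measurableT_comp (measurable_horner _)).
    exact: (smooth_mfun sg).
  by apply: expgrowthM; [exact: expgrowth_horner|exact: (smooth_growth sg)].
have i2 k : integ P (fun w => (He R m).[X i w] * dg k (fun k => X k w)).
  apply: (gfam_integ gX (g := fun x => (He R m).[x i] * dg k x)).
    move=> d0 T0 V mV; apply: measurable_funM.
      exact: (measurableT_comp (measurable_horner _)).
    exact: (smooth_dmfun sg).
  by apply: expgrowthM; [exact: expgrowth_horner|exact: (smooth_dgrowth sg)].
have i3 : integ P (fun w => X i w * ((He R m).[X i w] * g (fun k => X k w))).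
  apply: (gfam_integ gX (g := fun x => x i * ((He R m).[x i] * g x))).
    move=> d0 T0 V mV; apply: measurable_funM; first exact: mV.
    exact: (smooth_mfun sm).
  by apply: expgrowthM; [exact: expgrowth_coord|exact: (smooth_growth sm)].
rewrite (eq_rint _ (g := fun w => X i w * ((He R m).[X i w] * g (fun k => X k w))
  - (He R m)^`().[X i w] * g (fun k => X k w))); last first.
  by move=> w; rewrite HeS hornerD hornerN hornerM hornerX mulrBl -mulrA.
rewrite rintB// H.
have E k : \int[P]_w ((k == i)%:R * (He R m)^`().[X i w] * g (fun k => X k w) +
      (He R m).[X i w] * dg k (fun k => X k w)) =
    (k == i)%:R * \int[P]_w ((He R m)^`().[X i w] * g (fun k => X k w)) +
    \int[P]_w ((He R m).[X i w] * dg k (fun k => X k w)).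
  rewrite -rintZ// -rintD//; last exact: integZ.
  by apply: eq_rint => w; rewrite mulrA.
under eq_bigr do rewrite E mulrDr.
rewrite big_split/= (bigD1 i)//= eqxx Gi1 !mul1r big1 ?addr0.
  by rewrite addrAC subrr add0r.
by move=> k /negbTE ->; rewrite mul0r mulr0.
Qed.

End smooth_closure.

(** * The diagram formula *)

Section hermite_moments.
Context (R : realType) (V : finType).
Implicit Types (n : V -> nat) (A : {set V}).

(** The degrees left after an edge between [r] and [s] has used one leg at each end. *)
Definition decr2 n (r s : V) : V -> nat :=
  fun v => (n v - (v == r) - (v == s))%N.

Definition restr A n : V -> nat := fun v => if v \in A then n v else 0%N.

Section moments.
Context d (T : measurableType d) (P : probability T R) (X : V -> T -> R)
  (G : V -> V -> R).
Hypotheses (gX : gfam P X G) (G1 : forall v, G v v = 1).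

Definition Mom n : R := \int[P]_w \prod_v (He R (n v)).[X v w].

(** One leg of [r] is integrated by parts; it pairs with one of the [n s] legs of another vertex and
    yields the covariance of that edge. *)
Lemma MomE n r : (0 < n r)%N ->
  Mom n = \sum_(s | s != r) (n s)%:R * G r s * Mom (decr2 n r s).
Proof.
move=> nr.
pose q v := He R (n v); pose t := [seq v <- index_enum V | v != r].
have ut : uniq t by rewrite filter_uniq ?index_enum_uniq.
have sg := smooth_prod_horner q ut.
have E w : \prod_v (He R (n v)).[X v w] =
    (He R (n r).-1.+1).[X r w] * \prod_(v <- t) (q v).[X v w].
  by rewrite prednK// (bigD1 r)//= big_filter.
rewrite /Mom (eq_rint P E) (hermite_ibp _ gX (G1 r) sg).
rewrite [RHS]big_mkcond/=; apply: eq_bigr => s _.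
have mt : (s \in t) = (s != r) by rewrite mem_filter mem_index_enum andbT.
rewrite mt; have [sr|sr] := eqVneq s r.
  rewrite -[X in _ * X = _](_ : 0 = _) ?mulr0//.
  rewrite -[LHS](rint_cst P); apply: eq_rint => w.
  by rewrite mul0r mulr0.
rewrite -mulrA mulrCA; congr (_ * _).
have i0 : integ P (fun w => \prod_v (He R (decr2 n r s v)).[X v w]).
  apply: (gfam_integ gX (g := fun x => \prod_v (He R (decr2 n r s v)).[x v])).
    exact: (smooth_mfun (smooth_prod_horner _ (index_enum_uniq V))).
  exact: (smooth_growth (smooth_prod_horner _ (index_enum_uniq V))).
rewrite -rintZ//; apply: eq_rint => w.
rewrite mul1r He_deriv hornerZ.
rewrite [in RHS](bigD1 r)//= [in RHS](bigD1 s)//=.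
have -> : decr2 n r s r = (n r).-1.
  by rewrite /decr2 eqxx (negbTE _ : (r == s) = false) 1?eq_sym// subn0 subn1.
have -> : decr2 n r s s = (n s).-1.
  by rewrite /decr2 eqxx (negbTE sr) subn0 subn1.
have -> : \prod_(v <- t | v != s) (q v).[X v w] =
    \prod_(v | (v != r) && (v != s)) (He R (decr2 n r s v)).[X v w].
  rewrite big_filter_cond; apply: eq_bigr => v /andP[vr vs].
  by rewrite /decr2 (negbTE vr) (negbTE vs) !subn0.
ring.
Qed.

Lemma Mom0 n : (forall v, n v = 0%N) -> Mom n = 1.
Proof.
move=> n0; rewrite /Mom -[RHS](rint_cst P); apply: eq_rint => w.
by rewrite big1// => v _; rewrite n0 /= hornerC.
Qed.

End moments.

Lemma gfam_diag : gfam (@stdg R) (fun (_ : V) z => z) (fun _ _ => 1).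
Proof.
split=> // a c.
under eq_rint do rewrite -mulr_suml.
rewrite stdg_cos; congr (expR (- (_ / 2)) * _).
rewrite /qform expr2 mulr_suml; apply: eq_bigr => i _.
by rewrite mulr_sumr; apply: eq_bigr => k _; rewrite mulr1.
Qed.

(** With a single variable at all vertices every edge weighs 1, so the same recursion counts the
    loopless pairings of the legs. *)
Definition diagMom n : R := \int[@stdg R]_z \prod_v (He R (n v)).[z].

Lemma diagMomE n r : (0 < n r)%N ->
  diagMom n = \sum_(s | s != r) (n s)%:R * diagMom (decr2 n r s).
Proof.
move=> nr; rewrite -[LHS]/(Mom (@stdg R) (fun (_ : V) (z : R) => z) n).
rewrite (MomE gfam_diag _ nr)//.
by under eq_bigr do rewrite mulr1.
Qed.

Lemma diagMom0 n : (forall v, n v = 0%N) -> diagMom n = 1.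
Proof. exact: (@Mom0 _ _ (@stdg R) (fun (_ : V) (z : R) => z)). Qed.

Lemma sum_decr2 n r s A : r \in A -> (0 < n r)%N ->
  (\sum_(v in A) decr2 n r s v < \sum_(v in A) n v)%N.
Proof.
move=> rA nr; rewrite (bigD1 r)//= [X in (_ < X)%N](bigD1 r)//=.
rewrite -addSn leq_add//.
  by rewrite /decr2 eqxx -subnDA; case: (n r) nr => // m _; rewrite addSn subSS ltnS leq_subr.
by apply: leq_sum => v _; rewrite /decr2 -subnDA leq_subr.
Qed.

Lemma diagMom_ge0 n : 0 <= diagMom n.
Proof.
have [k] := ubnP (\sum_(v in [set: V]%SET) n v); elim: k n => // k ih n nk.
have [[r nr]|n0] := pselect (exists r, (0 < n r)%N); last first.
  rewrite diagMom0// => v; apply/eqP; rewrite -leqn0 leqNgt; apply/negP => nv.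
  by apply: n0; exists v.
rewrite (diagMomE nr) sumr_ge0// => s _; rewrite mulr_ge0//.
by apply: ih; rewrite (leq_trans (@sum_decr2 n r s [set: V]%SET (finset.in_setT r) nr)).
Qed.

(* [K Q B] abstracts a seminorm bound [|Q| <= B] for functions [Q] of a
   parameter [u], for which multiplication by an edge factor [G r s] is a
   contraction; [diagMom n] counts the Feynman diagrams with degrees [n]. *)
Section moment_bound.
Context (U : Type) (G : U -> V -> V -> R) (M : U -> (V -> nat) -> R).
Hypotheses (ME : forall u n r, (0 < n r)%N -> M u n =
    \sum_(s | s != r) (n s)%:R * G u r s * M u (decr2 n r s))
  (M0 : forall u n, (forall v, n v = 0%N) -> M u n = 1).
Variables (K : (U -> R) -> R -> Prop) (Q0 : U -> R) (A : {set V}) (B : R).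
Hypotheses (K0 : forall b, 0 <= b -> K (fun=> 0) b)
  (KD : forall Q Q' b b', K Q b -> K Q' b' -> K (fun u => Q u + Q' u) (b + b'))
  (KZ : forall Q b c, 0 <= c -> K Q b -> K (fun u => c * Q u) (c * b))
  (KG : forall Q b r s, r != s -> K Q b -> K (fun u => G u r s * Q u) b).

Lemma K_sum J (t : seq J) (F : pred J) (Q : J -> U -> R) (b : J -> R) :
  (forall j, F j -> K (Q j) (b j)) ->
  K (fun u => \sum_(j <- t | F j) Q j u) (\sum_(j <- t | F j) b j).
Proof.
move=> KQ; elim: t => [|j t ih].
  rewrite big_nil (_ : (fun _ => _) = fun=> 0); first exact: K0.
  by apply/funext => u; rewrite big_nil.
rewrite big_cons; case: ifPn => Fj.
  rewrite (_ : (fun _ => _) = fun u => Q j u + \sum_(j <- t | F j) Q j u).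
    by apply: KD => //; exact: KQ.
  by apply/funext => u; rewrite big_cons Fj.
rewrite (_ : (fun _ => _) = fun u => \sum_(j <- t | F j) Q j u)//.
by apply/funext => u; rewrite big_cons (negbTE Fj).
Qed.

(** Each step of the diagram recursion multiplies by one edge factor, a contraction for [K], and the
    multiplicities add up to the count [diagMom n]. *)
Lemma Mom_bound Q n : K Q B ->
  K (fun u => Q u * M u n) (B * diagMom n).
Proof.
move=> KQ.
have [k] := ubnP (\sum_(v in [set: V]%SET) n v); elim: k n => // k ih n nk.
have [[r nr]|n0] := pselect (exists r, (0 < n r)%N); last first.
  have {}n0 v : n v = 0%N.
    by apply/eqP; rewrite -leqn0 leqNgt; apply/negP => nv; apply: n0; exists v.
  rewrite diagMom0// mulr1 (_ : (fun _ => _) = Q)//.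
  by apply/funext => u; rewrite M0// mulr1.
rewrite (diagMomE nr) mulr_sumr.
rewrite (_ : (fun _ => _) = fun u => \sum_(s | s != r)
    (n s)%:R * (G u r s * (Q u * M u (decr2 n r s)))); last first.
  apply/funext => u; rewrite (ME _ nr) mulr_sumr.
  by apply: eq_bigr => s _; ring.
apply: K_sum => s sr; rewrite mulrCA; apply: KZ => //; apply: KG.
  by rewrite eq_sym.
by apply: ih; rewrite (leq_trans (@sum_decr2 n r s [set: V]%SET (finset.in_setT r) nr)).
Qed.

(** For Hermite moments, the covariance between the product over [A] and the product over its
    complement; it keeps the diagrams that have an edge across. *)
Definition Mc u n : R := M u n - M u (restr A n) * M u (restr (~: A) n).

Lemma Mc0 u n : (forall v, v \in A -> n v = 0%N) -> Mc u n = 0.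
Proof.
move=> nA; rewrite /Mc (M0 u (n := restr A n)); last first.
  by move=> v; rewrite /restr; case: ifPn => // /nA.
rewrite mul1r (_ : restr (~: A) n = n) ?subrr//; apply/funext => v.
by rewrite /restr inE; case: ifPn => // /negPn/nA ->.
Qed.

(** Pairing a leg of [r] inside [A] changes the full moment and the moment over [A] alike and leaves
    a difference of the same kind. Pairing it outside [A] has no counterpart in the product, where
    the outer degrees are zero, so the full moment stays. *)
Lemma McE u n r : r \in A -> (0 < n r)%N -> Mc u n =
  \sum_(s | s != r) (n s)%:R * G u r s *
    (if s \in A then Mc u (decr2 n r s) else M u (decr2 n r s)).
Proof.
move=> rA nr; rewrite /Mc (ME u nr) (ME u (n := restr A n) (r := r)); last first.
  by rewrite /restr rA.
rewrite mulr_suml -sumrB; apply: eq_bigr => s sr.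
rewrite {1}/restr; case: ifPn => sA; last by rewrite !mul0r subr0.
rewrite mulrBr -!mulrA; congr (_ - _ * (_ * (M u _ * M u _))).
  apply/funext => v; rewrite /restr /decr2.
  by case: ifPn.
apply/funext => v; rewrite /restr /decr2 inE; case: ifPn => // vA.
have vr : v != r by apply: contraNneq vA => ->.
have vs : v != s by apply: contraNneq vA => ->.
by rewrite (negbTE vr) (negbTE vs) !subn0.
Qed.

Hypothesis Kcross : forall r s, r \in A -> s \notin A ->
  K (fun u => G u r s * Q0 u) B.

(** Edges inside [A] are contractions until the first edge leaves [A]; that one is charged the bound
    [B], and all later edges are contractions again. If the legs of [A] run out first, the term is
    zero. *)
Lemma Mc_bound n : 0 <= B -> K (fun u => Q0 u * Mc u n) (B * diagMom n).
Proof.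
move=> B0.
have [k] := ubnP (\sum_(v in A) n v); elim: k n => // k ih n nk.
have [[r [rA nr]]|n0] := pselect (exists r, r \in A /\ (0 < n r)%N); last first.
  have {}n0 v : v \in A -> n v = 0%N.
    move=> vA; apply/eqP; rewrite -leqn0 leqNgt; apply/negP => nv.
    by apply: n0; exists v.
  rewrite (_ : (fun _ => _) = fun=> 0); last first.
    by apply/funext => u; rewrite Mc0// mulr0.
  by apply: K0; rewrite mulr_ge0// diagMom_ge0.
rewrite (diagMomE nr) mulr_sumr.
rewrite (_ : (fun _ => _) = fun u => \sum_(s | s != r) (n s)%:R *
    (if s \in A then G u r s * (Q0 u * Mc u (decr2 n r s))
     else G u r s * Q0 u * M u (decr2 n r s))); last first.
  apply/funext => u; rewrite (McE _ rA nr) mulr_sumr.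
  by apply: eq_bigr => s _; case: ifPn => _; ring.
apply: K_sum => s sr; rewrite mulrCA; apply: KZ => //.
have [sA|sA] := boolP (s \in A).
  apply: KG; first by rewrite eq_sym.
  by apply: ih; rewrite (leq_trans (@sum_decr2 n r s A rA nr)).
apply: Mom_bound; exact: Kcross.
Qed.

End moment_bound.

End hermite_moments.

(** * Counting diagrams *)

Section hermite_count.
Context (R : realType).
Local Notation He := (He R).

(** The number of ways to join [r] of [a] legs with [r] of [b] legs. *)
Definition lincoef (a b r : nat) : nat := (r`! * 'C(a, r) * 'C(b, r))%N.

(** Comparison of coefficients when [He a.+1 * He b] is expanded through multiplication by ['X].
    Truncated subtraction in [a + b - r.*2] is harmless: once [r] exceeds [b] the coefficients
    vanish. *)
Lemma lincoef_rec (a b r : nat) : (r <= a)%N ->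
  (lincoef a.+1 b r.+1 + a * lincoef a.-1 b r =
   lincoef a b r.+1 + (a + b - r.*2) * lincoef a b r)%N.
Proof.
move=> ra; have [br|rb] := ltnP b r.
  by rewrite /lincoef !(bin_small br) !(bin_small (leqW br)) !muln0.
have h1 : (a * 'C(a.-1, r) = (a - r) * 'C(a, r))%N by rewrite mul_bin_down.
have h2 : ('C(b, r.+1) * r.+1 = (b - r) * 'C(b, r))%N by rewrite mulnC mul_bin_left.
rewrite /lincoef binS factS.
have -> : (a * (r`! * 'C(a.-1, r) * 'C(b, r)) =
    r`! * ((a - r) * 'C(a, r)) * 'C(b, r))%N by rewrite -h1; ring.
have -> : (r.+1 * r`! * ('C(a, r.+1) + 'C(a, r)) * 'C(b, r.+1) =
    r.+1 * r`! * 'C(a, r.+1) * 'C(b, r.+1) +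
    r`! * 'C(a, r) * ((b - r) * 'C(b, r)))%N by rewrite -h2; ring.
rewrite -addnA; congr addn.
have -> : (a + b - r.*2 = (b - r) + (a - r))%N by rewrite -addnn; lia.
ring.
Qed.

Lemma mulX_He m : 'X * He m = He m.+1 + m%:R *: He m.-1.
Proof. by rewrite HeS He_deriv subrK. Qed.

Lemma He_linearization a b : He a * He b =
  \sum_(r < a.+1) (lincoef a b r)%:R *: He (a + b - r.*2).
Proof.
have [k] := ubnP a; elim: k a b => // k ih [|a] b ak.
  rewrite big_ord1 /lincoef fact0 !bin0 !mul1n scale1r mul1r double0 subn0.
  by rewrite add0n.
have -> : He a.+1 * He b = 'X * (He a * He b) - a%:R *: (He a.-1 * He b).
  by rewrite HeS He_deriv mulrBl -scalerAl mulrA.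
rewrite ih// mulr_sumr.
have E1 (r : 'I_a.+1) : 'X * ((lincoef a b r)%:R *: He (a + b - r.*2)) =
    (lincoef a b r)%:R *: He (a.+1 + b - r.*2) +
    ((a + b - r.*2) * lincoef a b r)%:R *: He (a.+1 + b - r.+1.*2).
  rewrite -scalerAr mulX_He scalerDr scalerA -natrM mulnC.
  have -> : ((a + b - r.*2).-1 = a.+1 + b - r.+1.*2)%N by rewrite -!addnn; lia.
  congr (_ + _); have [br|rb] := ltnP b r.
    by rewrite /lincoef (bin_small br) muln0 !scale0r.
  by congr (_ *: He _); have := ltn_ord r; rewrite -!addnn; lia.
rewrite (eq_bigr _ (fun r _ => E1 r)) big_split/=.
rewrite (big_ord_recl a) [RHS](big_ord_recl a.+1).
rewrite -!addrA; congr (_ + _); first by rewrite /lincoef !bin0.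
have E2 : \sum_(i < a) (lincoef a b (lift ord0 i))%:R *: He (a.+1 + b - (lift ord0 i).*2)
    = \sum_(i < a.+1) (lincoef a b i.+1)%:R *: He (a.+1 + b - i.+1.*2).
  by rewrite big_ord_recr /= [X in X%:R *: _]/lincoef (bin_small (ltnSn a)) muln0
    mul0n scale0r addr0.
have E3 : a%:R *: (He a.-1 * He b) =
    \sum_(i < a.+1) (a * lincoef a.-1 b i)%:R *: He (a.+1 + b - i.+1.*2).
  case: a ih ak {E1 E2} => [|a] ih ak.
    by rewrite big_ord1 mul0n !scale0r.
  rewrite /= ih; last by move: ak; rewrite !ltnS; exact: ltnW.
  rewrite [RHS]big_ord_recr/= [X in (_ * X)%N]/lincoef (bin_small (ltnSn a)) !muln0.
  rewrite scale0r addr0 scaler_sumr; apply: eq_bigr => i _.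
  by rewrite scalerA -natrM; congr (_ *: He _); rewrite -!addnn; lia.
rewrite E2 E3 addrA -big_split -sumrB; apply: eq_bigr => r _.
rewrite -[lift ord0 r : nat]/(r.+1) -[X in X - _ = _]scalerDl -scalerBl -natrD.
rewrite -lincoef_rec; last by rewrite -ltnS ltn_ord.
by rewrite natrD addrK.
Qed.

Lemma integ_stdg_poly (p : {poly R}) : integ (@stdg R) (horner p).
Proof.
have gd := @gfam_diag R unit.
have := gfam_integ gd (g := fun x => p.[x tt]).
apply; last exact: expgrowth_horner.
by move=> d T X mX; exact: (measurableT_comp (measurable_horner p)).
Qed.

Lemma stdg_He_ibp i (p : {poly R}) :
  \int[@stdg R]_z ((He i.+1).[z] * p.[z]) =
  \int[@stdg R]_z ((He i).[z] * p^`().[z]).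
Proof.
have := hermite_ibp (i := tt) i (@gfam_diag R unit) erefl (smooth_horner p tt).
move=> ->; rewrite (bigD1 tt)//= big1 ?addr0; last by case.
by rewrite mul1r; apply: eq_rint => z; rewrite mul1r.
Qed.

Lemma He_orth i j : \int[@stdg R]_z ((He i).[z] * (He j).[z]) = (i == j)%:R * i`!%:R.
Proof.
elim: i j => [|i ih] [|j].
- rewrite mul1r -[RHS](rint_cst (@stdg R)); apply: eq_rint => z.
  by rewrite /= hornerC mul1r.
- rewrite mul0r (@eq_rint _ (measurableTypeR R) _ _ _
    (fun z => (He j.+1).[z] * (1 : {poly R}).[z])).
    rewrite stdg_He_ibp -[1]/(1%:P) derivC -[RHS](rint_cst (@stdg R)).
    by apply: eq_rint => z; rewrite horner0 mulr0.
  by move=> z; rewrite mulrC.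
- rewrite mul0r stdg_He_ibp /= -[1]/(1%:P) derivC -[RHS](rint_cst (@stdg R)).
  by apply: eq_rint => z; rewrite horner0 mulr0.
- rewrite stdg_He_ibp He_deriv.
  rewrite (@eq_rint _ (measurableTypeR R) _ _ _
    (fun z => j.+1%:R * ((He i).[z] * (He j).[z]))).
    rewrite rintZ; last first.
      have := integ_stdg_poly (He i * He j); congr (integ _ _).
      by apply/funext => z /=; rewrite hornerM.
    rewrite ih eqSS; case: eqP => [->|_]; last by rewrite !mul0r mulr0.
    by rewrite !mul1r -natrM -factS.
  by move=> z; rewrite hornerZ mulrCA.
Qed.

Lemma He_sqr n : He n ^+ 2 =
  \sum_(k < n.+1) (lincoef n n (n - k))%:R *: He k.*2.
Proof.
rewrite expr2 He_linearization (reindex_inj rev_ord_inj)/=.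
apply: eq_bigr => k _; rewrite subSS; congr (_ *: He _).
by have := ltn_ord k; rewrite -!addnn; lia.
Qed.

Lemma lincoef_fact n k : (k <= n)%N -> (lincoef n n (n - k) * k`! = n`! * 'C(n, k))%N.
Proof.
move=> kn; rewrite /lincoef bin_sub// -(bin_fact kn); ring.
Qed.

(** Linearizing each square leaves even orders only, and orthogonality keeps the matching ones. The
    factorials combine through [lincoef n n (n - k) * k! = n! * 'C(n, k)] and
    [(2k)! = 'C(2k, k) * (k!)^2]. *)
Lemma He_sqr_moment n m : (\int[@stdg R]_z ((He n).[z] ^+ 2 * (He m).[z] ^+ 2) =
  (\sum_(k < n.+1) (n`! * m`! * 'C(n, k) * 'C(m, k) * 'C(k.*2, k))%N)%:R)%R.
Proof.
have E (z : measurableTypeR R) : (He n).[z] ^+ 2 * (He m).[z] ^+ 2 = \sum_(k < n.+1) \sum_(l < m.+1)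
    (lincoef n n (n - k) * lincoef m m (m - l))%:R * ((He k.*2).[z] * (He l.*2).[z]).
  rewrite -!horner_exp !He_sqr !horner_sum mulr_suml; apply: eq_bigr => k _.
  rewrite mulr_sumr; apply: eq_bigr => l _; rewrite !hornerZ natrM; ring.
have iHe k l : integ (@stdg R) (fun z => (He k).[z] * (He l).[z]).
  have := integ_stdg_poly (He k * He l); congr (integ _ _).
  by apply/funext => z /=; rewrite hornerM.
rewrite (eq_rint _ E) rint_sum; last first.
  by move=> k _; apply: integ_sum => l _; apply: integZ; exact: iHe.
rewrite natr_sum; apply: eq_bigr => k _.
rewrite rint_sum; last by move=> l _; apply: integZ; exact: iHe.
under eq_bigr do rewrite (rintZ _ (iHe _ _)) He_orth.
have kn : (k <= n)%N by rewrite -ltnS.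
have [mk|km] := ltnP m k.
  rewrite (bin_small mk) muln0 mul0n big1// => l _.
  rewrite (_ : _ == _ = false) ?mul0r ?mulr0//; apply/eqP => /(congr1 half).
  rewrite !doubleK => kl; have := ltn_ord l; rewrite -kl; lia.
have km' : (k < m.+1)%N by [].
rewrite (bigD1 (Ordinal km'))//= eqxx mul1r big1 ?addr0; last first.
  move=> l lk; rewrite (_ : _ == _ = false) ?mul0r ?mulr0//.
  apply/eqP => /(congr1 half); rewrite !doubleK => kl.
  by move/eqP: lk; apply; exact/val_inj.
rewrite -natrM; congr (_%:R).
have h : (k.*2`! = 'C(k.*2, k) * (k`! * k`!))%N.
  have kk : (k <= k.*2)%N by rewrite -addnn leq_addr.
  by rewrite -(bin_fact kk) -addnn addnK.
have h1 := lincoef_fact kn; have h2 := lincoef_fact km.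
transitivity ((lincoef n n (n - k) * k`!) * (lincoef m m (m - k) * k`!) *
  'C(k.*2, k))%N; first by rewrite h; ring.
by rewrite h1 h2; ring.
Qed.

Lemma sum_bin_expn n : (\sum_(k < n.+1) 'C(n, k) * 2 ^ k = 3 ^ n)%N.
Proof.
have -> : (3 ^ n = (1 + 2) ^ n)%N by [].
rewrite expnDn; apply: eq_bigr => k _.
by rewrite exp1n mul1n.
Qed.

Lemma bin_le_expn n k : ('C(n, k) * 2 ^ k <= 3 ^ n)%N.
Proof.
have [nk|kn] := ltnP n k; first by rewrite bin_small.
have kn' : (k < n.+1)%N by [].
by rewrite -sum_bin_expn (bigD1 (Ordinal kn'))//= leq_addr.
Qed.

Lemma central_bin_le k : ('C(k.*2, k) <= 4 ^ k)%N.
Proof.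
have kk : (k < k.*2.+1)%N by rewrite ltnS -addnn leq_addr.
have -> : (4 ^ k = (1 + 1) ^ k.*2)%N by rewrite -mul2n expnM.
rewrite expnDn.
rewrite (bigD1 (Ordinal kk))//= !exp1n !muln1 leq_addr//.
Qed.

(** The factor [q^2] is the square of the multiplicity that differentiation puts on one side of the
    inner product. One [q] completes [q!]; the other gives [q 'C(q-1, k) = (k+1) 'C(q, k+1)], and
    [k + 1 <= p] completes [p!]. The central binomial is at most [4^k], shared as [2^k] with each
    remaining binomial; these are terms of expansions of powers of [1 + 2]. *)
Lemma He_count (p q : nat) : (0 < p)%N -> (0 < q)%N ->
  q%:R ^+ 2 * \int[@stdg R]_z ((He p.-1).[z] ^+ 2 * (He q.-1).[z] ^+ 2) <=
  p`!%:R * q`!%:R * 3 ^+ (p + q).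
Proof.
case: p => // n _; case: q => // m _ /=.
rewrite He_sqr_moment -natrX -natrM -[3]/(3%:R) -natrX -!natrM ler_nat.
rewrite big_distrr /=.
apply: (@leq_trans (\sum_(k < n.+1) (n.+1`! * m.+1`! * 3 ^ m.+1) *
    ('C(n, k) * 2 ^ k))%N); last first.
  rewrite -big_distrr sum_bin_expn; set f := (_`! * _`!)%N.
  rewrite -[X in (X <= _)%N]/(f * 3 ^ m.+1 * 3 ^ n)%N.
  by rewrite -mulnA leq_mul2l -expnD leq_exp2l//; apply/orP; right; lia.
apply: leq_sum => k _.
have kn : (k.+1 <= n.+1)%N := ltn_ord k.
have h := mul_bin_diag m.+1 k; rewrite /= in h.
have h3 := bin_le_expn m.+1 k.+1; have h4 := central_bin_le k.
have e4 : (4 ^ k = 2 ^ k * 2 ^ k)%N by rewrite -expnMn.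
apply: (@leq_trans (n`! * m.+1`! * 'C(n, k) * (k.+1 * 'C(m.+1, k.+1)) * 4 ^ k)%N).
  rewrite -h factS.
  rewrite (_ : (_ * _ = m.+1 * m.+1 * n`! * m`! * 'C(n, k) * 'C(m, k) * 'C(k.*2, k))%N);
    last by rewrite expnS expn1; ring.
  by rewrite (_ : (_ * 4 ^ k = m.+1 * m.+1 * n`! * m`! * 'C(n, k) * 'C(m, k) * 4 ^ k)%N)
    ?leq_mul2l ?h4 ?orbT//; ring.
rewrite [n.+1`!]factS e4.
apply: (@leq_trans (n`! * m.+1`! * 'C(n, k) * 2 ^ k * (n.+1 * ('C(m.+1, k.+1) * 2 ^ k.+1)))%N).
  rewrite (_ : (_ * (2 ^ k * 2 ^ k) = n`! * m.+1`! * 'C(n, k) * 2 ^ k *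
    (k.+1 * ('C(m.+1, k.+1) * 2 ^ k)))%N); last by ring.
  by rewrite leq_mul2l leq_mul// ?leq_mul2l ?leq_exp2l ?leqnSn ?orbT.
rewrite (_ : (_ * (n.+1 * _) = n.+1 * n`! * m.+1`! * ('C(n, k) * 2 ^ k) *
  ('C(m.+1, k.+1) * 2 ^ k.+1))%N); last by ring.
rewrite (_ : (_ * 3 ^ m.+1 * _ = n.+1 * n`! * m.+1`! * ('C(n, k) * 2 ^ k) *
  3 ^ m.+1)%N); last by ring.
by rewrite leq_mul2l h3 orbT.
Qed.

End hermite_count.

(** * Interpolation *)

Section box_average.
Context (R : realType).
Local Notation mu := (@lebesgue_measure R).
Definition unif01 : probability (measurableTypeR R) R := uniform_prob (@ltr01 R).

Lemma unif01E (f : R -> R) : continuous f ->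
  integ unif01 f /\ \int[unif01]_x f x = \int[mu]_(x in `[0, 1]) f x.
Proof.
move=> cf.
have mf : measurable_fun setT f by exact: continuous_measurable_fun.
have E : (fun x => f x * uniform_pdf (0 : R) 1 x) = f \_ `[0, 1].
  apply/funext => x; rewrite /uniform_pdf patchE mem_setE subr0 invr1 in_itv/=.
  by case: ifP; rewrite ?mulr1 ?mulr0.
have fi : integ mu (fun x => f x * uniform_pdf (0 : R) 1 x).
  rewrite E -restrict_EFin; apply/(integrable_mkcond _ _).1 => //.
  apply: continuous_compact_integrable; first exact: segment_compact.
  exact: continuous_subspaceT.
have [] := @integ_density _ _ R mu unif01 (uniform_pdf (0 : R) 1) _ _ _ f mf fi.
- exact: measurable_uniform_pdf.
- by move=> x; apply: uniform_pdf_ge0.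
- by move=> B mB.
by move=> ? ->; split => //; rewrite E [RHS]Rintegral_mkcond.
Qed.

Definition lip1 (L : R) (f : R -> R) := forall x y, `|f y - f x| <= L * `|y - x|.

Lemma lip1_continuous L f : lip1 L f -> continuous f.
Proof.
move=> fL x; apply/cvgrPdist_le => e e0.
have L1 : 0 < `|L| + 1 by rewrite ltr_wpDl.
near=> y; rewrite (le_trans (fL _ _))//.
rewrite (@le_trans _ _ ((`|L| + 1) * `|x - y|))//.
  by rewrite ler_wpM2r// (le_trans (ler_norm _))// lerDl.
rewrite -ler_pdivlMl//; near: y.
by apply: cvgr_dist_le; [exact: cvg_id|rewrite mulr_gt0// invr_gt0].
Unshelve. all: by end_near. Qed.

(** The average of [f] over [[z, z + e]] has derivative [(f (z + e) - f z) / e] in [z], which is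
    Lipschitz with constant [2 L / e]; the mean value theorem then gives the quadratic remainder. *)
Lemma box_quad (L e r : R) (f : R -> R) : 0 < e -> lip1 L f ->
  `|\int[unif01]_s f (r + e * s) - \int[unif01]_s f (e * s) -
    r * ((f e - f 0) / e)| <= 2 * L / e * r ^+ 2.
Proof.
move=> e0 fL; have cf := lip1_continuous fL.
(* The interval [[- M, u]] contains every point at which the primitive [Phi] is used, with room at
   both ends. *)
pose M := `|r| + e + 1; pose u := M + 1.
pose Phi (x : R) := \int[mu]_(t in `[- M, x]) f t.
have r0 := normr_ge0 r.
have fu : mu.-integrable `[- M, u] (EFin \o f).
  apply: continuous_compact_integrable; first exact: segment_compact.
  exact: continuous_subspaceT.
have dPhi (x : R) : `|x| <= `|r| + e -> is_derive x 1 Phi (f x).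
  rewrite ler_norml => /andP[xl xr].
  have [||||dx ex] := @continuous_FTC1_closed R f (- M) x u.
  - by rewrite /u /M; lra.
  - by [].
  - by rewrite /M; lra.
  - exact: cf.
  by split; [exact: dx|rewrite -derive1E; exact: ex].
have shift (z : R) : `|z| <= `|r| ->
    \int[unif01]_s f (z + e * s) = (Phi (z + e) - Phi z) / e.
  rewrite ler_norml => /andP[zl zr].
  have cfz : continuous (fun s : R => f (z + e * s)).
    move=> s; apply: (@continuous_comp _ _ _ (fun s : R => z + e * s) f); last exact: cf.
    by apply: cvgD; [exact: cvg_cst|apply: cvgM; [exact: cvg_cst|exact: cvg_id]].
  rewrite (unif01E cfz).2.
  pose H (s : R) := Phi (z + e * s) / e.
  have dH (s : R) : 0 <= s <= 1 -> is_derive s 1 H (f (z + e * s)).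
    move=> /andP[s0 s1].
    have d1 : is_derive (z + e * s) 1 Phi (f (z + e * s)).
      apply: dPhi; have := mulr_ge0 (ltW e0) s0; have : e * s <= e by rewrite ger_pMr.
      by move=> ? ?; rewrite ler_norml; lra.
    have d2 : is_derive s 1 (fun s : R => z + e * s) e.
      by apply: is_derive_eq; rewrite /GRing.scale/=; ring.
    have d3 : is_derive s 1 (fun s : R => Phi (z + e * s)) (e * f (z + e * s)).
      by rewrite [e * f _]mulrC; exact: (@is_derive1_comp _ Phi (fun s : R => z + e * s) s _ _ d1 d2).
    have -> : H = (fun s => e^-1 * Phi (z + e * s)).
      by apply/funext => t; rewrite /H mulrC.
    apply: is_derive_eq; rewrite /GRing.scale/=; field.
    exact: lt0r_neq0.
  have cH (s : R) : 0 <= s <= 1 -> {for s, continuous H}.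
    move=> s01; apply: differentiable_continuous; apply/derivable1_diffP.
    by have [] := dH _ s01.
  have := @continuous_FTC2 R (fun s => f (z + e * s)) H 0 1 ltr01.
  rewrite /Rintegral => ->.
  - by rewrite /H/= mulr1 mulr0 addr0 mulrBl.
  - exact: continuous_subspaceT.
  - split.
    + move=> s; rewrite in_itv/= => /andP[s0 s1].
      by have [] := dH s _; rewrite ?ltW//.
    + by apply: cvg_at_right_filter; apply: cH; rewrite lexx ler01.
    + by apply: cvg_at_left_filter; apply: cH; rewrite lexx ler01.
  - move=> s; rewrite in_itv/= => /andP[s0 s1].
    by rewrite derive1E; have [] := dH s _; rewrite ?ltW.
have := shift 0; rewrite normr0 => /(_ r0).
under eq_Rintegral do rewrite add0r.
move=> ->; rewrite shift// add0r.
pose Psi (z : R) := Phi (z + e) - Phi z - z * (f e - f 0).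
have dPsi (z : R) : `|z| <= `|r| ->
    is_derive z 1 Psi (f (z + e) - f z - (f e - f 0)).
  move=> zr.
  have d1 : is_derive (z + e) 1 Phi (f (z + e)).
    apply: dPhi; rewrite (le_trans (ler_normD _ _))// lerD//.
    by rewrite ger0_norm// ltW.
  have d0 : is_derive z 1 Phi (f z).
    by apply: dPhi; rewrite (le_trans zr)// lerDl ltW.
  have d2 : is_derive z 1 (fun z : R => z + e) 1.
    by apply: is_derive_eq; rewrite /GRing.scale/=; ring.
  have d3 : is_derive z 1 (fun s : R => Phi (s + e)) (f (z + e)).
    by rewrite -[f (z + e)]mulr1; exact: (@is_derive1_comp _ Phi (fun s : R => s + e) z _ _ d1 d2).
  by apply: is_derive_eq; rewrite /GRing.scale/=; ring.
have key : `|Psi r - Psi 0| <= 2 * L * r ^+ 2.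
  have cPsi (z : R) : `|z| <= `|r| -> {for z, continuous Psi}.
    move=> zr; apply: differentiable_continuous; apply/derivable1_diffP.
    by have [] := dPsi _ zr.
  have bnd c : `|c| <= `|r| ->
     `|f (c + e) - f c - (f e - f 0)| <= 2 * L * `|r|.
    have L0 : 0 <= L by have := fL 0 1; rewrite subr0 normr1 mulr1; apply: le_trans.
    move=> cr; rewrite (_ : _ - _ - _ = (f (c + e) - f e) - (f c - f 0)); last by ring.
    rewrite (le_trans (ler_normB _ _))//.
    have := fL e (c + e); have := fL 0 c; rewrite subr0 addrK => h1 h2.
    have := ler_wpM2l L0 cr; lra.
  have seg (a b : R) : a <= b -> (forall z, a <= z <= b -> `|z| <= `|r|) ->
      exists2 c, `|c| <= `|r| & Psi b - Psi a = (f (c + e) - f c - (f e - f 0)) * (b - a).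
    move=> ab abr.
    have [||c] := @MVT_segment R Psi (fun c => f (c + e) - f c - (f e - f 0)) a b ab.
    - by move=> x; rewrite in_itv/= => /andP[? ?]; apply: dPsi; apply: abr; rewrite !ltW.
    - apply: continuous_in_subspaceT => x; rewrite inE/= in_itv/= => xab.
      exact/cPsi/abr.
    by rewrite in_itv/= => cab ->; exists c => //; exact: abr.
  have [r1|r1] := leP 0 r.
    have [z|c cr ->] := seg 0 r r1; first by move=> /andP[? ?]; rewrite !ger0_norm.
    rewrite subr0 normrM -[r ^+ 2]real_normK ?num_real// expr2 mulrA ler_wpM2r//.
    exact: bnd.
  have [z|c cr E] := seg r 0 (ltW r1).
    by move=> /andP[? ?]; rewrite !ler0_norm ?lerN2// ltW.
  rewrite distrC E sub0r normrM normrN.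
  rewrite -[r ^+ 2]real_normK ?num_real// expr2 mulrA ler_wpM2r//.
  exact: bnd.
rewrite (_ : _ - _ = (Psi r - Psi 0) / e).
  by rewrite normrM normfV (gtr0_norm e0) mulrAC ler_wpM2r// invr_ge0 ltW.
rewrite /Psi add0r; field; exact: lt0r_neq0.
Qed.

End box_average.

Section mollification.
Context (R : realType) (D : finType).
Implicit Types (x y : D -> R).

Definition upd x k (r : R) : D -> R := fun j => x j + (j == k)%:R * r.

Lemma updC x k r l s : upd (upd x k r) l s = upd (upd x l s) k r.
Proof. by apply/funext => j; rewrite /upd addrAC. Qed.

Lemma upd0 x k : upd x k 0 = x.
Proof. by apply/funext => j; rewrite /upd mulr0 addr0. Qed.

Lemma sum_upd x k r s : \sum_j `|upd x k r j - upd x k s j| = `|r - s|.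
Proof.
rewrite (bigD1 k)//= big1 ?addr0 => [|j jk].
  by rewrite /upd eqxx !mul1r opprD addrACA subrr add0r.
by rewrite /upd (negbTE jk) !mul0r !addr0 subrr normr0.
Qed.

Definition lipD (L : R) (f : (D -> R) -> R) := forall x y, `|f y - f x| <= L * \sum_j `|y j - x j|.

(** [f'] is the partial derivative of [f] in direction [k], expressed by a uniform quadratic
    remainder so that it survives averaging. *)
Definition tayl k (f f' : (D -> R) -> R) (C : R) :=
  forall x r, `|f (upd x k r) - f x - r * f' x| <= C * r ^+ 2.

Lemma lipD_upd L f k r x : lipD L f -> `|f (upd x k r) - f x| <= L * `|r|.
Proof.
move=> fL; rewrite -{2}(upd0 x k); apply: (le_trans (fL _ _)).
by rewrite sum_upd subr0.
Qed.

Definition avg (e : R) k (f : (D -> R) -> R) x := \int[@unif01 R]_s f (upd x k (e * s)).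

Lemma lipD_line L f x k : lipD L f -> lip1 L (fun s : R => f (upd x k s)).
Proof. by move=> fL s t; apply: (le_trans (fL _ _)); rewrite sum_upd. Qed.

Lemma avg_integ L f x k e : lipD L f ->
  integ (@unif01 R) (fun s : R => f (upd x k (e * s))).
Proof.
move=> fL; apply: (unif01E _).1; have cf := lip1_continuous (lipD_line x k fL).
move=> s; apply: (@continuous_comp _ _ _ (fun s : R => e * s)
  (fun s : R => f (upd x k s))); last exact: cf.
by apply: cvgM; [exact: cvg_cst|exact: cvg_id].
Qed.

Lemma avg_lip L f k e : lipD L f -> lipD L (avg e k f).
Proof.
move=> fL x y; rewrite -rintB; [|exact: (avg_integ _ _ _ fL)..].
apply: abs_rint_le.
  by apply: measurable_funB; exact: (integ_measurable (avg_integ _ _ _ fL)).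
move=> s; apply: (le_trans (fL _ _)); rewrite le_eqVlt; apply/predU1P; left.
by congr (_ * _); apply: eq_bigr => j _; rewrite /upd opprD addrACA subrr addr0.
Qed.

Lemma avg_le L B f k e : lipD L f -> (forall x, `|f x| <= B) ->
  forall x, `|avg e k f x| <= B.
Proof.
move=> fL fB x; apply: abs_rint_le => //.
exact: (integ_measurable (avg_integ _ _ _ fL)).
Qed.

Definition mean01 : R := \int[@unif01 R]_s `|s|.

Lemma avg_close L f k e x : 0 <= e -> lipD L f ->
  `|avg e k f x - f x| <= L * e * mean01.
Proof.
move=> e0 fL; have := avg_integ x k e fL => fi.
have ni : integ (@unif01 R) (fun s : R => `|s|).
  by apply: (unif01E _).1 => s; apply: norm_continuous.
rewrite -[f x in X in `|X|](rint_cst (@unif01 R)) -rintB//; last exact: integ_cst.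
rewrite -rintZ//; apply: le_abs_rint.
- by apply: measurable_funB => //; exact: (integ_measurable fi).
- exact: integZ.
- move=> s; apply: (le_trans (lipD_upd _ _ _ fL)).
  by rewrite normrM (ger0_norm e0) mulrA.
Qed.

Lemma avg_tayl m k f f' L L' C e : lipD L f -> lipD L' f' -> tayl m f f' C ->
  tayl m (avg e k f) (avg e k f') C.
Proof.
move=> fL fL' ff' x r.
have i1 := avg_integ (upd x m r) k e fL.
have i2 := avg_integ x k e fL.
have i3 := avg_integ x k e fL'.
rewrite -rintB// -rintZ// -rintB//; [|exact: integB|exact: integZ].
apply: abs_rint_le.
  apply: measurable_funB; [apply: measurable_funB|apply: measurable_funM] => //.
  - exact: (integ_measurable i1).
  - exact: (integ_measurable i2).
  - exact: (integ_measurable i3).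
by move=> s; rewrite updC; exact: ff'.
Qed.

Definition diffq (e : R) k (f : (D -> R) -> R) x := (f (upd x k e) - f x) / e.

Lemma avg_tayl_diffq k f L e : 0 < e -> lipD L f ->
  tayl k (avg e k f) (diffq e k f) (2 * L / e).
Proof.
move=> e0 fL x r; have := box_quad r e0 (lipD_line x k fL).
rewrite upd0.
rewrite (_ : avg e k f (upd x k r) = \int[@unif01 R]_s f (upd x k (r + e * s))) //.
by apply: eq_rint => s; congr f; apply/funext => j; rewrite /upd; ring.
Qed.

Lemma diffq_lip L f k e : 0 < e -> lipD L f -> lipD (2 * L / e) (diffq e k f).
Proof.
move=> e0 fL x y; rewrite /diffq -mulrBl normrM normfV (gtr0_norm e0).
rewrite [leRHS]mulrAC ler_wpM2r ?invr_ge0 ?(ltW e0)//.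
rewrite (_ : _ - _ = (f (upd y k e) - f (upd x k e)) - (f y - f x)); last by ring.
rewrite (_ : 2 * L * _ = L * \sum_j `|y j - x j| + L * \sum_j `|y j - x j|); last by ring.
rewrite (le_trans (ler_normB _ _))// lerD//.
apply: (le_trans (fL _ _)); rewrite le_eqVlt; apply/predU1P; left.
by congr (_ * _); apply: eq_bigr => j _; rewrite /upd opprD addrACA subrr addr0.
Qed.

Lemma diffq_le L f k e x : 0 < e -> lipD L f -> `|diffq e k f x| <= L.
Proof.
move=> e0 fL; rewrite /diffq normrM normfV (gtr0_norm e0) ler_pdivrMr//.
by apply: (le_trans (lipD_upd _ _ _ fL)); rewrite (gtr0_norm e0).
Qed.

Definition moll (e : R) (s : seq D) f := foldr (avg e) f s.

Lemma moll_lip e s f L : lipD L f -> lipD L (moll e s f).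
Proof. by move=> fL; elim: s => //= k s ih; exact: avg_lip. Qed.

Lemma moll_close e s f L x : 0 <= e -> lipD L f ->
  `|moll e s f x - f x| <= (size s)%:R * (L * e * mean01).
Proof.
move=> e0 fL; elim: s x => [|k s ih] x /=; first by rewrite subrr normr0 mul0r.
rewrite (_ : _ - _ = (avg e k (moll e s f) x - moll e s f x) +
  (moll e s f x - f x)); last by ring.
rewrite (le_trans (ler_normD _ _))// -natr1 mulrDl mul1r addrC lerD//.
by apply: avg_close => //; exact: moll_lip.
Qed.

Lemma moll_tayl e s m f f' L L' C : lipD L f -> lipD L' f' -> tayl m f f' C ->
  tayl m (moll e s f) (moll e s f') C.
Proof.
move=> fL fL' ff'; elim: s => //= k s ih.
by apply: (@avg_tayl _ _ _ _ L L') => //; exact: moll_lip.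
Qed.

(** Direction [k] gains a derivative at the moment it is averaged, namely a difference quotient,
    bounded by [L] since [f] is [L]-Lipschitz. The remaining averages preserve all three
    properties. *)
Lemma moll_smooth e s k f L : 0 < e -> k \in s -> lipD L f ->
  exists f', [/\ tayl k (moll e s f) f' (2 * L / e), lipD (2 * L / e) f' &
    forall x, `|f' x| <= L].
Proof.
move=> e0 + fL; elim: s => //= i s ih; rewrite inE.
have fL' := moll_lip e s fL.
have [<- _|ki /= ks] := eqVneq k i.
  exists (diffq e k (moll e s f)); split.
  - exact: avg_tayl_diffq.
  - exact: diffq_lip.
  - by move=> x; exact: diffq_le.
have [f' [t' l' b']] := ih ks.
exists (avg e i f'); split.
- exact: (avg_tayl _ _ fL' l' t').
- exact: avg_lip.
- exact: (avg_le _ _ l').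
Qed.

Lemma lipD_le L L' f : L <= L' -> lipD L f -> lipD L' f.
Proof.
move=> LL' fL x y; apply: (le_trans (fL x y)); rewrite ler_wpM2r//.
by apply: sumr_ge0.
Qed.

Lemma tayl_le k f f' C C' : C <= C' -> tayl k f f' C -> tayl k f f' C'.
Proof.
move=> CC' ff' x r; apply: (le_trans (ff' x r)); rewrite ler_wpM2r//.
exact: sqr_ge0.
Qed.

(** Applied to the gradient [h'], box averages produce second derivatives. Their bound 1, inherited
    from the Lipschitz constant of [h'], is independent of [e], whereas the [C] constructed here
    blows up as [e] tends to 0. *)
Theorem mollify (h : (D -> R) -> R) (h' : D -> (D -> R) -> R) (e : R) : 0 < e ->
  lipD 1 h -> (forall m, lipD 1 (h' m)) -> (forall m, tayl m h (h' m) 1) ->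
  exists g g1 g2 C, [/\ forall x, `|g x - h x| <= e,
    [/\ lipD C g, forall m, lipD C (g1 m) & forall m k, lipD C (g2 m k)],
    forall m, tayl m g (g1 m) C, forall m k, tayl k (g1 m) (g2 m k) C &
    forall m k x, `|g2 m k x| <= 1].
Proof.
move=> e0 hL h'L hh'.
have m0 : 0 <= mean01 by apply: rint_ge0.
(* With boxes of side [e / b] the errors accumulated over all coordinates add up to at most [e]. *)
pose b := 1 + #|D|%:R * mean01.
have b0 : 0 < b by rewrite ltr_pwDl// mulr_ge0.
pose d := e / b; have d0 : 0 < d by rewrite divr_gt0.
pose g1 m := moll d (enum D) (h' m).
have H m k : {f' | [/\ tayl k (g1 m) f' (2 * 1 / d),
    lipD (2 * 1 / d) f' & forall x, `|f' x| <= 1]}.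
  by apply: cid; apply: moll_smooth => //; rewrite mem_enum.
pose C : R := 1 + 2 * 1 / d.
have C1 : 1 <= C by rewrite lerDl mulr1 divr_ge0 ?(ltW d0).
have C2 : 2 * 1 / d <= C by rewrite lerDr.
exists (moll d (enum D) h), g1, (fun m k => sval (H m k)), C; split.
- move=> x; apply: (le_trans (moll_close _ _ (ltW d0) hL)).
  rewrite mul1r -cardE [leRHS](_ : e = d * b); last first.
    by rewrite /d divfK// gt_eqF.
  by rewrite /b mulrDr mulr1 mulrCA lerDr ltW.
- split=> [|m|m k]; first by apply: lipD_le C1 _; exact: moll_lip.
    by apply: lipD_le C1 _; exact: moll_lip.
  by case: (svalP (H m k)) => _ + _; exact: lipD_le.
- by move=> m; apply: tayl_le C1 _; exact: (moll_tayl _ _ hL (h'L m)).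
- by move=> m k; case: (svalP (H m k)) => + _ _; exact: tayl_le.
- by move=> m k; case: (svalP (H m k)).
Qed.

Lemma lipD_growth L f : lipD L f -> expgrowth f.
Proof.
move=> fL; exists (`|f (fun=> 0)| + `|L|), 1; split; [exact: addr_ge0|by []|].
move=> x; rewrite mul1r.
have : `|f x - f (fun=> 0)| <= `|L| * \sum_i `|x i|.
  apply: (le_trans (fL _ _)); under eq_bigr do rewrite subr0.
  by rewrite ler_wpM2r ?sumr_ge0// ler_norm.
set S := \sum_i _ => h; have S0 : 0 <= S by apply: sumr_ge0.
have h2 : `|f x| <= `|f (fun=> 0)| + `|L| * S.
  rewrite -[f x in leLHS](subrK (f (fun=> 0))) addrC.
  by rewrite (le_trans (ler_normD _ _))// lerD2l.
apply: (le_trans h2); rewrite mulrDl lerD//.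
  by rewrite ler_peMr// -expR0 ler_expR.
by rewrite ler_wpM2l// (le_trans _ (expR_ge1Dx _))// lerDr.
Qed.

(** Coordinates are changed one at a time; each change costs a quadratic remainder plus the
    Lipschitz variation of the partial derivative between [x] and the current point. *)
Lemma tayl_full (f : (D -> R) -> R) f' L C : (forall m, tayl m f (f' m) C) ->
  (forall m, lipD L (f' m)) -> 0 <= L -> 0 <= C ->
  forall x y, `|f y - f x - \sum_m (y m - x m) * f' m x| <=
    (C + L) * (\sum_m `|y m - x m|) ^+ 2.
Proof.
move=> ff' f'L L0 C0 x y.
pose z (s : seq D) : D -> R := fun j => if j \in s then y j else x j.
have key s : uniq s ->
    `|f (z s) - f x - \sum_(m <- s) (y m - x m) * f' m x| <=
    (C + L) * (\sum_(m <- s) `|y m - x m|) * (\sum_m `|y m - x m|).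
  set S := \sum_m _.
  have S0 : 0 <= S by apply: sumr_ge0.
  elim: s => [|k s ih] /=.
    rewrite !big_nil mulr0 mul0r subr0 (_ : z _ = x) ?subrr ?normr0//.
  move=> /andP[ks us]; have {}ih := ih us; rewrite !big_cons.
  have -> : z (k :: s) = upd (z s) k (y k - x k).
    apply/funext => j; rewrite /z /upd inE; have [->|jk] := eqVneq j k.
      by rewrite /= (negbTE ks) mul1r addrC subrK.
    by rewrite /= mul0r addr0.
  set a := y k - x k.
  have t1 := ff' k (z s) a.
  have t2 : `|f' k (z s) - f' k x| <= L * S.
    apply: (le_trans (f'L _ _ _)); rewrite ler_wpM2l//; apply: ler_sum => j _.
    by rewrite /z; case: ifP => // _; rewrite subrr normr0.
  have aS : `|a| <= S by rewrite /S (bigD1 k)//= lerDl sumr_ge0.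
  have -> : f (upd (z s) k a) - f x - (a * f' k x + \sum_(m <- s) (y m - x m) * f' m x)
    = (f (upd (z s) k a) - f (z s) - a * f' k (z s)) + a * (f' k (z s) - f' k x)
      + (f (z s) - f x - \sum_(m <- s) (y m - x m) * f' m x) by ring.
  rewrite (le_trans (ler_normD _ _))// [leRHS](_ : _ =
    (C + L) * `|a| * S + (C + L) * (\sum_(m <- s) `|y m - x m|) * S); last by ring.
  rewrite lerD// (le_trans (ler_normD _ _))// normrM.
  have e1 : C * a ^+ 2 <= C * `|a| * S.
    by rewrite -[a ^+ 2]real_normK ?num_real// expr2 mulrA ler_wpM2l// mulr_ge0.
  have e2 : `|a| * `|f' k (z s) - f' k x| <= `|a| * (L * S) by rewrite ler_wpM2l.
  rewrite (_ : (C + L) * _ * _ = C * `|a| * S + `|a| * (L * S)); last by ring.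
  by rewrite lerD// (le_trans t1).
have := key (index_enum D) (index_enum_uniq _).
rewrite (_ : z _ = y); last by apply/funext => j; rewrite /z mem_index_enum.
by rewrite -mulrA -expr2.
Qed.

(** Rounding the arguments to a grid of mesh [1/(n+1)] gives functions with countably many values,
    each taken on a measurable set; they converge to [f] by the Lipschitz bound. *)
Lemma lipD_mfun L f : lipD L f -> mfun f.
Proof.
move=> fL d T X mX.
pose q n (j : D) (w : T) : int := Num.floor (n.+1%:R * X j w).
pose Xn n (w : T) : D -> R := fun j => (q n j w)%:~R / n.+1%:R.
apply: (@measurable_fun_cvg _ _ R _ (fun n w => f (Xn n w))) => [n|w _]; last first.
  apply/cvgrPdist_le => e e0.
  have L1 : 0 < `|L| * #|D|%:R + 1 by rewrite ltr_wpDl// mulr_ge0.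
  near=> n.
  have n0 : 0 < n.+1%:R :> R by [].
  apply: (le_trans (fL _ _)).
  have : \sum_j `|X j w - Xn n w j| <= \sum_(j : D) n.+1%:R^-1.
    apply: ler_sum => j _; rewrite /Xn /q.
    have /andP[h1 h2] := floor_itv (n.+1%:R * X j w).
    have -> : X j w - (Num.floor (n.+1%:R * X j w))%:~R / n.+1%:R =
       (n.+1%:R * X j w - (Num.floor (n.+1%:R * X j w))%:~R) / n.+1%:R.
      by field; rewrite gt_eqF.
    rewrite normrM normfV (gtr0_norm n0) ler_pdivrMr// mulVf ?gt_eqF//.
    move: h2; rewrite intrD => h2.
    by rewrite ger0_norm ?subr_ge0// lerBlDl ltW.
  rewrite sumr_const -[_ *+ _]mulr_natl => h.
  apply: (@le_trans _ _ (`|L| * (#|D|%:R * n.+1%:R^-1))).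
    apply: (le_trans (ler_wpM2r _ (ler_norm L))); first exact: sumr_ge0.
    by rewrite ler_wpM2l.
  apply: (@le_trans _ _ ((`|L| * #|D|%:R + 1) * n.+1%:R^-1)).
    by rewrite mulrA ler_wpM2r// lerDl.
  rewrite -ler_pdivlMl//; apply/ltW; near: n.
  have h0 : 0 < (`|L| * #|D|%:R + 1)^-1 * e by rewrite mulr_gt0// invr_gt0.
  exact: (near_infty_natSinv_lt (PosNum h0)).
move=> _ B mB; rewrite setTI.
have -> : (fun w => f (Xn n w)) @^-1` B =
    \bigcup_(u : {ffun D -> int}) [set w | (forall j, q n j w = u j) /\
       B (f (fun j => (u j)%:~R / n.+1%:R))].
  apply/seteqP; split => w /=.
    move=> Bw; exists [ffun j => q n j w] => //=; split=> [j|]; rewrite ?ffunE//.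
    by under eq_fun do rewrite ffunE.
  move=> [u _ /= [qu]]; rewrite (_ : (fun j => _) = Xn n w)//.
  by apply/funext => j; rewrite /Xn qu.
apply: countable_bigcupT_measurable => // u.
have [Bu|nBu] := pselect (B (f (fun j => (u j)%:~R / n.+1%:R))); last first.
  by rewrite (_ : [set w | _] = set0)//; apply/seteqP; split => // w [].
rewrite (_ : [set w | _] = \big[setI/setT]_j [set w | q n j w = u j]); last first.
  rewrite -bigcap_seq; apply/seteqP; split => w /=.
    by move=> [h _] j _; exact: h.
  by move=> h; split=> // j; apply: (h j); rewrite /= mem_index_enum.
apply: bigsetI_measurable => j _.
rewrite (_ : [set w | _] = (fun w => n.+1%:R * X j w) @^-1`
   `[(u j)%:~R, (u j + 1)%:~R[); last first.
  apply/seteqP; split => w /=; rewrite in_itv/= /q.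
    by move=> <-; exact: floor_itv.
  by move=> h; apply/eqP; rewrite floor_eq.
rewrite -[X in measurable X]setTI.
by apply: (measurable_funM (measurable_cst _) (mX j)).
Unshelve. all: by end_near. Qed.

End mollification.

Section composition.
Context (R : realType) (I D : finType).

Lemma expgrowth_comp (f : (D -> R) -> R) L (U : D -> (I -> R) -> R) :
  lipD L f -> (forall l, expgrowth (U l)) -> expgrowth (fun x => f (U^~ x)).
Proof.
move=> fL eU; have L0 : 0 <= `|L| by [].
have : expgrowth (fun x : I -> R => `|f (fun=> 0)| + `|L| * \sum_(l : D) `|U l x|).
  apply: expgrowthD; first exact: (@expgrowth_bounded _ _ (fun=> _) _ (fun=> lexx _)).
  apply: expgrowthM; first exact: (@expgrowth_bounded _ _ (fun=> _) _ (fun=> lexx _)).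
  apply: expgrowth_sum => l; have [C [N [C0 N0 UC]]] := eU l.
  by exists C, N; split => // x; rewrite normr_id.
move=> [C [N [C0 N0 UC]]]; exists C, N; split => // x; apply: le_trans (UC x).
rewrite [leRHS]ger0_norm; last by rewrite addr_ge0// mulr_ge0// sumr_ge0.
rewrite -[f _ in leLHS](subrK (f (fun=> 0))) addrC.
rewrite (le_trans (ler_normD _ _))// lerD2l.
apply: (le_trans (fL _ _)); under eq_bigr do rewrite subr0.
by rewrite ler_wpM2r ?sumr_ge0// ler_norm.
Qed.

Lemma mfun_comp (f : (D -> R) -> R) (U : D -> (I -> R) -> R) :
  mfun f -> (forall l, mfun (U l)) -> mfun (fun x => f (U^~ x)).
Proof. by move=> mf mU d T X mX; apply: (mf) => l; exact: mU. Qed.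

Lemma smooth_bounded_line (u : (I -> R) -> R) du x v z : smooth u du ->
  exists K, 0 <= K /\ forall r, `|r| <= 1 ->
  `|u (fun k => x k + (z + r) * v k) - u (fun k => x k + z * v k)| <= K * `|r|.
Proof.
move=> su.
have := expgrowth_line x v (g := fun y => \sum_k v k * du k y).
case.
  apply: expgrowth_sum => k; apply: expgrowthM; last exact: (smooth_dgrowth su).
  exact: (@expgrowth_bounded _ _ _ `|v k|).
move=> C [N CN].
exists (`|C| * expR (`|N| * (`|z| + 1))); split; first by rewrite mulr_ge0 ?expR_ge0.
move=> r r1.
have [c cz ->] := derive_MVT z (z + r) (fun z => smooth_derive su x v z).
rewrite addrAC subrr add0r normrM ler_wpM2r//.
apply: (le_trans (CN c)).
rewrite (le_trans (ler_wpM2r (expR_ge0 _) (ler_norm C)))// ler_wpM2l// ler_expR.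
rewrite (le_trans (ler_wpM2r (normr_ge0 c) (ler_norm N)))// ler_wpM2l//.
rewrite -[c](subrK z) (le_trans (ler_normD _ _))// addrC lerD2l (le_trans cz)//.
by rewrite addrAC subrr add0r.
Qed.

(** Chain rule: replacing [f] by its linearization at the point of differentiation leaves a
    remainder quadratic in the step, because the inner functions are locally Lipschitz along the
    line. *)
Lemma smooth_comp (f : (D -> R) -> R) f' L C (U : D -> (I -> R) -> R) dU :
  0 <= L -> 0 <= C ->
  lipD L f -> (forall l, lipD L (f' l)) -> (forall l, tayl l f (f' l) C) ->
  (forall l, smooth (U l) (dU l)) ->
  smooth (fun x => f (U^~ x)) (fun k x => \sum_l f' l (U^~ x) * dU l k x).
Proof.
move=> L0 C0 fL f'L ff' sU.
have mU l : mfun (U l) by exact: (smooth_mfun (sU l)).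
have eU l : expgrowth (U l) by exact: (smooth_growth (sU l)).
split.
- by apply: mfun_comp => //; exact: lipD_mfun fL.
- move=> k d T X mX; apply: measurable_sum => l; apply: measurable_funM.
    exact: (mfun_comp (lipD_mfun (f'L l)) mU mX).
  exact: (smooth_dmfun (sU l)).
- exact: expgrowth_comp fL eU.
- move=> k; apply: expgrowth_sum => l; apply: expgrowthM.
    exact: expgrowth_comp (f'L l) eU.
  exact: (smooth_dgrowth (sU l)).
- move=> x v z.
  pose Uz l (z : R) := U l (fun k => x k + z * v k).
  pose dUz l (z : R) := \sum_k v k * dU l k (fun k => x k + z * v k).
  have dz l : is_derive z 1 (Uz l) (dUz l z) by exact: (smooth_derive (sU l)).
  pose y0 l := Uz l z.
  pose q (s : R) := f (Uz^~ s) - \sum_l (Uz l s - y0 l) * f' l y0.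
  have /choice[K KP] : forall l, exists K, 0 <= K /\ forall r, `|r| <= 1 ->
      `|Uz l (z + r) - Uz l z| <= K * `|r|.
    by move=> l; exact: (smooth_bounded_line x v z (sU l)).
  have K0 l : 0 <= K l by have [] := KP l.
  have dq : is_derive z 1 q 0.
    apply: (@quad_is_derive _ _ _ _ ((C + L) * (\sum_l K l) ^+ 2)) => r r1.
    rewrite mulr0 subr0 /q.
    rewrite [X in _ - (_ - X)]big1 => [|l _]; last by rewrite /y0 subrr mul0r.
    rewrite subr0 addrAC; apply: (le_trans (tayl_full ff' f'L L0 C0 y0 _)).
    rewrite -mulrA ler_wpM2l ?addr_ge0//.
    rewrite -[r ^+ 2]real_normK ?num_real// -exprMn.
    rewrite ler_pXn2r// ?nnegrE ?mulr_ge0 ?sumr_ge0//.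
    rewrite mulr_suml; apply: ler_sum => l _.
    by have [_] := KP l; apply.
  rewrite (_ : (fun _ => _) = fun s => q s + \sum_l (Uz l s - y0 l) * f' l y0); last first.
    by apply/funext => s; rewrite /q subrK.
  have ds : is_derive z 1 (fun s => \sum_l (Uz l s - y0 l) * f' l y0)
      (\sum_l dUz l z * f' l y0).
    elim: (index_enum D) => [|l t ih].
      rewrite big_nil (_ : (fun _ => _) = fun=> 0); first exact: is_derive_cst.
      by apply/funext => s; rewrite big_nil.
    rewrite big_cons (_ : (fun _ => _) = fun s => (Uz l s - y0 l) * f' l y0 +
      \sum_(l <- t) (Uz l s - y0 l) * f' l y0); last first.
      by apply/funext => s; rewrite big_cons.
    by apply: is_derive_eq; rewrite /GRing.scale/=; ring.
  apply: is_derive_eq; rewrite add0r /dUz.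
  under eq_bigr do rewrite mulr_suml.
  rewrite exchange_big; apply: eq_bigr => k _ /=; rewrite mulr_sumr.
  by apply: eq_bigr => l _; rewrite mulrAC mulrA.
- move=> k x v z; apply: cvgr_sum => l _; apply: cvgM; last first.
    exact: (smooth_continuous (sU l)).
  apply/cvgrPdist_le => e e0.
  have cU l' : continuous (fun z : R => U l' (fun k => x k + z * v k)).
    exact: (is_derive_continuous (fun z => smooth_derive (sU l') x v z)).
  pose S (s : R) := \sum_l' `|U l' (fun k => x k + z * v k) - U l' (fun k => x k + s * v k)|.
  have S0 : S s @[s --> z] --> \sum_(l' : D) (0 : R).
    apply: cvgr_sum => l' _.
    pose u s := U l' (fun k => x k + s * v k).
    have : `|u z - u s| @[s --> z] --> `|u z - u z|.
      by apply: cvg_norm; apply: cvgB; [exact: cvg_cst|exact: cU].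
    by rewrite subrr normr0.
  rewrite big1// in S0.
  have LS : L * S s @[s --> z] --> L * 0 by apply: cvgM => //; exact: cvg_cst.
  rewrite mulr0 in LS.
  near=> s; apply: (le_trans (f'L l _ _)).
  rewrite -/(S s) (le_trans (ler_norm _))//; near: s.
  by move/cvgr0Pnorm_le : LS; apply.
Unshelve. all: by end_near. Qed.

End composition.

Section nice_functions.
Context (R : realType) (V : finType).
Implicit Types f g : (V -> R) -> R.

Definition nice f := mfun f /\ expgrowth f.

Lemma nice_cst c : nice (fun=> c).
Proof.
split; first by move=> d T X mX; exact: measurable_cst.
exact: (@expgrowth_bounded _ _ (fun=> _) _ (fun=> lexx _)).
Qed.

Lemma niceD f g : nice f -> nice g -> nice (fun x => f x + g x).
Proof.
move=> [mf ef] [mg eg]; split; last exact: expgrowthD.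
by move=> d T X mX; apply: measurable_funD; [exact: mf|exact: mg].
Qed.

Lemma niceM f g : nice f -> nice g -> nice (fun x => f x * g x).
Proof.
move=> [mf ef] [mg eg]; split; last exact: expgrowthM.
by move=> d T X mX; apply: measurable_funM; [exact: mf|exact: mg].
Qed.

Lemma niceN f : nice f -> nice (fun x => - f x).
Proof.
move=> nf; rewrite (_ : (fun _ => _) = fun x => -1 * f x).
  by apply: niceM => //; exact: nice_cst.
by apply/funext => x; rewrite mulN1r.
Qed.

Lemma niceB f g : nice f -> nice g -> nice (fun x => f x - g x).
Proof. by move=> nf ng; apply: niceD => //; exact: niceN. Qed.

Lemma nice_norm f : nice f -> nice (fun x => `|f x|).
Proof.
move=> [mf [C [N [C0 N0 fC]]]]; split.
  by move=> d T X mX; apply: measurableT_comp => //; exact: mf.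
by exists C, N; split => // x; rewrite normr_id.
Qed.

Lemma nice_sum J (s : seq J) (Q : pred J) (f : J -> (V -> R) -> R) :
  (forall j, nice (f j)) -> nice (fun x => \sum_(j <- s | Q j) f j x).
Proof.
move=> nf; elim: s => [|j s ih].
  rewrite (_ : (fun _ => _) = fun=> 0); first exact: nice_cst.
  by apply/funext => x; rewrite big_nil.
rewrite (_ : (fun _ => _) = fun x => (if Q j then f j x else 0) +
  \sum_(j <- s | Q j) f j x).
  by apply: niceD => //; case: (Q j) => //; exact: nice_cst.
by apply/funext => x; rewrite big_cons; case: (Q j); rewrite ?add0r.
Qed.

Lemma nice_horner (p : {poly R}) (i : V) : nice (fun x => p.[x i]).
Proof.
split; last exact: expgrowth_horner.
by move=> d T X mX; exact: (measurableT_comp (measurable_horner p)).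
Qed.

Lemma nice_coord (i : V) : nice (fun x => x i).
Proof. by split; [move=> d T X; exact|exact: expgrowth_coord]. Qed.

Lemma smooth_nice g dg : smooth g dg -> nice g.
Proof. by move=> sg; split; [exact: (smooth_mfun sg)|exact: (smooth_growth sg)]. Qed.

Lemma smooth_dnice g dg k : smooth g dg -> nice (dg k).
Proof. by move=> sg; split; [exact: (smooth_dmfun sg)|exact: (smooth_dgrowth sg)]. Qed.

Lemma nice_integ d (T : measurableType d) (P : probability T R)
    (X : V -> T -> R) G f :
  gfam P X G -> nice f -> integ P (fun w => f (fun i => X i w)).
Proof. by move=> gX [mf ef]; exact: (gfam_integ gX mf ef). Qed.

Lemma smooth_coord (i : V) :
  smooth (fun x : V -> R => x i) (fun k x => (k == i)%:R).
Proof.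
apply: (smooth_eq (smooth_horner 'X i)) => [x|k x]; first by rewrite hornerX.
by rewrite derivX hornerC mulr1.
Qed.

Lemma smoothZ c g dg : smooth g dg ->
  smooth (fun x => c * g x) (fun k (x : V -> R) => c * dg k x).
Proof.
move=> sg; apply: (smooth_eq (smooth_mul (smooth_cst V c) sg)) => //.
by move=> k x; rewrite mul0r add0r.
Qed.

Lemma sum_delta (i : V) (f : V -> R) : \sum_k (k == i)%:R * f k = f i.
Proof.
rewrite (bigD1 i)//= eqxx mul1r big1 ?addr0// => k /negbTE ->.
by rewrite mul0r.
Qed.

End nice_functions.

(** * The path from the chaos vector to the normal vector *)

Section interpolation.
Context (R : realType) (I D J : finType).
Variables (i : D -> J -> I) (w : D -> J -> R) (l : J -> nat).
Hypothesis l0 : forall t, (0 < l t)%N.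

Definition chaos (m : D) (x : I -> R) : R :=
  \sum_t w m t * (He R (l t)).[x (i m t)].

(* The Malliavin inner product of [D (chaos m)] with [- D L^-1 (chaos q)]. *)
Definition gram (G : I -> I -> R) (m q : D) (x : I -> R) : R :=
  \sum_t \sum_u w m t * w q u * G (i m t) (i q u) * (l u)%:R *
    ((He R (l t).-1).[x (i m t)] * (He R (l u).-1).[x (i q u)]).

Let dchaos (m : D) (k : I) (x : I -> R) : R :=
  \sum_t w m t * ((k == i m t)%:R * ((l t)%:R * (He R (l t).-1).[x (i m t)])).

(** Coefficients of [- D L^-1] of [chaos m], contracted with the covariance: dividing by the order
    cancels the factor [l t] that differentiation produces, so [He (l t).-1] stands alone. *)
Let a G (m : D) (k : I) (x : I -> R) : R :=
  \sum_t w m t * G (i m t) k * (He R (l t).-1).[x (i m t)].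

Lemma smooth_chaos m : smooth (chaos m) (dchaos m).
Proof.
apply: smooth_sum => t; apply: smoothZ.
apply: (smooth_eq (smooth_horner (He R (l t)) (i m t))) => // k x.
by rewrite He_deriv hornerZ.
Qed.

Let nice_a G m k : nice (a G m k).
Proof. by apply: nice_sum => t; apply: niceM; [exact: nice_cst|exact: nice_horner]. Qed.

Let sum_a_dchaos G m q x : \sum_k a G m k x * dchaos q k x = gram G m q x.
Proof.
rewrite /a /gram; under eq_bigr do rewrite mulr_suml.
rewrite exchange_big; apply: eq_bigr => t _ /=.
rewrite /dchaos; under eq_bigr do rewrite mulr_sumr.
rewrite exchange_big; apply: eq_bigr => u _ /=.
rewrite -[RHS](sum_delta (i q u) (fun k => w m t * w q u * G (i m t) k *
   (l u)%:R * ((He R (l t).-1).[x (i m t)] * (He R (l u).-1).[x (i q u)]))).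
by apply: eq_bigr => k _; ring.
Qed.

Section ibp.
Context d (T : measurableType d) (P : probability T R).

(** The map [e] places the family of the chaoses inside a larger one, so that [g] may also depend on
    the independent normal vector. *)
Let chaos_ibp (V : finType) (e : I -> V) (Z : V -> T -> R) (H : V -> V -> R) m g dg :
  gfam P Z H -> (forall k, H (e k) (e k) = 1) -> smooth g dg ->
  \int[P]_y (chaos m (fun k => Z (e k) y) * g (fun v => Z v y)) =
  \sum_v \int[P]_y ((\sum_t w m t * H (e (i m t)) v *
     (He R (l t).-1).[Z (e (i m t)) y]) * dg v (fun v => Z v y)).
Proof.
move=> gZ H1 sg.
have E t : \int[P]_y ((He R (l t)).[Z (e (i m t)) y] * g (fun v => Z v y)) =
  \sum_v H (e (i m t)) v * \int[P]_y ((He R (l t).-1).[Z (e (i m t)) y] * dg v (fun v => Z v y)).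
  have -> : He R (l t) = He R ((l t).-1).+1 by rewrite prednK.
  exact: (hermite_ibp _ gZ).
have i1 t : integ P (fun y => (He R (l t)).[Z (e (i m t)) y] * g (fun v => Z v y)).
  apply: (nice_integ gZ (f := fun x => (He R (l t)).[x (e (i m t))] * g x)).
  by apply: niceM; [exact: nice_horner|exact: (smooth_nice sg)].
have i2 t v : integ P (fun y => (He R (l t).-1).[Z (e (i m t)) y] * dg v (fun v => Z v y)).
  apply: (nice_integ gZ (f := fun x => (He R (l t).-1).[x (e (i m t))] * dg v x)).
  by apply: niceM; [exact: nice_horner|exact: (smooth_dnice _ sg)].
rewrite (eq_rint _ (g := fun y => \sum_t w m t *
   ((He R (l t)).[Z (e (i m t)) y] * g (fun v => Z v y)))); last first.
  by move=> y; rewrite /chaos mulr_suml; apply: eq_bigr => t _; rewrite mulrA.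
rewrite rint_sum => [|t _]; last exact: integZ.
under eq_bigr do rewrite rintZ// E mulr_sumr.
rewrite exchange_big; apply: eq_bigr => v _ /=.
rewrite [RHS](eq_rint _ (g := fun y => \sum_t w m t * H (e (i m t)) v *
   ((He R (l t).-1).[Z (e (i m t)) y] * dg v (fun v => Z v y)))); last first.
  by move=> y; rewrite mulr_suml; apply: eq_bigr => t _; rewrite mulrA.
rewrite rint_sum => [|t _]; last exact: integZ.
by apply: eq_bigr => t _; rewrite rintZ// mulrA.
Qed.

(** Integration by parts of [chaos m] against [chaos q]: the Malliavin inner product is the
    covariance on average, so only its fluctuation costs. *)
Lemma mean_gram (X : I -> T -> R) G m q : gfam P X G -> (forall k, G k k = 1) ->
  \int[P]_y gram G m q (fun k => X k y) =
  \int[P]_y (chaos m (fun k => X k y) * chaos q (fun k => X k y)).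
Proof.
move=> gX G1; rewrite (chaos_ibp (e := id) m gX G1 (smooth_chaos q)).
rewrite -rint_sum; last first.
  move=> k _; apply: (nice_integ gX (f := fun x => a G m k x * dchaos q k x)).
  by apply: niceM => //; exact: (smooth_dnice _ (smooth_chaos q)).
by apply: eq_rint => y; rewrite -sum_a_dchaos.
Qed.

Lemma mean_chaos (X : I -> T -> R) G m : gfam P X G -> (forall k, G k k = 1) ->
  \int[P]_y chaos m (fun k => X k y) = 0.
Proof.
move=> gX G1; have := chaos_ibp (e := id) m gX G1 (smooth_cst I 1).
under [LHS]eq_rint do rewrite mulr1.
move=> ->; apply: big1 => k _; under eq_rint do rewrite mulr0.
exact: rint_cst.
Qed.

Variables (G : I -> I -> R) (C : D -> D -> R).
(** Vanishing cross covariances make the chaos variables and the normal vector independent. *)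
Let H (u v : I + D) : R := match u, v with
  | inl k, inl k' => G k k' | inr m, inr q => C m q | _, _ => 0 end.
Variable Z : (I + D)%type -> T -> R.
Hypotheses (gZ : gfam P Z H) (G1 : forall k, G k k = 1).
Variables (g : (D -> R) -> R) (g1 : D -> (D -> R) -> R) (g2 : D -> D -> (D -> R) -> R).
Variable L : R.
Hypotheses (gL : lipD L g) (g1L : forall m, lipD L (g1 m))
  (g2L : forall m k, lipD L (g2 m k)) (g1P : forall m, tayl m g (g1 m) L)
  (g2P : forall m k, tayl k (g1 m) (g2 m k) L)
  (g2_le1 : forall m k x, `|g2 m k x| <= 1).

Let L0 : D -> 0 <= L.
Proof.
move=> m; have := g1P m (fun=> 0) 1; rewrite expr1n mulr1.
exact: le_trans.
Qed.

Let F m (x : I + D -> R) : R := chaos m (x \o inl).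
Let dF m (v : I + D) (x : I + D -> R) : R := if v is inl k then dchaos m k (x \o inl) else 0.

Let smooth_F m : smooth (F m) (dF m).
Proof.
apply: (smooth_eq (g := F m) (dg := fun v x =>
  \sum_t w m t * ((v == inl (i m t))%:R * ((l t)%:R * (He R (l t).-1).[x (inl (i m t))])))) => //.
  apply: smooth_sum => t; apply: smoothZ.
  apply: (smooth_eq (smooth_horner (He R (l t)) (inl (i m t)))) => // k x.
  by rewrite He_deriv hornerZ.
move=> [k|q] x //=; rewrite big1// => t _; rewrite /= mul0r mulr0//.
Qed.

Let U (theta : R) m (x : I + D -> R) : R := sin theta * F m x + cos theta * x (inr m).
Let dU theta m v (x : I + D -> R) : R := sin theta * dF m v x + cos theta * (v == inr m)%:R.
Let smooth_U theta m : smooth (U theta m) (dU theta m).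
Proof. by apply: smoothD; apply: smoothZ => //; exact: smooth_coord. Qed.

Let psi theta := \int[P]_y g ((U theta)^~ (Z^~ y)).
Let dpsi theta := \int[P]_y
  (\sum_m (cos theta * F m (Z^~ y) - sin theta * Z (inr m) y) * g1 m ((U theta)^~ (Z^~ y))).

Let nice_U (f : (D -> R) -> R) theta : lipD L f -> nice (fun x => f ((U theta)^~ x)).
Proof.
move=> fL; split.
  apply: mfun_comp; first exact: (lipD_mfun fL).
  by move=> m; exact: (smooth_mfun (smooth_U theta m)).
apply: (expgrowth_comp fL) => m; exact: (smooth_growth (smooth_U theta m)).
Qed.

Let nice_F m : nice (F m). Proof. exact: (smooth_nice (smooth_F m)). Qed.

(** Differentiation under the mean: the second-order remainder in [theta] is bounded by [r^2 B],
    with [B] of exponential growth and hence integrable. *)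
Let dpsiP (theta : R) : 0 <= L -> is_derive theta 1 psi (dpsi theta).
Proof.
move=> L0'.
pose S (x : I + D -> R) : R := \sum_m (`|F m x| + `|x (inr m)|).
have nS : nice S.
  by apply: nice_sum => m; apply: niceD; apply: nice_norm => //; exact: nice_coord.
pose B (x : I + D -> R) := (L + L) * (S x * S x) + S x * \sum_m `|g1 m ((U theta)^~ x)|.
have nB : nice B.
  apply: niceD; first by apply: niceM; [exact: nice_cst|exact: niceM].
  apply: niceM => //; apply: nice_sum => m; apply: nice_norm; exact: nice_U.
pose V m (x : I + D -> R) := cos theta * F m x - sin theta * x (inr m).
have nV : nice (fun x => \sum_m V m x * g1 m ((U theta)^~ x)).
  apply: nice_sum => m; apply: niceM; last exact: nice_U.
  by apply: niceB; apply: niceM => //; [exact: nice_cst|exact: nice_cst|exact: nice_coord].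
apply: (@quad_is_derive _ _ _ _ (\int[P]_y B (Z^~ y))) => r r1.
have i1 := nice_integ gZ (nice_U (theta + r) gL).
have i2 := nice_integ gZ (nice_U theta gL).
have i3 := nice_integ gZ nV.
rewrite /psi /dpsi -rintB// -rintZ// -rintB//; [|exact: integB|exact: integZ].
rewrite mulrC -rintZ; last exact: (nice_integ gZ nB).
apply: le_abs_rint.
- exact: (integ_measurable (integB (integB i1 i2) (integZ r i3))).
- by apply: integZ; exact: (nice_integ gZ nB).
move=> y; set x := Z^~ y.
set Ur := (U (theta + r))^~ x; set U0 := (U theta)^~ x.
have dUr m : `|Ur m - U0 m - r * V m x| <= r ^+ 2 * (`|F m x| + `|x (inr m)|).
  rewrite /Ur /U0 /U /V [X in `|X|](_ : _ =
    (sin (theta + r) - sin theta - r * cos theta) * F m x +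
    (cos (theta + r) - cos theta + r * sin theta) * x (inr m)); last by ring.
  rewrite (le_trans (ler_normD _ _))// !normrM mulrDr lerD// ler_wpM2r//.
    exact: sin_quad.
  exact: cos_quad.
have dU1 m : `|Ur m - U0 m| <= `|r| * (`|F m x| + `|x (inr m)|).
  rewrite /Ur /U0 /U [X in `|X|](_ : _ =
    (sin (theta + r) - sin theta) * F m x +
    (cos (theta + r) - cos theta) * x (inr m)); last by ring.
  rewrite (le_trans (ler_normD _ _))// !normrM mulrDr lerD// ler_wpM2r//.
    by rewrite (le_trans (sin_lip _ _))// addrAC subrr add0r.
  by rewrite (le_trans (cos_lip _ _))// addrAC subrr add0r.
have h1 := tayl_full g1P g1L L0' L0' U0 Ur.
have h2 : (\sum_m `|Ur m - U0 m|) ^+ 2 <= r ^+ 2 * (S x * S x).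
  rewrite -[r ^+ 2]real_normK ?num_real// -[S x * S x]/(S x ^+ 2) -exprMn.
  rewrite ler_pXn2r ?nnegrE ?sumr_ge0//.
    by rewrite /S mulr_sumr; apply: ler_sum => m _; exact: dU1.
  by rewrite mulr_ge0// sumr_ge0// => m _; exact: addr_ge0.
have h3 : `|\sum_m (Ur m - U0 m - r * V m x) * g1 m U0| <=
    r ^+ 2 * (S x * \sum_m `|g1 m U0|).
  rewrite (le_trans (ler_norm_sum _ _ _))//.
  have -> : r ^+ 2 * (S x * \sum_m `|g1 m U0|) =
     \sum_m (r ^+ 2 * S x) * `|g1 m U0| by rewrite mulrA mulr_sumr.
  apply: ler_sum => m _; rewrite normrM ler_wpM2r//.
  rewrite (le_trans (dUr m))// ler_wpM2l ?sqr_ge0//.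
  rewrite /S (bigD1 m)//= lerDl sumr_ge0// => q _; exact: addr_ge0.
rewrite [X in `|X|](_ : _ = (g Ur - g U0 - \sum_m (Ur m - U0 m) * g1 m U0) +
   \sum_m (Ur m - U0 m - r * V m x) * g1 m U0); last first.
  have -> : \sum_m (Ur m - U0 m - r * V m x) * g1 m U0 =
    \sum_m (Ur m - U0 m) * g1 m U0 - r * \sum_m V m x * g1 m U0.
    by rewrite mulr_sumr -sumrB; apply: eq_bigr => m _; ring.
  by ring.
rewrite (le_trans (ler_normD _ _))// [r ^+ 2 * B x]mulrDr lerD// (le_trans h1)//.
rewrite [leRHS](_ : _ = (L + L) * (r ^+ 2 * (S x * S x))); last by ring.
by rewrite ler_wpM2l// addr_ge0.
Qed.

Let T_ m q (x : I + D -> R) : R := gram G m q (x \o inl).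

Let nice_T m q : nice (T_ m q).
Proof.
apply: nice_sum => t; apply: nice_sum => u.
by apply: niceM; [exact: nice_cst|apply: niceM; exact: nice_horner].
Qed.

Let smooth_g1 theta m : smooth (fun x => g1 m ((U theta)^~ x))
  (fun v x => \sum_q g2 m q ((U theta)^~ x) * dU theta q v x).
Proof.
have L0' := L0 m.
exact: (smooth_comp (C := L) L0' L0' (g1L m) (g2L m) (g2P m)).
Qed.

Let ibpF theta m : \int[P]_y (F m (Z^~ y) * g1 m ((U theta)^~ (Z^~ y))) =
  \int[P]_y (\sum_q sin theta * (g2 m q ((U theta)^~ (Z^~ y)) * T_ m q (Z^~ y))).
Proof.
have := chaos_ibp (e := inl) m gZ G1 (smooth_g1 theta m); rewrite /F => ->.
rewrite -rint_sum; last first.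
  move=> v _; apply: (nice_integ gZ (f := fun x => (\sum_t w m t * H (inl (i m t)) v *
     (He R (l t).-1).[x (inl (i m t))]) *
     \sum_q g2 m q ((U theta)^~ x) * dU theta q v x)).
  apply: niceM.
    by apply: nice_sum => t; apply: niceM; [exact: nice_cst|exact: nice_horner].
  by apply: nice_sum => q; apply: niceM; [exact: nice_U|exact: (smooth_dnice _ (smooth_U _ _))].
apply: eq_rint => y; set x := Z^~ y.
rewrite big_sumType/= [X in _ + X]big1 ?addr0; last first.
  move=> q _; rewrite [X in X * _]big1 ?mul0r// => t _.
  by rewrite mulr0 mul0r.
transitivity (\sum_k \sum_q sin theta * (g2 m q ((U theta)^~ x) *
    (a G m k (x \o inl) * dchaos q k (x \o inl)))).
  apply: eq_bigr => k _; rewrite mulr_sumr; apply: eq_bigr => q _.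
  by rewrite /dU /= mulr0 addr0 /a; ring.
rewrite exchange_big; apply: eq_bigr => q _ /=.
by rewrite -!mulr_sumr /T_ sum_a_dchaos.
Qed.

Let ibpN theta m : \int[P]_y (Z (inr m) y * g1 m ((U theta)^~ (Z^~ y))) =
  \int[P]_y (\sum_q cos theta * (g2 m q ((U theta)^~ (Z^~ y)) * C m q)).
Proof.
have nd v : nice (fun x => \sum_q g2 m q ((U theta)^~ x) * dU theta q v x).
  by apply: nice_sum => q; apply: niceM; [exact: nice_U|exact: (smooth_dnice _ (smooth_U _ _))].
have := gauss_ibp_family (inr m) gZ (smooth_g1 theta m) => ->.
under eq_bigr => v _ do rewrite -(rintZ _ (nice_integ gZ (nd v))).
rewrite -rint_sum; last by move=> v _; apply: integZ; exact: (nice_integ gZ (nd v)).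
apply: eq_rint => y; set x := Z^~ y.
rewrite big_sumType/= big1 ?add0r; last by move=> k _; rewrite mul0r.
under eq_bigr do rewrite mulr_sumr.
rewrite exchange_big; apply: eq_bigr => q _ /=.
rewrite -[RHS](sum_delta q (fun q' => cos theta * (g2 m q ((U theta)^~ x) * C m q'))).
apply: eq_bigr => q' _; rewrite /dU /= mulr0 add0r.
by rewrite (inj_eq (@inr_inj I D)); ring.
Qed.

(** The part from [F] yields [sin theta cos theta] times the inner product [T_], the part from the
    normal vector the same factor times [C]; only the difference remains. *)
Let dpsiE theta : dpsi theta = \int[P]_y
  (\sum_m \sum_q sin theta * cos theta *
     (g2 m q ((U theta)^~ (Z^~ y)) * (T_ m q (Z^~ y) - C m q))).
Proof.
have nA m : nice (fun x => F m x * g1 m ((U theta)^~ x)).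
  by apply: niceM => //; exact: nice_U.
have nB m : nice (fun x => x (inr m) * g1 m ((U theta)^~ x)).
  by apply: niceM; [exact: nice_coord|exact: nice_U].
have nC m : nice (fun x => \sum_q sin theta * (g2 m q ((U theta)^~ x) * T_ m q x)).
  apply: nice_sum => q; apply: niceM; first exact: nice_cst.
  by apply: niceM => //; exact: nice_U.
have nD m : nice (fun x => \sum_q cos theta * (g2 m q ((U theta)^~ x) * C m q)).
  apply: nice_sum => q; apply: niceM; first exact: nice_cst.
  by apply: niceM; [exact: nice_U|exact: nice_cst].
transitivity (\sum_m (cos theta * \int[P]_y (F m (Z^~ y) * g1 m ((U theta)^~ (Z^~ y))) -
    sin theta * \int[P]_y (Z (inr m) y * g1 m ((U theta)^~ (Z^~ y))))).
  have iA m := nice_integ gZ (nA m); have iB m := nice_integ gZ (nB m).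
  under eq_bigr => m _ do rewrite -(rintZ _ (iA m)) -(rintZ _ (iB m))
    -(rintB (integZ _ (iA m)) (integZ _ (iB m))).
  rewrite -rint_sum => [|m _]; last by apply: integB; exact: integZ.
  by apply: eq_rint => y; apply: eq_bigr => m _; ring.
have iC m := nice_integ gZ (nC m); have iD m := nice_integ gZ (nD m).
under eq_bigr => m _ do rewrite ibpF ibpN -(rintZ _ (iC m)) -(rintZ _ (iD m))
  -(rintB (integZ _ (iC m)) (integZ _ (iD m))).
rewrite -rint_sum => [|m _]; last by apply: integB; exact: integZ.
apply: eq_rint => y; apply: eq_bigr => m _.
by rewrite !mulr_sumr -sumrB; apply: eq_bigr => q _; ring.
Qed.

(** The derivative along the path is bounded uniformly in [theta], since the trigonometric factor
    and [g2] are at most 1 in absolute value; [pi / 2] is the length of the parameter interval. *)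
Lemma interpolation_smooth :
  `|\int[P]_y g (fun m => chaos m (fun k => Z (inl k) y)) -
    \int[P]_y g (fun m => Z (inr m) y)| <=
  pi / 2 * \sum_m \sum_q
    \int[P]_y `|gram G m q (fun k => Z (inl k) y) - C m q|.
Proof.
(* The sign of [L] is deduced from a coordinate; without one, both means are those of the same
   constant. *)
have [[m0 _]|nD] := pselect (exists m0 : D, True); last first.
  have D0 (m : D) : False by apply: nD; exists m.
  rewrite [X in _ * X]big1 ?mulr0; last by move=> m; case: (D0 m).
  have E (x y : D -> R) : x = y by apply/funext => m; case: (D0 m).
  rewrite (eq_rint _ (g := fun y => g (fun m => Z (inr m) y))) ?subrr ?normr0//.
  by move=> y; congr g; exact: E.
set V := \sum_m _.
have V0 : 0 <= V.
  by apply: sumr_ge0 => m _; apply: sumr_ge0 => q _; apply: rint_ge0.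
have nTC m q : nice (fun x => `|T_ m q x - C m q|).
  by apply: nice_norm; apply: niceB => //; exact: nice_cst.
have iTC m q := nice_integ gZ (nTC m q).
have iV : integ P (fun y => \sum_m \sum_q `|T_ m q (Z^~ y) - C m q|).
  by apply: integ_sum => m _; apply: integ_sum => q _.
have VE : V = \int[P]_y \sum_m \sum_q `|T_ m q (Z^~ y) - C m q|.
  rewrite rint_sum => [|m _]; last by apply: integ_sum => q _.
  by apply: eq_bigr => m _; rewrite rint_sum.
have := @derive_lip _ psi dpsi V 0 (pi / 2) (fun t => dpsiP t (L0 m0)).
have -> : `|pi / 2 - 0| = pi / 2 :> R by rewrite subr0 ger0_norm// divr_ge0// pi_ge0.
rewrite [V * _]mulrC /psi.
rewrite (eq_rint _ (g := fun y => g (fun m => chaos m (fun k => Z (inl k) y)))); last first.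
  move=> y; congr g; apply/funext => m; rewrite /U sin_pihalf cos_pihalf mul0r addr0 mul1r//.
rewrite [X in _ - X](eq_rint _ (g := fun y => g (fun m => Z (inr m) y))); last first.
  by move=> y; congr g; apply/funext => m; rewrite /U sin0 cos0 mul0r add0r mul1r.
apply=> theta; rewrite dpsiE VE; apply: le_abs_rint => //.
  apply: (integ_measurable (mu := P)); apply: (nice_integ gZ
   (f := fun x => \sum_m \sum_q sin theta * cos theta *
     (g2 m q ((U theta)^~ x) * (T_ m q x - C m q)))).
  apply: nice_sum => m; apply: nice_sum => q; apply: niceM; first exact: nice_cst.
  by apply: niceM; [exact: nice_U|apply: niceB => //; exact: nice_cst].
move=> y; rewrite (le_trans (ler_norm_sum _ _ _))//; apply: ler_sum => m _.
rewrite (le_trans (ler_norm_sum _ _ _))//; apply: ler_sum => q _.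
rewrite !normrM -[leRHS]mul1r ler_pM ?mulr_ge0//.
  by rewrite -[leRHS]mul1r ler_pM ?normr_sin ?normr_cos.
by rewrite ler_piMl.
Qed.

End ibp.
End interpolation.

Section gfam_constructions.
Context (R : realType).

Lemma gfam_sub (I V : finType) (e : I -> V) d (T : measurableType d)
    (P : probability T R) (Z : V -> T -> R) (H : V -> V -> R) :
  gfam P Z H -> gfam P (fun k => Z (e k)) (fun k k' => H (e k) (e k')).
Proof.
move=> [mZ sH cosZ]; split=> // a c.
pose b v : R := \sum_k (v == e k)%:R * a k.
have E (f : V -> R) : \sum_v b v * f v = \sum_k a k * f (e k).
  under eq_bigr do rewrite mulr_suml.
  rewrite exchange_big; apply: eq_bigr => k _ /=.
  rewrite -[RHS](sum_delta (e k) (fun v => a k * f v)).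
  by apply: eq_bigr => v _; rewrite mulrA.
have := cosZ b c; under eq_rint do rewrite E.
move=> ->; congr (expR (- (_ / 2)) * _); rewrite /qform.
transitivity (\sum_v b v * \sum_u b u * H v u).
  by apply: eq_bigr => v _; rewrite mulr_sumr; apply: eq_bigr => u _; rewrite mulrA.
rewrite E; apply: eq_bigr => k _; rewrite E mulr_sumr.
by apply: eq_bigr => k' _; rewrite mulrA.
Qed.

Section product.
Context (I D : finType) d d' (T : measurableType d) (T' : measurableType d').
Variables (P : probability T R) (P' : probability T' R).
Variables (X : I -> T -> R) (G : I -> I -> R) (N : D -> T' -> R) (C : D -> D -> R).

Definition block (u v : I + D) : R := match u, v with
  | inl k, inl k' => G k k' | inr m, inr q => C m q | _, _ => 0 end.

Definition pair_family (v : I + D) (z : T * T') : R :=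
  match v with inl k => X k z.1 | inr m => N m z.2 end.

(** Transforms multiply on a product: integrating out the second factor leaves a constant times the
    transform of the first. *)
Lemma gfam_pair : gfam P X G -> gfam P' N C ->
  gfam (P \x P')%E pair_family block.
Proof.
move=> [mX sG cosX] [mN sC cosN].
have mZ v : measurable_fun setT (pair_family v).
  case: v => k /=; first by apply: measurableT_comp (mX k) _.
  by apply: measurableT_comp (mN k) _.
split => // [[k|m] [k'|q] /=|a c]; [exact: sG|by []|by []|exact: sC|].
pose PP : probability (T * T')%type R := (P \x P')%E.
have mcos (c0 : R) : measurable_fun setT (fun z : T * T' =>
    cos (\sum_v a v * pair_family v z + c0)).
  apply: measurableT_comp; first exact: measurable_cos.
  apply: measurable_funD => //; apply: measurable_sum => v.
  exact: measurable_funM.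
have icos : integ PP (fun z => cos (\sum_v a v * pair_family v z + c)).
  by apply: (@integ_bounded _ _ _ PP _ 1) => // z; exact: normr_cos.
have E x y : \sum_v a v * pair_family v (x, y) + c =
    \sum_m a (inr m) * N m y + (\sum_k a (inl k) * X k x + c).
  by rewrite big_sumType/=; ring.
have i1 x : integ P' (fun y => cos (\sum_v a v * pair_family v (x, y) + c)).
  apply: (@integ_bounded _ _ _ P' _ 1) => [|z]; last exact: normr_cos.
  exact: (measurableT_comp (mcos c) (measurable_pair1 x)).
rewrite -(rfubini1 icos i1).2.
have e1 x : \int[P']_y cos (\sum_v a v * pair_family v (x, y) + c) =
    expR (- (qform C (a \o inr) / 2)) * cos (\sum_k a (inl k) * X k x + c).
  by under eq_rint do rewrite E; rewrite (cosN (a \o inr)).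
rewrite (eq_rint _ e1) rintZ; last first.
  apply: (@integ_bounded _ _ _ P _ 1) => [|z]; last exact: normr_cos.
  apply: measurableT_comp; first exact: measurable_cos.
  apply: measurable_funD => //; apply: measurable_sum => v.
  exact: measurable_funM.
rewrite (cosX (a \o inl)) mulrA -expRD; congr (expR _ * _).
suff -> : qform block a = qform G (a \o inl) + qform C (a \o inr) by field.
rewrite /qform big_sumType/=; congr (_ + _); apply: eq_bigr => k _.
  by rewrite big_sumType/= [X in _ + X]big1 ?addr0// => q _; rewrite mulr0.
by rewrite big_sumType/= [X in X + _]big1 ?add0r// => q _; rewrite mulr0.
Qed.

End product.

Lemma gfam_law (I : finType) d d' (T : measurableType d) (T' : measurableType d')
    (P : probability T R) (P' : probability T' R) (X : I -> T -> R)
    (X' : I -> T' -> R) G (f : (I -> R) -> R) :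
  gfam P X G -> gfam P' X' G -> nice f ->
  \int[P]_w f (fun i => X i w) = \int[P']_w f (fun i => X' i w).
Proof.
move=> gX gX' nf; have [mX _ cX] := gX; have [mX' _ cX'] := gX'.
have cE a c : \int[P]_w cos (\sum_i a i * X i w + c) =
    \int[P']_w cos (\sum_i a i * X' i w + c) by rewrite cX cX'.
exact: (law_transfer mX mX' cE nf.1 (nice_integ gX nf)).2.
Qed.

End gfam_constructions.

(** [h] is replaced by a mollified [g] at uniform distance [e / 2]. The bound obtained for [g] does
    not involve [e], which can then tend to 0. *)
Theorem interpolation (R : realType) (I D J : finType) (i : D -> J -> I)
    (w : D -> J -> R) (l : J -> nat) d d' (T : measurableType d)
    (T' : measurableType d') (P : probability T R) (P' : probability T' R)
    (X : I -> T -> R) G (N : D -> T' -> R) C (h : (D -> R) -> R) h' :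
  (forall t, (0 < l t)%N) ->
  gfam P X G -> (forall k, G k k = 1) -> gfam P' N C ->
  lipD 1 h -> (forall m, lipD 1 (h' m)) -> (forall m, tayl m h (h' m) 1) ->
  `|\int[P]_y h (fun m => chaos i w l m (fun k => X k y)) -
    \int[P']_y h (fun m => N m y)| <=
  pi / 2 * \sum_m \sum_q
    \int[P]_y `|gram i w l G m q (fun k => X k y) - C m q|.
Proof.
move=> l0 gX G1 gN hL h'L hh'; apply/ler_addgt0Pl => e e0.
have e20 : 0 < e / 2 by rewrite divr_gt0.
have [g [g1 [g2 [L [gh [gL g1L g2L] t1 t2 g21]]]]] := mollify e20 hL h'L hh'.
have gZ := gfam_pair gX gN.
pose PP : probability (T * T')%type R := (P \x P')%E.
pose Z := pair_family X N.
have gZ1 : gfam PP (fun k => Z (inl k)) G := gfam_sub inl gZ.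
have gZ2 : gfam PP (fun k => Z (inr k)) C := gfam_sub inr gZ.
have nh : nice h by split; [exact: lipD_mfun hL|exact: lipD_growth hL].
have ng : nice g by split; [exact: lipD_mfun gL|exact: lipD_growth gL].
have sch m : smooth (chaos i w l m) _ := smooth_chaos i w l m.
have nF (f : (D -> R) -> R) K : lipD K f -> nice (fun x => f (fun m => chaos i w l m x)).
  move=> fK; split.
    by apply: mfun_comp; [exact: lipD_mfun fK|move=> m; exact: (smooth_mfun (sch m))].
  by apply: (expgrowth_comp fK) => m; exact: (smooth_growth (sch m)).
have := interpolation_smooth i w l0 gZ G1 gL g1L g2L t1 t2 g21.
rewrite -(gfam_law gX gZ1 (nF _ _ gL)) -(gfam_law gN gZ2 ng).
have -> : \sum_m \sum_q \int[PP]_y `|gram i w l G m q (fun k => Z (inl k) y) - C m q| =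
    \sum_m \sum_q \int[P]_y `|gram i w l G m q (fun k => X k y) - C m q|.
  apply: eq_bigr => m _; apply: eq_bigr => q _; symmetry.
  apply: (gfam_law gX gZ1 (f := fun x => `|gram i w l G m q x - C m q|)).
  apply/nice_norm/niceB; last exact: nice_cst.
  apply: nice_sum => t; apply: nice_sum => u.
  by apply: niceM; [exact: nice_cst|apply: niceM; exact: nice_horner].
set a1 := \int[P]_y _; set b1 := \int[P']_y _ => key.
set a0 := \int[P]_y _; set b0 := \int[P']_y _.
have ha : `|a0 - a1| <= e / 2.
  have j1 := nice_integ gX (nF _ _ hL); have j2 := nice_integ gX (nF _ _ gL).
  rewrite -rintB//; apply: abs_rint_le => [|y]; last by rewrite distrC gh.
  exact: (integ_measurable (integB j1 j2)).
have hb : `|b1 - b0| <= e / 2.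
  have j1 := nice_integ gN nh; have j2 := nice_integ gN ng.
  rewrite -rintB//; apply: abs_rint_le => [|y]; last exact: gh.
  exact: (integ_measurable (integB j2 j1)).
rewrite (_ : a0 - b0 = (a0 - a1) + (a1 - b1) + (b1 - b0)); last by ring.
have t3 := ler_normD (a0 - a1 + (a1 - b1)) (b1 - b0).
have t4 := ler_normD (a0 - a1) (a1 - b1); lra.
Qed.

(** * Bounds in the frequency domain *)

Section complex_toolbox.
Context (R : realType).
Local Notation Re := complex.Re.
Local Notation Im := complex.Im.
Local Notation nc := (@Normc.normc R).
Implicit Types (x y z : R[i]) (a b : R).

Lemma ReM x y : Re (x * y) = Re x * Re y - Im x * Im y.
Proof. by case: x => a b; case: y. Qed.

Lemma ImM x y : Im (x * y) = Re x * Im y + Im x * Re y.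
Proof. by case: x => a b; case: y. Qed.

Lemma ReD x y : Re (x + y) = Re x + Re y.
Proof. by case: x => a b; case: y. Qed.

Lemma ImD x y : Im (x + y) = Im x + Im y.
Proof. by case: x => a b; case: y. Qed.

Lemma ReN x : Re (- x) = - Re x.
Proof. by case: x. Qed.

Lemma ImN x : Im (- x) = - Im x.
Proof. by case: x. Qed.

Lemma ReJ x : Re (conjc x) = Re x.
Proof. by case: x. Qed.

Lemma ImJ x : Im (conjc x) = - Im x.
Proof. by case: x. Qed.

Lemma Re_sum (I : Type) (s : seq I) (Q : pred I) (f : I -> R[i]) :
  Re (\sum_(i <- s | Q i) f i) = \sum_(i <- s | Q i) Re (f i).
Proof. by elim/big_rec2 : _ => // i y1 y2 _ <-; rewrite ReD. Qed.

Lemma Im_sum (I : Type) (s : seq I) (Q : pred I) (f : I -> R[i]) :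
  Im (\sum_(i <- s | Q i) f i) = \sum_(i <- s | Q i) Im (f i).
Proof. by elim/big_rec2 : _ => // i y1 y2 _ <-; rewrite ImD. Qed.

Lemma complex_ext x y : Re x = Re y -> Im x = Im y -> x = y.
Proof. by case: x => a b; case: y => c d /= -> ->. Qed.

Lemma nc_ge0 x : 0 <= nc x.
Proof. by case: x => a b; exact: sqrtr_ge0. Qed.

Lemma nc_sqr x : nc x ^+ 2 = Re x ^+ 2 + Im x ^+ 2.
Proof. by case: x => a b; rewrite sqr_sqrtr// addr_ge0// sqr_ge0. Qed.

Lemma ncM x y : nc (x * y) = nc x * nc y.
Proof. exact: Normc.normcM. Qed.

Lemma nc1 : nc 1 = 1. Proof. exact: Normc.normc1. Qed.

Lemma nc0 : nc 0 = 0. Proof. exact: Normc.normc0. Qed.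

Lemma nc_prod (I : Type) (s : seq I) (Q : pred I) (f : I -> R[i]) :
  nc (\prod_(i <- s | Q i) f i) = \prod_(i <- s | Q i) nc (f i).
Proof. exact: (big_morph _ ncM nc1). Qed.

Lemma ncN x : nc (- x) = nc x.
Proof. by case: x => a b; rewrite /= !sqrrN. Qed.

Lemma ncJ x : nc (conjc x) = nc x.
Proof. by case: x => a b; rewrite /= sqrrN. Qed.

Lemma ncR a : nc a%:C = `|a|.
Proof. by rewrite /= expr0n addr0 sqrtr_sqr. Qed.

Lemma Re_le x : `|Re x| <= nc x.
Proof.
by rewrite -sqrtr_sqr -[leRHS]ger0_norm ?nc_ge0// -sqrtr_sqr ler_wsqrtr// nc_sqr lerDl sqr_ge0.
Qed.

Lemma ncD x y : nc (x + y) <= nc x + nc y.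
Proof.
have := ler_normD x y; rewrite !normc_def -raddfD lecE/= eqxx/=.
by case: x => a b; case: y.
Qed.

Lemma nc_sum (I : Type) (s : seq I) (Q : pred I) (f : I -> R[i]) :
  nc (\sum_(i <- s | Q i) f i) <= \sum_(i <- s | Q i) nc (f i).
Proof.
elim/big_ind2 : _ => [|x1 x2 y1 y2 h1 h2|//]; first by rewrite nc0.
by rewrite (le_trans (ncD _ _))// lerD.
Qed.

Lemma nc_le x : nc x <= `|Re x| + `|Im x|.
Proof.
rewrite -(@ler_pXn2r _ 2)// ?nnegrE ?nc_ge0 ?addr_ge0// nc_sqr sqrrD.
by rewrite !real_normK ?num_real// -addrA lerD2l lerDr mulrn_wge0// mulr_ge0.
Qed.

Lemma cis0 : cis 0 = 1 :> R[i].
Proof. by rewrite /cis cos0 sin0. Qed.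

Lemma cisD a b : cis (a + b) = cis a * cis b.
Proof. by apply: complex_ext; rewrite ?ReM ?ImM /= ?cosD ?sinD// addrC. Qed.

Lemma cisN a : cis (- a) = conjc (cis a).
Proof. by rewrite /cis cosN sinN. Qed.

Lemma nc_cis a : nc (cis a) = 1.
Proof. by rewrite /= cos2Dsin2 sqrtr1. Qed.

Lemma cis_sum (I : Type) (s : seq I) (Q : pred I) (f : I -> R) :
  cis (\sum_(i <- s | Q i) f i) = \prod_(i <- s | Q i) cis (f i).
Proof. exact: (big_morph _ cisD cis0). Qed.

(** A real oscillation with complex amplitude; a product of two such is a sum of two, at the sum and
    at the difference of the phases. *)
Definition rc z a := Re (z * cis a).

Lemma rcE z a : rc z a = Re z * cos a - Im z * sin a.
Proof. by rewrite /rc ReM. Qed.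

Lemma rc_le z a : `|rc z a| <= nc z.
Proof. by rewrite (le_trans (Re_le _))// ncM nc_cis mulr1. Qed.

Lemma rcM z y a b : rc z a * rc y b =
  2^-1 * (rc (z * y) (a + b) + rc (z * conjc y) (a - b)).
Proof.
rewrite !rcE !ReM !ImM ReJ ImJ cosB sinB cosD sinD.
by field.
Qed.

End complex_toolbox.

Section complex_measurable.
Context (R : realType) d (T : measurableType d).
Local Notation Re := complex.Re.
Local Notation Im := complex.Im.
Local Notation nc := (@Normc.normc R).
Implicit Types (f g : T -> R[i]) (z : R[i]).

Lemma cmeas_cst z : cmeasurable (fun _ : T => z).
Proof. by split; exact: measurable_cst. Qed.

Lemma cmeasM f g : cmeasurable f -> cmeasurable g ->
  cmeasurable (fun x => f x * g x).
Proof.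
move=> [f1 f2] [g1 g2]; split.
  rewrite (_ : (fun _ => _) = fun x => Re (f x) * Re (g x) - Im (f x) * Im (g x)).
    by apply: measurable_funB; exact: measurable_funM.
  by apply/funext => x; rewrite ReM.
rewrite (_ : (fun _ => _) = fun x => Re (f x) * Im (g x) + Im (f x) * Re (g x)).
  by apply: measurable_funD; exact: measurable_funM.
by apply/funext => x; rewrite ImM.
Qed.

Lemma cmeasD f g : cmeasurable f -> cmeasurable g ->
  cmeasurable (fun x => f x + g x).
Proof.
move=> [f1 f2] [g1 g2]; split.
  rewrite (_ : (fun _ => _) = fun x => Re (f x) + Re (g x)).
    exact: measurable_funD.
  by apply/funext => x; rewrite ReD.
rewrite (_ : (fun _ => _) = fun x => Im (f x) + Im (g x)).
  exact: measurable_funD.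
by apply/funext => x; rewrite ImD.
Qed.

Lemma cmeasJ f : cmeasurable f -> cmeasurable (fun x => conjc (f x)).
Proof.
move=> [f1 f2]; split.
  by rewrite (_ : (fun _ => _) = fun x => Re (f x))//; apply/funext => x; rewrite ReJ.
rewrite (_ : (fun _ => _) = fun x => - Im (f x)); first exact: measurable_funN.
by apply/funext => x; rewrite ImJ.
Qed.

Lemma cmeasR (f : T -> R) : measurable_fun setT f ->
  cmeasurable (fun x => (f x)%:C).
Proof. by move=> mf; split => //=; exact: measurable_cst. Qed.

Lemma cmeas_cis (f : T -> R) : measurable_fun setT f ->
  cmeasurable (fun x => cis (f x)).
Proof.
move=> mf; split => /=; apply: measurableT_comp => //; first exact: measurable_cos.
by apply: continuous_measurable_fun => x; exact: continuous_sin.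
Qed.

Lemma cmeas_sum (I : Type) (s : seq I) (Q : pred I) (f : I -> T -> R[i]) :
  (forall i, cmeasurable (f i)) ->
  cmeasurable (fun x => \sum_(i <- s | Q i) f i x).
Proof.
move=> mf; elim: s => [|i s ih].
  rewrite (_ : (fun _ => _) = fun=> 0); first exact: cmeas_cst.
  by apply/funext => x; rewrite big_nil.
rewrite (_ : (fun _ => _) = fun x => (if Q i then f i x else 0) +
  \sum_(i <- s | Q i) f i x).
  by apply: cmeasD => //; case: (Q i) => //; exact: cmeas_cst.
by apply/funext => x; rewrite big_cons; case: (Q i); rewrite ?add0r.
Qed.

Lemma cmeas_prod (I : Type) (s : seq I) (f : I -> T -> R[i]) :
  (forall i, cmeasurable (f i)) -> cmeasurable (fun x => \prod_(i <- s) f i x).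
Proof.
move=> mf; elim: s => [|i s ih].
  rewrite (_ : (fun _ => _) = fun=> 1); first exact: cmeas_cst.
  by apply/funext => x; rewrite big_nil.
rewrite (_ : (fun _ => _) = fun x => f i x * \prod_(i <- s) f i x).
  exact: cmeasM.
by apply/funext => x; rewrite big_cons.
Qed.

Lemma measurable_nc f : cmeasurable f -> measurable_fun setT (fun x => nc (f x)).
Proof.
move=> [f1 f2].
rewrite (_ : (fun _ => _) = fun x => Num.sqrt (Re (f x) ^+ 2 + Im (f x) ^+ 2)).
  apply: measurableT_comp => //; first exact: continuous_measurable_fun (@sqrt_continuous R).
  by apply: measurable_funD; exact: measurable_funX.
by apply/funext => x; case: (f x).
Qed.

Lemma measurable_rc f (g : T -> R) : cmeasurable f -> measurable_fun setT g ->
  measurable_fun setT (fun x => rc (f x) (g x)).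
Proof. by move=> mf mg; case: (cmeasM mf (cmeas_cis mg)). Qed.

End complex_measurable.

Section complex_limits.
Context (R : realType).
Local Notation Re := complex.Re.
Local Notation Im := complex.Im.
Implicit Types (u v : nat -> R[i]) (x y z : R[i]).

Definition ccvg (F : set_system nat) (u : nat -> R[i]) z :=
  (Re (u n) @[n --> F] --> Re z) /\ (Im (u n) @[n --> F] --> Im z).

Lemma ccvgM (F : set_system nat) (FF : Filter F) u v x y : ccvg F u x -> ccvg F v y ->
  ccvg F (fun n => u n * v n) (x * y).
Proof.
move=> [u1 u2] [v1 v2]; split.
  rewrite (_ : (fun _ => _) = fun n => Re (u n) * Re (v n) - Im (u n) * Im (v n)).
    by rewrite ReM; apply: cvgB; exact: cvgM.
  by apply/funext => n; rewrite ReM.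
rewrite (_ : (fun _ => _) = fun n => Re (u n) * Im (v n) + Im (u n) * Re (v n)).
  by rewrite ImM; apply: cvgD; exact: cvgM.
by apply/funext => n; rewrite ImM.
Qed.

Lemma ccvg_cst (F : set_system nat) (FF : Filter F) z : ccvg F (fun=> z) z.
Proof. by split; exact: cvg_cst. Qed.

Lemma ccvg_prod (F : set_system nat) (FF : Filter F) (I : Type) (s : seq I)
    (u : I -> nat -> R[i]) (l : I -> R[i]) :
  (forall i, ccvg F (u i) (l i)) ->
  ccvg F (fun n => \prod_(i <- s) u i n) (\prod_(i <- s) l i).
Proof.
move=> ul; elim: s => [|i s ih].
  rewrite big_nil (_ : (fun _ => _) = fun=> 1); first exact: ccvg_cst.
  by apply/funext => n; rewrite big_nil.
rewrite big_cons (_ : (fun _ => _) = fun n => u i n * \prod_(i <- s) u i n).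
  exact: ccvgM.
by apply/funext => n; rewrite big_cons.
Qed.

End complex_limits.

(** * Oscillating quadrature sums and multiplication by edges *)

Section quadrature_sums.
Context (R : realType) (V : finType).
Local Notation mu := (@lebesgue_measure R).
Local Notation nc := (@Normc.normc R).
Variables (N : nat -> nat) (w x : forall n, 'I_(N n) -> R) (W : R).
Arguments w : clear implicits.
Arguments x : clear implicits.
Hypothesis wW : forall n, \sum_k `|w n k| <= W.
Implicit Types (Q : (V -> R) -> R) (U : (V -> R) -> R) (xi : V -> R) (z : R[i]).

(** One quadrature node is chosen independently for every vertex. The variance only needs [xi = 0]
    and [z = 1], but edge factors move both, so the bounds are carried for all of them. *)
Definition qsum n xi z Q : R := \sum_(k : {ffun V -> 'I_(N n)})
  (\prod_v w n (k v)) * rc z (\sum_v xi v * x n (k v)) * Q (fun v => x n (k v)).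

(* [Q] is integrated against a limit of the quadrature rules after modulation by
   the frequencies [xi]; [U xi] bounds the result, uniformly over the phase [z]. *)
Definition freq_bound Q U :=
  (exists2 M, 0 <= M & forall n xi z, `|qsum n xi z Q| <= M * nc z) /\
  forall xi z, exists2 L, qsum n xi z Q @[n --> \oo] --> L & `|L| <= U xi * nc z.

Lemma freq_bound0 U : (forall xi, 0 <= U xi) -> freq_bound (fun=> 0) U.
Proof.
move=> U0.
have E n xi z : qsum n xi z (fun=> 0) = 0.
  by rewrite /qsum big1// => k _; rewrite mulr0.
split; first by exists 0 => // n xi z; rewrite E normr0 mul0r.
move=> xi z; exists 0; last by rewrite normr0 mulr_ge0// nc_ge0.
by under eq_fun do rewrite E; exact: cvg_cst.
Qed.

Lemma freq_boundD Q Q' U U' : freq_bound Q U -> freq_bound Q' U' ->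
  freq_bound (fun u => Q u + Q' u) (fun xi => U xi + U' xi).
Proof.
move=> [[M M0 QM] QU] [[M' M'0 QM'] QU'].
have E n xi z : qsum n xi z (fun u => Q u + Q' u) = qsum n xi z Q + qsum n xi z Q'.
  by rewrite /qsum -big_split; apply: eq_bigr => k _ /=; rewrite mulrDr.
split.
  exists (M + M'); first exact: addr_ge0.
  by move=> n xi z; rewrite E (le_trans (ler_normD _ _))// mulrDl lerD.
move=> xi z; have [L LQ LU] := QU xi z; have [L' LQ' LU'] := QU' xi z.
exists (L + L'); first by under eq_fun do rewrite E; exact: cvgD.
by rewrite (le_trans (ler_normD _ _))// mulrDl lerD.
Qed.

Lemma freq_boundZ Q U c : 0 <= c -> freq_bound Q U ->
  freq_bound (fun u => c * Q u) (fun xi => c * U xi).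
Proof.
move=> c0 [[M M0 QM] QU].
have E n xi z : qsum n xi z (fun u => c * Q u) = c * qsum n xi z Q.
  by rewrite /qsum mulr_sumr; apply: eq_bigr => k _; rewrite mulrCA.
split.
  exists (c * M); first exact: mulr_ge0.
  by move=> n xi z; rewrite E normrM (ger0_norm c0) -mulrA ler_wpM2l.
move=> xi z; have [L LQ LU] := QU xi z.
exists (c * L); last by rewrite normrM (ger0_norm c0) -mulrA ler_wpM2l.
by under eq_fun do rewrite E; apply: cvgM => //; exact: cvg_cst.
Qed.

Section start.
Variable m : R -> R[i].
Hypothesis wm : forall s,
  ccvg \oo (fun n => \sum_k (w n k)%:C * cis (s * x n k)) (m s).

(** Without edges the sum factors over the vertices, and each factor tends to the transform [m] at
    the frequency of its vertex. *)
Lemma freq_bound1 : freq_bound (fun=> 1) (fun xi => \prod_v nc (m (xi v))).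
Proof.
have E n xi z : qsum n xi z (fun=> 1) =
    complex.Re (z * \prod_v \sum_k (w n k)%:C * cis (xi v * x n k)).
  rewrite bigA_distr_bigA mulr_sumr Re_sum; apply: eq_bigr => k _ /=.
  rewrite mulr1 /rc cis_sum big_split/= -(rmorph_prod (@real_complex R)) mulrCA.
  by rewrite [RHS]ReM /= mul0r subr0.
split.
  have W0 : 0 <= W by apply: le_trans (wW 0%N); exact: sumr_ge0.
  exists (W ^+ #|V|); first exact: exprn_ge0.
  move=> n xi z; rewrite E (le_trans (Re_le _))// ncM mulrC ler_wpM2r ?nc_ge0//.
  rewrite nc_prod -prodr_const; apply: ler_prod => v _; rewrite nc_ge0/=.
  apply: le_trans (wW n); rewrite (le_trans (nc_sum _ _ _))//.
  by apply: ler_sum => k _; rewrite ncM ncR nc_cis mulr1.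
move=> xi z.
have : ccvg \oo (fun n => z * \prod_v \sum_k (w n k)%:C * cis (xi v * x n k))
    (z * \prod_v m (xi v)).
  by apply: ccvgM; [exact: ccvg_cst|apply: ccvg_prod => v; exact: wm].
move=> [cR _]; exists (complex.Re (z * \prod_v m (xi v))).
  by under eq_fun do rewrite E; exact: cR.
by rewrite (le_trans (Re_le _))// ncM nc_prod mulrC.
Qed.

End start.

Definition shift xi (r s : V) (t : R) : V -> R :=
  fun v => xi v + t * ((v == r)%:R - (v == s)%:R).

(* Multiplication by an edge [r -- s] shifts the frequencies [xi r] and [xi s] in
   opposite directions and averages over the shift. *)
Definition edge (k : R -> R[i]) (r s : V) (u : V -> R) : R :=
  \int[mu]_t rc (k t) (t * (u r - u s)).

Section edges.
Variables (k : R -> R[i]) (r s : V).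
Hypotheses (mk : cmeasurable (T := measurableTypeR R) k)
  (ik : integ mu (fun t => nc (k t))).

Let integrand n xi z Q (t : R) := 2^-1 * (qsum n (shift xi r s t) (z * k t) Q +
  qsum n (shift xi r s (- t)) (z * conjc (k t)) Q).

Let sum_shift n xi t (K : {ffun V -> 'I_(N n)}) :
  \sum_v shift xi r s t v * x n (K v) =
  \sum_v xi v * x n (K v) + t * (x n (K r) - x n (K s)).
Proof.
rewrite /shift; under eq_bigr do rewrite mulrDl.
rewrite big_split/=; congr (_ + _).
rewrite -{1}(sum_delta r (fun v => x n (K v))) -(sum_delta s (fun v => x n (K v))).
rewrite -sumrB mulr_sumr; apply: eq_bigr => v _; ring.
Qed.

Let integrandE n xi z Q t : integrand n xi z Q t =
  \sum_(K : {ffun V -> 'I_(N n)}) ((\prod_v w n (K v)) *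
    rc z (\sum_v xi v * x n (K v)) * Q (fun v => x n (K v))) *
    rc (k t) (t * (x n (K r) - x n (K s))).
Proof.
rewrite /integrand /qsum -big_split mulr_sumr; apply: eq_bigr => K _ /=.
rewrite !sum_shift mulNr; set a := \prod_v _; set q := Q _.
set e := \sum_v _; set b := t * _.
have -> : a * rc z e * q * rc (k t) b = a * q * (rc z e * rc (k t) b) by ring.
by rewrite rcM; ring.
Qed.

Let irc (c : R) : integ mu (fun t => rc (k t) (t * c)).
Proof.
apply: integ_le ik => [|t]; last exact: rc_le.
by apply: measurable_rc => //; exact: measurable_funM.
Qed.

Let qsum_edge n xi z Q :
  qsum n xi z (fun u => edge k r s u * Q u) = \int[mu]_t integrand n xi z Q t.
Proof.
rewrite (eq_rint mu (integrandE n xi z Q)) rint_sum; last first.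
  by move=> K _; apply: integZ; exact: irc.
by apply: eq_bigr => K _; rewrite rintZ//; rewrite /edge; ring.
Qed.

Let measurable_integrand n xi z Q : measurable_fun setT (integrand n xi z Q).
Proof.
rewrite (funext (integrandE n xi z Q)).
apply: measurable_sum => K; apply: measurable_funM => //.
exact: (integ_measurable (irc _)).
Qed.

(** The product of two oscillations splits into two sums, with frequencies shifted by [t] and by
    [- t]. For fixed [t] both converge, and the uniform bound [M * nc z * nc (k t)] allows the limit
    under the integral over [t]. *)
Lemma freq_bound_edge Q U U' : freq_bound Q U ->
  (forall xi, exists g, [/\ integ mu g, \int[mu]_t g t <= U' xi &
    forall t, nc (k t) * (2^-1 * (U (shift xi r s t) + U (shift xi r s (- t)))) <= g t]) ->
  freq_bound (fun u => edge k r s u * Q u) U'.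
Proof.
move=> [[M M0 QM] QU] HU.
have dom n xi z t : `|integrand n xi z Q t| <= M * nc z * nc (k t).
  rewrite /integrand normrM ger0_norm ?invr_ge0// ler_pdivrMl//.
  rewrite (le_trans (ler_normD _ _))// (le_trans (lerD (QM _ _ _) (QM _ _ _)))//.
  by rewrite !ncM ncJ le_eqVlt; apply/predU1P; left; ring.
split.
  exists (M * \int[mu]_t nc (k t)).
    by rewrite mulr_ge0// rint_ge0// => t; exact: nc_ge0.
  move=> n xi z; rewrite qsum_edge mulrAC -rintZ//.
  by apply: le_abs_rint => //; [exact: measurable_integrand|exact: integZ].
move=> xi z.
have /choice[f fP] : forall t : R, exists L, integrand n xi z Q t @[n --> \oo] --> L /\
    `|L| <= nc z * (nc (k t) * (2^-1 * (U (shift xi r s t) + U (shift xi r s (- t))))).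
  move=> t.
  have [L1 c1 b1] := QU (shift xi r s t) (z * k t).
  have [L2 c2 b2] := QU (shift xi r s (- t)) (z * conjc (k t)).
  exists (2^-1 * (L1 + L2)); split.
    by apply: cvgM; [exact: cvg_cst|exact: cvgD].
  rewrite normrM ger0_norm ?invr_ge0// ler_pdivrMl//.
  rewrite (le_trans (ler_normD _ _))// (le_trans (lerD b1 b2))//.
  by rewrite !ncM ncJ le_eqVlt; apply/predU1P; left; field.
have [intf cf] := @rint_dct _ _ R mu (fun n => integrand n xi z Q) f
  (fun t => M * nc z * nc (k t)) (fun n => measurable_integrand n xi z Q)
  (fun t => (fP t).1) (integZ _ ik) (fun n t => dom n xi z t).
exists (\int[mu]_t f t).
  by under eq_fun do rewrite qsum_edge.
have [g [ig gU gP]] := HU xi.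
apply: (@le_trans _ _ (\int[mu]_t (nc z * g t))).
  apply: le_abs_rint; [exact: (integ_measurable intf)|exact: integZ|] => t.
  by apply: (le_trans (fP t).2); rewrite ler_wpM2l ?nc_ge0.
by rewrite rintZ// mulrC ler_wpM2r ?nc_ge0.
Qed.

(** A bound constant in [xi] is unaffected by the shift, so an edge whose amplitude has mass at most
    1 is a contraction. *)
Lemma freq_bound_edge_cst Q b : \int[mu]_t nc (k t) <= 1 ->
  freq_bound Q (fun=> b) -> freq_bound (fun u => edge k r s u * Q u) (fun=> b).
Proof.
move=> k1 QU; apply: (freq_bound_edge QU) => xi.
have b0 : 0 <= b.
  have [_ /(_ (fun=> 0) 1)[L _]] := QU; rewrite nc1 mulr1.
  exact: le_trans.
exists (fun t => b * nc (k t)); split; first exact: integZ.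
  by rewrite rintZ// ler_piMr.
by move=> t; rewrite mulrC -mulr2n -[b *+ 2]mulr_natl mulKf.
Qed.

End edges.

End quadrature_sums.

(** * Convolution of a bounded density with itself *)

Section convolution.
Context (R : realType).
Local Notation mu := (@lebesgue_measure R).
Variables (rho : R -> R) (b : R).
Hypotheses (crho : continuous rho) (rho0 : forall x, 0 <= rho x)
  (rhob : forall x, rho x <= b) (irho : integ mu rho).

Lemma integ_shift (G : R -> R) v : continuous G -> (forall x, 0 <= G x) ->
  integ mu G -> integ mu (fun x : R => G (v + x)) /\
  \int[mu]_x G (v + x) = \int[mu]_x G x.
Proof.
move=> cG G0 iG; have := ge0_integral_affine v ltr01 cG G0.
under [X in _ = X]eq_integral do rewrite mulr1 mul1r.
move=> E; split; last by rewrite /Rintegral -E.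
apply: ge0_integ => //; last by rewrite -E; exact: ge0_integ_lty.
apply: continuous_measurable_fun => x.
apply: (@continuous_comp _ _ _ (fun x : R => v + x) G); last exact: cG.
by apply: cvgD; [exact: cvg_cst|exact: cvg_id].
Qed.

Let mrho : measurable_fun setT rho.
Proof. exact: continuous_measurable_fun. Qed.

Let crev (s : R) : continuous (fun t : R => rho (s - t)).
Proof.
move=> t; apply: (@continuous_comp _ _ _ (fun x : R => s - x) rho); last exact: crho.
by apply: cvgB; [exact: cvg_cst|exact: cvg_id].
Qed.

Definition selfconv (s : R) := \int[mu]_t (rho t * rho (s - t)).

Lemma integ_selfconv s : integ mu (fun t => rho t * rho (s - t)).
Proof.
have := integZ b irho; apply: integ_le => [|t].
  have mr : measurable_fun setT (fun t : R => rho (s - t)).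
    by apply: (measurableT_comp mrho); exact: measurable_funB.
  exact: (measurable_funM mrho mr).
by rewrite ger0_norm ?mulr_ge0// mulrC ler_wpM2r.
Qed.

Lemma selfconv_ge0 s : 0 <= selfconv s.
Proof. by apply: rint_ge0 => t; rewrite mulr_ge0. Qed.

Lemma selfconv_le s : selfconv s <= b * \int[mu]_t rho t.
Proof.
rewrite -rintZ//; apply: le_rint; [exact: integ_selfconv|exact: integZ|].
by move=> t; rewrite mulrC ler_wpM2r.
Qed.

(** The two arguments keep the sum [x + y] while [t] runs; this is how an edge acts on the
    frequencies of its two ends. *)
Lemma selfconv_shift (x y : R) : integ mu (fun t => rho (x + t) * rho (y - t)) /\
  \int[mu]_t (rho (x + t) * rho (y - t)) = selfconv (x + y).
Proof.
pose G (t : R) := rho t * rho (x + y - t).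
have cG : continuous G by move=> t; apply: cvgM; [exact: crho|exact: crev].
have G0 t : 0 <= G t by rewrite mulr_ge0.
have [i1 e1] := integ_shift x cG G0 (integ_selfconv (x + y)).
have E t : G (x + t) = rho (x + t) * rho (y - t).
  by rewrite /G; congr (_ * rho _); ring.
split; last by rewrite -[RHS]e1; apply: eq_rint => t; rewrite E.
by rewrite (_ : (fun _ => _) = fun t => G (x + t))//; apply/funext => t; rewrite E.
Qed.

Lemma continuous_selfconv : continuous selfconv.
Proof.
have key (s : R) (u : nat -> R) : u n @[n --> \oo] --> s ->
    selfconv (u n) @[n --> \oo] --> selfconv s.
  move=> us.
  have mf n : measurable_fun setT (fun t => rho t * rho (u n - t)).
    exact: (integ_measurable (integ_selfconv _)).
  have cf (t : R) : rho t * rho (u n - t) @[n --> \oo] --> rho t * rho (s - t).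
    apply: cvgM; first exact: cvg_cst.
    have ust : u n - t @[n --> \oo] --> s - t by apply: cvgB => //; exact: cvg_cst.
    by apply: cvg_comp ust _; exact: crho.
  have df n t : `|rho t * rho (u n - t)| <= b * rho t.
    by rewrite ger0_norm ?mulr_ge0// mulrC ler_wpM2r.
  exact: (@rint_dct _ _ R mu _ _ _ mf cf (integZ b irho) df).2.
by move=> s; apply/(@cvg_nbhsP _ R^o) => u; exact: key.
Qed.

Lemma mass_selfconv :
  integ mu selfconv /\ \int[mu]_s selfconv s = (\int[mu]_t rho t) ^+ 2.
Proof.
pose f (z : R * R) := rho z.2 * rho (z.1 - z.2).
have mf : measurable_fun setT (f : measurableTypeR R * measurableTypeR R -> R).
  apply: measurable_funM; first exact: measurableT_comp.
  apply: measurableT_comp => //; exact: measurable_funB.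
have f0 z : 0 <= f z by rewrite mulr_ge0.
have sec t : integ mu (fun s : R => rho (s - t)) /\
    \int[mu]_s rho (s - t) = \int[mu]_s rho s.
  have [i1 e1] := integ_shift (- t) crho rho0 irho.
  have E : (fun s => rho (- t + s)) = (fun s => rho (s - t)).
    by apply/funext => s; rewrite addrC.
  by split; [rewrite -E|rewrite -e1; apply: eq_rint => s; rewrite addrC].
have iff : integ (mu \x mu)%E f.
  apply/(@integrable21ltyP _ _ (measurableTypeR R) (measurableTypeR R) R mu mu).
    exact/measurable_EFinP.
  under eq_integral => t _.
    under eq_integral do rewrite /= ger0_norm//.
    rewrite -(rintE (integZ (rho t) (sec t).1)) (rintZ _ (sec t).1) (sec t).2 mulrC.
    over.
  rewrite -rintE ?ltry//; exact: integZ.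
have [i1 e1] := rfubini1 iff (fun s => integ_selfconv s).
have sec2 t : integ mu (fun s : R => f (s, t)) by exact: (integZ (rho t) (sec t).1).
split => //; rewrite e1 -(rfubini2 iff sec2) /f/=.
under eq_rint => t do rewrite (rintZ _ (sec t).1) (sec t).2.
under eq_rint => t do rewrite mulrC.
by rewrite rintZ// expr2.
Qed.

End convolution.

(** After its inner edge, only the total frequency of a copy matters; a crossing edge changes it in
    a way that does not depend on which vertex of the copy it touches. *)
Lemma shift_pair (R : realType) (xi : bool * bool -> R) (r s : bool * bool) t :
  r.1 -> ~~ s.1 ->
  shift xi r s t (true, true) + shift xi r s t (true, false) =
    xi (true, true) + xi (true, false) + t /\
  shift xi r s t (false, true) + shift xi r s t (false, false) =
    xi (false, true) + xi (false, false) - t.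
Proof.
case: r => [[] r2]//= _; case: s => [[] s2]//= _.
by case: r2; case: s2; rewrite /shift !xpair_eqE /=; split; ring.
Qed.

(** In each product one factor is estimated by its supremum. The choice is such that, in the
    application, both surviving factors are shifted by [+ t] and can be integrated over [t]. *)
Lemma cross_le (R : realType) (M c k A1 A2 A3 A4 : R) : 0 <= M -> 0 <= k ->
  k <= M -> 0 <= A1 -> 0 <= A2 -> 0 <= A3 -> 0 <= A4 -> A2 <= c -> A3 <= c ->
  k * (2^-1 * (M * A1 * (M * A2) + M * A3 * (M * A4))) <=
  M ^+ 3 * c * (2^-1 * (A1 + A4)).
Proof.
move=> M0 k0 kM h1 h2 h3 h4 A2c A3c.
rewrite (_ : M ^+ 3 * c * _ = M * (2^-1 * (M ^+ 2 * c * A1 + M ^+ 2 * c * A4))); last by ring.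
apply: ler_pM => //; first by rewrite mulr_ge0 ?invr_ge0// addr_ge0// !mulr_ge0.
rewrite ler_wpM2l ?invr_ge0//.
rewrite (_ : M * A1 * (M * A2) = M ^+ 2 * A2 * A1); last by ring.
rewrite (_ : M * A3 * (M * A4) = M ^+ 2 * A3 * A4); last by ring.
by rewrite lerD// ler_wpM2r// ler_wpM2l// sqr_ge0.
Qed.

(* A vertex is a pair (copy of the Gram term, side of the inner product); the
   covariance of the two copies only involves diagrams with an edge across. *)
Section four_point.
Context (R : realType).
Local Notation mu := (@lebesgue_measure R).
Local Notation nc := (@Normc.normc R).
Local Notation V := (bool * bool)%type.
Variables (N : nat -> nat) (w x : forall n, 'I_(N n) -> R) (W : R).
Arguments w : clear implicits.
Arguments x : clear implicits.
Hypothesis wW : forall n, \sum_k `|w n k| <= W.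
Variable m : R -> R[i].
Hypothesis wm : forall s,
  ccvg \oo (fun n => \sum_k (w n k)%:C * cis (s * x n k)) (m s).
Variable b : R.
Local Notation rho := (fun s => nc (m s)).
Hypotheses (cm : continuous rho) (mb : forall s, nc (m s) <= b) (im : integ mu rho).
Variables (a : bool -> R -> R[i]) (M : R).
Hypotheses (ma : forall i, cmeasurable (T := measurableTypeR R) (a i))
  (aM : forall i t, nc (a i t) ^+ 2 <= M)
  (ia : forall i, integ mu (fun t => nc (a i t) ^+ 2))
  (a1 : forall i, \int[mu]_t nc (a i t) ^+ 2 <= 1).

Let k (r s : V) (t : R) : R[i] := conjc (a r.2 t) * a s.2 t.

Definition edge4 (u : V -> R) (r s : V) : R := edge (k r s) r s u.

Let mk r s : cmeasurable (T := measurableTypeR R) (k r s).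
Proof. by apply: cmeasM => //; exact: cmeasJ. Qed.

(** From this both estimates of an edge follow: its amplitude is at most [M] and has mass at most
    1. *)
Let k_amgm r s t : nc (k r s t) <= 2^-1 * (nc (a r.2 t) ^+ 2 + nc (a s.2 t) ^+ 2).
Proof.
rewrite /k ncM ncJ ler_pdivlMl// -subr_ge0.
rewrite (_ : _ - _ = (nc (a r.2 t) - nc (a s.2 t)) ^+ 2) ?sqr_ge0//.
by rewrite sqrrB; ring.
Qed.

Let kM r s t : nc (k r s t) <= M.
Proof.
apply: (le_trans (k_amgm _ _ _)); rewrite ler_pdivrMl// mulr_natl mulr2n.
exact: lerD.
Qed.

Let M0 : 0 <= M.
Proof. by apply: le_trans (aM true 0); exact: sqr_ge0. Qed.

Let b0 : 0 <= b.
Proof. by apply: le_trans (mb 0); exact: nc_ge0. Qed.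

Let ik r s : integ mu (fun t => nc (k r s t)).
Proof.
have := integZ 2^-1 (integD (ia r.2) (ia s.2)); apply: integ_le => [|t].
  exact: measurable_nc.
by rewrite ger0_norm ?nc_ge0.
Qed.

Let k1 r s : \int[mu]_t nc (k r s t) <= 1.
Proof.
have i1 := integD (ia r.2) (ia s.2).
apply: (@le_trans _ _ (\int[mu]_t (2^-1 * (nc (a r.2 t) ^+ 2 + nc (a s.2 t) ^+ 2)))).
  by apply: le_rint => //; exact: integZ.
rewrite rintZ// rintD// ler_pdivrMl// mulr1 -[2]/(1 + 1); exact: lerD.
Qed.

Let c00 : V := (true, true).
Let c01 : V := (true, false).
Let c10 : V := (false, true).
Let c11 : V := (false, false).

Let I1 := \int[mu]_s nc (m s).
Let A := selfconv rho.
Let B := M ^+ 3 * b * I1 ^+ 3.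

Let rho0 s : 0 <= rho s. Proof. exact: nc_ge0. Qed.

Let start_bound : freq_bound w x (fun=> 1)
  (fun xi => nc (m (xi c00)) * nc (m (xi c01)) * (nc (m (xi c10)) * nc (m (xi c11)))).
Proof.
have := freq_bound1 V wW wm; congr (freq_bound _ _ _ _); apply/funext => xi.
transitivity (\prod_(i : bool) \prod_(j : bool) nc (m (xi (i, j)))).
  by rewrite pair_bigA; apply: eq_bigr => -[i j].
by rewrite !big_bool.
Qed.

Let half_mean (y : R) : 2^-1 * (y + y) = y. Proof. by field. Qed.

(** The inner edge of the second copy trades the two transforms at its ends for their convolution at
    the total frequency; the amplitude is bounded by [M]. *)
Let bound10 : freq_bound w x (fun u => edge4 u c10 c11 * 1)
  (fun xi => nc (m (xi c00)) * nc (m (xi c01)) * (M * A (xi c10 + xi c11))).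
Proof.
apply: (freq_bound_edge (mk c10 c11) (ik c10 c11) start_bound) => xi.
set p := nc (m (xi c00)) * _.
have p0 : 0 <= p by rewrite mulr_ge0.
have [i1 e1] := selfconv_shift cm rho0 mb im (xi c10) (xi c11).
have [i2 e2] := selfconv_shift cm rho0 mb im (xi c11) (xi c10).
exists (fun t => M * p * (2^-1 * (rho (xi c10 + t) * rho (xi c11 - t) +
  rho (xi c11 + t) * rho (xi c10 - t)))); split.
- by apply: integZ; apply: integZ; exact: integD.
- rewrite rintZ; last by apply: integZ; exact: integD.
  rewrite rintZ; last exact: integD.
  by rewrite rintD// e1 e2 [xi c11 + _]addrC half_mean mulrAC mulrC mulrA.
- move=> t; rewrite /shift !eqxx /= !subrr !mulr0 !addr0 subr0 sub0r !mulr1 !mulrN1 opprK.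
  rewrite -/p -mulrDr [2^-1 * (p * _)]mulrCA -[leRHS]mulrA [nc (m (xi c10 - t)) * _]mulrC.
  by rewrite ler_wpM2r// mulr_ge0// mulr_ge0 ?invr_ge0// addr_ge0// mulr_ge0.
Qed.

(** The inner edges of the two copies, common to all diagrams because each Malliavin inner product
    contracts one pair of legs. *)
Definition Q4 (u : V -> R) := edge4 u c00 c01 * edge4 u c10 c11.

Let bound00 : freq_bound w x Q4
  (fun xi => M * A (xi c00 + xi c01) * (M * A (xi c10 + xi c11))).
Proof.
have A0 := selfconv_ge0 rho0.
have -> : Q4 = fun u => edge4 u c00 c01 * (edge4 u c10 c11 * 1).
  by apply/funext => u; rewrite /Q4 mulr1.
apply: (freq_bound_edge (mk c00 c01) (ik c00 c01) bound10) => xi.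
set p := M * A (xi c10 + _).
have p0 : 0 <= p by rewrite mulr_ge0.
have [i1 e1] := selfconv_shift cm rho0 mb im (xi c00) (xi c01).
have [i2 e2] := selfconv_shift cm rho0 mb im (xi c01) (xi c00).
exists (fun t => M * p * (2^-1 * (rho (xi c00 + t) * rho (xi c01 - t) +
  rho (xi c01 + t) * rho (xi c00 - t)))); split.
- by apply: integZ; apply: integZ; exact: integD.
- rewrite rintZ; last by apply: integZ; exact: integD.
  rewrite rintZ; last exact: integD.
  by rewrite rintD// e1 e2 [xi c01 + _]addrC half_mean mulrAC.
- move=> t; rewrite /shift !eqxx /= !subrr !mulr0 !addr0 subr0 sub0r !mulr1 !mulrN1 opprK.
  rewrite -/p -mulrDl [(_ + _) * p]mulrC.
  rewrite [2^-1 * (p * _)]mulrCA -[leRHS]mulrA [nc (m (xi c00 - t)) * _]mulrC.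
  by rewrite ler_wpM2r// mulr_ge0// mulr_ge0 ?invr_ge0// addr_ge0// mulr_ge0.
Qed.

(** Three amplitudes give [M^3]; of the two convolutions, one is bounded by [b I1] and the other
    integrates to [I1^2] over the shift, whence [B]. *)
Let cross (r s : V) : r.1 -> ~~ s.1 ->
  freq_bound w x (fun u => edge4 u r s * Q4 u) (fun=> B).
Proof.
move=> r1 s1.
have A0 := selfconv_ge0 rho0.
have Ab := selfconv_le cm rho0 mb im.
have cA := continuous_selfconv cm rho0 mb im.
have [iA eA] := mass_selfconv cm rho0 mb im.
apply: (freq_bound_edge (mk r s) (ik r s) bound00) => xi.
have [i1 e1] := integ_shift (xi c00 + xi c01) cA A0 iA.
have [i2 e2] := integ_shift (xi c10 + xi c11) cA A0 iA.
exists (fun t => M ^+ 3 * (b * I1) * (2^-1 * (A (xi c00 + xi c01 + t) +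
  A (xi c10 + xi c11 + t)))); split.
- by apply: integZ; apply: integZ; exact: integD.
- rewrite rintZ; last by apply: integZ; exact: integD.
  rewrite rintZ; last exact: integD.
  rewrite rintD// e1 e2 half_mean eA -/I1 /B.
  by rewrite le_eqVlt; apply/predU1P; left; ring.
- move=> t.
  have E0 t' := (shift_pair xi t' r1 s1).1.
  have E1 t' := (shift_pair xi t' r1 s1).2.
  rewrite !E0 !E1 opprK.
  by apply: cross_le (kM r s t) (A0 _) (A0 _) (A0 _) (A0 _) (Ab _) (Ab _) => //; exact: nc_ge0.
Qed.

(** The abstract seminorm is instantiated by [freq_bound] with bounds constant in the frequencies,
    and evaluated at zero frequency and phase 1. *)
Theorem four_point_bound (Mo : (V -> R) -> (V -> nat) -> R) (n : V -> nat) :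
  (forall u n r, (0 < n r)%N -> Mo u n =
    \sum_(s | s != r) (n s)%:R * edge4 u r s * Mo u (decr2 n r s)) ->
  (forall u n, (forall v, n v = 0%N) -> Mo u n = 1) ->
  exists2 L, qsum w x n0 (fun=> 0) 1 (fun u => Q4 u * Mc Mo [set v : V | v.1]%SET u n) @[n0 --> \oo] --> L &
    `|L| <= M ^+ 3 * b * I1 ^+ 3 * diagMom R n.
Proof.
move=> ME Mo0.
have B0 : 0 <= B.
  by rewrite !mulr_ge0 ?exprn_ge0//; apply: rint_ge0 => s; exact: nc_ge0.
have := @Mc_bound R V (V -> R) edge4 Mo ME Mo0
  (fun Q c => freq_bound w x Q (fun=> c)) Q4 [set v : V | v.1]%SET B.
case/(_ _ _ _ _ _ n B0).
- by move=> c c0; exact: freq_bound0.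
- by move=> Q Q' c c'; exact: freq_boundD.
- by move=> Q c z; exact: freq_boundZ.
- by move=> Q c r s _; exact: freq_bound_edge_cst.
- by move=> r s; rewrite !inE; exact: cross.
- move=> _ /(_ (fun=> 0) 1)[L cL]; rewrite nc1 mulr1 => Lb.
  by exists L.
Qed.

End four_point.

(** * First-order Wiener integrals *)

Section gaussian_variables.
Context (R : realType) d (T : measurableType d) (P : probability T R).
Local Notation mu := (@lebesgue_measure R).

(** Jensen's inequality, by expanding the mean of [(|f| - c)^2] with [c] the mean of [|f|]. *)
Lemma l1_le_l2 (f : T -> R) : measurable_fun setT f ->
  integ P (fun y => f y ^+ 2) ->
  integ P f /\ (\int[P]_y `|f y|) ^+ 2 <= \int[P]_y f y ^+ 2.
Proof.
move=> mf if2.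
have i1 : integ P f.
  have := integD (integ_cst P 1) if2; apply: integ_le => // y.
  have := sqr_ge0 (`|f y| - 1); rewrite -[f y ^+ 2]real_normK ?num_real//.
  by rewrite sqrrB expr1n mulr1; have := normr_ge0 (f y); nra.
split => //; set c := \int[P]_y _.
have iA := integ_norm i1.
have h : 0 <= \int[P]_y (f y ^+ 2 + (c ^+ 2 + (- (2 * c)) * `|f y|)).
  apply: rint_ge0 => y; have := sqr_ge0 (`|f y| - c).
  by rewrite sqrrB real_normK ?num_real//; lra.
move: h; rewrite rintD//; last by apply: integD; [exact: integ_cst|exact: integZ].
rewrite rintD; [|exact: integ_cst|exact: integZ].
by rewrite rint_cst rintZ// -/c; lra.
Qed.

Lemma pushforward_rint (Y : T -> R) (nu : {measure set (measurableTypeR R) -> \bar R})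
    (f : R -> R) :
  measurable_fun setT Y -> (forall B : set R, measurable B -> P (Y @^-1` B) = nu B) ->
  measurable_fun setT f -> (forall x, 0 <= f x) ->
  \int[P]_y f (Y y) = \int[nu]_x f x.
Proof.
move=> mY PY mf f0; rewrite /Rintegral; congr fine.
transitivity (\int[pushforward P (Y : T -> measurableTypeR R)]_x (f x)%:E)%E.
  rewrite ge0_integral_pushforward//; first exact/measurable_EFinP.
  by move=> x _; rewrite lee_fin.
have mY' : measurable_fun setT (Y : T -> measurableTypeR R) by [].
pose nu' : {measure set (measurableTypeR R) -> \bar R} :=
  measure_function_pushforward__canonical__measure_function_Measure P mY'.
transitivity (\int[nu']_x (f x)%:E)%E; first by [].
by apply: eq_measure_integral => B mB _; rewrite -PY.
Qed.

Lemma gaussian_rv_cos (Y : T -> R) m v s c : gaussian_rv P Y m v ->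
  \int[P]_y cos (s * Y y + c) = expR (- (s ^+ 2 * v / 2)) * cos (s * m + c).
Proof.
move=> [v0 mY PY].
(* Adding 1 makes the integrand nonnegative, so that the change of variables for nonnegative
   functions applies. *)
pose f (x : R) := 1 + cos (s * x + c).
have f0 x : 0 <= f x by rewrite /f; have := cos_geN1 (s * x + c); lra.
have cf : continuous f.
  move=> x; apply: cvgD; first exact: cvg_cst.
  apply: (@continuous_comp _ _ _ (fun x : R => s * x + c) cos); last exact: continuous_cos.
  by apply: cvgD; [apply: cvgM; [exact: cvg_cst|exact: cvg_id]|exact: cvg_cst].
have mf : measurable_fun setT f by exact: continuous_measurable_fun.
have icos : integ P (fun y => cos (s * Y y + c)).
  apply: (@integ_bounded _ _ _ P _ 1) => [|y]; last exact: normr_cos.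
  apply: measurableT_comp; first exact: measurable_cos.
  by apply: measurable_funD => //; exact: measurable_funM.
suff : \int[P]_y f (Y y) = 1 + expR (- (s ^+ 2 * v / 2)) * cos (s * m + c).
  rewrite /f rintD//; last exact: integ_cst.
  by rewrite rint_cst => /addrI.
have [v_0|v_n0] := eqVneq v 0.
  pose dm : {measure set (measurableTypeR R) -> \bar R} := @dirac _ (measurableTypeR R) m R.
  rewrite (pushforward_rint (nu := dm) mY)//; last first.
    by move=> B mB; rewrite PY// v_0 eqxx.
  rewrite /Rintegral integral_dirac//; last exact/measurable_EFinP.
  by rewrite diracT mul1e/= /f v_0 mulr0 mul0r oppr0 expR0 mul1r.
pose e := Num.sqrt v.
have e0 : 0 < e by rewrite sqrtr_gt0 lt_neqAle eq_sym v_n0.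
have e_n0 : e != 0 by rewrite gt_eqF.
rewrite (pushforward_rint (nu := normal_prob m e) mY)//; last first.
  by move=> B mB; rewrite PY// (negbTE v_n0).
have cpdf (m' s' : R) : s' != 0 -> continuous (normal_pdf m' s').
  exact: continuous_normal_pdf.
have EE : (\int[normal_prob m e]_x (f x)%:E = \int[stdg R]_z (f (m + e * z))%:E)%E.
  rewrite (@ge0_integral_density _ _ R mu (normal_prob m e) (normal_pdf m e))//.
  - rewrite (@ge0_integral_density _ _ R mu (stdg R) (normal_pdf 0 1)).
    + rewrite (ge0_integral_affine m e0 (G := fun x => f x * normal_pdf m e x)).
      * apply: eq_integral => x _; congr EFin; rewrite -mulrA; congr (_ * _).
        rewrite !normal_pdfE ?oner_neq0// /normal_fun addrAC subrr add0r subr0 expr1n.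
        rewrite exprMn /normal_peak.
        have -> : - (e ^+ 2 * x ^+ 2) / (e ^+ 2 *+ 2) = - x ^+ 2 / (1 *+ 2).
          by rewrite -mulr_natr -[1 *+ 2]mulr_natr; field.
        rewrite mulrAC; congr (_ * _).
        rewrite expr1n -[_ * pi *+ 2]mulrnAr -mulrnAr sqrtrM ?sqr_ge0// sqrtr_sqr gtr0_norm//.
        by rewrite mul1r invfM mulrAC mulVf ?mul1r.
      * by move=> x; apply: cvgM; [exact: cf|exact: cpdf].
      * by move=> x; rewrite mulr_ge0// normal_pdf_ge0.
    + exact: measurable_normal_pdf.
    + by move=> x; exact: normal_pdf_ge0.
    + by [].
    + apply: continuous_measurable_fun => x.
      apply: (@continuous_comp _ _ _ (fun x : R => m + e * x) f); last exact: cf.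
      by apply: cvgD; [exact: cvg_cst|apply: cvgM; [exact: cvg_cst|exact: cvg_id]].
    + by [].
  - exact: measurable_normal_pdf.
  - by move=> x; exact: normal_pdf_ge0.
have E : \int[normal_prob m e]_x f x = \int[stdg R]_z f (m + e * z).
  by rewrite /Rintegral EE.
rewrite E /f.
transitivity (\int[stdg R]_z (1 + cos ((s * e) * z + (s * m + c)))).
  by apply: eq_rint => z; congr (1 + cos _); ring.
rewrite rintD; last 2 first.
- exact: integ_cst.
- apply: (@integ_bounded _ _ _ (stdg R) _ 1) => [|y]; last exact: normr_cos.
  apply: measurableT_comp; first exact: measurable_cos.
  by apply: measurable_funD => //; exact: measurable_funM.
rewrite rint_cst stdg_cos; congr (1 + expR (- (_ / 2)) * _).
by rewrite exprMn sqr_sqrtr.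
Qed.

Lemma gaussian_rv_law (Y : T -> R) m v (f : R -> R) : gaussian_rv P Y m v ->
  measurable_fun setT f -> integ (stdg R) (fun z => f (m + Num.sqrt v * z)) ->
  integ P (fun y => f (Y y)) /\
  \int[P]_y f (Y y) = \int[stdg R]_z f (m + Num.sqrt v * z).
Proof.
move=> gY mf iF; have [v0 mY _] := gY.
pose X (_ : unit) (z : R) := m + Num.sqrt v * z.
pose X' (_ : unit) := Y.
have mX i : measurable_fun setT (X i).
  by apply: measurable_funD => //; exact: measurable_funM.
have mX' i : measurable_fun setT (X' i) by [].
have sumu (g : unit -> R) : \sum_i g i = g tt.
  by rewrite (big_pred1 tt)//; case.
have cE (a : unit -> R) c : \int[stdg R]_z cos (\sum_i a i * X i z + c) =
    \int[P]_y cos (\sum_i a i * X' i y + c).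
  rewrite (eq_rint P (g := fun y => cos (a tt * Y y + c))); last by move=> y; rewrite sumu.
  rewrite (gaussian_rv_cos _ _ gY).
  transitivity (\int[stdg R]_z cos ((a tt * Num.sqrt v) * z + (a tt * m + c))).
    by apply: eq_rint => z; rewrite sumu /X; congr (cos _); ring.
  by rewrite stdg_cos exprMn sqr_sqrtr.
have mF : mfun (fun u : unit -> R => f (u tt)).
  move=> d0 T0 X0 mX0; exact: (measurableT_comp mf (mX0 tt)).
have [h1 h2] := @law_transfer R unit _ _ _ _ (stdg R) P X X' mX mX' cE _ mF iF.
by split => //; rewrite -h2.
Qed.

Lemma stdg_moments (m s : R) :
  [/\ integ (stdg R) (fun z => m + s * z), \int[stdg R]_z (m + s * z) = m,
   integ (stdg R) (fun z => (m + s * z) ^+ 2) &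
   \int[stdg R]_z (m + s * z) ^+ 2 = m ^+ 2 + s ^+ 2].
Proof.
have i1 : integ (stdg R) (fun z => z).
  have := integ_stdg_poly ('X : {poly R}).
  by rewrite (_ : horner 'X = id)//; apply/funext => z; rewrite hornerX.
have i2 : integ (stdg R) (fun z => z * z).
  have := integ_stdg_poly ('X * 'X : {poly R}).
  by rewrite (_ : horner _ = fun z => z * z)//; apply/funext => z; rewrite hornerM hornerX.
have H1 : He R 1 = 'X by rewrite /= mulr1 -[1]/(1%:P) derivC subr0.
have e1 : \int[stdg R]_z z = 0.
  have := He_orth R 1 0; rewrite H1 /= mul0r => <-.
  by apply: eq_rint => z; rewrite hornerX hornerC mulr1.
have e2 : \int[stdg R]_z (z * z) = 1.
  have E := He_orth R 1 1; rewrite H1 eqxx mul1r in E.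
  transitivity (1`!%:R : R) => //; rewrite -E.
  by apply: eq_rint => z; rewrite hornerX.
have j1 : integ (stdg R) (fun z => m + s * z) by apply: integD; [exact: integ_cst|exact: integZ].
have E z : (m + s * z) ^+ 2 = m ^+ 2 + ((2 * m * s) * z + s ^+ 2 * (z * z)) by ring.
have j3 : integ (stdg R) (fun z => (2 * m * s) * z + s ^+ 2 * (z * z)).
  by apply: integD; exact: integZ.
split => //.
- by rewrite rintD ?rint_cst ?rintZ ?e1 ?mulr0 ?addr0//; [exact: integ_cst|exact: integZ].
- rewrite (_ : (fun _ => _) = fun z => m ^+ 2 + ((2 * m * s) * z + s ^+ 2 * (z * z))).
    by apply: integD => //; exact: integ_cst.
  by apply/funext => z; rewrite E.
- transitivity (\int[stdg R]_z (m ^+ 2 + ((2 * m * s) * z + s ^+ 2 * (z * z)))).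
    by apply: eq_rint => z; rewrite E.
  rewrite rintD//; last exact: integ_cst.
  rewrite rint_cst rintD; [|exact: integZ|exact: integZ].
  by rewrite !rintZ// e1 e2 mulr0 add0r mulr1.
Qed.

Lemma gaussian_rv_moments (Y : T -> R) m v : gaussian_rv P Y m v ->
  [/\ integ P Y, \int[P]_y Y y = m, integ P (fun y => Y y ^+ 2) &
   \int[P]_y Y y ^+ 2 = m ^+ 2 + v].
Proof.
move=> gY; have [v0 mY _] := gY.
have [i1 e1 i2 e2] := stdg_moments m (Num.sqrt v).
have [a1 b1] := gaussian_rv_law gY (f := id) (@measurable_id _ _ _) i1.
have msq : measurable_fun setT (fun x : R => x ^+ 2) by exact: measurable_funX.
have [a2 b2] := gaussian_rv_law gY msq i2.
by split => //; rewrite ?b1// b2 e2 sqr_sqrtr.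
Qed.

(** An [L^2] limit of centred Gaussian variables is Gaussian: variances and cosine transforms both
    converge along the approximations. *)
Lemma l2_limit_cos (Y : T -> R) s c : measurable_fun setT Y ->
  integ P (fun y => Y y ^+ 2) ->
  (forall e, 0 < e -> exists Z v, gaussian_rv P Z 0 v /\
     \int[P]_y (Y y - Z y) ^+ 2 <= e) ->
  \int[P]_y cos (s * Y y + c) =
  expR (- (s ^+ 2 * (\int[P]_y Y y ^+ 2) / 2)) * cos c.
Proof.
move=> mY iY2 app.
have /choice[Z ZP] : forall n : nat, exists Zv : (T -> R) * R, gaussian_rv P Zv.1 0 Zv.2 /\
    \int[P]_y (Y y - Zv.1 y) ^+ 2 <= n.+1%:R^-1 ^+ 2.
  move=> n; have [|Z0 [v0 H]] := app (n.+1%:R^-1 ^+ 2); first by rewrite exprn_gt0// invr_gt0.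
  by exists (Z0, v0).
set V := \int[P]_y Y y ^+ 2.
have V0 : 0 <= V by apply: rint_ge0 => y; exact: sqr_ge0.
pose e n : R := n.+1%:R^-1.
have e0 n : 0 < e n by rewrite /e invr_gt0.
have mZ n : measurable_fun setT (Z n).1 by have [[]] := ZP n.
have iZ2 n : integ P (fun y => (Z n).1 y ^+ 2).
  by have [/gaussian_rv_moments[]] := ZP n.
have vE n : \int[P]_y (Z n).1 y ^+ 2 = (Z n).2.
  by have [/gaussian_rv_moments[_ _ _ ->] _] := ZP n; rewrite expr0n add0r.
have iD n : integ P (fun y => (Y y - (Z n).1 y) ^+ 2).
  have := integZ 2 (integD iY2 (iZ2 n)); apply: integ_le => [|y].
    by apply: measurable_funX; exact: measurable_funB.
  rewrite ger0_norm ?sqr_ge0//; have := sqr_ge0 (Y y + (Z n).1 y); lra.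
have mD n : measurable_fun setT (fun y => Y y - (Z n).1 y) by exact: measurable_funB.
have l1 n : \int[P]_y `|Y y - (Z n).1 y| <= e n.
  have [_ h] := l1_le_l2 (mD n) (iD n).
  rewrite -(@ler_pXn2r _ 2)// ?nnegrE ?(ltW (e0 n))//; last by apply: rint_ge0.
  exact: le_trans h (ZP n).2.
(* From [b^2 - a^2 = (a - b)^2 - 2 a (a - b)], with the cross term split with weight [e n]; the
   approximations were chosen with error [e n ^ 2], so the bound tends to 0. *)
have vV n : `|(Z n).2 - V| <= e n ^+ 2 + e n * (V + 1).
  rewrite -vE /V -rintB//.
  apply: (@le_trans _ _ (\int[P]_y ((1 + (e n)^-1) * (Y y - (Z n).1 y) ^+ 2 + e n * Y y ^+ 2))).
    apply: le_abs_rint; first by apply: measurable_funB; exact: measurable_funX.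
      by apply: integD; exact: integZ.
    move=> y; set a := Y y; set b := (Z n).1 y.
    have -> : b ^+ 2 - a ^+ 2 = (a - b) ^+ 2 - 2 * a * (a - b) by ring.
    rewrite (le_trans (ler_normB _ _))// (ger0_norm (sqr_ge0 _)) [(1 + _) * _]mulrDl mul1r -addrA lerD2l.
    have : 0 <= (e n)^-1 * (`|a - b| - e n * `|a|) ^+ 2.
      by rewrite mulr_ge0 ?sqr_ge0// invr_ge0 ltW.
    rewrite [X in 0 <= X](_ : _ = (e n)^-1 * `|a - b| ^+ 2 + e n * `|a| ^+ 2 -
       2 * `|a| * `|a - b|); last by field; rewrite gt_eqF.
    by rewrite !real_normK ?num_real// subr_ge0 !normrM ger0_norm.
  rewrite rintD; [|exact: integZ|exact: integZ].
  rewrite !rintZ// -/V.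
  have h := (ZP n).2.
  have e1 : 0 <= 1 + (e n)^-1 by rewrite addr_ge0// invr_ge0 ltW.
  rewrite (le_trans (lerD (ler_wpM2l e1 h) (lexx _)))//.
  rewrite -/(e n) [leLHS](_ : _ = e n ^+ 2 + e n * (V + 1))//.
  by field; rewrite gt_eqF.
have ecvg : e n @[n --> \oo] --> 0 by exact: cvg_harmonic.
have vcvg : (Z n).2 @[n --> \oo] --> V.
  have h : e n ^+ 2 + e n * (V + 1) @[n --> \oo] --> 0 ^+ 2 + 0 * (V + 1).
    apply: cvgD; first by rewrite !expr2; exact: cvgM.
    by apply: cvgM => //; exact: cvg_cst.
  rewrite expr0n mul0r addr0 in h.
  apply/subr_cvg0; apply: norm_cvg0.
  by apply: (squeeze_cvgr _ (cvg_cst 0) h); apply: nearW => n; rewrite normr_ge0 vV.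
have c1 : \int[P]_y cos (s * (Z n).1 y + c) @[n --> \oo] --> \int[P]_y cos (s * Y y + c).
  have icos (X : T -> R) : measurable_fun setT X -> integ P (fun y => cos (s * X y + c)).
    move=> mX; apply: (@integ_bounded _ _ _ P _ 1) => [|y]; last exact: normr_cos.
    apply: measurableT_comp; first exact: measurable_cos.
    by apply: measurable_funD => //; exact: measurable_funM.
  have h : `|s| * e n @[n --> \oo] --> `|s| * 0 by apply: cvgM => //; exact: cvg_cst.
  rewrite mulr0 in h.
  apply/subr_cvg0; apply: norm_cvg0.
  apply: (squeeze_cvgr _ (cvg_cst 0) h); apply: nearW => n; rewrite normr_ge0/=.
  have [iDn _] := l1_le_l2 (mD n) (iD n).
  have iDn' := integ_norm iDn.
  rewrite -rintB; [|exact: icos|exact: icos].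
  apply: (le_trans _ (ler_wpM2l (normr_ge0 s) (l1 n))); rewrite -rintZ//.
  apply: le_abs_rint; [|exact: integZ|].
    exact: (integ_measurable (integB (icos _ (mZ n)) (icos _ mY))).
  move=> y; rewrite (le_trans (cos_lip _ _))// -normrM distrC.
  by rewrite le_eqVlt; apply/predU1P; left; congr `|_|; ring.
have c2 : \int[P]_y cos (s * (Z n).1 y + c) @[n --> \oo] -->
    expR (- (s ^+ 2 * V / 2)) * cos c.
  have E n : \int[P]_y cos (s * (Z n).1 y + c) = expR (- (s ^+ 2 * (Z n).2 / 2)) * cos c.
    by have [g _] := ZP n; rewrite (gaussian_rv_cos _ _ g) mulr0 add0r.
  under eq_fun do rewrite E.
  apply: cvgM; last exact: cvg_cst.
  have : - (s ^+ 2 * (Z n).2 / 2) @[n --> \oo] --> - (s ^+ 2 * V / 2).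
    by apply: cvgN; apply: cvgM; [apply: cvgM => //; exact: cvg_cst|exact: cvg_cst].
  by move/(cvg_comp _ _); apply; exact: continuous_expR.
exact: (cvg_unique _ c1 c2).
Qed.

Lemma normal_vector_gfam n (N : 'I_n -> T -> R) (S : 'M[R]_n) :
  normal_vector P N S -> (forall i k, S i k = S k i) ->
  gfam P N (fun i k => S i k).
Proof.
move=> NS sS.
have mN i : measurable_fun setT (N i).
  have [_ + _] := NS (fun k => (k == i)%:R).
  by under eq_fun do rewrite sum_delta.
split => // a c.
have := gaussian_rv_cos 1 c (NS a); rewrite expr1n !mul1r add0r => <-.
by apply: eq_rint => y; rewrite mul1r.
Qed.

End gaussian_variables.

(** * Integrals over tuples and Hermitian kernels *)

Section tuple_integrals.
Context (R : realType).
Local Notation mu := (@lebesgue_measure R).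
Local Notation nc := (@Normc.normc R).
Local Notation tR n := (n.-tuple (measurableTypeR R)).
Local Notation mut n := (lebesgue_tuple R n).

Lemma integral_tuple_cons n (f : tR n.+1 -> \bar R) :
  measurable_fun setT f -> (forall x, (0 <= f x)%E) ->
  (\int[mut n.+1]_x f x = \int[mu]_x \int[mut n]_y f [tuple of x :: y])%E.
Proof.
move=> mf f0.
have mc := @measurable_cons_pair _ (measurableTypeR R) n.
transitivity (\int[pushforward (mu \x mut n)%E (@cons_pair _ (measurableTypeR R) n)]_x f x)%E.
  by [].
rewrite ge0_integral_pushforward// preimage_setT fubini_tonelli1//.
  exact: measurableT_comp.
by move=> x; exact: f0.
Qed.

Lemma integral_tuple_prod n (h : R -> R) : measurable_fun setT h ->
  (forall x, 0 <= h x) -> integ mu h ->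
  integ (mut n) (fun x => \prod_(k < n) h (tnth x k)) /\
  \int[mut n]_x \prod_(k < n) h (tnth x k) = (\int[mu]_x h x) ^+ n.
Proof.
move=> mh h0 ih.
have mprod m : measurable_fun setT (fun x : tR m => \prod_(k < m) h (tnth x k)).
  apply: measurable_prod => k _; apply: (measurableT_comp mh).
  exact: measurable_tnth.
have p0 m (x : tR m) : 0 <= \prod_(k < m) h (tnth x k) by apply: prodr_ge0.
suff E : (\int[mut n]_x (\prod_(k < n) h (tnth x k))%:E = ((\int[mu]_x h x) ^+ n)%:E)%E.
  split; last by rewrite /Rintegral E.
  have h' : (\int[mut n]_x (\prod_(k < n) h (tnth x k))%:E < +oo)%E by rewrite E ltry.
  exact: (ge0_integ (mprod n) (p0 n) h').
elim: n => [|n IH].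
  under eq_integral do rewrite big_ord0.
  rewrite expr0 /lebesgue_tuple /= integral_dirac//.
  by rewrite diracT mul1e.
rewrite integral_tuple_cons; last 2 first.
- by apply/measurable_EFinP; exact: mprod.
- by move=> x; rewrite lee_fin.
under eq_integral => x _.
  under eq_integral => y _.
    rewrite big_ord_recl tnth0.
    under eq_bigr do rewrite tnthS.
    rewrite EFinM; over.
  rewrite ge0_integralZl//; last 3 first.
  - by apply/measurable_EFinP; exact: mprod.
  - by move=> y _; rewrite lee_fin.
  - by rewrite lee_fin.
  rewrite IH -EFinM; over.
rewrite /= -rintE; last by under eq_fun do rewrite mulrC; exact: integZ.
under eq_Rintegral do rewrite mulrC.
by rewrite rintZ// exprSr.
Qed.

Lemma Sym_id m (f : m.-tuple R -> R[i]) :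
  (forall (s : {perm 'I_m}) x, f [tuple tnth x (s k) | k < m] = f x) -> Defs.Sym f = f.
Proof.
move=> fs; apply/funext => x; rewrite /Defs.Sym.
under eq_bigr do rewrite fs.
rewrite sumr_const -[f x *+ _]mulr_natl mulrA.
have -> : #|{perm 'I_m}| = m`! by rewrite -card_Sn; apply: eq_card.
by rewrite mulVf ?mul1r// pnatr_eq0 -lt0n fact_gt0.
Qed.

Lemma Sym_tensor_pow m (g : R -> R[i]) : Defs.Sym (@tensor_pow R m g) = @tensor_pow R m g.
Proof.
apply: Sym_id => s x; rewrite /tensor_pow.
rewrite [RHS](reindex_inj (@perm_inj _ s)).
by apply: eq_bigr => k _; rewrite tnth_mktuple.
Qed.

Lemma conjcD (x y : R[i]) : conjc (x + y) = conjc x + conjc y.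
Proof. by case: x => a b; case: y => a' b'; rewrite /= opprD. Qed.

Lemma conjc_scale (a : R) (x : R[i]) : conjc (a%:C * x) = a%:C * conjc x.
Proof. by case: x => b c; apply: complex_ext => /=; ring. Qed.

(** Hermitian symmetry at every point rather than almost everywhere: it passes to sums and tensor
    powers without handling null sets. *)
Definition herm (g : R -> R[i]) :=
  cLp (T := measurableTypeR R) mu 2 g /\ forall x, g (- x) = conjc (g x).

Definition herm_tensor m (f : m.-tuple R -> R[i]) :=
  cLp (T := tR m) (mut m) 2 f /\ forall x, f (map_tuple -%R x) = conjc (f x).

Lemma herm_Hbar g : herm g -> Hbar g.
Proof. by move=> [gL gJ]; split => //; apply: aeW. Qed.

Lemma herm_tensor_Hbar m f : @herm_tensor m f -> @Hbar_tensor R m f.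
Proof. by move=> [gL gJ]; split => //; apply: aeW. Qed.

Lemma cLp2_integ d (T : measurableType d) (nu : {measure set T -> \bar R}) f :
  cLp nu 2 f -> integ nu (fun x => nc (f x) ^+ 2).
Proof.
move=> [mf foo]; apply: ge0_integ => //.
  by apply: measurable_funX; exact: measurable_nc.
by move=> x; exact: sqr_ge0.
Qed.

Lemma integ_cLp2 d (T : measurableType d) (nu : {measure set T -> \bar R}) f :
  cmeasurable f -> integ nu (fun x => nc (f x) ^+ 2) -> cLp nu 2 f.
Proof. by move=> mf i2; split => //; apply: ge0_integ_lty => // x; exact: sqr_ge0. Qed.

Lemma cLp2_comb d (T : measurableType d) (nu : {measure set T -> \bar R}) f g (z y : R[i]) :
  cLp nu 2 f -> cLp nu 2 g -> cLp nu 2 (fun x => z * f x + y * g x).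
Proof.
move=> fL gL.
have mfg : cmeasurable (fun x => z * f x + y * g x).
  by apply: cmeasD; apply: cmeasM; [exact: cmeas_cst|exact: fL.1|exact: cmeas_cst|exact: gL.1].
apply: integ_cLp2 => //.
have := integZ 2 (integD (integZ (nc z ^+ 2) (cLp2_integ fL)) (integZ (nc y ^+ 2) (cLp2_integ gL))).
apply: integ_le => [|x]; first by apply: measurable_funX; exact: measurable_nc.
rewrite ger0_norm ?sqr_ge0// -!exprMn -!ncM.
have := ncD (z * f x) (y * g x).
have := nc_ge0 (z * f x); have := nc_ge0 (y * g x); have := nc_ge0 (z * f x + y * g x).
set u := nc _; set v := nc _; set t := nc _ => u0 v0 t0 uvt.
have h1 : u ^+ 2 <= (t + v) ^+ 2 by rewrite ler_pXn2r ?nnegrE ?addr_ge0.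
have := sqr_ge0 (t - v); lra.
Qed.

Lemma tensor_pow_herm m g : herm g -> @herm_tensor m (@tensor_pow R m g).
Proof.
move=> [gL gJ]; split; last first.
  move=> x; rewrite /tensor_pow rmorph_prod; apply: eq_bigr => k _.
  by rewrite tnth_map gJ.
apply: integ_cLp2.
  by apply: cmeas_prod => k; case: gL.1 => m1 m2; split;
    [apply: (measurableT_comp m1)|apply: (measurableT_comp m2)]; exact: measurable_tnth.
have := (@integral_tuple_prod m (fun x => nc (g x) ^+ 2) _ _ (cLp2_integ gL)).1.
rewrite (_ : (fun x => nc _ ^+ 2) = fun x : m.-tuple R => \prod_(k < m) nc (g (tnth x k)) ^+ 2).
  apply; first by apply: measurable_funX; exact: (measurable_nc gL.1).
  by move=> x; exact: sqr_ge0.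
by apply/funext => x; rewrite nc_prod prodrXl.
Qed.

Lemma sqnorm_tensor_pow m g : herm g ->
  sqnormL2 (mut m) (@tensor_pow R m g) = sqnormL2 mu g ^+ m.
Proof.
move=> [gL gJ]; rewrite /sqnormL2.
rewrite -(@integral_tuple_prod m (fun x => nc (g x) ^+ 2) _ _ (cLp2_integ gL)).2.
- by apply: eq_rint => x; rewrite nc_prod prodrXl.
- by apply: measurable_funX; exact: (measurable_nc gL.1).
- by move=> x; exact: sqr_ge0.
Qed.

Lemma herm_tensor0 m : @herm_tensor m (fun=> 0).
Proof.
split; last by move=> x; rewrite conjc0.
apply: integ_cLp2; first exact: cmeas_cst.
by under eq_fun do rewrite nc0 expr0n; exact: integrable0.
Qed.

Lemma herm_tensorD m f g (a b : R) : @herm_tensor m f -> @herm_tensor m g ->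
  @herm_tensor m (fun x => a%:C * f x + b%:C * g x).
Proof.
move=> [fL fJ] [gL gJ]; split; first exact: cLp2_comb.
by move=> x; rewrite fJ gJ conjcD !conjc_scale.
Qed.

Lemma herm_tensor_sum m (J : Type) (s : seq J) (c : J -> R) (f : J -> m.-tuple R -> R[i]) :
  (forall j, @herm_tensor m (f j)) ->
  @herm_tensor m (fun x => \sum_(j <- s) (c j)%:C * f j x).
Proof.
move=> fh; elim: s => [|j s ih].
  by under eq_fun do rewrite big_nil; exact: herm_tensor0.
rewrite (_ : (fun _ => _) = fun x => (c j)%:C * f j x +
   1%:C * \sum_(j <- s) (c j)%:C * f j x); first exact: herm_tensorD.
by apply/funext => x; rewrite big_cons mul1r.
Qed.

Lemma herm_sum (J : Type) (s : seq J) (c : J -> R) (g : J -> R -> R[i]) :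
  (forall j, herm (g j)) -> herm (fun x => \sum_(j <- s) (c j)%:C * g j x).
Proof.
move=> gh; elim: s => [|j s [ih1 ih2]].
  under eq_fun do rewrite big_nil; split; last by move=> x; rewrite conjc0.
  apply: integ_cLp2; first exact: cmeas_cst.
  by under eq_fun do rewrite nc0 expr0n; exact: integrable0.
have [g1 g2] := gh j.
rewrite (_ : (fun _ => _) = fun x => (c j)%:C * g j x +
   1%:C * \sum_(j <- s) (c j)%:C * g j x); last first.
  by apply/funext => x; rewrite big_cons mul1r.
split; first exact: cLp2_comb.
by move=> x; rewrite g2 ih2 conjcD !conjc_scale.
Qed.

Lemma tensor_pow1 (g : R -> R[i]) x : @tensor_pow R 1 g x = g (tnth x ord0).
Proof. by rewrite /tensor_pow big_ord1. Qed.

(** For Hermitian functions the complex integral is real, so this is the scalar product of their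
    real Hilbert space. *)
Definition inner (f g : R -> R[i]) : R := \int[mu]_x complex.Re (f x * conjc (g x)).

Lemma integ_inner f g : herm f -> herm g ->
  integ mu (fun x => complex.Re (f x * conjc (g x))).
Proof.
move=> [fL _] [gL _].
have := integD (cLp2_integ fL) (cLp2_integ gL); apply: integ_le => [|x].
  by have [] := cmeasM fL.1 (cmeasJ gL.1).
rewrite (le_trans (Re_le _))// ncM ncJ.
have := sqr_ge0 (nc (f x) - nc (g x)); have := nc_ge0 (f x); have := nc_ge0 (g x); nra.
Qed.

Lemma qform_inner (I : finType) (g : I -> R -> R[i]) (a : I -> R) :
  (forall i, herm (g i)) ->
  qform (fun i k => inner (g i) (g k)) a =
  sqnormL2 mu (fun x => \sum_i (a i)%:C * g i x).
Proof.
move=> gh; rewrite /qform /sqnormL2.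
transitivity (\sum_i \sum_k \int[mu]_x (a i * a k * complex.Re (g i x * conjc (g k x)))).
  by apply: eq_bigr => i _; apply: eq_bigr => k _; rewrite rintZ//; exact: integ_inner.
have i1 i k : integ mu (fun x => a i * a k * complex.Re (g i x * conjc (g k x))).
  by apply: integZ; exact: integ_inner.
under eq_bigr => i _ do rewrite -(rint_sum _ (fun k _ => i1 i k)).
rewrite -rint_sum; last by move=> i _; apply: integ_sum => k _.
apply: eq_rint => x.
rewrite nc_sqr Re_sum Im_sum !expr2 !mulr_suml -big_split/=; apply: eq_bigr => i _.
rewrite !mulr_sumr -big_split/=; apply: eq_bigr => k _.
by rewrite !ReM !ImM ReJ ImJ /=; ring.
Qed.

End tuple_integrals.

Section first_chaos.
Context (R : realType) d (T : measurableType d) (P : probability T R).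
Local Notation mu := (@lebesgue_measure R).
Local Notation nc := (@Normc.normc R).
Variables (W : set R -> T -> R[i]) (I : forall m, (m.-tuple R -> R[i]) -> T -> R).
Hypotheses (HW : gaussian_random_measure P W) (HI : wiener_ito P W I).

Definition X1 (g : R -> R[i]) : T -> R := I (@tensor_pow R 1 g).

Lemma expectation_rint (Y : T -> R) (r : R) : measurable_fun setT Y ->
  (forall y, 0 <= Y y) -> ('E_P[Y] = r%:E)%E -> integ P Y /\ \int[P]_y Y y = r.
Proof.
move=> mY Y0; rewrite unlock => E; split; last by rewrite /Rintegral E.
by apply: ge0_integ => //; rewrite E ltry.
Qed.

Lemma I_isometry m f : (0 < m)%N -> @herm_tensor R m f -> Defs.Sym f = f ->
  [/\ measurable_fun setT (I f), integ P (fun y => I f y ^+ 2) &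
  \int[P]_y I f y ^+ 2 = m`!%:R * sqnormL2 (lebesgue_tuple R m) f].
Proof.
move=> m0 fh fS; have [H _ _ _] := HI.
have [mI _ E] := H m f m0 (herm_tensor_Hbar fh).
rewrite fS in E.
have mI2 : measurable_fun setT (fun y => I f y ^+ 2) by exact: measurable_funX.
by have [] := expectation_rint mI2 (fun y => sqr_ge0 _) E.
Qed.

Lemma I_sum m (J : Type) (s : seq J) (c : J -> R) (f : J -> m.-tuple R -> R[i]) :
  (0 < m)%N -> (forall j, @herm_tensor R m (f j)) ->
  {ae P, forall y, I (fun x => \sum_(j <- s) (c j)%:C * f j x) y =
     \sum_(j <- s) c j * I (f j) y}.
Proof.
move=> m0 fh; have [_ L _ _] := HI.
elim: s => [|j s ih].
  have := L m _ _ 0 0 m0 (herm_tensor_Hbar (herm_tensor0 R m)) (herm_tensor_Hbar (herm_tensor0 R m)).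
  apply: filterS => y E; rewrite big_nil.
  transitivity (0 * I (fun _ : m.-tuple R => 0) y + 0 * I (fun _ : m.-tuple R => 0) y).
    by rewrite -E; congr (I _ y); apply/funext => x; rewrite big_nil !mulr0 addr0.
  by rewrite !mul0r addr0.
have := L m _ _ (c j) 1 m0 (herm_tensor_Hbar (fh j))
  (herm_tensor_Hbar (herm_tensor_sum s c fh)).
apply: filterS2 ih => y E1; rewrite big_cons -E1 mul1r => <-; congr (I _ y).
by apply/funext => x; rewrite big_cons mul1r.
Qed.

Lemma X1_sum (J : Type) (s : seq J) (c : J -> R) (g : J -> R -> R[i]) :
  (forall j, herm (g j)) ->
  {ae P, forall y, X1 (fun x => \sum_(j <- s) (c j)%:C * g j x) y =
     \sum_(j <- s) c j * X1 (g j) y}.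
Proof.
move=> gh.
have := @I_sum 1 J s c (fun j => @tensor_pow R 1 (g j)) isT
  (fun j => @tensor_pow_herm R 1 _ (gh j)).
rewrite (_ : (fun x => \sum_(j <- s) _) =
   @tensor_pow R 1 (fun x => \sum_(j <- s) (c j)%:C * g j x))//.
apply/funext => x; rewrite tensor_pow1; apply: eq_bigr => j _.
by rewrite tensor_pow1.
Qed.

Lemma X1_moment g : herm g -> [/\ measurable_fun setT (X1 g),
  integ P (fun y => X1 g y ^+ 2) & \int[P]_y X1 g y ^+ 2 = sqnormL2 mu g].
Proof.
move=> gh.
have [//|mI i2 ->] := @I_isometry 1 _ _ (@tensor_pow_herm R 1 _ gh) (@Sym_tensor_pow R 1 g).
by split => //; rewrite sqnorm_tensor_pow// expr1 mul1r.
Qed.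

(** The Gaussian clause for [W] leaves the mean of the combination open; it vanishes because each
    [W (D k)] has mean zero. *)
Lemma W_combination_gaussian n (D : 'I_n -> set R) (c : 'I_n -> R[i]) :
  (forall k, finite_borel (D k)) ->
  exists v, gaussian_rv P (fun y => complex.Re (\sum_k c k * W (D k) y)) 0 v.
Proof.
move=> fD; have [_ G _ mean _] := HW.
have single (z : R[i]) k : integ P (fun y => complex.Re (z * W (D k) y)).
  have [|m [v /gaussian_rv_moments[+ _ _ _]]] := G 1%N (fun=> D k) (fun=> z) => //.
  by under eq_fun do rewrite big_ord1.
have iR k : integ P (fun y => complex.Re (W (D k) y)).
  by have := single 1 k; under eq_fun do rewrite mul1r.
have iI k : integ P (fun y => complex.Im (W (D k) y)).
  (* The multiplier [- i] turns the real part into the imaginary part. *)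
  have := single (0 -i* 1) k.
  rewrite (_ : (fun y => complex.Re _) = fun y => complex.Im (W (D k) y))//.
  by apply/funext => y; rewrite ReM /= mul0r mulN1r opprK add0r.
have [m [v gZ]] := G n D c fD.
exists v; suff <- : m = 0 by [].
have [_ <- _ _] := gaussian_rv_moments gZ.
transitivity (\int[P]_y \sum_k (complex.Re (c k) * complex.Re (W (D k) y) -
    complex.Im (c k) * complex.Im (W (D k) y))).
  by apply: eq_rint => y; rewrite Re_sum; apply: eq_bigr => k _; rewrite ReM.
rewrite rint_sum; last by move=> k _; apply: integB; exact: integZ.
rewrite big1// => k _; rewrite rintB; [|exact: integZ|exact: integZ].
have := mean _ (fD k); rewrite /cintegral => -[e1 e2].
by rewrite !rintZ// e1 e2 !mulr0 subrr.
Qed.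

(** [X1 g] is real, so the real parts of the simple integrals approximate it at least as well in
    [L^2], and they are centred Gaussian. *)
Lemma X1_cos g s c : herm g ->
  \int[P]_y cos (s * X1 g y + c) = expR (- (s ^+ 2 * sqnormL2 mu g / 2)) * cos c.
Proof.
move=> gh; have [mY iY2 E] := X1_moment gh; rewrite -E.
apply: l2_limit_cos => // e e0; have [_ _ WI _] := HI.
have [n [cc [D [fD _ h]]]] := WI g (herm_Hbar gh) e e0.
have [v gZ] := W_combination_gaussian cc fD.
exists (fun y => complex.Re (\sum_k cc k * W (D k) y)), v; split => //.
have [_ mZ _] := gZ.
have [mW _ _ _ _] := HW.
have mc : cmeasurable (fun y => (X1 g y)%:C - \sum_k cc k * W (D k) y).
  have -> : (fun y => (X1 g y)%:C - \sum_k cc k * W (D k) y) =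
     fun y => (X1 g y)%:C + (-1) * \sum_k cc k * W (D k) y.
    by apply/funext => y; rewrite mulN1r.
  apply: cmeasD; first exact: cmeasR.
  apply: cmeasM; first exact: cmeas_cst.
  by apply: cmeas_sum => k; apply: cmeasM; [exact: cmeas_cst|exact: mW].
have i2 : integ P (fun y => nc ((X1 g y)%:C - \sum_k cc k * W (D k) y) ^+ 2).
  apply: ge0_integ; first by apply: measurable_funX; exact: measurable_nc.
    by move=> y; exact: sqr_ge0.
  exact: lt_trans h (ltry _).
have le2 : \int[P]_y nc ((X1 g y)%:C - \sum_k cc k * W (D k) y) ^+ 2 <= e.
  by rewrite -lee_fin rintE// ltW.
apply: le_trans le2; apply: le_rint => //.
  apply: integ_le i2 => [|y].
    by apply: measurable_funX; exact: measurable_funB.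
  rewrite ger0_norm ?sqr_ge0// nc_sqr ReD ReN /= lerDl; exact: sqr_ge0.
by move=> y; rewrite nc_sqr ReD ReN /= lerDl; exact: sqr_ge0.
Qed.

(** By linearity a combination of the integrals is almost surely the integral of the combination,
    whose variance is the quadratic form of the scalar products. *)
Lemma X1_gfam (J : finType) (g : J -> R -> R[i]) : (forall j, herm (g j)) ->
  gfam P (fun j => X1 (g j)) (fun j k => inner (g j) (g k)).
Proof.
move=> gh; split.
- by move=> j; have [] := X1_moment (gh j).
- move=> j k; apply: eq_rint => x; rewrite !ReM !ReJ !ImJ; ring.
move=> a c; rewrite qform_inner//.
have hs := herm_sum (index_enum J) a gh.
have := X1_cos 1 c hs; rewrite expr1n mul1r => <-.
rewrite /Rintegral; congr fine; apply: ae_eq_integral => //.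
- apply/measurable_EFinP; apply: measurableT_comp; first exact: measurable_cos.
  apply: measurable_funD => //; apply: measurable_sum => j; apply: measurable_funM => //.
  by have [] := X1_moment (gh j).
- apply/measurable_EFinP; apply: measurableT_comp; first exact: measurable_cos.
  apply: measurable_funD => //; apply: measurable_funM => //.
  by have [] := X1_moment hs.
have := X1_sum (index_enum J) a gh; apply: filterS => y E _.
by rewrite E mul1r.
Qed.

Lemma I_tensor_pow m g : (0 < m)%N -> herm g -> sqnormL2 mu g = 1 ->
  {ae P, forall y, I (@tensor_pow R m g) y = (He R m).[X1 g y]}.
Proof.
move=> m0 gh g1; have [_ _ _ H] := HI.
have := H m g m0 (herm_Hbar gh) g1; apply: filterS => y ->.
by rewrite hermiteE.
Qed.

End first_chaos.

(** * Approximation of the chaos kernels *)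

Section lebesgue_scaling.
Context (R : realType).
Local Notation mu := (@lebesgue_measure R).

(** The rescaled image of Lebesgue measure agrees with it on half-open intervals, hence on all
    measurable sets. *)
Lemma ge0_integral_scale (e : R) (g : R -> R) : 0 < e ->
  measurable_fun setT g -> (forall x, 0 <= g x) ->
  (\int[mu]_x (g x)%:E = e%:E * \int[mu]_x (g (e * x))%:E)%E.
Proof.
move=> e0 mg g0.
have me : measurable_fun setT (fun x : measurableTypeR R => (e * x : measurableTypeR R)).
  exact: measurable_funM.
pose nu0 : {measure set (measurableTypeR R) -> \bar R} :=
  measure_function_pushforward__canonical__measure_function_Measure mu me.
pose nu : {measure set (measurableTypeR R) -> \bar R} := mscale (NngNum (ltW e0)) nu0.
have E A : measurable A -> mu A = nu A.
  apply: lebesgue_measure_unique => _ [[a b]] _ <-.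
  rewrite /nu /= /mscale /= /pushforward.
  rewrite (_ : (fun x => e * x) @^-1` `]a, b] = `]a / e, b / e]%classic); last first.
    by apply/seteqP; split => x /=; rewrite !in_itv/= ltr_pdivrMr// ler_pdivlMr// mulrC.
  rewrite !lebesgue_measure_itv/= !lte_fin ltr_pM2r ?invr_gt0//.
  case: ifPn => _; rewrite ?mule0// -!EFinB -EFinM; congr EFin.
  by field; rewrite gt_eqF.
have mg' : measurable_fun setT (EFin \o g) by exact/measurable_EFinP.
rewrite (@eq_measure_integral _ _ _ _ nu)//.
  rewrite ge0_integral_mscale//=; last by move=> x _; rewrite lee_fin.
  congr (_ * _)%E.
  by rewrite ge0_integral_pushforward// => x _; rewrite lee_fin.
by move=> A mA _; exact: E.
Qed.

Lemma integ_scale (e : R) (g : R -> R) : 0 < e -> integ mu g ->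
  integ mu (fun x => g (e * x)) /\
  \int[mu]_x g (e * x) = e^-1 * \int[mu]_x g x.
Proof.
move=> e0 ig.
have mg := integ_measurable ig.
have pos (f : R -> R) : (forall x, 0 <= f x) -> integ mu f ->
    integ mu (fun x => f (e * x)) /\
    \int[mu]_x f (e * x) = e^-1 * \int[mu]_x f x.
  move=> f0 jf; have mf := integ_measurable jf.
  have E := ge0_integral_scale e0 mf f0.
  have i1 : integ mu (fun x => f (e * x)).
    apply: ge0_integ => //.
      by apply: (measurableT_comp mf); exact: measurable_funM.
    rewrite -(@lte_pmul2l _ e%:E)// ?fin_numE// ?lte_fin// -E.
    by rewrite gt0_muley// ?lte_fin//; exact: ge0_integ_lty.
  split => //.
  move: E; rewrite -rintE// -rintE// -EFinM => -[->].
  by rewrite mulKf// gt_eqF.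
have ip := integ_norm ig.
have [i1 e1] := pos _ (fun x => normr_ge0 (g x)) ip.
have q0 x : 0 <= `|g x| + g x by have := ler_norm (- g x); rewrite normrN; lra.
have [i2 e2] := pos _ q0 (integD ip ig).
have -> : (fun x => g (e * x)) = fun x => (`|g (e * x)| + g (e * x)) - `|g (e * x)|.
  by apply/funext => x; rewrite addrAC subrr add0r.
split; first exact: integB.
by rewrite rintB// e1 e2 rintD//; ring.
Qed.

End lebesgue_scaling.

(** * Quadrature against an integrable function *)

Section quadrature.
Context (R : realType).
Local Notation mu := (@lebesgue_measure R).
Variable u : R -> R.
Hypothesis iu : integ mu u.

Let mu_ : measurable_fun setT u. Proof. exact: integ_measurable iu. Qed.

Let cell (n : nat) (k : int) (t : R) : R := (Num.floor (n.+1%:R * t) == k)%:R.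

Let measurable_cell n k : measurable_fun setT (cell n k).
Proof.
rewrite (_ : cell n k = \1_((fun t : R => n.+1%:R * t) @^-1` `[k%:~R, (k + 1)%:~R[%classic)).
  apply: measurable_indic; rewrite -[X in measurable X]setTI.
  exact: (@measurable_funM _ _ R setT (fun=> n.+1%:R) id).
apply/funext => t; rewrite indicE /cell; congr (_ %:R); congr nat_of_bool; apply/idP/idP.
  by move=> /eqP <-; rewrite inE/= in_itv/=; exact: floor_itv.
by rewrite inE/= in_itv/= => h; rewrite floor_eq.
Qed.

(* Cells of width 1/(n+1) covering [-(n+1), n+1). *)
Definition qsize (n : nat) : nat := 2 * n.+1 ^ 2.
Let cell_index n (z : int) : (- (n.+1 ^ 2)%N%:Z <= z)%R -> (z < (n.+1 ^ 2)%N%:Z)%R ->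
  (absz (z + (n.+1 ^ 2)%N%:Z)%R)%:Z = (z + (n.+1 ^ 2)%N%:Z)%R /\
  (absz (z + (n.+1 ^ 2)%N%:Z)%R < qsize n)%N.
Proof.
move=> g1 g2.
have E : (absz (z + (n.+1 ^ 2)%N%:Z)%R)%:Z = (z + (n.+1 ^ 2)%N%:Z)%R.
  by rewrite gez0_abs//; lia.
by split => //; rewrite /qsize; lia.
Qed.

Let idx n (k : 'I_(qsize n)) : int := (k : nat)%:Z - (n.+1 ^ 2)%N%:Z.
Definition qpoint n (k : 'I_(qsize n)) : R := (idx k)%:~R / n.+1%:R.
(** Integrals of [u] over the cells, not values of [u]: the rule then converges for every integrable
    [u], with total variation at most its [L^1] norm. *)
Definition qweight n (k : 'I_(qsize n)) : R := \int[mu]_t (u t * cell n (idx k) t).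

Let idx_inj n : injective (@idx n).
Proof. by move=> k k' /addIr[] /val_inj. Qed.

Let sum_cell n t (g : 'I_(qsize n) -> R) :
  \sum_k g k * cell n (idx k) t = if [pick k | Num.floor (n.+1%:R * t) == idx k] is Some k
    then g k else 0.
Proof.
case: pickP => [k /eqP kt|no].
  rewrite (bigD1 k)//= {1}/cell kt eqxx mulr1 big1 ?addr0// => k' k'k.
  rewrite /cell kt (negbTE (_ : idx k != idx k')) ?mulr0//.
  by apply: contra k'k => /eqP/idx_inj ->.
by rewrite big1// => k _; rewrite /cell no mulr0.
Qed.

Let sum_cell_le n t (g : 'I_(qsize n) -> R) b : 0 <= b -> (forall k, `|g k| <= b) ->
  `|\sum_k g k * cell n (idx k) t| <= b.
Proof. by move=> b0 gb; rewrite sum_cell; case: pickP => // _; rewrite normr0. Qed.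

Let icell n k : integ mu (fun t => u t * cell n k t).
Proof.
apply: integ_le (integ_norm iu) => [|t].
  by apply: measurable_funM; [exact: mu_|exact: measurable_cell].
rewrite normrM ler_piMr// /cell; case: eqP => _; rewrite ?normr1 ?normr0//.
Qed.

Lemma qweight_sum n : \sum_k `|@qweight n k| <= \int[mu]_t `|u t|.
Proof.
have ia k : integ mu (fun t => `|u t| * cell n k t).
  have := integ_norm (icell n k); rewrite (_ : (fun t => `|u t * cell n k t|) =
    fun t => `|u t| * cell n k t)//.
  by apply/funext => t; rewrite normrM [X in _ * X]ger0_norm// /cell; case: eqP.
apply: (@le_trans _ _ (\sum_(k < qsize n) \int[mu]_t (`|u t| * cell n (idx k) t))).
  apply: ler_sum => k _; apply: le_abs_rint => //; first exact: (integ_measurable (icell _ _)).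
  by move=> t; rewrite normrM [X in _ * X]ger0_norm// /cell; case: eqP.
rewrite -rint_sum//; apply: le_rint; [by apply: integ_sum|exact: integ_norm|] => t.
rewrite (le_trans (ler_norm _))// sum_cell_le//.
by move=> k; rewrite normr_id.
Qed.

(** The sum is the integral of [u] against the step function [Gn], which converges to [G] pointwise
    and is bounded by 1. *)
Lemma quadrature_cvg (G : R -> R) L : 0 <= L -> (forall t, `|G t| <= 1) -> lip1 L G ->
  \sum_k @qweight n k * G (@qpoint n k) @[n --> \oo] --> \int[mu]_t (u t * G t).
Proof.
move=> L0 G1 GL.
pose Gn n t := \sum_(k < qsize n) G (qpoint k) * cell n (idx k) t.
have E n : \sum_k @qweight n k * G (@qpoint n k) = \int[mu]_t (u t * Gn n t).
  transitivity (\sum_(k < qsize n) \int[mu]_t (G (qpoint k) * (u t * cell n (idx k) t))).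
    by apply: eq_bigr => k _; rewrite (rintZ _ (icell n (idx k))) mulrC.
  rewrite -rint_sum; last by move=> k _; exact: integZ.
  by apply: eq_rint => t; rewrite mulr_sumr; apply: eq_bigr => k _; rewrite mulrCA.
under eq_fun do rewrite E.
have mGn n : measurable_fun setT (fun t => u t * Gn n t).
  apply: measurable_funM => //; apply: measurable_sum => k.
  by apply: measurable_funM.
have dom n t : `|u t * Gn n t| <= `|u t|.
  by rewrite normrM ler_piMr// sum_cell_le.
apply: (@rint_dct _ _ R mu _ _ _ mGn _ (integ_norm iu) dom).2 => t.
apply: cvgM; first exact: cvg_cst.
apply/subr_cvg0; apply: norm_cvg0.
have h : L * n.+1%:R^-1 @[n --> \oo] --> L * 0 by apply: cvgM; [exact: cvg_cst|exact: cvg_harmonic].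
rewrite mulr0 in h.
apply: (squeeze_cvgr _ (cvg_cst 0) h); near=> n; rewrite normr_ge0/=.
have tn : `|t| + 1 <= n.+1%:R.
  have : `|t| + 1 <= n%:R by near: n; exact: nbhs_infty_ger.
  by move=> /le_trans; apply; rewrite ler_nat.
have n0 : 0 < n.+1%:R :> R by [].
have /andP[f1 f2] := floor_itv (n.+1%:R * t).
rewrite /Gn sum_cell; case: pickP => [k /eqP kt|no].
  rewrite (le_trans (GL _ _))// ler_wpM2l// /qpoint -kt.
  rewrite (_ : _ - t = (((Num.floor (n.+1%:R * t))%:~R) - n.+1%:R * t) / n.+1%:R); last first.
    by field; rewrite gt_eqF.
  rewrite normrM normfV (gtr0_norm n0) ler_pdivrMr// mulVf ?gt_eqF//.
  rewrite distrC ger0_norm ?subr_ge0// lerBlDl ltW//.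
  by move: f2; rewrite intrD.
(* Once [n + 1 >= |t| + 1], the point [t] lies in the covered range, so some cell contains it. *)
exfalso.
have K2 : (n.+1 ^ 2)%N%:R = n.+1%:R ^+ 2 :> R by rewrite natrX.
have hb : `|n.+1%:R * t| + n.+1%:R <= n.+1%:R ^+ 2.
  by rewrite normrM (gtr0_norm n0) expr2 -[X in _ + X]mulr1 -mulrDr ler_wpM2l// ltW.
have n1 : 1 <= n.+1%:R :> R by rewrite ler1n.
have /andP[b1 b2] : - ((n.+1 ^ 2)%N%:R : R) <= n.+1%:R * t < (n.+1 ^ 2)%N%:R.
  rewrite K2; apply/andP; split.
    by have := ler_norm (- (n.+1%:R * t)); rewrite normrN; lra.
  by have := ler_norm (n.+1%:R * t); lra.
have g1 : (- ((n.+1 ^ 2)%N%:Z) <= Num.floor (n.+1%:R * t))%R.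
  by rewrite floor_ge_int rmorphN.
have g2 : (Num.floor (n.+1%:R * t) < ((n.+1 ^ 2)%N%:Z))%R.
  by rewrite floor_lt_int.
set z := Num.floor _ in g1 g2 no.
pose z' : nat := absz (z + (n.+1 ^ 2)%N%:Z)%R.
have [z'E zk] := cell_index g1 g2.
have := no (Ordinal zk); rewrite /idx/= z'E.
by rewrite addrK eqxx.
Unshelve. all: by end_near. Qed.

End quadrature.

(** * Fourier transforms of real functions *)

Section fourier_real.
Context (R : realType).
Local Notation mu := (@lebesgue_measure R).
Local Notation nc := (@Normc.normc R).

Definition ft (u : R -> R) : R -> R[i] := fourier (fun t => (u t)%:C).

Lemma Re_ft u s : complex.Re (ft u s) = \int[mu]_t (u t * cos (s * t)).
Proof.
by apply: eq_rint => t; rewrite ReM /= mulr0 subr0 cosN mulrC [t * s]mulrC.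
Qed.

Section transform.
Variable u : R -> R.
Hypothesis iu : integ mu u.

Let mtrig (s : R) : measurable_fun setT (fun t : R => cos (s * t)) /\
  measurable_fun setT (fun t : R => sin (s * t)).
Proof.
have ms : measurable_fun setT (fun t : R => s * t) by exact: measurable_funM.
split; first exact: (measurableT_comp (@measurable_cos R) ms).
apply: (measurableT_comp _ ms).
by apply: continuous_measurable_fun => x; exact: continuous_sin.
Qed.

Let icos s : integ mu (fun t => u t * cos (s * t)).
Proof.
apply: integ_le (integ_norm iu) => [|t].
  by apply: measurable_funM; [exact: integ_measurable iu|exact: (mtrig s).1].
by rewrite normrM ler_piMr// normr_cos.
Qed.

Let isin s : integ mu (fun t => u t * sin (s * t)).
Proof.
apply: integ_le (integ_norm iu) => [|t].
  by apply: measurable_funM; [exact: integ_measurable iu|exact: (mtrig s).2].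
by rewrite normrM ler_piMr// normr_sin.
Qed.

Lemma Im_ft s : complex.Im (ft u s) = - \int[mu]_t (u t * sin (s * t)).
Proof.
rewrite -rintN//.
by apply: eq_rint => t; rewrite ImM /= mulr0 add0r sinN mulNr mulrC [t * s]mulrC.
Qed.

Lemma ftN s : ft u (- s) = conjc (ft u s).
Proof.
apply: complex_ext; rewrite ?ReJ ?ImJ ?Re_ft ?Im_ft.
  by apply: eq_rint => t; rewrite mulNr cosN.
rewrite opprK -rintN//; first by apply: eq_rint => t; rewrite mulNr sinN mulrN opprK.
Qed.

Lemma ft_le s : nc (ft u s) <= 2 * \int[mu]_t `|u t|.
Proof.
rewrite (le_trans (nc_le _))// Re_ft Im_ft normrN mulr_natl mulr2n lerD//.
  apply: le_abs_rint; [exact: integ_measurable (icos s)|exact: integ_norm|] => t.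
  by rewrite normrM ler_piMr// normr_cos.
apply: le_abs_rint; [exact: integ_measurable (isin s)|exact: integ_norm|] => t.
by rewrite normrM ler_piMr// normr_sin.
Qed.

Let trig_cvg (G : R -> R) (s : R) (v : nat -> R) :
  (forall x y : R, `|G y - G x| <= `|y - x|) -> (forall x, `|G x| <= 1) ->
  (forall s, integ mu (fun t => u t * G (s * t))) ->
  v n @[n --> \oo] --> s ->
  \int[mu]_t (u t * G (v n * t)) @[n --> \oo] --> \int[mu]_t (u t * G (s * t)).
Proof.
move=> GL G1 iG vs.
have mf n : measurable_fun setT (fun t => u t * G (v n * t)) by exact: integ_measurable (iG _).
have dom n t : `|u t * G (v n * t)| <= `|u t| by rewrite normrM ler_piMr.
apply: (@rint_dct _ _ R mu _ _ _ mf _ (integ_norm iu) dom).2 => t.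
apply: cvgM; first exact: cvg_cst.
apply/subr_cvg0; apply: norm_cvg0.
have h : `|v n * t - s * t| @[n --> \oo] --> `|s * t - s * t|.
  apply: cvg_norm; apply: cvgB; last exact: cvg_cst.
  by apply: cvgM => //; exact: cvg_cst.
rewrite subrr normr0 in h.
by apply: (squeeze_cvgr _ (cvg_cst 0) h); apply: nearW => n; rewrite normr_ge0 GL.
Qed.

Lemma continuous_Re_ft : continuous (fun s => complex.Re (ft u s)).
Proof.
move=> s; apply/(@cvg_nbhsP _ R^o) => v vs.
under eq_fun do rewrite Re_ft; rewrite Re_ft.
by apply: trig_cvg => //; [exact: cos_lip|exact: normr_cos].
Qed.

Lemma continuous_Im_ft : continuous (fun s => complex.Im (ft u s)).
Proof.
move=> s; apply/(@cvg_nbhsP _ R^o) => v vs.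
under eq_fun do rewrite Im_ft; rewrite Im_ft; apply: cvgN.
by apply: trig_cvg => //; [exact: sin_lip|exact: normr_sin].
Qed.

Lemma continuous_nc_ft : continuous (fun s => nc (ft u s)).
Proof.
pose f s := complex.Re (ft u s); pose g s := complex.Im (ft u s).
have -> : (fun s => nc (ft u s)) = fun s => Num.sqrt (f s * f s + g s * g s).
  by apply/funext => t; rewrite /f /g; case: (ft u t) => a b /=; rewrite -!expr2.
move=> s; have cf := @continuous_Re_ft s; have cg := @continuous_Im_ft s.
apply: (@continuous_comp _ _ _ (fun s => f s * f s + g s * g s) Num.sqrt).
  exact: cvgD (cvgM cf cf) (cvgM cg cg).
exact: sqrt_continuous.
Qed.

Lemma cmeasurable_ft : cmeasurable (T := measurableTypeR R) (ft u).
Proof.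
split; apply: continuous_measurable_fun;
  (exact: continuous_Re_ft || exact: continuous_Im_ft).
Qed.

(** The conjugate appears because the exponentials carry the sign opposite to that of the Fourier
    transform. *)
Lemma quadrature_ft s : ccvg \oo
  (fun n => \sum_k (@qweight R u n k)%:C * cis (s * @qpoint R n k)) (conjc (ft u s)).
Proof.
have lipG (G : R -> R) : (forall x y : R, `|G y - G x| <= `|y - x|) ->
    lip1 `|s| (fun t => G (s * t)).
  by move=> GL x y; rewrite (le_trans (GL _ _))// -mulrBr normrM.
split.
  rewrite ReJ Re_ft (_ : (fun n => _) = fun n =>
    \sum_k @qweight R u n k * cos (s * @qpoint R n k)).
    apply: (quadrature_cvg iu (L := `|s|)) => //; last exact: (lipG _ (@cos_lip R)).
    by move=> t; exact: normr_cos.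
  by apply/funext => n; rewrite Re_sum; apply: eq_bigr => k _; rewrite ReM /= mul0r subr0.
rewrite ImJ Im_ft opprK (_ : (fun n => _) = fun n =>
    \sum_k @qweight R u n k * sin (s * @qpoint R n k)).
  apply: (quadrature_cvg iu (L := `|s|)) => //; last exact: (lipG _ (@sin_lip R)).
  by move=> t; exact: normr_sin.
by apply/funext => n; rewrite Im_sum; apply: eq_bigr => k _; rewrite ImM /= mul0r addr0.
Qed.

End transform.

(** Invariance of the [L^1] norm under dilation is the reason why the supremum bound on the
    transform of [phi_J] does not depend on [J]. *)
Lemma dilate_integ (u : R -> R) (J : int) : integ mu u ->
  integ mu (dilate_phi u J) /\ \int[mu]_t `|dilate_phi u J t| = \int[mu]_t `|u t|.
Proof.
move=> iu; have e0 : 0 < 2 ^ (- J) :> R by rewrite exprz_gt0.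
have [i1 _] := integ_scale e0 iu.
have [i2 e2] := integ_scale e0 (integ_norm iu).
split; first exact: integZ.
transitivity (\int[mu]_t (2 ^ (- J) * `|u (2 ^ (- J) * t)|)).
  by apply: eq_rint => t; rewrite /dilate_phi normrM (gtr0_norm e0).
by rewrite rintZ// e2 mulVKf// gt_eqF.
Qed.

Lemma ft_dilate (u : R -> R) (J : int) s : integ mu u ->
  ft (dilate_phi u J) s = ft u (2 ^ J * s).
Proof.
move=> iu; have e0 : 0 < 2 ^ (- J) :> R by rewrite exprz_gt0.
have [iJ _] := dilate_integ J iu.
have e1 t : 2 ^ J * s * (2 ^ (- J) * t) = s * t :> R.
  have n0 : 2 ^ J != 0 :> R by rewrite expfz_neq0.
  by rewrite -invr_expz; field.
have key (G : R -> R) : integ mu (fun t => u t * G (2 ^ J * s * t)) ->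
    \int[mu]_t (dilate_phi u J t * G (s * t)) = \int[mu]_t (u t * G (2 ^ J * s * t)).
  move=> iG; have [i2 e2] := integ_scale e0 iG.
  transitivity (\int[mu]_t (2 ^ (- J) * (u (2 ^ (- J) * t) * G (2 ^ J * s * (2 ^ (- J) * t))))).
    by apply: eq_rint => t; rewrite e1 mulrA.
  by rewrite rintZ// e2 mulVKf// gt_eqF.
have mtrig (G : R -> R) : (forall x, `|G x| <= 1) -> continuous G ->
    integ mu (fun t => u t * G (2 ^ J * s * t)).
  move=> G1 cG; apply: integ_le (integ_norm iu) => [|t].
    apply: measurable_funM; first exact: integ_measurable iu.
    by apply: (measurableT_comp (continuous_measurable_fun cG)); exact: measurable_funM.
  by rewrite normrM ler_piMr.
apply: complex_ext; rewrite ?Re_ft ?Im_ft//.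
  by apply: key; apply: mtrig; [exact: normr_cos|exact: continuous_cos].
by congr -%R; apply: key; apply: mtrig; [exact: normr_sin|exact: continuous_sin].
Qed.

End fourier_real.

(** * Selecting balanced signs by roots of unity *)

Section roots_of_unity.
Context (R : realType).
Local Notation nc := (@Normc.normc R).

Lemma conjcM (x y : R[i]) : conjc (x * y) = conjc x * conjc y.
Proof. by case: x => a b; case: y => a' b'; apply: complex_ext => /=; ring. Qed.

Lemma conjc_sum (I : Type) (s : seq I) (f : I -> R[i]) :
  conjc (\sum_(i <- s) f i) = \sum_(i <- s) conjc (f i).
Proof. by elim/big_rec2 : _ => [|i y1 y2 _ <-]; rewrite ?conjc0 ?conjcD. Qed.

Lemma cisX (a : R) n : cis a ^+ n = cis (n%:R * a).
Proof.
elim: n => [|n ih]; first by rewrite expr0 mul0r cis0.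
by rewrite exprS ih -cisD -natr1 mulrDl mul1r addrC.
Qed.

Lemma cis_neq1 (a : R) : 0 < a < pi -> cis (2 * a) != 1 :> R[i].
Proof.
move=> api; apply/eqP => /(congr1 (@complex.Re R)) /=.
rewrite mulr_natl mulr2n cosD -!expr2 cos2sin2 => E.
have := sin_gt0_pi api; have : sin a ^+ 2 = 0 by lra.
by move=> /eqP; rewrite expf_eq0 => /andP[_ /eqP ->]; rewrite ltxx.
Qed.

Lemma cis_2pi (d : nat) : cis (d%:R * (2 * pi)) = 1 :> R[i].
Proof.
rewrite -cisX; have -> : cis (2 * pi) = 1 :> R[i]; last by rewrite expr1n.
have -> : 2 * pi = pi + pi :> R by ring.
have c1 : cos (pi + pi) = 1 :> R by rewrite cosD cospi sinpi; ring.
have s1 : sin (pi + pi) = 0 :> R by rewrite sinD cospi sinpi; ring.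
by rewrite /cis c1 s1.
Qed.

Lemma sum_roots (M d : nat) : (0 < d < M)%N ->
  \sum_(s < M) cis (2 * pi * s%:R / M%:R * d%:R) = 0 :> R[i].
Proof.
move=> /andP[d0 dM]; have M0 : (0 < M)%N by exact: leq_ltn_trans dM.
have M0' : M%:R != 0 :> R by rewrite pnatr_eq0 -lt0n.
pose z : R[i] := cis (2 * (pi * d%:R / M%:R)).
have E s : cis (2 * pi * s%:R / M%:R * d%:R) = z ^+ s :> R[i].
  by rewrite /z cisX; congr cis; ring.
under eq_bigr do rewrite E.
have z1 : z != 1.
  apply: cis_neq1; rewrite divr_gt0 ?mulr_gt0 ?pi_gt0 ?ltr0n//=.
  by rewrite ltr_pdivrMr ?ltr0n// ltr_pM2l ?pi_gt0// ltr_nat.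
have zM : z ^+ M = 1.
  rewrite /z cisX -(cis_2pi d); congr cis; field; exact: M0'.
apply/eqP; have := subrX1 z M; rewrite zM subrr => /esym/eqP.
by rewrite mulf_eq0 subr_eq0 (negbTE z1).
Qed.

Lemma sum_rootsZ (M : nat) (d : int) : (`|d| < M)%N ->
  \sum_(s < M) cis (2 * pi * s%:R / M%:R * d%:~R) = (if d == 0 then M%:R else 0) :> R[i].
Proof.
move=> dM; case: eqP => [->|/eqP d0].
  by under eq_bigr do rewrite mulr0 cis0; rewrite sumr_const card_ord.
have d1 : (0 < `|d|)%N by rewrite absz_gt0.
have := @sum_roots M `|d| (introT andP (conj d1 dM)).
case: d d0 dM d1 => [d|d] _ _ _ //=.
move=> /(congr1 conjc); rewrite conjc0 conjc_sum => H.
rewrite -[RHS]H; apply: eq_bigr => s _.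
by rewrite -cisN NegzE rmorphN mulrN.
Qed.

(** This integer vanishes exactly when half of the frequencies are negative, which is the condition
    in the chaos kernels. *)
Lemma sum_sg (l : nat) (x : l.-tuple R) : (forall k, tnth x k != 0) ->
  \sum_(k < l) Num.sg (tnth x k) =
  (l%:Z - (2 * count (fun y => y < 0)%R x)%N%:Z)%:~R.
Proof.
move=> x0.
have -> : count (fun y => y < 0) x = (\sum_(k < l) (tnth x k < 0)%R)%N.
  by rewrite -sum1_count big_tuple big_mkcond; apply: eq_bigr => k _; case: ifP.
have E k : Num.sg (tnth x k) = 1 - 2 * (tnth x k < 0)%R%:R.
  have [h|h|/eqP h] := ltgtP (tnth x k) 0.
  - by rewrite ltr0_sg//=; ring.
  - by rewrite gtr0_sg//=; ring.
  - by rewrite (negbTE (x0 k)) in h.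
under eq_bigr do rewrite E.
rewrite sumrB sumr_const card_ord -mulr_sumr -natr_sum.
by rewrite rmorphB/= -!pmulrn natrM.
Qed.

End roots_of_unity.

Lemma measurable_sg (R : realType) :
  measurable_fun setT (fun x : measurableTypeR R => Num.sg (x : R)).
Proof.
rewrite (_ : (fun _ => _) = fun x : R => (0 < x)%R%:R - (x < 0)%R%:R); last first.
  apply/funext => x; case: (ltgtP x 0) => [h|h|->].
  - by rewrite ltr0_sg// sub0r.
  - by rewrite gtr0_sg// subr0.
  - by rewrite sgr0 subrr.
apply: measurable_funB.
  rewrite (_ : (fun _ => _) = \1_`]0, +oo[%classic); first exact: measurable_indic.
  apply/funext => x; rewrite indicE; congr (_%:R); congr nat_of_bool.
  by rewrite mem_setE in_itv/= andbT.
rewrite (_ : (fun _ => _) = \1_`]-oo, 0[%classic); first exact: measurable_indic.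
apply/funext => x; rewrite indicE; congr (_%:R); congr nat_of_bool.
by rewrite mem_setE in_itv.
Qed.

Section wave_functions.
Context (R : realType).
Local Notation mu := (@lebesgue_measure R).
Local Notation nc := (@Normc.normc R).
Variables (psi : R -> R[i]) (fX : R -> R).
Local Notation ps := (fourier (reC psi)).
Hypotheses (ipsi : integ mu (fun t => complex.Re (psi t)))
  (iX : integ mu fX) (X0 : forall x, 0 <= fX x) (XN : forall x, fX (- x) = fX x)
  (ps0 : ps 0 = 0).
Variable j : int.
Local Notation sg := (sigma psi fX j).
Hypotheses (sg0 : 0 < sg).

(* Averaging the tensor powers of [amp th t] over the [M]-th roots of unity
   [exp(i th)] keeps the part of the kernel with as many positive as negative
   frequencies. *)
Definition amp (th t x : R) : R[i] :=
  cis (th * Num.sg x + t * x) * ps (2 ^ j * x) * (Num.sqrt (fX x) / sg)%:C.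

(** The last factor is what a quadrature node [u] of [phi_J] contributes for one frequency;
    multiplied over all frequencies it depends on their sum only. *)
Definition wave (th t u x : R) : R[i] := amp th t x * cis (- (x * u)).

Lemma nc_amp th t x : nc (amp th t x) ^+ 2 = nc (ps (2 ^ j * x)) ^+ 2 * fX x / sg ^+ 2.
Proof.
rewrite /amp !ncM nc_cis mul1r ncR exprMn normrM normfV (gtr0_norm sg0) exprMn exprVn.
rewrite real_normK ?num_real//.
have -> : Num.sqrt (fX x) ^+ 2 = fX x by rewrite sqr_sqrtr.
by ring.
Qed.

Lemma nc_wave th t u x : nc (wave th t u x) = nc (amp th t x).
Proof. by rewrite /wave ncM nc_cis mulr1. Qed.

Lemma cmeasurable_amp th t : cmeasurable (T := measurableTypeR R) (amp th t).
Proof.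
have mf := integ_measurable iX.
apply: cmeasM; last first.
  apply: cmeasR; apply: measurable_funM => //.
  by apply: measurableT_comp => //; exact: continuous_measurable_fun (@sqrt_continuous R).
apply: cmeasM.
  apply: cmeas_cis; apply: measurable_funD; apply: measurable_funM => //.
  exact: measurable_sg.
have [m1 m2] := cmeasurable_ft ipsi.
have ms : measurable_fun setT (fun x : R => 2 ^ j * x) by exact: measurable_funM.
by split; [exact: (measurableT_comp m1 ms)|exact: (measurableT_comp m2 ms)].
Qed.

Let iden : integ mu (fun x => nc (ps (2 ^ j * x)) ^+ 2 * fX x).
Proof.
pose B := 2 * \int[mu]_t `|complex.Re (psi t)|.
have [m1 m2] := cmeasurable_ft ipsi.
have ms : measurable_fun setT (fun x : R => 2 ^ j * x) by exact: measurable_funM.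
have mp : cmeasurable (T := measurableTypeR R) (fun x => ps (2 ^ j * x)).
  by split; [exact: (measurableT_comp m1 ms)|exact: (measurableT_comp m2 ms)].
have := integZ (B ^+ 2) iX; apply: integ_le => [|x].
  apply: measurable_funM; last exact: integ_measurable iX.
  by apply: measurable_funX; exact: measurable_nc.
rewrite ger0_norm; last by rewrite mulr_ge0// sqr_ge0.
rewrite ler_wpM2r// ler_pXn2r ?nnegrE ?nc_ge0//; last first.
  by rewrite mulr_ge0// rint_ge0.
exact: (ft_le ipsi).
Qed.

(** Dividing by [sigma] gives unit norm, as the Hermite formula for tensor powers requires. *)
Lemma amp_integ th t : integ mu (fun x => nc (amp th t x) ^+ 2) /\
  \int[mu]_x nc (amp th t x) ^+ 2 = 1.
Proof.
have E x : nc (amp th t x) ^+ 2 = (sg ^+ 2)^-1 * (nc (ps (2 ^ j * x)) ^+ 2 * fX x).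
  by rewrite nc_amp mulrC.
split; first by rewrite (funext E); exact: integZ.
transitivity (\int[mu]_x ((sg ^+ 2)^-1 * (nc (ps (2 ^ j * x)) ^+ 2 * fX x))).
  by apply: eq_rint => x; exact: E.
rewrite rintZ// /sg /sigma sqr_sqrtr; last first.
  by apply: rint_ge0 => x; rewrite mulr_ge0// sqr_ge0.
rewrite mulVf//; apply: contraTneq sg0 => E0.
by rewrite /sigma E0 sqrtr0 ltxx.
Qed.

Lemma ampN th t x : amp th t (- x) = conjc (amp th t x).
Proof.
rewrite /amp !conjcM conjc_real XN; congr (_ * _ * _).
  by rewrite sgrN !mulrN -opprD cisN.
by rewrite mulrN; exact: (ftN ipsi).
Qed.

Lemma waveN th t u x : wave th t u (- x) = conjc (wave th t u x).
Proof. by rewrite /wave conjcM ampN mulNr cisN. Qed.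

Lemma cmeasurable_wave th t u : cmeasurable (T := measurableTypeR R) (wave th t u).
Proof.
apply: cmeasM; first exact: cmeasurable_amp.
by apply: cmeas_cis; apply: measurable_funN; exact: measurable_funM.
Qed.

Lemma wave_herm th t u : herm (wave th t u).
Proof.
split; last exact: waveN.
apply: integ_cLp2; first exact: cmeasurable_wave.
by rewrite (_ : (fun x => _) = fun x => nc (amp th t x) ^+ 2); [exact: (amp_integ th t).1|apply/funext => x; rewrite nc_wave].
Qed.

Lemma wave_norm th t u : sqnormL2 mu (wave th t u) = 1.
Proof.
rewrite /sqnormL2 -(amp_integ th t).2; apply: eq_rint => x.
by rewrite nc_wave.
Qed.

(** A zero frequency has no sign; since the wavelet transform vanishes there, such points drop out
    of the selection of balanced signs. *)
Lemma amp0 th t : amp th t 0 = 0.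
Proof. by rewrite /amp [2 ^ j * 0]mulr0 ps0 mulr0 mul0r. Qed.

Lemma ampE th t x : amp th t x = cis (th * Num.sg x) * amp 0 t x.
Proof. by rewrite /amp mul0r add0r cisD !mulrA. Qed.

End wave_functions.

Section complex_products.
Context (R : realType).
Local Notation nc := (@Normc.normc R).

Lemma realCM (a b : R) : (a * b)%:C = a%:C * b%:C :> R[i].
Proof. by apply: complex_ext => /=; ring. Qed.

Lemma realCX (a : R) n : (a ^+ n)%:C = a%:C ^+ n :> R[i].
Proof. by elim: n => [|n ih]; rewrite ?expr0// !exprS realCM ih. Qed.

Lemma conjc_prod (I : Type) (s : seq I) (f : I -> R[i]) :
  conjc (\prod_(i <- s) f i) = \prod_(i <- s) conjc (f i).
Proof. by elim/big_rec2 : _ => [|i y1 y2 _ <-]; rewrite ?conjc1 ?conjcM. Qed.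

Lemma nc_sqr_product_le (c b : R) (p S z : R[i]) : nc S <= 1 -> nc z <= b ->
  nc (c%:C * (p * S) * z) ^+ 2 <= c ^+ 2 * b ^+ 2 * nc p ^+ 2.
Proof.
move=> S1 zb; rewrite !ncM ncR.
have E : (`|c| * (nc p * nc S) * nc z) ^+ 2 = c ^+ 2 * nc p ^+ 2 * (nc S * nc z) ^+ 2.
  by rewrite -[c ^+ 2]real_normK ?num_real//; ring.
have cp0 : 0 <= c ^+ 2 * nc p ^+ 2 by rewrite mulr_ge0 ?sqr_ge0.
rewrite E [leRHS]mulrAC ler_wpM2l//.
rewrite ler_pXn2r ?nnegrE ?mulr_ge0 ?nc_ge0//; last exact: le_trans (nc_ge0 _) zb.
by rewrite -[leRHS]mul1r ler_pM ?nc_ge0.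
Qed.

Lemma conjc_product (c : R) (p S z : R[i]) :
  conjc (c%:C * (p * S) * z) = c%:C * (conjc p * conjc S) * conjc z.
Proof. by rewrite !conjcM conjc_real. Qed.

End complex_products.

Section chaos_approximation.
Context (R : realType).
Local Notation mu := (@lebesgue_measure R).
Local Notation nc := (@Normc.normc R).
Local Notation mut l := (lebesgue_tuple R l).
Variables (psi : R -> R[i]) (phi fX A : R -> R) (nu : R).
Local Notation ps := (fourier (reC psi)).
Hypotheses (ipsi : integ mu (fun t => complex.Re (psi t)))
  (iX : integ mu fX) (X0 : forall x, 0 <= fX x) (XN : forall x, fX (- x) = fX x)
  (ps0 : ps 0 = 0) (iphi : integ mu phi).
Variables (j : int) (t : R) (J : int) (l M : nat).
Local Notation sg := (sigma psi fX j).
Hypotheses (sg0 : 0 < sg) (l0 : (0 < l)%N) (lM : (l < M)%N) (l_even : ~~ odd l).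

Let am0 := amp psi fX j 0 t.
Let phase (s : 'I_M) : R := 2 * pi * s%:R / M%:R.
(** The power [sg ^+ l] undoes the normalization of the [l] amplitudes. *)
Let cc : R := sg `^ (nu - l%:R) * c_coef A l * sg ^+ l.

Let M0 : M%:R != 0 :> R.
Proof. by rewrite pnatr_eq0 -lt0n; exact: leq_ltn_trans lM. Qed.

Let sgn_avg (x : l.-tuple R) : R[i] :=
  (M%:R^-1)%:C * \sum_s cis (phase s * \sum_(k < l) Num.sg (tnth x k)).

Let kform (m : R -> R[i]) (x : l.-tuple R) : R[i] :=
  cc%:C * (\prod_(k < l) am0 (tnth x k) * sgn_avg x) * m (\sum_(k < l) tnth x k).

(** The averaged phase is 1 when the signs balance and 0 otherwise, since the sum of the signs is at
    most [l < M] in absolute value; a zero frequency makes both sides vanish. *)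
Let selection (x : l.-tuple R) : \prod_(k < l) am0 (tnth x k) * sgn_avg x =
  \prod_(k < l) am0 (tnth x k) * (count (fun y => y < 0) x == l./2)%:R.
Proof.
have [/existsP[k /eqP xk]|no] := boolP [exists k, tnth x k == 0].
  by rewrite (bigD1 k)//= xk [am0 0]amp0// !mul0r.
have x0 k : tnth x k != 0 by apply: contraNneq no => xk; apply/existsP; exists k; apply/eqP.
congr (_ * _); rewrite /sgn_avg sum_sg//.
set c := count _ _.
have cl : (c <= l)%N by rewrite -[X in (_ <= X)%N](size_tuple x) count_size.
set d : int := (l%:Z - (2 * c)%N%:Z)%R.
have dM : (`|d| < M)%N by rewrite /d; lia.
rewrite sum_rootsZ//.
have -> : (d == 0) = (c == l./2).
  by have := odd_double_half l; rewrite (negbTE l_even) /d; lia.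
case: eqP => _; last by rewrite mulr0.
have -> : M%:R = (M%:R)%:C :> R[i] by rewrite rmorph_nat.
by rewrite -realCM mulVf.
Qed.

Let am0E (y : R) : cis (t * y) * ps (2 ^ j * y) * (Num.sqrt (fX y))%:C = am0 y * sg%:C.
Proof.
rewrite /am0 /amp mul0r add0r -[RHS]mulrA -realCM; congr (_ * _%:C).
by rewrite divfK// gt_eqF.
Qed.

Lemma chaos_kernelE (x : l.-tuple R) :
  chaos_kernel psi phi fX A nu J t j x = kform (ft (dilate_phi phi J)) x.
Proof.
rewrite /chaos_kernel /kform selection; congr (_ * _).
under eq_bigr do rewrite am0E.
rewrite big_split/= prodr_const card_ord /cc [in RHS]realCM realCX.
by rewrite [\prod_(i < l) am0 _ * _]mulrC !mulrA.
Qed.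

Local Notation g := (dilate_phi phi J).
Let ig : integ mu g := (dilate_integ J iphi).1.

Definition atoms n : finType := ('I_(qsize n) * 'I_M)%type.
Definition atom_weight n (p : atoms n) : R := qweight g p.1 / M%:R.
Definition atom_wave n (p : atoms n) : R -> R[i] :=
  wave psi fX j (2 * pi * p.2%:R / M%:R) t (@qpoint R n p.1).

Let mn n (s : R) : R[i] := \sum_k (@qweight R g n k)%:C * cis (- (s * @qpoint R n k)).

(** A finite sum of tensor powers has the form of the exact kernel, with the transform of [phi_J]
    replaced by its quadrature sum [mn n]; hence the error is [kform (dm n)]. *)
Lemma tensor_sumE n (x : l.-tuple R) :
  \sum_(p : atoms n) (cc * atom_weight p)%:C * tensor_pow (atom_wave p) x =
  kform (mn n) x.
Proof.
rewrite /kform /sgn_avg /mn.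
transitivity (\sum_(k < qsize n) \sum_(s < M) (cc * (qweight g k / M%:R))%:C *
   (\prod_(i < l) am0 (tnth x i) * cis (phase s * \sum_(k < l) Num.sg (tnth x k)) *
    cis (- ((\sum_(k < l) tnth x k) * @qpoint R n k)))).
  rewrite pair_bigA; apply: eq_bigr => -[k s] _; congr (_ * _).
  rewrite /tensor_pow /atom_wave /wave big_split/=; congr (_ * _); last first.
    by rewrite mulr_suml -sumrN cis_sum.
  under eq_bigr do rewrite ampE.
  by rewrite big_split/= mulrC mulr_sumr cis_sum.
rewrite mulr_sumr; apply: eq_bigr => k _.
rewrite !mulr_sumr !mulr_suml; apply: eq_bigr => s _.
rewrite !realCM; ring.
Qed.

Let iam0 : integ mu (fun y => nc (am0 y) ^+ 2).
Proof. by apply: (amp_integ _ _ _ _ _ _).1. Qed.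

Let mam0 : cmeasurable (T := measurableTypeR R) am0.
Proof. by apply: cmeasurable_amp. Qed.

Let avg_le x : nc (sgn_avg x) <= 1.
Proof.
rewrite /sgn_avg ncM ncR ger0_norm ?invr_ge0//.
rewrite ler_pdivrMl ?lt0r ?M0 ?ler0n// mulr1 (le_trans (nc_sum _ _ _))//.
by under eq_bigr do rewrite nc_cis; rewrite sumr_const card_ord.
Qed.

Let avgN x : sgn_avg (map_tuple -%R x) = conjc (sgn_avg x).
Proof.
rewrite /sgn_avg conjc_scale conjc_sum; congr (_ * _); apply: eq_bigr => s _.
rewrite -cisN -mulrN -sumrN; congr (cis (_ * _)); apply: eq_bigr => k _.
by rewrite tnth_map sgrN.
Qed.

Let mtnth (k : 'I_l) : measurable_fun setT (fun x : l.-tuple (measurableTypeR R) => tnth x k : R).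
Proof. exact: measurable_tnth. Qed.

Let cmeas_kform m : cmeasurable (T := measurableTypeR R) m ->
  cmeasurable (T := l.-tuple (measurableTypeR R)) (kform m).
Proof.
move=> [m1 m2]; apply: cmeasM; last first.
  have ms : measurable_fun setT (fun x : l.-tuple (measurableTypeR R) =>
      \sum_(k < l) tnth x k : R) by apply: measurable_sum => k; exact: mtnth.
  by split; [exact: (measurableT_comp m1 ms)|exact: (measurableT_comp m2 ms)].
apply: cmeasM; first exact: cmeas_cst.
apply: cmeasM.
  apply: cmeas_prod => k; have [a1 a2] := mam0.
  by split; [exact: (measurableT_comp a1 (mtnth k))|exact: (measurableT_comp a2 (mtnth k))].
apply: cmeasM; first exact: cmeas_cst.
apply: cmeas_sum => s; apply: cmeas_cis; apply: measurable_funM => //.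
by apply: measurable_sum => k; exact: (measurableT_comp (@measurable_sg R) (mtnth k)).
Qed.

Let dom (x : l.-tuple R) : R := \prod_(k < l) nc (am0 (tnth x k)) ^+ 2.

Let idom : integ (mut l) dom.
Proof.
have m2 : measurable_fun setT (fun y : R => nc (am0 y) ^+ 2).
  by apply: measurable_funX; exact: (measurable_nc mam0).
exact: (integral_tuple_prod l m2 (fun y => sqr_ge0 _) iam0).1.
Qed.

Let kform_le m b x : (forall s, nc (m s) <= b) ->
  nc (kform m x) ^+ 2 <= cc ^+ 2 * b ^+ 2 * dom x.
Proof.
move=> mb; have b0 : 0 <= b by apply: le_trans (mb 0); exact: nc_ge0.
rewrite /dom prodrXl -nc_prod; apply: nc_sqr_product_le => //.
Qed.

Let herm_kform m b : cmeasurable (T := measurableTypeR R) m ->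
  (forall s, nc (m s) <= b) -> (forall s, m (- s) = conjc (m s)) ->
  herm_tensor (kform m).
Proof.
move=> mm mb mN; split.
  apply: integ_cLp2; first exact: cmeas_kform.
  have := integZ (cc ^+ 2 * b ^+ 2) idom; apply: integ_le => [|x].
    by apply: measurable_funX; exact: (measurable_nc (cmeas_kform mm)).
  by rewrite ger0_norm ?sqr_ge0// kform_le.
move=> x; rewrite /kform conjc_product avgN; congr (_ * (_ * _) * _).
  by rewrite conjc_prod; apply: eq_bigr => k _; rewrite tnth_map /am0 ampN.
by rewrite -mN -sumrN; congr m; apply: eq_bigr => k _; rewrite tnth_map.
Qed.

Let Sym_kform m : Defs.Sym (kform m) = kform m.
Proof.
apply: Sym_id => s x.
set y : l.-tuple R := [tuple tnth x (s k) | k < l].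
have Ea (f : R -> R) : \sum_(k < l) f (tnth y k) = \sum_(k < l) f (tnth x k).
  rewrite [RHS](reindex_inj (@perm_inj _ s)).
  by apply: eq_bigr => k _; rewrite tnth_mktuple.
have Em : \prod_(k < l) am0 (tnth y k) = \prod_(k < l) am0 (tnth x k).
  rewrite [RHS](reindex_inj (@perm_inj _ s)).
  by apply: eq_bigr => k _; rewrite tnth_mktuple.
have Es : sgn_avg y = sgn_avg x.
  by congr (_ * _); apply: eq_bigr => s0 _; congr (cis (_ * _)); exact: (Ea (@Num.sg R)).
by rewrite /kform Em Es (Ea id).
Qed.

Let B := 2 * \int[mu]_s `|g s|.

Let mn_le n s : nc (mn n s) <= \int[mu]_s `|g s|.
Proof.
rewrite (le_trans (nc_sum _ _ _))//; apply: le_trans (qweight_sum ig n).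
by apply: ler_sum => k _; rewrite ncM ncR nc_cis mulr1.
Qed.

Let cmeas_mn n : cmeasurable (T := measurableTypeR R) (mn n).
Proof.
apply: cmeas_sum => k; apply: cmeasM; first exact: cmeas_cst.
by apply: cmeas_cis; apply: measurable_funN; exact: measurable_funM.
Qed.

Let mnN n s : mn n (- s) = conjc (mn n s).
Proof.
rewrite /mn conjc_sum; apply: eq_bigr => k _.
by rewrite conjc_scale -cisN mulNr.
Qed.

Let dm n (s : R) : R[i] := ft g s - mn n s.

Let dm_le n s : nc (dm n s) <= B + \int[mu]_s `|g s|.
Proof.
rewrite /dm (le_trans (ncD _ _))// ncN.
exact: (lerD (ft_le ig s) (mn_le n s)).
Qed.

Let cmeas_dm n : cmeasurable (T := measurableTypeR R) (dm n).
Proof.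
rewrite (_ : dm n = fun s => ft g s + (-1) * mn n s); last first.
  by apply/funext => s; rewrite mulN1r.
apply: cmeasD; first exact: cmeasurable_ft.
by apply: cmeasM; [exact: cmeas_cst|exact: cmeas_mn].
Qed.

Let dmN n s : dm n (- s) = conjc (dm n s).
Proof.
rewrite /dm mnN ftN// conjcD; congr (_ + _).
by rewrite -mulN1r -[in RHS]mulN1r conjcM; congr (_ * _); apply: complex_ext => /=; rewrite ?oppr0.
Qed.

Let dm_cvg s : nc (dm n s) @[n --> \oo] --> 0.
Proof.
have [h1 h2] := quadrature_ft ig (- s).
rewrite ftN// conjcK in h1 h2.
have E n : \sum_k (@qweight R g n k)%:C * cis (- s * @qpoint R n k) = mn n s.
  by apply: eq_bigr => k _; rewrite mulNr.
move: h1 h2; (under eq_fun do rewrite E) => h1; (under eq_fun do rewrite E) => h2.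
have d1 : `|complex.Re (ft g s) - complex.Re (mn n s)| @[n --> \oo] -->
    `|complex.Re (ft g s) - complex.Re (ft g s)|.
  by apply: cvg_norm; apply: cvgB => //; exact: cvg_cst.
have d2 : `|complex.Im (ft g s) - complex.Im (mn n s)| @[n --> \oo] -->
    `|complex.Im (ft g s) - complex.Im (ft g s)|.
  by apply: cvg_norm; apply: cvgB => //; exact: cvg_cst.
have d3 : `|complex.Re (ft g s) - complex.Re (mn n s)| +
    `|complex.Im (ft g s) - complex.Im (mn n s)| @[n --> \oo] -->
    `|complex.Re (ft g s) - complex.Re (ft g s)| + `|complex.Im (ft g s) - complex.Im (ft g s)|.
  exact: cvgD d1 d2.
rewrite !subrr normr0 addr0 in d3.
apply: (squeeze_cvgr _ (cvg_cst 0) d3); apply: nearW => n; rewrite nc_ge0/=.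
by apply: (le_trans (nc_le _)); rewrite /dm ReD ImD ReN ImN.
Qed.

(** Dominated convergence: the transform and its quadrature sums are bounded uniformly in [n], and
    the amplitudes are square integrable. *)
Lemma kform_cvg : sqnormL2 (mut l) (kform (dm n)) @[n --> \oo] --> 0.
Proof.
set b := B + \int[mu]_s `|g s|.
have mf n : measurable_fun setT (fun x : l.-tuple (measurableTypeR R) => nc (kform (dm n) x) ^+ 2).
  by apply: measurable_funX; exact: (measurable_nc (cmeas_kform (cmeas_dm n))).
have df n (x : l.-tuple (measurableTypeR R)) :
    `|nc (kform (dm n) x) ^+ 2| <= cc ^+ 2 * b ^+ 2 * dom x.
  by rewrite ger0_norm ?sqr_ge0// kform_le// => s; exact: dm_le.
have cf (x : l.-tuple (measurableTypeR R)) : nc (kform (dm n) x) ^+ 2 @[n --> \oo] --> (0 : R).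
  set c := nc (cc%:C * (\prod_(k < l) am0 (tnth x k) * sgn_avg x)).
  have E n : nc (kform (dm n) x) ^+ 2 =
     c ^+ 2 * (nc (dm n (\sum_(k < l) tnth x k)) * nc (dm n (\sum_(k < l) tnth x k))).
    by rewrite /kform ncM -/c exprMn -expr2.
  under eq_fun do rewrite E.
  have h : c ^+ 2 * (nc (dm n (\sum_(k < l) tnth x k)) * nc (dm n (\sum_(k < l) tnth x k)))
      @[n --> \oo] --> c ^+ 2 * (0 * 0).
    by apply: cvgM; [exact: cvg_cst|apply: cvgM; exact: dm_cvg].
  by rewrite !mulr0 in h.
have := (@rint_dct _ _ R (mut l) _ (fun=> 0) _ mf cf (integZ (cc ^+ 2 * b ^+ 2) idom) df).2.
by rewrite {2}/Rintegral integral0.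
Qed.

Context d (T : measurableType d) (P : probability T R).
Variables (W : set R -> T -> R[i]) (I : forall m, (m.-tuple R -> R[i]) -> T -> R).
Hypotheses (HW : gaussian_random_measure P W) (HI : wiener_ito P W I).

Let F := I (@chaos_kernel R psi phi fX A nu J t j l).

Definition atom_sum n (y : T) : R :=
  \sum_(p : atoms n) cc * atom_weight p * (He R l).[X1 I (atom_wave p) y].

Let wh n (p : atoms n) : herm (atom_wave p).
Proof. by apply: wave_herm. Qed.

Let FE : F = I (kform (ft g)).
Proof. by congr I; apply/funext => x; exact: chaos_kernelE. Qed.

Let hft : herm_tensor (kform (ft g)).
Proof.
apply: (herm_kform (b := B)); first exact: cmeasurable_ft.
  by move=> s; exact: ft_le.
by move=> s; exact: ftN.
Qed.

(** Linearity and the Hermite formula hold almost surely for each kernel; finitely many null sets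
    are collected. *)
Let atom_sumE n : {ae P, forall y, F y - atom_sum n y = I (kform (dm n)) y}.
Proof.
have m1 := I_sum HI (index_enum (atoms n)) (fun p => cc * atom_weight p) l0
  (fun p => tensor_pow_herm l (wh p)).
have m2 : {ae P, forall y, \sum_(p : atoms n) cc * atom_weight p * I (tensor_pow (m:=l) (atom_wave p)) y = atom_sum n y}.
  rewrite /atom_sum; elim: (index_enum _) => [|p s ih].
    by apply: aeW => y; rewrite !big_nil.
  have wn : sqnormL2 mu (atom_wave p) = 1 by apply: wave_norm.
  have h := I_tensor_pow HI l0 (wh p) wn.
  apply: filterS2 ih h => y e1 e2; rewrite !big_cons e1; congr (_ * _ + _).
  exact: e2.
have [_ L _ _] := HI.
have hs := herm_tensor_sum (index_enum (atoms n)) (fun p => cc * atom_weight p)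
  (fun p => tensor_pow_herm l (wh p)).
have := L l _ _ 1 (-1) l0 (herm_tensor_Hbar hft) (herm_tensor_Hbar hs).
move=> h.
apply: filterS3 m1 m2 h => y e1 e2 e3.
rewrite FE -e2 -e1.
transitivity (1 * I (kform (ft g)) y + -1 * I (fun x : l.-tuple R => \sum_(p : atoms n)
  (cc * atom_weight p)%:C * tensor_pow (atom_wave p) x) y).
  by rewrite mul1r mulN1r.
rewrite -e3; congr (I _ y); apply/funext => x.
rewrite (tensor_sumE n x) /kform /dm mul1r.
have -> : (-1)%:C = -1 :> R[i] by apply: complex_ext => /=; rewrite ?oppr0.
by rewrite mulN1r mulrBr.
Qed.

Let hdm n : herm_tensor (kform (dm n)).
Proof.
apply: (herm_kform (b := B + \int[mu]_s `|g s|)); first exact: cmeas_dm.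
  by move=> s; exact: dm_le.
by move=> s; exact: dmN.
Qed.

Lemma measurable_atom_sum n : measurable_fun setT (atom_sum n).
Proof.
apply: measurable_sum => p; apply: measurable_funM => //.
apply: (measurableT_comp (measurable_horner _)).
by have [] := X1_moment HI (wh p).
Qed.

(** The error is itself a chaos of order [l] with a symmetric Hermitian kernel, so the isometry
    turns mean-square convergence into convergence of kernels. *)
Theorem chaos_approx :
  [/\ measurable_fun setT F, integ P (fun y => F y ^+ 2),
   forall n, integ P (fun y => (F y - atom_sum n y) ^+ 2) &
   \int[P]_y (F y - atom_sum n y) ^+ 2 @[n --> \oo] --> 0].
Proof.
have [mF iF _] := I_isometry HI l0 hft (Sym_kform _); rewrite -FE in mF iF.
have H n : integ P (fun y => (F y - atom_sum n y) ^+ 2) /\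
    \int[P]_y (F y - atom_sum n y) ^+ 2 = l`!%:R * sqnormL2 (mut l) (kform (dm n)).
  have [mI iI <-] := I_isometry HI l0 (hdm n) (Sym_kform _).
  have mD : measurable_fun setT (fun y => (F y - atom_sum n y) ^+ 2).
    by apply: measurable_funX; apply: measurable_funB => //; exact: measurable_atom_sum.
  have mI2 : measurable_fun setT (fun y => I (kform (dm n)) y ^+ 2) by exact: measurable_funX.
  have E : (\int[P]_y ((F y - atom_sum n y) ^+ 2)%:E =
      \int[P]_y (I (kform (dm n)) y ^+ 2)%:E)%E.
    apply: ae_eq_integral => //; [exact/measurable_EFinP|exact/measurable_EFinP|].
    by have := atom_sumE n; apply: filterS => y -> _.
  split; last by rewrite /Rintegral E.
  apply: ge0_integ => //; first by move=> y; exact: sqr_ge0.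
  by rewrite E; apply: ge0_integ_lty => // y; exact: sqr_ge0.
split => //; first by move=> n; exact: (H n).1.
under eq_fun do rewrite (H _).2.
have h : l`!%:R * sqnormL2 (mut l) (kform (dm n)) @[n --> \oo] --> (l`!%:R * 0 : R).
  by apply: cvgM; [exact: cvg_cst|exact: kform_cvg].
by rewrite mulr0 in h.
Qed.

End chaos_approximation.

(** * Fluctuations of the Malliavin inner product *)

Section variance_of_sum.
Context (R : realType) d (T : measurableType d) (P : probability T R) (K : finType).

Lemma variance_sum (c : K -> R) (B : K -> T -> R) :
  (forall p, integ P (B p)) -> (forall p q, integ P (fun y => B p y * B q y)) ->
  let Y y := \sum_p c p * B p y in
  [/\ integ P Y, integ P (fun y => Y y ^+ 2) &
   \int[P]_y (Y y - \int[P]_z Y z) ^+ 2 =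
   \sum_p \sum_q c p * c q *
     (\int[P]_y (B p y * B q y) - \int[P]_y B p y * \int[P]_y B q y)].
Proof.
move=> iB iBB Y.
have iY : integ P Y by apply: integ_sum => p _; exact: integZ.
pose e := \int[P]_z Y z.
have eE : e = \sum_p c p * \int[P]_y B p y.
  by rewrite /e rint_sum => [|p _]; [apply: eq_bigr => p _; rewrite rintZ|exact: integZ].
have Y2 y : Y y ^+ 2 = \sum_p \sum_q c p * c q * (B p y * B q y).
  rewrite expr2 mulr_suml; apply: eq_bigr => p _; rewrite mulr_sumr.
  by apply: eq_bigr => q _; ring.
have iY2 : integ P (fun y => Y y ^+ 2).
  rewrite (funext Y2); apply: integ_sum => p _; apply: integ_sum => q _; exact: integZ.
split => //.
transitivity (\int[P]_y (Y y ^+ 2 - 2 * e * Y y + e ^+ 2)).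
  by apply: eq_rint => y; rewrite -/e; ring.
rewrite rintD; [|by apply: integB => //; exact: integZ|exact: integ_cst].
rewrite rintB//; last exact: integZ.
rewrite rintZ// -/e rint_cst.
have -> : \int[P]_y Y y ^+ 2 = \sum_p \sum_q c p * c q * \int[P]_y (B p y * B q y).
  transitivity (\int[P]_y (\sum_p \sum_q c p * c q * (B p y * B q y))).
    by apply: eq_rint => y; exact: Y2.
  rewrite rint_sum => [|p _]; last by apply: integ_sum => q _; exact: integZ.
  apply: eq_bigr => p _; rewrite rint_sum => [|q _]; last exact: integZ.
  by apply: eq_bigr => q _; rewrite rintZ.
have e2 : e ^+ 2 = \sum_p \sum_q c p * c q * (\int[P]_y B p y * \int[P]_y B q y).
  rewrite expr2 eE mulr_suml; apply: eq_bigr => p _; rewrite mulr_sumr.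
  by apply: eq_bigr => q _; ring.
transitivity (\sum_p \sum_q c p * c q * \int[P]_y (B p y * B q y) - e ^+ 2).
  by ring.
rewrite e2 -sumrB; apply: eq_bigr => p _; rewrite -sumrB; apply: eq_bigr => q _.
by rewrite mulrBr.
Qed.

End variance_of_sum.

(** * The variance as a sum over four quadrature nodes *)

Section gram_variance.
Context (R : realType) d (T : measurableType d) (P : probability T R).
Local Notation mu := (@lebesgue_measure R).
Local Notation nc := (@Normc.normc R).
Local Notation V := (bool * bool)%type.
Variables (W : set R -> T -> R[i]) (I : forall m, (m.-tuple R -> R[i]) -> T -> R).
Hypotheses (HW : gaussian_random_measure P W) (HI : wiener_ito P W I).
Variables (N : nat -> nat) (w x : forall n, 'I_(N n) -> R) (Wb : R).
Arguments w : clear implicits.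
Arguments x : clear implicits.
Hypothesis wW : forall n, \sum_k `|w n k| <= Wb.
Variable m : R -> R[i].
Hypothesis wm : forall s,
  ccvg \oo (fun n => \sum_k (w n k)%:C * cis (s * x n k)) (m s).
Variable b : R.
Local Notation rho := (fun s => nc (m s)).
Hypotheses (cm : continuous rho) (mb : forall s, nc (m s) <= b) (im : integ mu rho).
Variables (a : bool -> R -> R[i]) (M : R).
Hypotheses (ma : forall i, cmeasurable (T := measurableTypeR R) (a i))
  (aM : forall i t, nc (a i t) ^+ 2 <= M)
  (ia : forall i, integ mu (fun t => nc (a i t) ^+ 2))
  (a1 : forall i, \int[mu]_t nc (a i t) ^+ 2 = 1)
  (aN : forall i t, a i (- t) = conjc (a i t)).

(** The waves seen as functions of the quadrature node alone, the amplitude [a i] being fixed for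
    each side of the inner product. *)
Definition shifted i (u : R) : R -> R[i] := fun t => a i t * cis (- (t * u)).

Let nc_shifted i u t : nc (shifted i u t) = nc (a i t).
Proof. by rewrite /shifted ncM nc_cis mulr1. Qed.

Let hs i u : herm (shifted i u).
Proof.
split; last by move=> t; rewrite /shifted conjcM aN mulNr cisN.
apply: integ_cLp2.
  apply: cmeasM => //; apply: cmeas_cis; apply: measurable_funN.
  exact: measurable_funM.
by under eq_fun do rewrite nc_shifted; exact: ia.
Qed.

Let inner1 i u : inner (shifted i u) (shifted i u) = 1.
Proof.
rewrite /inner -(a1 i); apply: eq_rint => t.
by rewrite ReM ReJ ImJ -(nc_shifted i u t) nc_sqr; ring.
Qed.

(** The covariance of two waves is an oscillatory integral in the difference of their nodes, which
    is the edge factor of the diagrams. *)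
Lemma inner_shifted (u : V -> R) r s :
  inner (shifted r.2 (u r)) (shifted s.2 (u s)) = edge4 a u r s.
Proof.
rewrite /inner /edge4 /edge; apply: eq_rint => t; rewrite /rc -[RHS]ReJ; congr complex.Re.
rewrite /shifted !conjcM conjcK -!cisN opprK.
have -> : - (t * (u r - u s)) = - (t * u r) + t * u s by ring.
by rewrite cisD; ring.
Qed.

Variable n : bool -> nat.

Let wave_at (u : V -> R) (v : V) := X1 I (shifted v.2 (u v)).
Let Mo (u : V -> R) := Mom P (wave_at u).

Let gwave u : gfam P (wave_at u) (edge4 a u).
Proof.
have := X1_gfam HW HI (J := V) (fun v => hs v.2 (u v)).
by rewrite (_ : (fun j k => _) = edge4 a u)//; apply/funext => r; apply/funext => s; exact: inner_shifted.
Qed.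

Let edge1 u v : edge4 a u v v = 1.
Proof. by rewrite -inner_shifted inner1. Qed.

Let Hf n0 i (k : 'I_(N n0)) (y : T) : R := (He R (n i)).[X1 I (shifted i (x n0 k)) y].

(** The part of the Malliavin inner product with given orders and amplitudes on the two sides; only
    the nodes are summed. *)
Definition fluct n0 (y : T) : R := \sum_(p : 'I_(N n0) * 'I_(N n0))
  (w n0 p.1 * w n0 p.2 * inner (shifted true (x n0 p.1)) (shifted false (x n0 p.2))) *
  ((He R (n true)).[X1 I (shifted true (x n0 p.1)) y] *
   (He R (n false)).[X1 I (shifted false (x n0 p.2)) y]).

(** Two pairs of nodes, one per copy, read as a choice of a node for each of the four vertices. *)
Let place n0 (p : ('I_(N n0) * 'I_(N n0)) * ('I_(N n0) * 'I_(N n0))) : {ffun V -> 'I_(N n0)} :=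
  [ffun v : V => let q := if v.1 then p.1 else p.2 in if v.2 then q.1 else q.2].

Let sum_place n0 (F : {ffun V -> 'I_(N n0)} -> R) :
  \sum_k F k = \sum_p \sum_q F (place (p, q)).
Proof.
rewrite pair_bigA (reindex (@place n0)).
  by apply: eq_bigr => -[p q] _.
exists (fun k : {ffun V -> 'I_(N n0)} =>
   ((k (true, true), k (true, false)), (k (false, true), k (false, false)))).
  by move=> [[p1 p2] [q1 q2]] _; rewrite /place !ffunE.
by move=> k _; apply/ffunP => -[[] []]; rewrite !ffunE.
Qed.

Let prodV (F : V -> R) : \prod_v F v =
  F (true, true) * F (true, false) * (F (false, true) * F (false, false)).
Proof.
transitivity (\prod_(i : bool) \prod_(j : bool) F (i, j)).
  by rewrite pair_bigA; apply: eq_bigr => -[i j].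
by rewrite !big_bool.
Qed.

Let n4 (v : V) := n v.2.

(** Expanding the variance over two pairs of nodes, the coefficients supply the inner edges [Q4],
    and the covariance of the Hermite products is [Mc] for the vertices of the first copy. *)
Lemma fluct_var n0 : [/\ integ P (fluct n0), integ P (fun y => fluct n0 y ^+ 2) &
  \int[P]_y (fluct n0 y - \int[P]_z fluct n0 z) ^+ 2 =
  qsum w x n0 (fun=> 0) 1 (fun u => Q4 a u * Mc Mo [set v : V | v.1]%SET u n4)].
Proof.
pose J := (bool * 'I_(N n0))%type.
have gJ : gfam P (fun j : J => X1 I (shifted j.1 (x n0 j.2)))
    (fun j k : J => inner (shifted j.1 (x n0 j.2)) (shifted k.1 (x n0 k.2))).
  by apply: (X1_gfam HW HI) => j; exact: hs.
pose B (p : 'I_(N n0) * 'I_(N n0)) y := Hf true p.1 y * Hf false p.2 y.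
have nB (p : 'I_(N n0) * 'I_(N n0)) : nice (fun z : J -> R =>
    (He R (n true)).[z (true, p.1)] * (He R (n false)).[z (false, p.2)]).
  by apply: niceM; exact: nice_horner.
have iB p : integ P (B p) by exact: (nice_integ gJ (nB p)).
have iBB p q : integ P (fun y => B p y * B q y).
  exact: (nice_integ gJ (niceM (nB p) (nB q))).
pose c (p : 'I_(N n0) * 'I_(N n0)) :=
  w n0 p.1 * w n0 p.2 * inner (shifted true (x n0 p.1)) (shifted false (x n0 p.2)).
have [i1 i2 E] := variance_sum c iB iBB.
split => //; rewrite [LHS]E /qsum sum_place; apply: eq_bigr => p _; apply: eq_bigr => q _.
set k := place (p, q); pose u v := x n0 (k v).
have kE : (k (true, true) = p.1) * (k (true, false) = p.2) *
          (k (false, true) = q.1) * (k (false, false) = q.2).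
  by rewrite /k /place !ffunE.
have r1 : rc 1 (\sum_v 0 * x n0 (k v)) = 1.
  by rewrite big1 => [|v _]; rewrite ?mul0r// /rc mul1r cis0.
rewrite r1 mulr1 prodV !kE.
have cp : c p * c q = w n0 p.1 * w n0 p.2 * (w n0 q.1 * w n0 q.2) * Q4 a u.
  rewrite /c /Q4.
  rewrite -(inner_shifted u (true, true) (true, false)) -(inner_shifted u (false, true) (false, false)).
  by rewrite /u !kE/=; ring.
rewrite cp [RHS]mulrA -/u; congr (_ * _).
rewrite /Mc /Mo /Mom; congr (_ - _ * _); apply: eq_rint => y; rewrite prodV /wave_at /u !kE/= /restr ?inE/=.
- by [].
- by rewrite !hornerC !mulr1.
- by rewrite !hornerC !mul1r.
Qed.

Theorem fluct_limit : exists2 L,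
  \int[P]_y (fluct n0 y - \int[P]_z fluct n0 z) ^+ 2 @[n0 --> \oo] --> L &
  `|L| <= M ^+ 3 * b * (\int[mu]_s nc (m s)) ^+ 3 * diagMom R n4.
Proof.
have a1' i : \int[mu]_t nc (a i t) ^+ 2 <= 1 by rewrite a1.
have ME u nn r : (0 < nn r)%N -> Mo u nn =
    \sum_(s | s != r) (nn s)%:R * edge4 a u r s * Mo u (decr2 nn r s).
  exact: (MomE (gwave u) (edge1 u)).
have MZ u nn : (forall v, nn v = 0%N) -> Mo u nn = 1 by exact: (Mom0 P (wave_at u)).
have [L cL Lb] := four_point_bound wW wm cm mb im ma aM ia a1' n4 ME MZ.
exists L => //.
rewrite (_ : (fun n0 => _) = fun n0 => qsum w x n0 (fun=> 0) 1
  (fun u => Q4 a u * Mc Mo [set v : V | v.1]%SET u n4))//.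
by apply/funext => n0; have [] := fluct_var n0.
Qed.

End gram_variance.

(** * Boundedness of the amplitudes *)

Section wavelet_regularity.
Context (R : realType).
Local Notation nc := (@Normc.normc R).

Lemma fourier_zero (alpha : R) psi phi :
  assumption_W alpha psi phi -> fourier (reC psi) 0 = 0.
Proof.
move=> [a0 _ [Cpsi [_ _ _ ->]] _ _].
by rewrite normr0 powR0 ?gt_eqF// mulr0.
Qed.

(** Away from 0 all factors are bounded. Near 0 the squared wavelet transform decays like
    [|x|^(2 alpha)] and absorbs the singularity [|x|^(beta - 1)]. At 0 the transform is zero,
    whatever the value [fX 0]. *)
Lemma spectral_product_bound (alpha beta B : R) psi phi (fX : R -> R) (j : int) :
  assumption_W alpha psi phi -> spectral_density beta fX -> 1 <= 2 * alpha + beta ->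
  (forall x, nc (fourier (reC psi) x) <= B) ->
  exists M, forall x, nc (fourier (reC psi) (2 ^ j * x)) ^+ 2 * fX x <= M.
Proof.
move=> HW [_ X0 _ [CX [_ CX0 [Mx CXM] fXE]]] ab pB.
have ps0 := fourier_zero HW.
have [a0 _ [Cpsi [_ [Mc CM] _ psE]] _ _] := HW.
have B0 : 0 <= B by apply: le_trans (pB 0); exact: nc_ge0.
have Mc0 : 0 <= Mc by apply: le_trans (CM 0); exact: nc_ge0.
have Mx0 : 0 <= Mx by apply: le_trans (CXM 0); exact: CX0.
have psB x : nc (fourier (reC psi) x) ^+ 2 <= B ^+ 2.
  by rewrite ler_pXn2r ?nnegrE ?nc_ge0.
have sq0 x : 0 <= nc (fourier (reC psi) x) ^+ 2 by exact: sqr_ge0.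
case: fXE => [[_ fE]|[b0 b1 _ fE]].
  exists (B ^+ 2 * Mx) => x; rewrite fE; exact: ler_pM.
pose e : R := (2 ^ j) `^ alpha.
have e0 : 0 <= e by exact: powR_ge0.
exists ((B ^+ 2 + (Mc * e) ^+ 2) * Mx) => x.
have [->|x0] := eqVneq x 0.
  rewrite [2 ^ j * 0]mulr0 ps0 nc0 expr0n/= mul0r.
  by rewrite mulr_ge0// addr_ge0// sqr_ge0.
have nx0 : 0 < `|x| by rewrite normr_gt0.
have p0 : 0 <= `|x| `^ (beta - 1) by exact: powR_ge0.
rewrite (fE x x0).
have [x1|x1] := leP 1 `|x|.
  have p1 : `|x| `^ (beta - 1) <= 1.
    by rewrite -[leRHS](powRr0 `|x|); apply: ler_powR => //; lra.
  apply: ler_pM => //; first by rewrite mulr_ge0.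
    by rewrite (le_trans (psB _))// lerDl sqr_ge0.
  by rewrite -[leRHS]mulr1 ler_pM.
have psx : nc (fourier (reC psi) (2 ^ j * x)) <= Mc * e * `|x| `^ alpha.
  rewrite psE ncM ncR (ger0_norm (powR_ge0 _ _)) normrM powRM// (gtr0_norm (exprz_gt0 _ _))//.
  by rewrite mulrA ler_pM ?mulr_ge0 ?nc_ge0 ?powR_ge0// ler_wpM2r ?powR_ge0.
(* the total exponent of [`|x|] is [2 * alpha + beta - 1 >= 0] *)
have a1 : (`|x| `^ alpha) ^+ 2 * `|x| `^ (beta - 1) <= 1.
  have nx : `|x| != 0 by rewrite gt_eqF.
  rewrite expr2 -!powRD ?nx ?implybT// -[leRHS](powRr0 `|x|).
  by apply: ger_powR; [rewrite nx0 ltW|lra].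
apply: (@le_trans _ _ ((Mc * e * `|x| `^ alpha) ^+ 2 * (Mx * `|x| `^ (beta - 1)))).
  apply: ler_pM => //; first by rewrite mulr_ge0.
    by rewrite ler_pXn2r ?nnegrE ?nc_ge0// !mulr_ge0// powR_ge0.
  by rewrite ler_wpM2r.
rewrite (_ : _ * _ = (Mc * e) ^+ 2 * Mx *
  ((`|x| `^ alpha) ^+ 2 * `|x| `^ (beta - 1))); last by ring.
apply: (@le_trans _ _ ((Mc * e) ^+ 2 * Mx * 1)).
  by rewrite ler_wpM2l// mulr_ge0// sqr_ge0.
by rewrite mulr1 ler_wpM2r// lerDr sqr_ge0.
Qed.

End wavelet_regularity.

(** * Regularity of the test functions in the sum norm *)

Section test_functions.
Context (R : realType) (n : nat).
Variable h : 'rV[R]_n -> R.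
Hypothesis hH : test_H2 h.

Let row (x : 'I_n -> R) : 'rV[R]_n := \row_m x m.

Let row_upd x m r : row (upd x m r) = row x + r *: delta_mx 0 m.
Proof. by apply/rowP => k; rewrite !mxE eqxx/= mulrC. Qed.

Let line_derive (x : 'I_n -> R) m (s : R) :
  is_derive s 1 (fun r : R => h (row (upd x m r))) (partial h m (row (upd x m s))).
Proof.
have [dh _ _ _ _] := hH.
have E : (fun r : R => r^-1 *: (h (row (upd x m (r *: 1 + s))) - h (row (upd x m s)))) =
    fun r : R => r^-1 *: (h (r *: delta_mx 0 m + row (upd x m s)) - h (row (upd x m s))).
  apply/funext => r; congr (_ *: (h _ - _)); rewrite !row_upd.
  by rewrite [r *: 1]mulr1 scalerDl [RHS]addrCA.
split.
  by rewrite /derivable E; exact: dh.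
by rewrite /partial /derive E.
Qed.

Lemma upd_lip_lipD (f : ('I_n -> R) -> R) :
  (forall x m r, `|f (upd x m r) - f x| <= `|r|) -> lipD 1 f.
Proof.
move=> fu x y; rewrite mul1r.
pose z (s : seq 'I_n) : 'I_n -> R := fun j => if j \in s then y j else x j.
have key s : uniq s -> `|f (z s) - f x| <= \sum_(m <- s) `|y m - x m|.
  elim: s => [|k s ih] /=.
    by rewrite big_nil (_ : z _ = x) ?subrr ?normr0.
  move=> /andP[ks us]; have {}ih := ih us; rewrite big_cons.
  have -> : z (k :: s) = upd (z s) k (y k - x k).
    apply/funext => j; rewrite /z /upd inE; have [->|jk] := eqVneq j k.
      by rewrite /= (negbTE ks) mul1r addrC subrK.
    by rewrite /= mul0r addr0.
  rewrite -(subrK (f (z s)) (f (upd _ _ _))) -addrA.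
  by rewrite (le_trans (ler_normD _ _))// lerD.
have := key (index_enum _) (index_enum_uniq _).
by rewrite (_ : z _ = y)//; apply/funext => j; rewrite /z mem_index_enum.
Qed.

Lemma test_H2_lip : lipD 1 (fun x => h (row x)).
Proof.
have [_ _ _ h1 _] := hH; apply: upd_lip_lipD => x m r.
have := derive_lip 0 r (line_derive x m) (fun s => h1 m _).
by rewrite upd0 mul1r subr0.
Qed.

(** The hypothesis bounds the variation by the Euclidean norm, which is at most the sum norm. *)
Lemma test_H2_partial_lip m : lipD 1 (fun x => partial h m (row x)).
Proof.
have [_ _ _ _ h2] := hH; move=> x y; rewrite mul1r.
have [<-|/eqP yx] := eqVneq (row y) (row x).
  by rewrite subrr normr0 sumr_ge0.
have e0 : 0 < eucl_norm (row y - row x).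
  rewrite sqrtr_gt0 lt_neqAle eq_sym sumr_ge0 ?andbT => [|i _]; last exact: sqr_ge0.
  apply/negP => /eqP E; apply: yx; apply/rowP => i.
  have Z : forall i, true -> (row y - row x) 0 i ^+ 2 = 0.
    by apply: psumr_eq0P => // k _; exact: sqr_ge0.
  have := Z i isT.
  by rewrite !mxE => /eqP; rewrite sqrf_eq0 subr_eq0 => /eqP.
have := h2 m _ _ yx; rewrite ler_pdivrMr// mul1r => /le_trans; apply.
set S := \sum_j _; have S0 : 0 <= S by apply: sumr_ge0.
rewrite /eucl_norm -[leRHS](ger0_norm S0) -sqrtr_sqr ler_sqrt ?sqr_ge0//.
rewrite expr2 {2}/S mulr_sumr; apply: ler_sum => i _; rewrite !mxE.
rewrite -[X in X ^+ 2]/(y i - x i) -[_ ^+ 2]real_normK ?num_real// expr2 ler_wpM2r//.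
by rewrite /S (bigD1 i)//= lerDl sumr_ge0.
Qed.

Lemma test_H2_tayl m : tayl m (fun x => h (row x)) (fun x => partial h m (row x)) 1.
Proof.
move=> x r; have L := test_H2_partial_lip m.
have := derive_quad (L := 1) 0 r (line_derive x m).
rewrite upd0 subr0; apply => u v; have := L (upd x m u) (upd x m v).
by rewrite sum_upd.
Qed.

End test_functions.

(** * Passage to the limit in mean square *)

Section limits_in_mean_square.
Context (R : realType) d (T : measurableType d) (P : probability T R).

Lemma integ_product (f g : T -> R) : measurable_fun setT f -> measurable_fun setT g ->
  integ P (fun y => f y ^+ 2) -> integ P (fun y => g y ^+ 2) ->
  integ P (fun y => f y * g y).
Proof.
move=> mf mg if2 ig2; have := integD if2 ig2; apply: integ_le => [|y].
  exact: measurable_funM.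
rewrite normrM -[f y ^+ 2]real_normK ?num_real// -[g y ^+ 2]real_normK ?num_real//.
have := sqr_ge0 (`|f y| - `|g y|); have := normr_ge0 (f y); have := normr_ge0 (g y); nra.
Qed.

Lemma covariance_rint (f g : T -> R) : measurable_fun setT f -> measurable_fun setT g ->
  integ P (fun y => f y ^+ 2) -> integ P (fun y => g y ^+ 2) ->
  fine (covariance P f g) =
  \int[P]_y (f y * g y) - (\int[P]_y f y) * (\int[P]_y g y).
Proof.
move=> mf mg if2 ig2.
have [i1 _] := l1_le_l2 mf if2; have [i2 _] := l1_le_l2 mg ig2.
have ifg := integ_product mf mg if2 ig2.
set a := \int[P]_y f y; set b := \int[P]_y g y.
transitivity (\int[P]_y ((f y - a) * (g y - b))).
  by rewrite unlock; rewrite unlock.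
transitivity (\int[P]_y (f y * g y - b * f y - (a * g y - a * b))).
  by apply: eq_rint => y; ring.
have j1 := integZ b i1; have j2 := integZ a i2.
rewrite rintB; [|exact: integB|by apply: integB => //; exact: integ_cst].
rewrite !rintB//; last exact: integ_cst.
by rewrite rint_cst !rintZ// -/a -/b; ring.
Qed.

(** Cauchy-Schwarz, from the nonnegativity in [s] of the mean of [(f - s g)^2]. *)
Lemma norm_mean_product (f g : T -> R) : measurable_fun setT f -> measurable_fun setT g ->
  integ P (fun y => f y ^+ 2) -> integ P (fun y => g y ^+ 2) ->
  `|\int[P]_y (f y * g y)| <=
  Num.sqrt (\int[P]_y f y ^+ 2) * Num.sqrt (\int[P]_y g y ^+ 2).
Proof.
move=> mf mg if2 ig2.
have ifg := integ_product mf mg if2 ig2.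
set a := \int[P]_y f y ^+ 2; set b := \int[P]_y g y ^+ 2.
set c := \int[P]_y (f y * g y).
have a0 : 0 <= a by apply: rint_ge0 => y; exact: sqr_ge0.
have b0 : 0 <= b by apply: rint_ge0 => y; exact: sqr_ge0.
have H s : 0 <= a - 2 * s * c + s ^+ 2 * b.
  have <- : \int[P]_y (f y - s * g y) ^+ 2 = a - 2 * s * c + s ^+ 2 * b.
    transitivity (\int[P]_y (f y ^+ 2 - 2 * s * (f y * g y) + s ^+ 2 * g y ^+ 2)).
      by apply: eq_rint => y; ring.
    have j1 := integZ (2 * s) ifg; have j2 := integZ (s ^+ 2) ig2.
    rewrite rintD//; last exact: integB.
    by rewrite rintB// !rintZ.
  by apply: rint_ge0 => y; exact: sqr_ge0.
rewrite -sqrtrM// -sqrtr_sqr ler_sqrt ?mulr_ge0//.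
have [b00|bn0] := eqVneq b 0.
  rewrite b00 mulr0; have [->|c0] := eqVneq c 0; first by rewrite expr0n.
  (* When [g] has zero second moment the polynomial is affine in [s], and here its value would be
     [- a - 2]. *)
  have := H ((a + 1) / c); rewrite b00 mulr0 addr0.
  rewrite (_ : _ - _ = a - 2 * (a + 1)); last by field.
  by move=> ?; exfalso; lra.
have := H (c / b); rewrite (_ : _ + _ = a - c ^+ 2 / b); last by field.
by rewrite subr_ge0 ler_pdivrMr// lt0r bn0.
Qed.

End limits_in_mean_square.

Section chaos_limit.
Context (R : realType) (D : finType) (I J : nat -> finType) d d'
  (T : measurableType d) (T' : measurableType d') (P : probability T R)
  (P' : probability T' R).
Variables (i : forall n, D -> J n -> I n) (w : forall n, D -> J n -> R)
  (l : forall n, J n -> nat) (X : forall n, I n -> T -> R)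
  (G : forall n, I n -> I n -> R).
Arguments i : clear implicits.
Arguments w : clear implicits.
Arguments l : clear implicits.
Arguments X : clear implicits.
Arguments G : clear implicits.
Hypotheses (l0 : forall n t, (0 < l n t)%N) (gX : forall n, gfam P (X n) (G n))
  (G1 : forall n k, G n k k = 1).
Let Fn n m y := chaos (i n) (w n) (l n) m (fun k => X n k y).
Let gr n m q y := gram (i n) (w n) (l n) (G n) m q (fun k => X n k y).
Variables (F : D -> T -> R) (gn : nat -> D -> D -> R) (g : D -> D -> R).
Hypotheses (mF : forall m, measurable_fun setT (F m))
  (iF : forall m, integ P (fun y => F m y ^+ 2))
  (FL2 : forall m, \int[P]_y (F m y - Fn n m y) ^+ 2 @[n --> \oo] --> 0)
  (gnb : forall n m q, \int[P]_y `|gr n m q y - \int[P]_z gr n m q z| <= gn n m q)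
  (gng : forall m q, gn n m q @[n --> \oo] --> g m q).

Let nF n m : nice (chaos (i n) (w n) (l n) m) := smooth_nice (smooth_chaos _ _ _ m).

Let nG n m q : nice (gram (i n) (w n) (l n) (G n) m q).
Proof.
apply: nice_sum => t; apply: nice_sum => u.
by apply: niceM; [exact: nice_cst|apply: niceM; exact: nice_horner].
Qed.

Let mFn n m : measurable_fun setT (Fn n m).
Proof. exact: integ_measurable (nice_integ (gX n) (nF n m)). Qed.

Let iFn2 n m : integ P (fun y => Fn n m y ^+ 2).
Proof. exact: (nice_integ (gX n) (niceM (nF n m) (nF n m))). Qed.

Let dl n m y := F m y - Fn n m y.

Let mdl n m : measurable_fun setT (dl n m).
Proof. exact: measurable_funB. Qed.

Let idl n m : integ P (fun y => dl n m y ^+ 2).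
Proof.
have := integZ 2 (integD (iF m) (iFn2 n m)); apply: integ_le => [|y].
  exact: measurable_funX.
rewrite ger0_norm ?sqr_ge0// /dl -subr_ge0.
have -> : 2 * (F m y ^+ 2 + Fn n m y ^+ 2) - (F m y - Fn n m y) ^+ 2 =
  (F m y + Fn n m y) ^+ 2 by ring.
exact: sqr_ge0.
Qed.

Let ep n m := Num.sqrt (\int[P]_y dl n m y ^+ 2).
Let sF m := Num.sqrt (\int[P]_y F m y ^+ 2).

Let ep0 n m : 0 <= ep n m. Proof. exact: sqrtr_ge0. Qed.

Let ep_cvg m : ep n m @[n --> \oo] --> 0.
Proof.
have h : ep n m @[n --> \oo] --> Num.sqrt (0 : R).
  exact: (cvg_comp _ _ (FL2 m) (@sqrt_continuous R 0)).
by rewrite sqrtr0 in h.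
Qed.

Let dl_mean n m : \int[P]_y `|dl n m y| <= ep n m.
Proof.
have [_ h] := l1_le_l2 (mdl n m) (idl n m).
have p0 : 0 <= \int[P]_y `|dl n m y| by apply: rint_ge0.
rewrite -[leLHS](ger0_norm p0) -sqrtr_sqr ler_sqrt//.
by apply: rint_ge0 => y; exact: sqr_ge0.
Qed.

(** The approximations are centred, so the mean of [F] is at most the [L^1] error. *)
Let mean_F n m : `|\int[P]_y F m y| <= ep n m.
Proof.
apply: le_trans (dl_mean n m).
have [i1 _] := l1_le_l2 (mF m) (iF m); have [i2 _] := l1_le_l2 (mFn n m) (iFn2 n m).
have [i3 _] := l1_le_l2 (mdl n m) (idl n m).
have -> : \int[P]_y F m y = \int[P]_y dl n m y.
  by rewrite rintB// [X in _ - X](mean_chaos (i n) (w n) (@l0 n) m (gX n) (@G1 n)) subr0.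
by apply: le_abs_rint => //; exact: integ_norm.
Qed.

(** The mean of the approximate inner product is a second moment of the approximate chaoses; writing
    these as [F] minus an error leaves cross terms controlled by [ep]. *)
Let covar_bound n m q : `|\int[P]_y gr n m q y -
    (\int[P]_y (F m y * F q y) - \int[P]_y F m y * \int[P]_y F q y)| <=
  ep n m * sF q + sF m * ep n q + 2 * (ep n m * ep n q).
Proof.
have -> : \int[P]_y gr n m q y = \int[P]_y (Fn n m y * Fn n q y).
  exact: (mean_gram (i n) (w n) (@l0 n) m q (gX n) (@G1 n)).
have p1 := integ_product (mdl n m) (mF q) (idl n m) (iF q).
have p2 := integ_product (mF m) (mdl n q) (iF m) (idl n q).
have p3 := integ_product (mdl n m) (mdl n q) (idl n m) (idl n q).
have p4 := integ_product (mF m) (mF q) (iF m) (iF q).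
have E : \int[P]_y (Fn n m y * Fn n q y) = \int[P]_y (F m y * F q y) -
   \int[P]_y (dl n m y * F q y) - \int[P]_y (F m y * dl n q y) +
   \int[P]_y (dl n m y * dl n q y).
  rewrite -!rintB -?rintD//; [|by apply: integB => //; exact: integB|exact: integB].
  by apply: eq_rint => y; rewrite /dl; ring.
have b1 := norm_mean_product (mdl n m) (mF q) (idl n m) (iF q).
have b2 := norm_mean_product (mF m) (mdl n q) (iF m) (idl n q).
have b3 := norm_mean_product (mdl n m) (mdl n q) (idl n m) (idl n q).
have b4 : `|\int[P]_y F m y * \int[P]_y F q y| <= ep n m * ep n q.
  by rewrite normrM ler_pM.
rewrite E; set a := \int[P]_y (F m y * F q y).
rewrite (_ : a - _ - _ + _ - _ = (- \int[P]_y (dl n m y * F q y)) +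
  (- \int[P]_y (F m y * dl n q y)) + (\int[P]_y (dl n m y * dl n q y) +
   \int[P]_y F m y * \int[P]_y F q y)); last by ring.
rewrite (le_trans (ler_normD _ _))// lerD//.
  by rewrite (le_trans (ler_normD _ _))// lerD// normrN.
by rewrite (le_trans (ler_normD _ _))// mulr_natl mulr2n lerD.
Qed.

(** The interpolation bound is applied for every [n] with the fixed normal vector of covariance [C];
    the mismatch between [C] and the mean inner product joins the errors that vanish as [n]
    grows. *)
Theorem chaos_limit (N : D -> T' -> R) C (h : (D -> R) -> R) h' :
  gfam P' N C ->
  (forall m q, C m q = \int[P]_y (F m y * F q y) - \int[P]_y F m y * \int[P]_y F q y) ->
  lipD 1 h -> (forall m, lipD 1 (h' m)) -> (forall m, tayl m h (h' m) 1) ->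
  `|\int[P]_y h (fun m => F m y) - \int[P']_y h (fun m => N m y)| <=
  pi / 2 * \sum_m \sum_q g m q.
Proof.
move=> gN CE hL h'L hh'.
pose B n := \sum_m ep n m + pi / 2 * \sum_m \sum_q
  (gn n m q + (ep n m * sF q + sF m * ep n q + 2 * (ep n m * ep n q))).
have cB : B n @[n --> \oo] --> \sum_(m : D) (0 : R) + pi / 2 * \sum_m \sum_q
  (g m q + (0 * sF q + sF m * 0 + 2 * (0 * 0))).
  apply: cvgD; first by apply: cvgr_sum => m _; exact: ep_cvg.
  apply: cvgM; first exact: cvg_cst.
  apply: cvgr_sum => m _; apply: cvgr_sum => q _.
  apply: cvgD; first exact: gng.
  apply: cvgD; last by apply: cvgM; [exact: cvg_cst|apply: cvgM; exact: ep_cvg].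
  by apply: cvgD; apply: cvgM; first [exact: cvg_cst|exact: ep_cvg].
have E0 : \sum_(m : D) (0 : R) + pi / 2 * \sum_m \sum_q
  (g m q + (0 * sF q + sF m * 0 + 2 * (0 * 0))) = pi / 2 * \sum_m \sum_q g m q.
  rewrite big1// add0r; congr (_ * _); apply: eq_bigr => m _; apply: eq_bigr => q _.
  by rewrite !(mul0r, mulr0) !addr0.
rewrite E0 in cB.
suff H n : `|\int[P]_y h (fun m => F m y) - \int[P']_y h (fun m => N m y)| <= B n.
  exact: (cvgr_to_ge cB (nearW _ H)).
have mhF : measurable_fun setT (fun y => h (fun m => F m y)).
  exact: (lipD_mfun hL).
have mhFn : measurable_fun setT (fun y => h (fun m => Fn n m y)).
  exact: (lipD_mfun hL).
have i3 m : integ P (fun y => `|dl n m y|).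
  by have [i3 _] := l1_le_l2 (mdl n m) (idl n m); exact: integ_norm.
have hd y : `|h (fun m => F m y) - h (fun m => Fn n m y)| <= \sum_m `|dl n m y|.
  by have := hL (fun m => Fn n m y) (fun m => F m y); rewrite mul1r.
have id : integ P (fun y => h (fun m => F m y) - h (fun m => Fn n m y)).
  apply: (integ_le (g := fun y => \sum_m `|dl n m y|)) => //.
    exact: measurable_funB.
  by apply: integ_sum => m _; exact: i3.
have ihFn : integ P (fun y => h (fun m => Fn n m y)).
  have nh : nice (fun x => h (fun m => chaos (i n) (w n) (l n) m x)).
    split; last by apply: (expgrowth_comp hL) => m; exact: (nF n m).2.
    by apply: mfun_comp; [exact: lipD_mfun hL|move=> m; exact: (nF n m).1].
  exact: (nice_integ (gX n) nh).
have key := interpolation (i n) (w n) (@l0 n) (gX n) (@G1 n) gN hL h'L hh'.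
have -> : \int[P]_y h (fun m => F m y) =
   \int[P]_y (h (fun m => F m y) - h (fun m => Fn n m y)) + \int[P]_y h (fun m => Fn n m y).
  by rewrite -rintD//; apply: eq_rint => y; rewrite subrK.
rewrite -addrA (le_trans (ler_normD _ _))// lerD//.
  apply: (@le_trans _ _ (\int[P]_y \sum_m `|dl n m y|)).
    by apply: le_abs_rint => //; [exact: measurable_funB|apply: integ_sum => m _; exact: i3].
  by rewrite rint_sum//; apply: ler_sum => m _; exact: dl_mean.
apply: (le_trans key); rewrite ler_wpM2l ?divr_ge0 ?pi_ge0//.
apply: ler_sum => m _; apply: ler_sum => q _.
have ig := nice_integ (gX n) (nG n m q).
set e := \int[P]_z gr n m q z.
have igc : integ P (fun y => `|gr n m q y - e|).
  by apply: integ_norm; apply: integB => //; exact: integ_cst.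
apply: (@le_trans _ _ (\int[P]_y (`|gr n m q y - e| + `|e - C m q|))).
  apply: le_rint.
  - by apply: integ_norm; apply: integB => //; exact: integ_cst.
  - by apply: integD => //; exact: integ_cst.
  - by move=> y; rewrite (le_trans _ (ler_normD _ _))// addrA subrK.
rewrite rintD//; last exact: integ_cst.
rewrite (rint_cst P `|e - C m q|); apply: lerD; first exact: gnb.
by rewrite CE; exact: covar_bound.
Qed.

End chaos_limit.

Section square_integrable_sums.
Context (R : realType) (L : finType).

Lemma sqr_sum_le (a : L -> R) : (\sum_l a l) ^+ 2 <= #|L|%:R * \sum_l a l ^+ 2.
Proof.
have S : \sum_l \sum_k (2^-1 * (a l ^+ 2 + a k ^+ 2)) = #|L|%:R * \sum_l a l ^+ 2.
  under eq_bigr do rewrite -mulr_sumr big_split/= sumr_const.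
  rewrite -mulr_sumr big_split/= sumr_const -sumrMnl cardT -cardE.
  rewrite -mulr2n -[X in 2^-1 * X]mulr_natl mulKf ?pnatr_eq0// mulr_natl.
  by rewrite sumrMnl.
rewrite -S expr2 mulr_suml; apply: ler_sum => l _; rewrite mulr_sumr.
apply: ler_sum => k _; have := sqr_ge0 (a l - a k); nra.
Qed.

Context d (T : measurableType d) (P : probability T R).

Lemma square_integ_sum (c : L -> R) (f : L -> T -> R) :
  (forall l, measurable_fun setT (f l)) -> (forall l, integ P (fun y => f l y ^+ 2)) ->
  let K := #|L|%:R * \sum_l c l ^+ 2 * \int[P]_y f l y ^+ 2 in
  integ P (fun y => (\sum_l c l * f l y) ^+ 2) /\
  \int[P]_y (\sum_l c l * f l y) ^+ 2 <= K.
Proof.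
move=> mf if2 K.
have le y : (\sum_l c l * f l y) ^+ 2 <= #|L|%:R * \sum_l c l ^+ 2 * f l y ^+ 2.
  apply: (le_trans (sqr_sum_le _)); rewrite ler_wpM2l//.
  by apply: ler_sum => l _; rewrite exprMn.
have iD : integ P (fun y => #|L|%:R * \sum_l c l ^+ 2 * f l y ^+ 2).
  by apply: integZ; apply: integ_sum => l _; exact: integZ.
have iS : integ P (fun y => (\sum_l c l * f l y) ^+ 2).
  apply: integ_le iD => [|y]; last by rewrite ger0_norm ?sqr_ge0.
  apply: measurable_funX; apply: measurable_sum => l; exact: measurable_funM.
split => //; apply: (le_trans (le_rint iS iD le)).
rewrite rintZ; last by apply: integ_sum => l _; exact: integZ.
rewrite rint_sum => [|l _]; last exact: integZ.
by rewrite /K le_eqVlt; apply/predU1P; left; congr (_ * _); apply: eq_bigr => l _; rewrite rintZ.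
Qed.

Lemma square_mean_sum_cvg (c : L -> R) (f : nat -> L -> T -> R) :
  (forall n l, measurable_fun setT (f n l)) ->
  (forall n l, integ P (fun y => f n l y ^+ 2)) ->
  (forall l, \int[P]_y f n l y ^+ 2 @[n --> \oo] --> 0) ->
  \int[P]_y (\sum_l c l * f n l y) ^+ 2 @[n --> \oo] --> 0.
Proof.
move=> mf if2 f0.
have h : #|L|%:R * \sum_l c l ^+ 2 * \int[P]_y f n l y ^+ 2 @[n --> \oo] -->
    #|L|%:R * \sum_l c l ^+ 2 * 0.
  apply: cvgM; first exact: cvg_cst.
  by apply: cvgr_sum => l _; apply: cvgM; [exact: cvg_cst|exact: f0].
rewrite [\sum_l _ * 0]big1 ?mulr0 in h; last by move=> l _; rewrite mulr0.
apply: (squeeze_cvgr _ (cvg_cst 0) h); apply: nearW => n.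
rewrite (square_integ_sum c (mf n) (if2 n)).2 andbT.
by apply: rint_ge0 => y; exact: sqr_ge0.
Qed.

End square_integrable_sums.

Section wave_fluctuations.
Context (R : realType).
Local Notation mu := (@lebesgue_measure R).
Local Notation nc := (@Normc.normc R).
Variables (psi : R -> R[i]) (fX g : R -> R).
Local Notation ps := (fourier (reC psi)).
Hypotheses (ipsi : integ mu (fun t => complex.Re (psi t)))
  (iX : integ mu fX) (X0 : forall x, 0 <= fX x) (XN : forall x, fX (- x) = fX x)
  (ig : integ mu g) (iftg : integ mu (fun s => nc (ft g s))).
Variables (M : R) (j : bool -> int) (th t : bool -> R).
Hypotheses (sg0 : forall i, 0 < sigma psi fX (j i))
  (psM : forall i x, nc (ps (2 ^ j i * x)) ^+ 2 * fX x / sigma psi fX (j i) ^+ 2 <= M).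
Context d (T : measurableType d) (P : probability T R).
Variables (W : set R -> T -> R[i]) (I : forall m, (m.-tuple R -> R[i]) -> T -> R).
Hypotheses (HW : gaussian_random_measure P W) (HI : wiener_ito P W I).

Let a i := amp psi fX (j i) (th i) (t i).

Definition wave_fluct (p q : nat) n : T -> R :=
  fluct I (@qweight R g) (@qpoint R) a (fun i => (if i then p else q).-1) n.

Lemma wave_fluct_integ p q n :
  integ P (wave_fluct p q n) /\ integ P (fun y => wave_fluct p q n y ^+ 2).
Proof.
have [|i|i u|i1 i2 _] := fluct_var HW HI (@qweight R g) (@qpoint R) (a := a) _ _ _
  (fun i => (if i then p else q).-1) n.
- by move=> i; exact: cmeasurable_amp.
- exact: (amp_integ ipsi iX X0 (sg0 i) _ _).1.
- exact: ampN.
- by split.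
Qed.

(** In each copy the two vertices have degrees [p - 1] and [q - 1], one leg of each being used by
    the inner edge. The factor [q^2] anticipates the multiplicity in the inner product. *)
Lemma wave_fluct_limit p q : (0 < p)%N -> (0 < q)%N ->
  exists2 L : R, \int[P]_y (wave_fluct p q n y - \int[P]_z wave_fluct p q n z) ^+ 2
      @[n --> \oo] --> L &
    q%:R ^+ 2 * `|L| <= M ^+ 3 * (2 * \int[mu]_s `|g s|) *
      (\int[mu]_s nc (ft g s)) ^+ 3 * (p`!%:R * q`!%:R * 3 ^+ (p + q)).
Proof.
move=> p0 q0.
pose m s := conjc (ft g s).
have rE : (fun s => nc (m s)) = fun s => nc (ft g s) by apply/funext => s; rewrite ncJ.
have cm : continuous (fun s => nc (m s)) by rewrite rE; exact: continuous_nc_ft.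
have mb s : nc (m s) <= 2 * \int[mu]_t `|g t| by rewrite ncJ; exact: ft_le.
have im : integ mu (fun s => nc (m s)) by rewrite rE.
have ma i : cmeasurable (T := measurableTypeR R) (a i) by exact: cmeasurable_amp.
have aM i x : nc (a i x) ^+ 2 <= M by rewrite nc_amp.
have ia i := amp_integ ipsi iX X0 (sg0 i) (th i) (t i).
have aN i x : a i (- x) = conjc (a i x) by exact: ampN.
have [L cL Lb] := fluct_limit HW HI (qweight_sum ig) (quadrature_ft ig) cm mb im
  ma aM (fun i => (ia i).1) (fun i => (ia i).2) aN (fun i => (if i then p else q).-1).
exists L => //.
have EI : \int[mu]_s nc (m s) = \int[mu]_s nc (ft g s) by rewrite rE.
set B := M ^+ 3 * _ * _.
have {}Lb : `|L| <= B * diagMom R (fun v : bool * bool => (if v.2 then p else q).-1).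
  by rewrite /B -EI.
have B0 : 0 <= B.
  have M0 : 0 <= M by apply: le_trans (psM true 0); rewrite divr_ge0 ?sqr_ge0// mulr_ge0// sqr_ge0.
  apply: mulr_ge0; last by rewrite exprn_ge0// rint_ge0// => s; exact: nc_ge0.
  by apply: mulr_ge0; [exact: exprn_ge0|rewrite mulr_ge0// rint_ge0].
apply: (@le_trans _ _ (q%:R ^+ 2 * (B * diagMom R (fun v : bool * bool => (if v.2 then p else q).-1)))).
  by rewrite ler_wpM2l ?sqr_ge0.
rewrite mulrCA ler_wpM2l//; apply: le_trans (He_count R p0 q0).
rewrite le_eqVlt; apply/predU1P; left; congr (_ * _); apply: eq_rint => z.
transitivity (\prod_(i : bool) \prod_(k : bool) (He R (if k then p else q).-1).[z]).
  by rewrite pair_bigA; apply: eq_bigr => -[i k].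
by rewrite !big_bool/=; ring.
Qed.

End wave_fluctuations.

(** * Assembly *)

Section deviations.
Context (R : realType) d (T : measurableType d) (P : probability T R).

Lemma mean_abs_deviation (f : T -> R) : integ P f -> integ P (fun y => f y ^+ 2) ->
  integ P (fun y => `|f y - \int[P]_z f z|) /\
  \int[P]_y `|f y - \int[P]_z f z| <= Num.sqrt (\int[P]_y (f y - \int[P]_z f z) ^+ 2).
Proof.
move=> i1 i2; set e := \int[P]_z f z.
have id : integ P (fun y => f y - e) by apply: integB => //; exact: integ_cst.
have id2 : integ P (fun y => (f y - e) ^+ 2).
  rewrite (_ : (fun y => _) = fun y => f y ^+ 2 - 2 * e * f y + e ^+ 2).
    by apply: integD; [apply: integB => //; exact: integZ|exact: integ_cst].
  by apply/funext => y; ring.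
have [_ le] := l1_le_l2 (integ_measurable id) id2.
split; first exact: integ_norm.
have p0 : 0 <= \int[P]_y `|f y - e| by apply: rint_ge0.
rewrite -[leLHS](ger0_norm p0) -sqrtr_sqr ler_sqrt//.
by apply: rint_ge0 => y; exact: sqr_ge0.
Qed.

End deviations.

(** Orders are shifted to start at 1 and odd ones padded with zeros, so that all orders up to [K]
    are indexed by ['I_K]. *)
Lemma sum_even_orders (V : zmodType) (K : nat) (f : nat -> V) :
  \sum_(2 <= l < K.+1 | ~~ odd l) f l = \sum_(l < K) (if odd l.+1 then 0 else f l.+1).
Proof.
transitivity (\sum_(1 <= l < K.+1) (if odd l then 0 else f l)).
  rewrite big_mkcond/=; case: K => [|K]; first by rewrite !big_geq.
  rewrite [RHS]big_ltn//= add0r; apply: eq_bigr => l _; by case: odd.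
by rewrite big_add1 big_mkord.
Qed.

(** Normalizing the amplitudes turns the factor [sigma ^ (nu - l)] into [sigma ^ nu], the same for
    all orders. *)
Lemma powRB_exprn (R : realType) (s nu c : R) n : 0 < s ->
  s `^ (nu - n%:R) * c * s ^+ n = s `^ nu * c.
Proof.
move=> s0; have sn : s != 0 by rewrite gt_eqF.
by rewrite mulrAC -powR_mulrn ?(ltW s0)// -powRD ?sn ?implybT// subrK.
Qed.

Section expansion_arithmetic.
Context (R : realType).

Lemma sqrt_even_power n : ~~ odd n -> Num.sqrt (3 ^+ n) = 3 ^+ n./2 :> R.
Proof.
move=> on; have := odd_double_half n; rewrite (negbTE on) add0n => nE.
by rewrite -[in LHS]nE -muln2 exprM sqrtr_sqr ger0_norm// exprn_ge0.
Qed.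

(** From variances to standard deviations: as both orders are even, the square root of [3 ^ (p + q)]
    is a product of integer powers, one per order. *)
Lemma sqrt_order_bound (L B : R) p q : 0 <= B -> ~~ odd p -> ~~ odd q ->
  q%:R ^+ 2 * `|L| <= B * (p`!%:R * q`!%:R * 3 ^+ (p + q)) ->
  q%:R * Num.sqrt L <= Num.sqrt B *
    (Num.sqrt p`!%:R * Num.sqrt q`!%:R * (3 ^+ p./2 * 3 ^+ q./2)).
Proof.
move=> B0 op oq Lb.
rewrite -(sqrt_even_power op) -(sqrt_even_power oq) -!sqrtrM ?mulr_ge0 ?exprn_ge0// -exprD.
apply: (@le_trans _ _ (Num.sqrt (q%:R ^+ 2 * `|L|))).
  rewrite sqrtrM ?sqr_ge0// sqrtr_sqr normr_nat ler_wpM2l//.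
  by rewrite ler_wsqrtr// ler_norm.
by rewrite ler_wsqrtr.
Qed.

Lemma coefficient_bound (y p1 p2 c1 c2 s B f1 f2 t1 t2 : R) k n :
  0 <= y -> 0 <= p1 -> 0 <= p2 -> n%:R * s <= B * (f1 * f2 * (t1 * t2)) ->
  `|y * (p1 * c1) * (y * (p2 * c2)) / k%:R ^+ 2 * n%:R| * s <=
  (k%:R ^+ 2)^-1 * (B * (y * p1 * (`|c1| * f1 * t1) * (y * p2 * (`|c2| * f2 * t2)))).
Proof.
move=> y0 p10 p20 key.
rewrite !normrM normfV normrX !normr_nat (ger0_norm y0) (ger0_norm p10) (ger0_norm p20).
rewrite (_ : _ * s = y * (p1 * `|c1|) * (y * (p2 * `|c2|)) / k%:R ^+ 2 * (n%:R * s)); last by ring.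
apply: (le_trans (ler_wpM2l _ key)); first by rewrite !mulr_ge0 ?invr_ge0 ?exprn_ge0.
by rewrite le_eqVlt; apply/predU1P; left; ring.
Qed.

Lemma covariance_mx_sym disp (T : measurableType disp) (P : probability T R) n
  (F : 'I_n -> T -> R) m q : covariance_mx P F m q = covariance_mx P F q m.
Proof. by rewrite !mxE covarianceC. Qed.

Lemma mean_over_pairs k (c : R) :
  \sum_(z : 'I_k.+1 * 'I_k.+1) (k.+1%:R ^+ 2)^-1 * c = c.
Proof.
rewrite sumr_const card_prod card_ord -[LHS]mulr_natl natrM mulrA -expr2.
by rewrite mulfV ?mul1r// expf_neq0// pnatr_eq0.
Qed.

Lemma cubic_ge0 (M a b : R) : 0 <= M -> 0 <= a -> 0 <= b -> 0 <= M ^+ 3 * (2 * a) * b ^+ 3.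
Proof. by move=> M0 a0 b0; rewrite !mulr_ge0 ?exprn_ge0. Qed.

(** The double sum factors into a square. The scaling identity is asked for only in the presence of
    an element of [D], from which the positivity of the constants is derived. *)
Lemma quadratic_sum_bound (D : finType) (f : D -> D -> R) (p : D -> R) (c b b' y s : R) :
  0 <= c -> (D -> y ^+ 2 * b = y^-1 * b') ->
  (forall m q, f m q <= b * (y * p m * s * (y * p q * s))) ->
  c * \sum_m \sum_q f m q <= c * (\sum_m p m) ^+ 2 * b' * y^-1 * s ^+ 2.
Proof.
move=> c0 bb fb; rewrite -!mulrA ler_wpM2l//.
apply: (@le_trans _ _ (\sum_m \sum_q b * (y * p m * s * (y * p q * s)))).
  by apply: ler_sum => m _; apply: ler_sum => q _.
rewrite le_eqVlt; apply/predU1P; left.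
rewrite expr2 !mulr_suml; apply: eq_bigr => m _; rewrite mulr_sumr.
apply: eq_bigr => q _.
transitivity (y ^+ 2 * b * (p m * p q * s ^+ 2)); first by ring.
by rewrite (bb m); ring.
Qed.

End expansion_arithmetic.

(** * All orders and all coordinates together *)

Section chaos_expansion_bound.
Context (R : realType).
Local Notation mu := (@lebesgue_measure R).
Local Notation nc := (@Normc.normc R).
Variables (psi : R -> R[i]) (phi fX A : R -> R) (nu : R).
Local Notation ps := (fourier (reC psi)).
Hypotheses (ipsi : integ mu (fun t => complex.Re (psi t)))
  (iX : integ mu fX) (X0 : forall x, 0 <= fX x) (XN : forall x, fX (- x) = fX x)
  (ps0 : ps 0 = 0) (iphi : integ mu phi) (iftphi : integ mu (fun s => nc (ft phi s))).
Variables (d : nat) (j : 'I_d -> int) (M : R).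
Local Notation sg m := (sigma psi fX (j m)).
Hypotheses (sg0 : forall m, 0 < sg m)
  (psM : forall m x, nc (ps (2 ^ j m * x)) ^+ 2 * fX x / sg m ^+ 2 <= M).
Context disp (T : measurableType disp) (P : probability T R).
Variables (W : set R -> T -> R[i]) (I : forall m, (m.-tuple R -> R[i]) -> T -> R).
Hypotheses (HW : gaussian_random_measure P W) (HI : wiener_ito P W I).
Variables (t : 'I_d -> R) (J : int) (K : nat).

Local Notation g := (dilate_phi phi J).
Let y : R := 2 `^ (J%:~R / 2).
Let coeff m l : R := sg m `^ (nu - l%:R) * c_coef A l * sg m ^+ l.
Let cf m (l : 'I_K) : R := if odd l.+1 then 0 else y * coeff m l.+1.
Let F m := truncated_chaos I psi phi fX A nu J K (t m) (j m).

(** The same [K.+1] roots of unity serve all orders up to [K], so the waves do not depend on the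
    order and one Gaussian family carries all the chaoses. *)
Let In n : finType := ('I_d * atoms K.+1 n)%type.
Let Jn n : finType := ('I_K * atoms K.+1 n)%type.
Let idx n (m : 'I_d) (u : Jn n) : In n := (m, u.2).
Let wt n (m : 'I_d) (u : Jn n) : R := cf m u.1 * atom_weight phi J u.2.
Let ord n (u : Jn n) : nat := u.1.+1.
Let vec n (k : In n) : R -> R[i] := atom_wave psi fX (j k.1) (2 ^ J * t k.1) k.2.
Let X n (k : In n) : T -> R := X1 I (vec k).
Let G n (k k' : In n) : R := inner (vec k) (vec k').

Let hv n (k : In n) : herm (vec k). Proof. exact: wave_herm. Qed.

Let gX n : gfam P (@X n) (@G n). Proof. exact: (X1_gfam HW HI (@hv n)). Qed.

Let G1 n (k : In n) : G k k = 1.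
Proof.
rewrite /G /inner -(wave_norm ipsi iX X0 (sg0 k.1) (2 * pi * k.2.2%:R / K.+1%:R)
  (2 ^ J * t k.1) (@qpoint R n k.2.1)).
by apply: eq_rint => x; rewrite ReM ReJ ImJ nc_sqr; ring.
Qed.

Let exact_term m (l : 'I_K) (z : T) : R :=
  if odd l.+1 then 0 else
  I (@chaos_kernel R psi phi fX A nu J (2 ^ J * t m) (j m) l.+1) z.

Let approx_term n m (l : 'I_K) (z : T) : R :=
  if odd l.+1 then 0 else atom_sum psi phi fX A nu (j m) (2 ^ J * t m) J l.+1 K.+1 I n z.

Let FE m : F m = fun z => \sum_l y * exact_term m l z.
Proof.
apply/funext => z; rewrite /F /truncated_chaos sum_even_orders mulr_sumr.
by apply: eq_bigr => l _; rewrite /exact_term; case: odd.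
Qed.

Let chaosE n m z : chaos (@idx n) (@wt n) (@ord n) m (fun k => X k z) =
  \sum_l y * approx_term n m l z.
Proof.
rewrite /chaos.
transitivity (\sum_(l < K) \sum_(p : atoms K.+1 n) cf m l * atom_weight phi J p *
    (He R l.+1).[X1 I (atom_wave psi fX (j m) (2 ^ J * t m) p) z]).
  by rewrite pair_bigA; apply: eq_bigr => -[l p] _.
apply: eq_bigr => l _; rewrite /approx_term /cf; case: ifP => _.
  by rewrite mulr0 big1// => p _; rewrite !mul0r.
rewrite /atom_sum mulr_sumr; apply: eq_bigr => p _.
by rewrite /coeff !mulrA.
Qed.

Let approx m (l : 'I_K) :
  [/\ measurable_fun setT (exact_term m l), integ P (fun z => exact_term m l z ^+ 2),
   forall n, integ P (fun z => (exact_term m l z - approx_term n m l z) ^+ 2) &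
   \int[P]_z (exact_term m l z - approx_term n m l z) ^+ 2 @[n --> \oo] --> 0].
Proof.
rewrite /exact_term /approx_term; case: (boolP (odd l.+1)) => od.
  have E : (fun _ : T => (0 - 0) ^+ 2 : R) = fun=> 0 by rewrite subrr expr0n.
  split; [exact: measurable_cst|by rewrite expr0n; exact: integ_cst| |].
    by move=> n; rewrite E; exact: integ_cst.
  by rewrite E rint_cst; exact: cvg_cst.
have lK : (l.+1 < K.+1)%N by rewrite ltnS.
exact: (chaos_approx A nu ipsi iX X0 XN ps0 iphi (2 ^ J * t m) J (sg0 m) (ltn0Sn l) lK od HI).
Qed.

Let m_approx n m l : measurable_fun setT (approx_term n m l).
Proof.
rewrite /approx_term; case: odd; first exact: measurable_cst.
exact: (measurable_atom_sum phi A nu ipsi iX X0 XN (2 ^ J * t m) J l.+1 K.+1 (sg0 m) HI n).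
Qed.

Let mF m : measurable_fun setT (F m).
Proof.
rewrite FE; apply: measurable_sum => l; apply: measurable_funM => //.
by have [] := approx m l.
Qed.

Let iF m : integ P (fun z => F m z ^+ 2).
Proof.
rewrite FE.
have ml l : measurable_fun setT (exact_term m l) by have [] := approx m l.
have il l : integ P (fun z => exact_term m l z ^+ 2) by have [] := approx m l.
exact: (square_integ_sum (fun=> y) ml il).1.
Qed.

Let FL2 m : \int[P]_z (F m z - chaos (@idx n) (@wt n) (@ord n) m (fun k => X k z)) ^+ 2
  @[n --> \oo] --> 0.
Proof.
have ml n l : measurable_fun setT (fun z => exact_term m l z - approx_term n m l z).
  by have [ml _ _ _] := approx m l; apply: measurable_funB => //; exact: m_approx.
have il n l : integ P (fun z => (exact_term m l z - approx_term n m l z) ^+ 2).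
  by have [] := approx m l.
have cl l : \int[P]_z (exact_term m l z - approx_term n m l z) ^+ 2 @[n --> \oo] --> 0.
  by have [] := approx m l.
have := square_mean_sum_cvg (fun=> y) ml il cl.
rewrite (_ : (fun n => _) = fun n =>
  \int[P]_z (F m z - chaos (@idx n) (@wt n) (@ord n) m (fun k => X k z)) ^+ 2)//.
apply/funext => n; apply: eq_rint => z; rewrite chaosE FE -sumrB; congr (_ ^+ 2).
by apply: eq_bigr => l _; rewrite mulrBr.
Qed.

Let side (m q : 'I_d) (i : bool) := if i then m else q.
Let theta (s s' : 'I_K.+1) (i : bool) : R :=
  2 * pi * (if i then s else s')%:R / K.+1%:R.
Let L4 := (('I_K * 'I_K) * ('I_K.+1 * 'I_K.+1))%type.
Let fl (m q : 'I_d) (a : L4) n : T -> R :=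
  wave_fluct psi fX g (fun i => j (side m q i)) (theta a.2.1 a.2.2)
    (fun i => 2 ^ J * t (side m q i)) I a.1.1.+1 a.1.2.+1 n.
Let cl (m q : 'I_d) (a : L4) : R :=
  cf m a.1.1 * cf q a.1.2 * (K.+1%:R ^+ 2)^-1 * (a.1.2.+1)%:R.

(** Sums over orders and roots of unity are separated from the sums over nodes; for fixed orders and
    roots the latter form one [wave_fluct]. *)
Let gramE n m q z : gram (@idx n) (@wt n) (@ord n) (@G n) m q (fun k => X k z) =
  \sum_a cl m q a * fl m q a n z.
Proof.
rewrite /gram pair_bigA /fl /wave_fluct /fluct.
under [RHS]eq_bigr do rewrite mulr_sumr.
rewrite [RHS]pair_bigA.
rewrite (reindex (fun b : L4 * ('I_(qsize n) * 'I_(qsize n)) =>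
  ((b.1.1.1, (b.2.1, b.1.2.1)), (b.1.1.2, (b.2.2, b.1.2.2))))); last first.
  exists (fun c : Jn n * Jn n =>
    (((c.1.1, c.2.1), (c.1.2.2, c.2.2.2)), (c.1.2.1, c.2.2.1))).
    by move=> [[[l l'] [s s']] [k k']] _.
  by move=> [[l [k s]] [l' [k' s']]] _.
apply: eq_bigr => -[[[l l'] [s s']] [k k']] _ /=.
rewrite /cl /wt /atom_weight /ord /G /X /vec /atom_wave /=.
set i0 := inner _ _; set h1 := _.[_]; set h2 := _.[_].
rewrite expr2 invfM; ring.
Qed.

Let psM2 m q (i : bool) x :
  nc (ps (2 ^ j (side m q i) * x)) ^+ 2 * fX x / sg (side m q i) ^+ 2 <= M.
Proof. exact: psM. Qed.

Let fl_integ m q a n : integ P (fl m q a n) /\ integ P (fun z => fl m q a n z ^+ 2).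
Proof.
exact: (@wave_fluct_integ R psi fX g ipsi iX X0 XN (fun i => j (side m q i)) _ _
  (fun i => sg0 (side m q i)) _ _ P W I HW HI).
Qed.

(** The triangle inequality separates the finitely many pieces, each bounded by its standard
    deviation; this is what makes the final bound the square of a sum over orders. *)
Let gram_deviation n m q :
  \int[P]_z `|gram (@idx n) (@wt n) (@ord n) (@G n) m q (fun k => X k z) -
    \int[P]_z gram (@idx n) (@wt n) (@ord n) (@G n) m q (fun k => X k z)| <=
  \sum_a `|cl m q a| * Num.sqrt (\int[P]_z (fl m q a n z - \int[P]_z fl m q a n z) ^+ 2).
Proof.
have mE : \int[P]_z gram (@idx n) (@wt n) (@ord n) (@G n) m q (fun k => X k z) =
    \sum_a cl m q a * \int[P]_z fl m q a n z.
  rewrite (eq_rint P (gramE n m q)) rint_sum => [|a _].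
    by apply: eq_bigr => a _; rewrite rintZ//; exact: (fl_integ m q a n).1.
  by apply: integZ; exact: (fl_integ m q a n).1.
have dv a := mean_abs_deviation (fl_integ m q a n).1 (fl_integ m q a n).2.
apply: (@le_trans _ _ (\int[P]_z \sum_a `|cl m q a| *
    `|fl m q a n z - \int[P]_z fl m q a n z|)).
  have isum : integ P (fun z => \sum_a `|cl m q a| * `|fl m q a n z - \int[P]_z fl m q a n z|).
    by apply: integ_sum => a _; apply: integZ; exact: (dv a).1.
  have le z : `|gram (@idx n) (@wt n) (@ord n) (@G n) m q (fun k => X k z) -
      \int[P]_z gram (@idx n) (@wt n) (@ord n) (@G n) m q (fun k => X k z)| <=
      \sum_a `|cl m q a| * `|fl m q a n z - \int[P]_z fl m q a n z|.
    rewrite mE gramE -sumrB (le_trans (ler_norm_sum _ _ _))//.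
    by apply: ler_sum => a _; rewrite -mulrBr normrM.
  apply: le_rint => //; apply: (integ_le _ _ isum) => [|z]; last by rewrite normr_id.
  apply: measurableT_comp => //; apply: measurable_funB => //.
  rewrite (funext (gramE n m q)); apply: measurable_sum => a.
  by apply: measurable_funM => //; exact: integ_measurable (fl_integ m q a n).1.
rewrite rint_sum => [|a _]; last by apply: integZ; exact: (dv a).1.
apply: ler_sum => a _; rewrite rintZ; last exact: (dv a).1.
by rewrite ler_wpM2l//; exact: (dv a).2.
Qed.

Let I0 := \int[mu]_s nc (ft phi s).
Let B0 := M ^+ 3 * (2 * \int[mu]_s `|phi s|) * I0 ^+ 3.
Let S := \sum_(2 <= l < K.+1 | ~~ odd l) `|c_coef A l| * Num.sqrt l`!%:R * 3 ^+ l./2.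

Let M0 (m : 'I_d) : 0 <= M.
Proof. by apply: le_trans (psM m 0); rewrite divr_ge0 ?sqr_ge0// mulr_ge0// sqr_ge0. Qed.

Let B00 (m : 'I_d) : 0 <= B0.
Proof.
apply: mulr_ge0; last by rewrite exprn_ge0// rint_ge0// => s; exact: nc_ge0.
by apply: mulr_ge0; [exact: exprn_ge0 (M0 m)|rewrite mulr_ge0// rint_ge0].
Qed.

Let y0 : 0 < y. Proof. exact: powR_gt0. Qed.

Let y2 : y ^+ 2 = 2 ^ J.
Proof.
rewrite /y expr2 -powRD ?pnatr_eq0 ?implybT//.
by rewrite (_ : _ + _ = J%:~R); [rewrite powR_intmul|field].
Qed.

Let ft_dilate_mass : integ mu (fun s => nc (ft g s)) /\
  \int[mu]_s nc (ft g s) = y ^- 2 * I0.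
Proof.
have e0 : 0 < 2 ^ J :> R by rewrite exprz_gt0.
have E : (fun s => nc (ft g s)) = fun s => nc (ft phi (2 ^ J * s)).
  by apply/funext => s; rewrite ft_dilate.
by rewrite E y2; exact: integ_scale.
Qed.

(** With [y^2 = 2^J], the mass of the transform of [phi_J] is [y^-2] times that of [phi]; its cube
    under the root gives [y^-3], against the prefactor [y^2]. *)
Let scale_bound (m : 'I_d) : y ^+ 2 * Num.sqrt (M ^+ 3 * (2 * \int[mu]_s `|g s|) *
  (\int[mu]_s nc (ft g s)) ^+ 3) = y^-1 * Num.sqrt B0.
Proof.
have yn : y != 0 by rewrite gt_eqF.
rewrite ft_dilate_mass.2 (dilate_integ J iphi).2.
rewrite [X in Num.sqrt X](_ : _ = B0 * (y ^- 3) ^+ 2); last by rewrite /B0; field.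
rewrite sqrtrM ?(B00 m)// sqrtr_sqr ger0_norm ?invr_ge0 ?exprn_ge0 ?(ltW y0)//.
by field.
Qed.

Let Bg := M ^+ 3 * (2 * \int[mu]_s `|g s|) * (\int[mu]_s nc (ft g s)) ^+ 3.

Let size_ m (l : 'I_K) : R := if odd l.+1 then 0 else
  y * sg m `^ nu * (`|c_coef A l.+1| * Num.sqrt (l.+1)`!%:R * 3 ^+ (l.+1)./2).

Let coeffE m l : coeff m l = sg m `^ nu * c_coef A l.
Proof. exact: (powRB_exprn nu (c_coef A l) l (sg0 m)). Qed.

Let Bg0 (m : 'I_d) : 0 <= Bg.
Proof.
exact: (cubic_ge0 (M0 m) (rint_ge0 _ (fun s => normr_ge0 _)) (rint_ge0 _ (fun s => nc_ge0 _))).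
Qed.

Let cl_bound m q (a : L4) (L : R) :
  (a.1.2.+1)%:R ^+ 2 * `|L| <= Bg * ((a.1.1.+1)`!%:R * (a.1.2.+1)`!%:R *
    3 ^+ (a.1.1.+1 + a.1.2.+1)) ->
  `|cl m q a| * Num.sqrt L <=
  (K.+1%:R ^+ 2)^-1 * (Num.sqrt Bg * (size_ m a.1.1 * size_ q a.1.2)).
Proof.
rewrite /cl /cf /size_; move: a.1.1 a.1.2 => l l' Lb.
case: (boolP (odd l.+1)) => od1; first by rewrite !mul0r normr0 !(mul0r, mulr0).
case: (boolP (odd l'.+1)) => od2; first by rewrite !(mul0r, mulr0) normr0 mul0r.
rewrite (coeffE m l.+1) (coeffE q l'.+1).
have key := sqrt_order_bound (Bg0 m) od1 od2 Lb.
exact: coefficient_bound (ltW y0) (powR_ge0 _ _) (powR_ge0 _ _) key.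
Qed.

Let size_sum m : \sum_l size_ m l = y * sg m `^ nu * S.
Proof.
rewrite /S sum_even_orders mulr_sumr; apply: eq_bigr => l _.
by rewrite /size_; case: odd; rewrite ?mulr0.
Qed.

(** The equal weights over the roots of unity add up to 1, and the sum over pairs of orders
    factors. *)
Let bound_sum m q (b : R) :
  \sum_(a : L4) (K.+1%:R ^+ 2)^-1 * (b * (size_ m a.1.1 * size_ q a.1.2)) =
  b * (y * sg m `^ nu * S * (y * sg q `^ nu * S)).
Proof.
transitivity (b * ((\sum_l size_ m l) * \sum_l size_ q l)); last first.
  by congr (b * _); congr (_ * _); exact: size_sum.
transitivity (\sum_(x : 'I_K * 'I_K) \sum_(z : 'I_K.+1 * 'I_K.+1)
   (K.+1%:R ^+ 2)^-1 * (b * (size_ m x.1 * size_ q x.2))).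
  by rewrite pair_bigA.
under eq_bigr do rewrite mean_over_pairs.
rewrite -mulr_sumr; congr (_ * _); rewrite big_distrlr/= pair_bigA.
by apply: eq_bigr => -[].
Qed.

Let fl_limit m q (a : L4) : exists2 L : R,
  \int[P]_z (fl m q a n z - \int[P]_z fl m q a n z) ^+ 2 @[n --> \oo] --> L &
  (a.1.2.+1)%:R ^+ 2 * `|L| <= Bg * ((a.1.1.+1)`!%:R * (a.1.2.+1)`!%:R *
    3 ^+ (a.1.1.+1 + a.1.2.+1)).
Proof.
exact: (@wave_fluct_limit R psi fX g ipsi iX X0 XN (dilate_integ J iphi).1
  ft_dilate_mass.1 M (fun i => j (side m q i)) (theta a.2.1 a.2.2)
  (fun i => 2 ^ J * t (side m q i)) (fun i => sg0 (side m q i)) (psM2 m q) _ _ P W I HW HI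
  a.1.1.+1 a.1.2.+1 (ltn0Sn _) (ltn0Sn _)).
Qed.

(** The square root is continuous, so the standard deviations of the pieces converge along the
    quadratures; their limits, rather than their values, are bounded, and what remains is
    arithmetic. *)
Theorem chaos_expansion_bound d' (T' : measurableType d') (P' : probability T' R)
    (N : 'I_d -> T' -> R) (h : ('I_d -> R) -> R) h' :
  normal_vector P' N (covariance_mx P F) ->
  lipD 1 h -> (forall m, lipD 1 (h' m)) -> (forall m, tayl m h (h' m) 1) ->
  `|\int[P]_z h (fun m => F m z) - \int[P']_z h (fun m => N m z)| <=
  pi / 2 * (\sum_m sg m `^ nu) ^+ 2 * Num.sqrt B0 * y^-1 * S ^+ 2.
Proof.
move=> NV hL h'L hh'.
have CE m q : covariance_mx P F m q =
    \int[P]_z (F m z * F q z) - \int[P]_z F m z * \int[P]_z F q z.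
  by rewrite mxE covariance_rint.
have gN := normal_vector_gfam NV (covariance_mx_sym P F).
have /choice[L LP] : forall x : 'I_d * 'I_d * L4, exists L : R,
    \int[P]_z (fl x.1.1 x.1.2 x.2 n z - \int[P]_z fl x.1.1 x.1.2 x.2 n z) ^+ 2
      @[n --> \oo] --> L /\
    (x.2.1.2.+1)%:R ^+ 2 * `|L| <= Bg * ((x.2.1.1.+1)`!%:R * (x.2.1.2.+1)`!%:R *
      3 ^+ (x.2.1.1.+1 + x.2.1.2.+1)).
  move=> [[m q] a]; have [L cL Lb] := fl_limit m q a.
  exists L; split; [exact: cL|exact: Lb].
pose gn n m q := \sum_a `|cl m q a| *
  Num.sqrt (\int[P]_z (fl m q a n z - \int[P]_z fl m q a n z) ^+ 2).
pose gl m q := \sum_a `|cl m q a| * Num.sqrt (L (m, q, a)).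
have gng m q : gn n m q @[n --> \oo] --> gl m q.
  apply: cvgr_sum => a _; apply: cvgM; first exact: cvg_cst.
  exact: (cvg_comp _ _ (LP (m, q, a)).1 (@sqrt_continuous R _)).
have l0 n (u : Jn n) : (0 < ord u)%N by [].
have := @chaos_limit R _ In Jn _ _ T T' P P' idx wt ord X G l0 gX G1 F gn gl mF iF FL2
  gram_deviation gng N _ h h' gN CE hL h'L hh'.
move=> /le_trans; apply; apply: quadratic_sum_bound scale_bound _.
  by rewrite divr_ge0 ?pi_ge0.
move=> m q; rewrite -[X in _ <= X]bound_sum.
by apply: ler_sum => a _; apply: cl_bound; exact: (LP (m, q, a)).2.
Qed.

End chaos_expansion_bound.

Lemma cLp1_norm_integ (R : realType) (f : R -> R[i]) :
  cLp (T := measurableTypeR R) lebesgue_measure 1 f ->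
  integ (@lebesgue_measure R) (fun x => @Normc.normc R (f x)).
Proof.
move=> [mf foo]; apply: ge0_integ => //; first exact: measurable_nc.
by move=> x; exact: nc_ge0.
Qed.

Lemma cLp1_Re_integ (R : realType) (f : R -> R[i]) :
  cLp (T := measurableTypeR R) lebesgue_measure 1 f ->
  integ (@lebesgue_measure R) (fun x => complex.Re (f x)).
Proof.
move=> fL; have [[mf _] _] := fL.
by apply: integ_le (cLp1_norm_integ fL) => // x; exact: Re_le.
Qed.

Theorem proposition1 (R : realType) (alpha beta nu : R)
    (psi : R -> R[i]) (phi fX A : R -> R) (d : nat) (j : 'I_d -> int) :
  analytic_wavelet psi ->
  assumption_W alpha psi phi ->
  spectral_density beta fX ->
  1 <= 2 * alpha + beta ->
  power_or_log nu A ->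
  (0 < d)%N ->
  (forall m, 0 < sigma psi fX (j m)) ->
  exists C : R,
    forall (disp : measure_display) (Omega : measurableType disp)
      (P : probability Omega R) (X : R -> Omega -> R)
      (W : set R -> Omega -> R[i])
      (I : forall l : nat, (l.-tuple R -> R[i]) -> Omega -> R),
    stationary_gaussian P fX X ->
    gaussian_random_measure P W ->
    wiener_ito P W I ->
    forall (t : 'I_d -> R) (h : 'rV[R]_d -> R), test_H2 h ->
    forall (J : int) (K : nat), (2 <= K)%N -> ~~ odd K ->
    let F := fun m : 'I_d =>
      truncated_chaos I psi phi fX A nu J K (t m) (j m) in
    forall (disp' : measure_display) (Omega' : measurableType disp')
      (P' : probability Omega' R) (N : 'I_d -> Omega' -> R),
    normal_vector P' N (covariance_mx P F) ->
    `|fine 'E_P[fun w => h (\row_m F m w)]%E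
      - fine 'E_P'[fun w => h (\row_m N m w)]%E|
    <= C * 2 `^ (- (J%:~R / 2)) *
       (\sum_(2 <= l < K.+1 | ~~ odd l)
          `|c_coef A l| * Num.sqrt l`!%:R * 3 ^+ l./2) ^+ 2.
Proof.
move=> hpsi hW hX ab _ d0 sg0.
have [psi1 _ _] := hpsi.
have [_ _ _ phi1 [ftphi1 _]] := hW.
have [fX1 X0 XN _] := hX.
pose mu := @lebesgue_measure R; pose nc := @Normc.normc R.
have ipsi : integ mu (fun t => complex.Re (psi t)) by exact: cLp1_Re_integ.
have iX : integ mu fX by exact: (cLp1_Re_integ fX1).
have iphi : integ mu phi by exact: (cLp1_Re_integ phi1).
have iftphi : integ mu (fun s => nc (ft phi s)) by exact: (cLp1_norm_integ ftphi1).
have ps0 := fourier_zero hW.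
have /choice[Mb MbP] m : exists b, forall x,
    nc (fourier (reC psi) (2 ^ j m * x)) ^+ 2 * fX x <= b.
  exact: (spectral_product_bound (j m) hW hX ab (ft_le ipsi)).
have Mb0 m : 0 <= Mb m by apply: le_trans (MbP m 0); rewrite mulr_ge0// sqr_ge0.
(* The terms are nonnegative, so their sum bounds the amplitudes at every scale [j m] at once. *)
pose M := \sum_m Mb m / sigma psi fX (j m) ^+ 2.
have psM m x : nc (fourier (reC psi) (2 ^ j m * x)) ^+ 2 * fX x /
    sigma psi fX (j m) ^+ 2 <= M.
  apply: (@le_trans _ _ (Mb m / sigma psi fX (j m) ^+ 2)).
    by rewrite ler_wpM2r// invr_ge0 sqr_ge0.
  rewrite /M (bigD1 m)//= lerDl sumr_ge0// => k _.
  by rewrite divr_ge0// sqr_ge0.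
(* Built from the scales, [psi], [phi], [fX] and [nu], before any probability space, [t], [h], [J]
   or [K] is introduced. *)
exists (pi / 2 * (\sum_m sigma psi fX (j m) `^ nu) ^+ 2 * Num.sqrt (M ^+ 3 *
  (2 * \int[mu]_s `|phi s|) * (\int[mu]_s nc (ft phi s)) ^+ 3)).
move=> disp Omega P X W I _ HWm HI t h hh J K _ _ F disp' Omega' P' N NV.
rewrite powRN unlock.
exact: (chaos_expansion_bound ipsi iX X0 XN ps0 iphi iftphi sg0 psM HWm HI NV
  (test_H2_lip hh) (test_H2_partial_lip hh) (test_H2_tayl hh)).
Qed.
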